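(* Let $M$ be a Henselian non-trivially valued field of residue characteristic zero, with field sort $K(M)$, residue field $k(M)$, value group $\Gamma(M)$ and group of leading terms $\mathrm{RV}^*(M)$. Let $A\le B$ and $A\le C$ be valued subfields of $K(M)$ such that $M$ is $|B\cup C|^+$-saturated and strongly $|B\cup C|^+$-homogeneous. Assume: - $[K(M)^*:(K(M)^* )^N]$ is finite for every $N>0$; - for every $N>0$, every coset of $(\mathrm{RV}^* )^N$ in $\mathrm{RV}^*$ contains $\mathrm{rv}(a)$ for some $a\in A^*$; - for every $N>0$, every coset of $(k^* )^N$ in $k^*$ contains $\mathrm{res}(a)$ for some $a\in A$ of value $0$; - every $\gamma\in\Gamma(\mathrm{dcl}^{eq}(\varnothing))$ equals $\mathrm{val}(a)$ for some $a\in A$; - $\mathrm{res}(C)$ and $\mathrm{res}(B)$ are linearly disjoint over $\mathrm{res}(A)$, and $\mathrm{val}(C)\cap\mathrm{val}(B)=\mathrm{val}(A)$; - the extension $C\ge A$ is separated. Then $\mathrm{tp}(C/B)$ does not divide over $A$ if and only if, in the field $k(M)$, $\mathrm{tp}(\mathrm{res}(C)/\mathrm{res}(B))$ does not divide over $\mathrm{res}(A)$ and, in the ordered group $\Gamma(M)$, $\mathrm{tp}(\mathrm{val}(C)/\mathrm{val}(B))$ does not divide over $\mathrm{val}(A)$.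
   Context: Convention: valuations are written additively with $\mathrm{val}(0)=-\infty$ the least value, so $\mathrm{val}(x+y)\le\max(\mathrm{val}(x),\mathrm{val}(y))$, the valuation ring is $\mathcal{O}=\{x:\mathrm{val}(x)\le0\}$ with maximal ideal $\mathfrak{M}=\{x:\mathrm{val}(x)<0\}$. $\mathrm{res}:\mathcal{O}\to k$ is the residue map and $\mathrm{res}(D)=\mathrm{res}(D\cap\mathcal{O})$ for a subfield $D$. $\mathrm{RV}^*=K^*/(1+\mathfrak{M})$ with quotient map $\mathrm{rv}$. An extension $C\ge A$ of valued fields is separated if every finite-dimensional $A$-vector subspace of $C$ has a basis $(v_i)_i$ such that $\mathrm{val}(\sum_i\lambda_iv_i)=\max_i\mathrm{val}(\lambda_iv_i)$ for all $\lambda_i\in A$. A formula divides over $A$ if for some $A$-indiscernible sequence of conjugates of its parameters, starting with the original, the corresponding formulas are jointly inconsistent; a type divides over $A$ if it implies a formula that does. $\mathrm{val}(D)$ for a subfield $D$ denotes its value group. The valued field is considered in any of the usual bi-interpretable languages. *)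

(* Defs.v *)
From mathcomp Require Import all_boot all_order all_algebra.
From mathcomp Require Import boolp classical_sets functions cardinality.

Set Implicit Arguments.
Unset Strict Implicit.
Unset Printing Implicit Defensive.

Import Order.TTheory GRing.Theory Num.Theory.
Local Open Scope classical_set_scope.
Local Open Scope card_scope.
Local Open Scope ring_scope.

(** * Many-sorted first-order logic *)

(* Each function symbol lives on a single sort; maps between sorts and partial
   maps are given by relation symbols for their graphs. *)
Record signature := Signature {
  sort : Type;
  fsym : Type;
  fsort : fsym -> sort;
  farity : fsym -> nat;
  rsym : Type;
  rdom : rsym -> seq sort }.

Definition args (S : Type) (T : S -> Type) (l : seq S) : Type :=
  forall i : 'I_(size l), T (tnth (in_tuple l) i).

Record structure (S : signature) := Structure {
  car :> sort S -> Type;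
  fint : forall f : fsym S, ('I_(farity f) -> car (fsort f)) -> car (fsort f);
  rint : forall r : rsym S, args car (rdom r) -> Prop }.

(* The free variables of a formula are the elements of a sort-indexed family
   of types, possibly infinite: a formula over [V] has a variable for each
   element of each [V s], and can use only finitely many of them. *)
Definition ctx (S : signature) := sort S -> Type.

Definition cadd (S : signature) (V W : ctx S) : ctx S :=
  fun s => (V s + W s)%type.

Inductive csingle (S : signature) (s : sort S) : sort S -> Type :=
  here : csingle s s.

Inductive term (S : signature) (V : ctx S) : sort S -> Type :=
| Var s : V s -> term V s
| App (f : fsym S) :
    ('I_(farity f) -> term V (fsort f)) -> term V (fsort f).

Inductive formula (S : signature) (V : ctx S) : Type :=
| FEq s : term V s -> term V s -> formula V
| FRel (r : rsym S) : args (term V) (rdom r) -> formula V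
| FBot : formula V
| FImp : formula V -> formula V -> formula V
| FAll s : formula (cadd V (csingle s)) -> formula V.

Section Semantics.
Variables (S : signature) (M : structure S).

Definition asg (V : ctx S) := forall s, V s -> M s.

Definition acat (V W : ctx S) (e : asg V) (e' : asg W) : asg (cadd V W) :=
  fun s v => match v with inl x => e s x | inr y => e' s y end.

Definition aone (s : sort S) (x : M s) : asg (csingle s) :=
  fun _ v => match v in csingle _ s' return M s' with here => x end.

Fixpoint eval (V : ctx S) (e : asg V) s (t : term V s) : M s :=
  match t in term _ s' return M s' with
  | Var _ v => e _ v
  | App f ts => @fint S M f (fun i => eval e (ts i))
  end.

Fixpoint sat (V : ctx S) (phi : formula V) : asg V -> Prop :=
  match phi with
  | FEq _ t u => fun e => eval e t = eval e u
  | FRel r ts => fun e => @rint S M r (fun i => eval e (ts i))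
  | FBot => fun=> False
  | FImp p q => fun e => sat p e -> sat q e
  | FAll s p => fun e => forall x : M s, sat p (acat e (aone x))
  end.

Definition psets := forall s, set (M s).

Definition tagged_union (D : psets) : set {s & M s} :=
  [set u | D (projT1 u) (projT2 u)].

Definition csub (D : psets) : ctx S := fun s => {x : M s | D s x}.

Definition incl (D : psets) : asg (csub D) := fun s x => sval x.

Definition tp (C B : psets) : set (formula (cadd (csub C) (csub B))) :=
  [set phi | sat phi (acat (@incl C) (@incl B))].

(* [phi] speaks about [b (i 0)], ..., [b (i (n - 1))] for increasing [i], each
   of them a tuple in several sorts. *)
Definition indiscernible (P : ctx S) (A : psets) (b : nat -> asg P) :=
  forall (n : nat) (i j : 'I_n -> nat),
    {homo i : x y / (x < y)%N} -> {homo j : x y / (x < y)%N} ->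
  forall phi : formula (cadd (fun s => ('I_n * P s)%type) (csub A)),
    sat phi (acat (fun s (v : 'I_n * P s) => b (i v.1) s v.2) (@incl A)) <->
    sat phi (acat (fun s (v : 'I_n * P s) => b (j v.1) s v.2) (@incl A)).

(* The parameter tuple [b] has [n s] entries in each sort [s].  The terms of an
   [A]-indiscernible sequence are conjugate over [A] (take one-element index
   sets in [indiscernible]).  Inconsistency is with the elementary diagram of
   [M]: some finite part of the set of instances has no solution in [M]. *)
Definition formula_divides (X : ctx S) (n : sort S -> nat) (A : psets)
    (phi : formula (cadd X (fun s => 'I_(n s))))
    (b : asg (fun s => 'I_(n s))) :=
  exists c : nat -> asg (fun s => 'I_(n s)),
    [/\ forall s i, c 0%N s i = b s i,
        indiscernible A c &
        exists m : nat,
          ~ exists x : asg X, forall i : 'I_m, sat phi (acat x (c i))].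

(* Implication modulo the elementary diagram of [M]: the parameters of [phi]
   may lie outside of [B]. *)
Definition type_implies (X : ctx S) (B : psets) (p : set (formula (cadd X (csub B))))
    (n : sort S -> nat) (phi : formula (cadd X (fun s => 'I_(n s))))
    (b : asg (fun s => 'I_(n s))) :=
  exists (m : nat) (psi : 'I_m -> formula (cadd X (csub B))),
    (forall i, p (psi i)) /\
    forall x : asg X,
      (forall i, sat (psi i) (acat x (@incl B))) -> sat phi (acat x b).

Definition type_divides (X : ctx S) (A B : psets)
    (p : set (formula (cadd X (csub B)))) :=
  exists (n : sort S -> nat) (phi : formula (cadd X (fun s => 'I_(n s))))
         (b : asg (fun s => 'I_(n s))),
    type_implies p phi b /\ formula_divides A phi b.

(* |E|^+-saturation: 1-types, in any sort, over at most |E| parameters. *)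
Definition succ_saturated (T : Type) (E : set T) :=
  forall D : psets, tagged_union D #<= E ->
  forall (s : sort S) (p : set (formula (cadd (csingle s) (csub D)))),
    (forall (m : nat) (psi : 'I_m -> formula (cadd (csingle s) (csub D))),
       (forall i, p (psi i)) ->
       exists x : M s, forall i, sat (psi i) (acat (aone x) (@incl D))) ->
  exists x : M s, forall phi, p phi -> sat phi (acat (aone x) (@incl D)).

Definition elementary_on (D : psets) (f : asg (csub D)) :=
  forall phi : formula (csub D), sat phi (@incl D) <-> sat phi f.

Definition automorphism (g : forall s, M s -> M s) :=
  [/\ forall s, bijective (g s),
      forall (f : fsym S) (a : 'I_(farity f) -> M (fsort f)),
        g _ (@fint S M f a) = @fint S M f (fun i => g _ (a i)) &
      forall (r : rsym S) (a : args M (rdom r)),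
        @rint S M r a <-> @rint S M r (fun i => g _ (a i))].

Definition strongly_succ_homogeneous (T : Type) (E : set T) :=
  forall D : psets, tagged_union D #<= E ->
  forall f : asg (csub D), elementary_on f ->
  exists2 g, automorphism g & forall s (x : csub D s), g s (sval x) = f s x.

(* For an actual sort [s] of [M], this is also the set of elements of [s] in
   the definable closure of the empty set in M^eq. *)
Definition dcl0 (s : sort S) : set (M s) :=
  [set x | exists phi : formula (csingle s),
     forall y, sat phi (aone y) <-> y = x].

End Semantics.

Arguments tp {S M}.
Arguments dcl0 {S}.

(** * Fields and ordered groups as first-order structures *)

Inductive ring_op := RZero | ROne | RAdd | ROpp | RMul.

Definition ring_arity (o : ring_op) : nat :=
  match o with RZero | ROne => 0 | ROpp => 1 | RAdd | RMul => 2 end.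

Definition ring_int (R : nzRingType) (o : ring_op) :
    ('I_(ring_arity o) -> R) -> R :=
  match o with
  | RZero => fun=> 0
  | ROne => fun=> 1
  | RAdd => fun a => a ord0 + a ord_max
  | ROpp => fun a => - a ord0
  | RMul => fun a => a ord0 * a ord_max
  end.

Inductive group_op := GUnit | GMul | GInv.

Definition group_arity (o : group_op) : nat :=
  match o with GUnit => 0 | GInv => 1 | GMul => 2 end.

Definition zmod_int (G : zmodType) (o : group_op) :
    ('I_(group_arity o) -> G) -> G :=
  match o with
  | GUnit => fun=> 0
  | GMul => fun a => a ord0 + a ord_max
  | GInv => fun a => - a ord0
  end.

Definition group_int (G : groupType) (o : group_op) :
    ('I_(group_arity o) -> G) -> G :=
  match o with
  | GUnit => fun=> 1%g
  | GMul => fun a => (a ord0 * a ord_max)%g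
  | GInv => fun a => ((a ord0)^-1)%g
  end.

Record orderedGroupType := OrderedGroup {
  ogroup_sort :> porderZmodType;
  ogroup_le_total : total (<=%R : rel ogroup_sort);
  ogroup_le_add : forall z x y : ogroup_sort, x <= y -> z + x <= z + y }.

Definition field_sig : signature :=
  @Signature unit ring_op (fun=> tt) ring_arity
    void (fun r => match r with end).

Definition field_structure (k : fieldType) : structure field_sig :=
  @Structure field_sig (fun=> k) (@ring_int k) (fun r => match r with end).

Definition ogroup_sig : signature :=
  @Signature unit group_op (fun=> tt) group_arity
    unit (fun=> [:: tt; tt]).

Definition ogroup_structure (G : orderedGroupType) : structure ogroup_sig :=
  @Structure ogroup_sig (fun=> G) (@zmod_int G)
    (fun _ a => (a ord0 : G) <= (a ord_max : G)).

Definition psets_field (k : fieldType) (D : set k) :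
  psets (field_structure k) := fun=> D.

Definition psets_ogroup (G : orderedGroupType) (D : set G) :
  psets (ogroup_structure G) := fun=> D.

(** * Valued fields *)

(* [option G] is [G] with the least element [-oo = None] added. *)
Section ValueMonoid.
Variable G : orderedGroupType.

Definition vle (x y : option G) : bool :=
  match x, y with
  | None, _ => true
  | Some _, None => false
  | Some a, Some b => a <= b
  end.

Definition vlt (x y : option G) : bool := ~~ vle y x.

Definition vmax (x y : option G) : option G := if vle x y then y else x.

Definition vadd (x y : option G) : option G :=
  match x, y with Some a, Some b => Some (a + b) | _, _ => None end.

End ValueMonoid.

(* The residue field, the value group and the group of leading terms are given
   with their quotient maps, which determines them up to unique isomorphism.
   [vres] is meaningful only on the valuation ring, [vrv] only on nonzero
   elements; their other values are unconstrained and never used. *)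
Record valuedField := ValuedField {
  vK :> fieldType;
  vk : fieldType;
  vG : orderedGroupType;
  vRV : groupType;
  vval : vK -> option vG;
  vres : vK -> vk;
  vrv : vK -> vRV;
  vval0 : forall x, vval x = None <-> x = 0;
  vvalM : forall x y, vval (x * y) = vadd (vval x) (vval y);
  vvalD : forall x y, vle (vval (x + y)) (vmax (vval x) (vval y));
  vval_surj : forall g, exists x, vval x = Some g;
  vres1 : vres 1 = 1;
  vresD : forall x y, vle (vval x) (Some 0) -> vle (vval y) (Some 0) ->
    vres (x + y) = vres x + vres y;
  vresM : forall x y, vle (vval x) (Some 0) -> vle (vval y) (Some 0) ->
    vres (x * y) = vres x * vres y;
  vres_ker : forall x, vle (vval x) (Some 0) ->
    (vres x = 0 <-> vlt (vval x) (Some 0));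
  vres_surj : forall r, exists2 x, vle (vval x) (Some 0) & vres x = r;
  vrvM : forall x y, x != 0 -> y != 0 -> vrv (x * y) = (vrv x * vrv y)%g;
  vrv_ker : forall x, x != 0 ->
    (vrv x = 1%g <-> vlt (vval (x - 1)) (Some 0));
  vrv_surj : forall r, exists2 x, x != 0 & vrv x = r }.

(* The language has the sorts K, k, Gamma and RV^*, the ring operations on K
   and k, the group operations on Gamma and RV^*, the order of Gamma, and the
   graphs of [val] (on K^* ), [res] (on the valuation ring) and [rv] (on K^* ).
   It is bi-interpretable with the other usual languages of valued fields. *)
Inductive vf_sort := VF | RF | VG | RV.

Inductive vf_fsym :=
| KOp of ring_op | kOp of ring_op | GOp of group_op | RVOp of group_op.

Inductive vf_rsym := GLe | ValGraph | ResGraph | RvGraph.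

Definition vf_fsort (f : vf_fsym) : vf_sort :=
  match f with KOp _ => VF | kOp _ => RF | GOp _ => VG | RVOp _ => RV end.

Definition vf_farity (f : vf_fsym) : nat :=
  match f with
  | KOp o | kOp o => ring_arity o
  | GOp o | RVOp o => group_arity o
  end.

Definition vf_rdom (r : vf_rsym) : seq vf_sort :=
  match r with
  | GLe => [:: VG; VG]
  | ValGraph => [:: VF; VG]
  | ResGraph => [:: VF; RF]
  | RvGraph => [:: VF; RV]
  end.

Definition vf_sig : signature :=
  Signature vf_fsort vf_farity vf_rdom.

Section ValuedFieldStructure.
Variable M : valuedField.

Definition vf_car (s : vf_sort) : Type :=
  match s with VF => vK M | RF => vk M | VG => vG M | RV => vRV M end.

Definition vf_fint (f : vf_fsym) :
    ('I_(vf_farity f) -> vf_car (vf_fsort f)) -> vf_car (vf_fsort f) :=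
  match f return
    ('I_(vf_farity f) -> vf_car (vf_fsort f)) -> vf_car (vf_fsort f) with
  | KOp o => @ring_int (vK M) o
  | kOp o => @ring_int (vk M) o
  | GOp o => @zmod_int (vG M) o
  | RVOp o => @group_int (vRV M) o
  end.

Definition vf_rint (r : vf_rsym) : args vf_car (vf_rdom r) -> Prop :=
  match r return args vf_car (vf_rdom r) -> Prop with
  | GLe => fun a => (a ord0 : vG M) <= (a ord_max : vG M)
  | ValGraph => fun a => vval (a ord0 : vK M) = Some (a ord_max : vG M)
  | ResGraph => fun a => vle (vval (a ord0 : vK M)) (Some 0) /\
      vres (a ord0 : vK M) = (a ord_max : vk M)
  | RvGraph => fun a => (a ord0 : vK M) != 0 /\
      vrv (a ord0 : vK M) = (a ord_max : vRV M)
  end.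

Definition vf_structure : structure vf_sig :=
  @Structure vf_sig vf_car vf_fint vf_rint.

Definition psetsK (D : {pred M}) : psets vf_structure :=
  fun s => match s return set (vf_car s) with
           | VF => [set` D]
           | _ => set0
           end.

Definition valuation_ring : {pred M} := [pred x | vle (vval x) (Some 0)].

Definition henselian :=
  forall (p : {poly M}) (a : M),
    p \is a polyOver valuation_ring -> a \in valuation_ring ->
    vlt (vval p.[a]) (Some 0) -> vval p^`().[a] = Some 0 ->
  exists b : M, [/\ b \in valuation_ring, p.[b] = 0 &
                    vlt (vval (b - a)) (Some 0)].

Definition nontrivially_valued := exists2 x : M, x != 0 & vval x != Some 0.

Definition res_of (D : {pred M}) : set (vk M) :=
  [set r | exists x, [/\ x \in D, x \in valuation_ring & vres x = r]].

Definition val_of (D : {pred M}) : set (vG M) :=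
  [set g | exists2 x, x \in D & vval x = Some g].

End ValuedFieldStructure.

(** * Linear algebra over subfields *)

Section Linear.
Variable L : fieldType.

Definition lin_indep (F : set L) (n : nat) (v : 'I_n -> L) :=
  forall l : 'I_n -> L, (forall i, F (l i)) ->
    \sum_(i < n) l i * v i = 0 -> forall i, l i = 0.

Definition lin_span (F : set L) (n : nat) (v : 'I_n -> L) : set L :=
  [set x | exists2 l : 'I_n -> L, (forall i, F (l i)) &
                                  x = \sum_(i < n) l i * v i].

Definition lin_basis (F : set L) (n : nat) (v : 'I_n -> L) (V : set L) :=
  lin_indep F v /\ lin_span F v = V.

Definition linearly_disjoint (F E1 E2 : set L) :=
  forall (n : nat) (v : 'I_n -> L), (forall i, E1 (v i)) ->
    lin_indep F v -> lin_indep E2 v.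

Definition nonzero : set L := [set x | x != 0].

End Linear.

(* [C] is a separated extension of [A].  The maximum of the empty family is
   [val 0]. *)
Definition separated (M : valuedField) (A C : {pred M}) :=
  forall V : set M, V `<=` [set` C] ->
    (exists (n : nat) (v : 'I_n -> M), lin_basis [set` A] v V) ->
  exists (n : nat) (v : 'I_n -> M), lin_basis [set` A] v V /\
    forall l : 'I_n -> M, (forall i, l i \in A) ->
      vval (\sum_(i < n) l i * v i) =
      \big[@vmax (vG M)/None]_(i < n) vval (l i * v i).

(* The set of cosets of the [N]-th powers in the multiplicative group of [L]. *)
Definition power_cosets (L : fieldType) (N : nat) : set (set L) :=
  [set [set x * y ^+ N | y in @nonzero L] | x in @nonzero L].

Arguments power_cosets : clear implicits.

(* Main.v *)
(* Given partial elementary maps [Ek] of the residue field and [EG] of the value group,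
   an isomorphism between subfields that is compatible with them and preserves [n]-th
   powers for all [n] is elementary, by back and forth over countable subfields; powers
   are controlled by countably many representatives in [A], since by Hensel's lemma the
   class of an element modulo [n]-th powers depends only on its leading term.
   Consequently an [res A]-indiscernible sequence in [k] or a [val A]-indiscernible
   sequence in [Gamma] is [A]-indiscernible in [M], so dividing in [k] or [Gamma] lifts
   to [M]. Conversely, if [tp(C/B)] divides, an ultrafilter construction gives an
   [A]-indiscernible sequence of conjugates [B_i] of (a countable part of) [B] that
   witnesses it. As the types in [k] and [Gamma] do not divide, [res C] and [val C] have
   conjugates over [A] that work for all [res B_i] and [val B_i] at once, and these are
   realised by a conjugate [C'] of [C] over [A]. By separatedness, every leading term
   of the compositum of [C'] and [B_i] is a product of one from [C'], one from [B_i] and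
   a unit generated by residues, so the maps [C -> C'] and [B -> B_i] extend to an
   elementary map of the composita: [C'] satisfies [tp(C/B)] over all the [B_i]. *)

From Stdlib Require List.
Require Import Defs.
From mathcomp Require Import all_boot all_order all_algebra.
From mathcomp Require Import boolp classical_sets functions cardinality filter.
From mathcomp Require Import ring.

Set Implicit Arguments.
Unset Strict Implicit.
Unset Printing Implicit Defensive.

Import Order.TTheory GRing.Theory Num.Theory.
Local Open Scope classical_set_scope.
Local Open Scope card_scope.
Local Open Scope ring_scope.

(** The obstacle is the group of leading terms: it extends the value group by the multiplicative
    group of the residue field, and the types of residues and of values do not determine a type in
    it. In place of angular components, classes modulo n-th powers are tracked for all n. If n
    val(y) is an old value, a representative in A of the class of a unit allows y to be corrected by
    a unit to an n-th root of an old element; this is why units need representatives of value 0.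
    Only countably many elements can be treated at a time, while linear disjointness and
    separatedness speak about all of A. The parts of B and C that matter are therefore taken inside
    a countable field closed under witnesses for these hypotheses. Independence is used only on the
    side of B and C: once the leading terms of their compositum are known, the same formal products
    give those of the compositum of C' and B_i, since residues and values correspond under
    elementary maps of k and Gamma. *)

Local Notation pin D := (@Defs.incl _ _ D).

(** * Definability and saturation *)

Section Renaming.
Variable S : signature.
Implicit Types V W U : ctx S.

Definition ren V W := forall s, V s -> W s.

Definition lift_ren V W (f : ren V W) (X : ctx S) : ren (cadd V X) (cadd W X) :=
  fun s v => match v with inl x => inl (f s x) | inr y => inr y end.

Fixpoint trename V W (f : ren V W) s (t : term V s) : term W s :=
  match t with
  | Var _ v => Var (f _ v)
  | App g ts => App (fun i => trename f (ts i))
  end.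

Fixpoint rename V W (f : ren V W) (phi : formula V) : formula W :=
  match phi with
  | FEq _ t u => FEq (trename f t) (trename f u)
  | FRel r ts => FRel (fun i => trename f (ts i))
  | FBot => FBot W
  | FImp p q => FImp (rename f p) (rename f q)
  | FAll s p => FAll (rename (@lift_ren _ _ f (csingle s)) p)
  end.

End Renaming.

Section Definable.
Variables (S : signature) (N : structure S).
Implicit Types V W U : ctx S.

Definition acomp V W (e : asg N W) (f : ren V W) : asg N V :=
  fun s v => e s (f s v).

Lemma asg_ext V (e e' : asg N V) : (forall s v, e s v = e' s v) -> e = e'.
Proof.
move=> h; apply: functional_extensionality_dep => s.
by apply: functional_extensionality_dep => v.
Qed.

Lemma eval_rename V W (f : ren V W) (e : asg N W) s (t : term V s) :
  eval e (trename f t) = eval (acomp e f) t.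
Proof.
elim: t => //= g ts IH; congr (fint _).
by apply: functional_extensionality_dep => i; exact: IH.
Qed.

Lemma sat_rename V W (f : ren V W) (phi : formula V) (e : asg N W) :
  sat (rename f phi) e <-> sat phi (acomp e f).
Proof.
elim: phi W f e => {V} [V s t u|V r ts|V|V p IHp q IHq|V s p IHp] W f e /=.
- by rewrite !eval_rename.
- suff -> : (fun i => eval e (trename f (ts i))) =
            (fun i => eval (acomp e f) (ts i)) by [].
  by apply: functional_extensionality_dep => i; exact: eval_rename.
- by [].
- by rewrite IHp IHq.
- split=> h x; have := h x; rewrite IHp; congr (sat p _);
    by apply: asg_ext => s' [].
Qed.

(** Definability is a property of predicates here, so that formulas are composed through closure
    lemmas and their syntax is hardly ever written out. *)
Definition definable V (Q : asg N V -> Prop) :=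
  exists phi : formula V, forall e, sat phi e <-> Q e.

Lemma definable_sat V (phi : formula V) : definable (sat phi).
Proof. by exists phi. Qed.

Lemma definable_iff V (P Q : asg N V -> Prop) :
  (forall e, P e <-> Q e) -> definable P -> definable Q.
Proof. by move=> PQ [phi h]; exists phi => e; rewrite h. Qed.

Lemma definable_ren V W (f : ren V W) (Q : asg N V -> Prop) :
  definable Q -> definable (fun e : asg N W => Q (acomp e f)).
Proof. by move=> [phi h]; exists (rename f phi) => e; rewrite sat_rename h. Qed.

Lemma definable_bot V : definable (fun _ : asg N V => False).
Proof. by exists (FBot V). Qed.

Lemma definable_imp V (P Q : asg N V -> Prop) :
  definable P -> definable Q -> definable (fun e => P e -> Q e).
Proof.
by move=> [p hp] [q hq]; exists (FImp p q) => e /=; rewrite hp hq.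
Qed.

Lemma definable_not V (P : asg N V -> Prop) :
  definable P -> definable (fun e => ~ P e).
Proof. by move=> hP; exact: definable_imp (definable_bot V). Qed.

Lemma definable_top V : definable (fun _ : asg N V => True).
Proof.
by apply: definable_iff (definable_not (definable_bot V)) => e; split=> // _ [].
Qed.

Lemma definable_and V (P Q : asg N V -> Prop) :
  definable P -> definable Q -> definable (fun e => P e /\ Q e).
Proof.
move=> hP hQ.
apply: definable_iff (definable_not (definable_imp hP (definable_not hQ))) => e.
split=> [h|[p q] h]; last exact: h.
by split; apply: contrapT => h'; apply: h => // p q; exact: h'.
Qed.

Lemma definable_and_list V (T : Type) (l : seq T) (P : T -> asg N V -> Prop) :
  (forall i, definable (P i)) ->
  definable (fun e => forall i, List.In i l -> P i e).
Proof.
move=> hP; elim: l => [|a l IH].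
  by apply: definable_iff (definable_top V).
apply: definable_iff (definable_and (hP a) IH) => e; split=> [[h1 h2] i /=|h].
  by case=> [<- //|]; exact: h2.
by split=> [|i hi]; apply: h; [left|right].
Qed.

Lemma definable_forall_fin V (I : finType) (P : I -> asg N V -> Prop) :
  (forall i, definable (P i)) -> definable (fun e => forall i, P i e).
Proof.
move=> hP; apply: definable_iff (definable_and_list (enum I) hP) => e.
split=> h i; last by move=> _; exact: h.
apply: h; have := mem_enum I i; elim: (enum I) => //= a l IH.
by rewrite inE => /orP[/eqP->|/IH]; [left|right].
Qed.

Lemma definable_all V s (Q : asg N (cadd V (csingle s)) -> Prop) :
  definable Q -> definable (fun e : asg N V => forall x, Q (acat e (aone x))).
Proof.
by move=> [phi h]; exists (FAll phi) => e; split=> /= H x; apply/h; exact: H.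
Qed.

Lemma definable_ex V s (Q : asg N (cadd V (csingle s)) -> Prop) :
  definable Q ->
  definable (fun e : asg N V => exists x, Q (acat e (aone x))).
Proof.
move=> hQ; apply: definable_iff (definable_not (definable_all (definable_not hQ))).
move=> e; split=> [h|[x hx] h]; last exact: h hx.
by apply: contrapT => h'; apply: h => x hx; apply: h'; exists x.
Qed.

Lemma definable_eq V s (v w : V s) : definable (fun e : asg N V => e s v = e s w).
Proof. by exists (FEq (Var v) (Var w)). Qed.

(** Contexts such as [csub D] may be infinite; a finite list of variables, of any sorts and possibly
    with repetitions, serves as the finite context of those that occur. *)
Definition listed V (l : seq {s & V s}) : ctx S :=
  fun s => {v : V s | List.In (existT V s v) l}.

Definition unlist V (l : seq {s & V s}) : ren (listed l) V := fun s v => sval v.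
Arguments unlist {V} l.

Definition widen_list V (l l' : seq {s & V s})
  (h : forall x, List.In x l -> List.In x l') : ren (listed l) (listed l') :=
  fun s v => exist _ (sval v) (h _ (svalP v)).

Lemma In_flatten (T : Type) (n : nat) (f : 'I_n -> seq T) i x :
  List.In x (f i) -> List.In x (flatten [seq f i | i <- enum 'I_n]).
Proof.
move=> hx; have := mem_enum 'I_n i; elim: (enum 'I_n) => //= a l IH.
rewrite inE => /orP[/eqP<-|/IH h]; apply/List.in_app_iff; by [left|right].
Qed.

Lemma term_support V s (t : term V s) :
  exists (l : seq {s & V s}) (t0 : term (listed l) s),
    forall e : asg N V, eval e t = eval (acomp e (unlist l)) t0.
Proof.
elim: t => [s0 v|g ts IH].
  exists [:: existT V s0 v].
  have h : List.In (existT V s0 v) [:: existT V s0 v] by left.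
  by exists (Var (exist _ v h : listed [:: existT V s0 v] s0)).
pose l i := sval (cid (IH i)).
pose t0 i : term (listed (l i)) _ := sval (cid (svalP (cid (IH i)))).
have ht i e : eval e (ts i) = eval (acomp e (unlist (l i))) (t0 i).
  exact: svalP (cid (svalP (cid (IH i)))) e.
exists (flatten [seq l i | i <- enum 'I_(farity g)]).
exists (App (fun i => trename (widen_list (@In_flatten _ _ l i)) (t0 i))) => e /=.
congr (fint _); apply: functional_extensionality_dep => i.
by rewrite eval_rename ht.
Qed.

Lemma formula_support V (phi : formula V) :
  exists (l : seq {s & V s}) (phi0 : formula (listed l)),
    forall e : asg N V, sat phi e <-> sat phi0 (acomp e (unlist l)).
Proof.
elim: phi => {V} [V s t u|V r ts|V|V p [l1 [p0 h1]] q [l2 [q0 h2]]|V s p [l [p0 h]]].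
- have [l1 [t0 h1]] := term_support t; have [l2 [u0 h2]] := term_support u.
  have i1 x : List.In x l1 -> List.In x (l1 ++ l2).
    by move=> h; apply/List.in_app_iff; left.
  have i2 x : List.In x l2 -> List.In x (l1 ++ l2).
    by move=> h; apply/List.in_app_iff; right.
  exists (l1 ++ l2), (FEq (trename (widen_list i1) t0) (trename (widen_list i2) u0)).
  by move=> e /=; rewrite !eval_rename h1 h2.
- pose l i := sval (cid (term_support (ts i))).
  pose t0 i : term (listed (l i)) _ := sval (cid (svalP (cid (term_support (ts i))))).
  have ht i e : eval e (ts i) = eval (acomp e (unlist (l i))) (t0 i).
    exact: svalP (cid (svalP (cid (term_support (ts i))))) e.
  exists (flatten [seq l i | i <- enum 'I_(size (rdom r))]).
  exists (FRel (fun i => trename (widen_list (@In_flatten _ _ l i)) (t0 i))) => e /=.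
  set f := (fun i => eval e _); set g := (fun i => eval _ _).
  suff -> : f = g by [].
  by apply: functional_extensionality_dep => i; rewrite /f /g eval_rename ht.
- by exists [::], (FBot _).
- have i1 x : List.In x l1 -> List.In x (l1 ++ l2).
    by move=> h; apply/List.in_app_iff; left.
  have i2 x : List.In x l2 -> List.In x (l1 ++ l2).
    by move=> h; apply/List.in_app_iff; right.
  exists (l1 ++ l2), (FImp (rename (widen_list i1) p0) (rename (widen_list i2) q0)).
  by move=> e /=; rewrite !sat_rename h1 h2.
(* The bound variable is dropped from the list; [f] below ties its occurrences to the quantifier and
   gives the others a new proof of membership. *)
pose strip (x : {s' & cadd V (csingle s) s'}) : seq {s' & V s'} :=
  match x with existT s' (inl v) => [:: existT V s' v] | _ => [::] end.
pose l' := flatten [seq strip x | x <- l].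
have hl' s' (v : V s') : List.In (existT (cadd V (csingle s)) s' (inl v)) l ->
    List.In (existT V s' v) l'.
  rewrite /l' {h p0 l'}; elim: l => //= a l IH [->|/IH h']; first by left.
  by apply/List.in_app_iff; right.
pose f : ren (listed l) (cadd (listed l') (csingle s)) := fun s' v =>
  match v with
  | exist (inl v) hv => inl (exist _ v (hl' _ _ hv))
  | exist (inr y) _ => inr y
  end.
exists l', (FAll (rename f p0)) => e /=; split=> H x.
  rewrite sat_rename; move: (H x); rewrite h; congr (sat p0 _).
  by apply: asg_ext => s' [[v|y] hv].
rewrite h; move: (H x); rewrite sat_rename; congr (sat p0 _).
by apply: asg_ext => s' [[v|y] hv].
Qed.

Lemma sat_support V (phi : formula V) :
  exists l : seq {s & V s}, forall e e' : asg N V,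
    (forall s v, List.In (existT V s v) l -> e s v = e' s v) ->
    (sat phi e <-> sat phi e').
Proof.
have [l [phi0 h]] := formula_support phi; exists l => e e' hee.
rewrite !h; have -> // : acomp e (unlist l) = acomp e' (unlist l).
by apply: asg_ext => s [v hv]; exact: hee.
Qed.

(** A block of infinitely many existential quantifiers is first order because only the listed
    variables of [W] occur; these are quantified one at a time, and [d] supplies values for all the
    others. *)
Lemma definable_ex_ctx (d : forall s, N s) W U (Q : asg N (cadd W U) -> Prop) :
  definable Q -> definable (fun u : asg N U => exists x : asg N W, Q (acat x u)).
Proof.
case=> phi0 hQ; have [l0 [phi1 h1]] := formula_support phi0.
pose strip (x : {s' & cadd W U s'}) : seq {s' & W s'} :=
  match x with existT s' (inl v) => [:: existT W s' v] | _ => [::] end.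
pose l := flatten [seq strip x | x <- l0].
have hl s' (v : W s') : List.In (existT (cadd W U) s' (inl v)) l0 ->
    List.In (existT W s' v) l.
  rewrite /l {h1 phi1 l}; elim: l0 => //= a l0 IH [->|/IH h']; first by left.
  by apply/List.in_app_iff; right.
pose f : ren (listed l0) (cadd (listed l) U) := fun s' v =>
  match v with
  | exist (inl v) hv => inl (exist _ v (hl _ _ hv))
  | exist (inr y) _ => inr y
  end.
suff main : definable (fun u : asg N U =>
    exists x : asg N (listed l), sat (rename f phi1) (acat x u)).
  apply: definable_iff main => u; split=> -[x].
    rewrite sat_rename => hx.
    exists (fun s w => if pselect (List.In (existT W s w) l) is left h
                       then x s (exist _ w h) else d s).
    rewrite -hQ h1; move: hx; congr (sat phi1 _).
    apply: asg_ext => s' [[v|y] hv] //=.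
    rewrite /acomp /= /unlist /=; case: pselect => [h|/(_ (hl _ _ hv))//].
    by congr (x s' _); apply: eq_exist.
  rewrite -hQ h1 => hx; exists (acomp x (unlist l)); rewrite sat_rename.
  move: hx; congr (sat phi1 _).
  by apply: asg_ext => s' [[v|y] hv].
move: (rename f phi1) => {hl f phi1 h1 hQ}; move: l => {strip l0 phi0 Q}l phi.
elim: l phi => [|[s w] l IH] phi.
  pose g : ren (cadd (@listed W [::]) U) U := fun s' v =>
    match v with inl x => False_rect _ (svalP x) | inr y => y end.
  exists (rename g phi) => u; rewrite sat_rename.
  have eqg (x : asg N (@listed W [::])) : acomp u g = acat x u.
    by apply: asg_ext => s' [[//]|y].
  split=> [h|[x]]; last by rewrite -eqg.
  have x : asg N (@listed W [::]) by move=> s' [].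
  by exists x; rewrite -eqg.
(* The head of the list may occur again in [l]. A variable is sent to the new quantifier only if it
   is absent from [l], and then [hcons] identifies it with the head. *)
have hcons s' (v : W s') : List.In (existT W s' v) ((existT W s w) :: l) ->
    ~ List.In (existT W s' v) l -> existT W s w = existT W s' v by case.
pose f : ren (cadd (listed ((existT W s w) :: l)) U)
             (cadd (cadd (listed l) U) (csingle s)) := fun s' v =>
  match v with
  | inl (exist v hv) =>
    match pselect (List.In (existT W s' v) l) with
    | left h => inl (inl (exist _ v h))
    | right h => inr (match hcons _ v hv h in _ = p return csingle s (projT1 p)
                      with erefl => here s end)
    end
  | inr y => inl (inr y)
  end.
have [psi hpsi] := definable_ex (definable_sat (rename f phi)).
apply: definable_iff (IH psi) => u; split=> -[x].
  rewrite hpsi => -[y]; rewrite sat_rename => h.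
  by exists (fun s' v => acomp (acat (acat x u) (aone y)) f (inl v));
    move: h; congr (sat phi _); apply: asg_ext => s' [[v hv]|z].
move=> h.
have hw : List.In (existT W s w) ((existT W s w) :: l) by left.
exists (fun s' v => x s' (exist _ (sval v) (or_intror (svalP v)))).
rewrite hpsi; exists (x s (exist _ w hw)); rewrite sat_rename.
move: h; congr (sat phi _); apply: asg_ext => s' [[v hv]|z] //=.
rewrite /acomp /=; case: pselect => [h'|h'] /=.
  by congr (x s' _); apply: eq_exist.
(* The equality given by [hcons] is generalised to one with a free endpoint, so that the match on it
   can be eliminated. *)
have gen p (E : existT W s w = p)
    (hp : List.In (existT W (projT1 p) (projT2 p)) ((existT W s w) :: l)) :
    aone (x s (exist _ w hw)) (match E in _ = q return csingle s (projT1 q) with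
      erefl => here s end) = x (projT1 p) (exist _ (projT2 p) hp).
  by case: p / E hp => hp /=; congr (x s _); apply: eq_exist.
by have -> := gen _ (hcons s' v hv h') hv.
Qed.

Definition pdefinable (D : psets N) W (Q : asg N W -> Prop) :=
  exists phi : formula (cadd W (csub D)),
    forall e, sat phi (acat e (pin D)) <-> Q e.

Lemma pdefinable_iff D W (P Q : asg N W -> Prop) :
  (forall e, P e <-> Q e) -> pdefinable D P -> pdefinable D Q.
Proof. by move=> PQ [phi h]; exists phi => e; rewrite h. Qed.

Lemma pdefinable_gen D W (R : asg N (cadd W (csub D)) -> Prop) :
  definable R -> pdefinable D (fun e => R (acat e (pin D))).
Proof. by move=> [phi h]; exists phi => e. Qed.

Lemma definable_pdefinable D W (Q : asg N W -> Prop) :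
  definable Q -> pdefinable D Q.
Proof.
move=> hQ.
exact: pdefinable_gen (definable_ren (fun s (v : W s) => inl v : cadd W (csub D) s) hQ).
Qed.

Lemma pdefinable_sub (D D' : psets N) W (Q : asg N W -> Prop) :
  (forall s, D s `<=` D' s) -> pdefinable D Q -> pdefinable D' Q.
Proof.
move=> DD' [phi h].
pose f : ren (cadd W (csub D)) (cadd W (csub D')) := fun s v =>
  match v with inl x => inl x | inr (exist y hy) => inr (exist _ y (DD' s y hy)) end.
exists (rename f phi) => e; rewrite sat_rename -h.
suff -> : acomp (acat e (pin D')) f = acat e (pin D) by [].
by apply: asg_ext => s [v|[y hy]].
Qed.

Lemma pdefinable_and D W (P Q : asg N W -> Prop) :
  pdefinable D P -> pdefinable D Q -> pdefinable D (fun e => P e /\ Q e).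
Proof.
move=> [p hp] [q hq].
have [phi h] := definable_and (definable_sat p) (definable_sat q).
by exists phi => e; rewrite h hp hq.
Qed.

Lemma pdefinable_and_list D W (T : Type) (l : seq T) (P : T -> asg N W -> Prop) :
  (forall i, List.In i l -> pdefinable D (P i)) ->
  pdefinable D (fun e => forall i, List.In i l -> P i e).
Proof.
elim: l => [|a l IH] hP.
  by apply: pdefinable_iff (definable_pdefinable D (definable_top W)).
have := pdefinable_and (hP a (or_introl erefl)) (IH (fun i hi => hP i (or_intror hi))).
apply: pdefinable_iff => e; split=> [[h1 h2] i /=|h].
  by case=> [<- //|]; exact: h2.
by split=> [|i hi]; apply: h; [left|right].
Qed.

Lemma pdefinable_ren D V W (f : ren V W) (Q : asg N V -> Prop) :
  pdefinable D Q -> pdefinable D (fun e : asg N W => Q (acomp e f)).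
Proof.
move=> [phi h]; exists (rename (@lift_ren S V W f (csub D)) phi) => e.
rewrite sat_rename -h.
suff -> : acomp (acat e (pin D)) (@lift_ren S V W f (csub D)) =
          acat (acomp e f) (pin D) by [].
by apply: asg_ext => s [].
Qed.

Lemma pdefinable_eq (D : psets N) W s (w : W s) (a : N s) :
  D s a -> pdefinable D (fun e : asg N W => e s w = a).
Proof.
move=> ha; pose c : csub D s := exist _ a ha.
exact: pdefinable_gen (definable_eq (inl w : cadd W (csub D) s) (inr c)).
Qed.

Lemma pdefinable_ex_ctx D (d : forall s, N s) W U (Q : asg N (cadd W U) -> Prop) :
  pdefinable D Q -> pdefinable D (fun u : asg N U => exists x : asg N W, Q (acat x u)).
Proof.
move=> [phi h].
pose f : ren (cadd (cadd W U) (csub D)) (cadd W (cadd U (csub D))) := fun s v =>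
  match v with inl (inl x) => inl x | inl (inr y) => inr (inl y)
             | inr z => inr (inr z) end.
have [psi hpsi] := definable_ex_ctx d (definable_ren f (definable_sat phi)).
exists psi => u; rewrite hpsi; split=> -[x hx]; exists x; move: hx; rewrite -h;
  by congr (sat phi _); apply: asg_ext => s [[]|].
Qed.

Section Realize.
Variable small : psets N -> Prop.

(** The bound on the parameters is a predicate: it is later instantiated by cardinality at most that
    of B and C together, by countability, and by the predicates that these induce on the residue
    field and the value group. *)
Definition type_saturated :=
  forall D : psets N, small D ->
  forall (s : Defs.sort S) (p : set (formula (cadd (csingle s) (csub D)))),
    (forall (m : nat) (psi : 'I_m -> formula (cadd (csingle s) (csub D))),
       (forall i, p (psi i)) ->
       exists x : N s, forall i, sat (psi i) (acat (aone x) (pin D))) ->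
  exists x : N s, forall phi, p phi -> sat phi (acat (aone x) (pin D)).

Definition small_addable :=
  forall D D' : psets N, small D -> countable (tagged_union D') ->
    small (fun s => D s `|` D' s).

Hypothesis hsat : type_saturated.
Hypothesis hsmall : small_addable.
Variable d : forall s, N s.

Lemma aone_here s (e : asg N (csingle s)) : aone (e s (here s)) = e.
Proof. by apply: asg_ext => s' []. Qed.

Lemma realize1 D s (T : Type) (P : T -> asg N (csingle s) -> Prop) :
  small D -> (forall i, pdefinable D (P i)) ->
  (forall l : seq T, exists y, forall i, List.In i l -> P i y) ->
  exists y, forall i, P i y.
Proof.
move=> hD hP hfin.
pose p := [set phi | exists i, forall e, sat phi (acat e (pin D)) <-> P i e].
have [m psi hpsi|x hx] := hsat hD (p := p).
  pose i_ k := sval (cid (hpsi k)).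
  have hi k e : sat (psi k) (acat e (pin D)) <-> P (i_ k) e.
    exact: svalP (cid (hpsi k)) e.
  have [y hy] := hfin [seq i_ k | k <- enum 'I_m].
  exists (y s (here s)) => k; rewrite aone_here hi; apply: hy.
  have := mem_enum 'I_m k; elim: (enum 'I_m) => //= a l IH.
  by rewrite inE => /orP[/eqP->|/IH]; [left|right].
exists (aone x) => i; have [phi hphi] := hP i.
by rewrite -hphi; apply: hx; exists i.
Qed.

Lemma lists_below (T : Type) (idx : T -> nat) (n : nat) :
  injective idx -> exists l, forall v, List.In v l <-> (idx v < n)%N.
Proof.
move=> inj; elim: n => [|n [l hl]]; first by exists [::].
have [[v hv]|no] := pselect (exists v, idx v = n).
  exists (v :: l) => u /=; rewrite hl (ltnS (idx u)) (leq_eqVlt (idx u)) -hv; split.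
    by case=> [->|->]; rewrite ?eqxx ?orbT.
  by case/orP=> [/eqP/inj->|]; [left|right].
exists l => u; rewrite hl (ltnS (idx u)) (leq_eqVlt (idx u)); split=> [->|]; first by rewrite orbT.
by case/orP => // /eqP h; case: no; exists u.
Qed.

(** Types in countably many variables: the variables are assigned in the order of [idx], each by one
    application of saturation for 1-types. The invariant [Inv n x] keeps every finite part of the
    type solvable without changing the values of index below n. *)
Lemma realize D W (idx : {s & W s} -> nat) (T : Type) (P : T -> asg N W -> Prop) :
  injective idx -> small D -> (forall i, pdefinable D (P i)) ->
  (forall l : seq T, exists x, forall i, List.In i l -> P i x) ->
  exists x, forall i, P i x.
Proof.
move=> inj hD hP hfin.
pose agree n (x x' : asg N W) :=
  forall s w, (idx (existT W s w) < n)%N -> x' s w = x s w.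
pose Inv n x := forall l : seq T, exists x', agree n x x' /\
  forall i, List.In i l -> P i x'.
have step n x : Inv n x -> exists x', agree n x x' /\ Inv n.+1 x'.
  move=> hx; have [[[s w] hv]|no] := pselect (exists v, idx v = n); last first.
    exists x; split=> // l; have [x' [ag h]] := hx l; exists x'; split=> //.
    move=> s w; rewrite ltnS leq_eqVlt => /orP[/eqP h'|]; last exact: ag.
    by case: no; exists (existT W s w).
  have [below hbelow] := lists_below n inj.
  (* The finitely many values chosen so far become parameters. *)
  pose D' : psets N := fun s => [set a | exists2 v, List.In v below &
    existT N s a = existT N (projT1 v) (x _ (projT2 v))].
  have cD' : countable (tagged_union D').
    have sub : tagged_union D' `<=`
        [set existT N (projT1 v) (x _ (projT2 v)) | v in [set v | List.In v below]].
      by move=> [s' a] /= [v hv' ->]; exists v.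
    apply: sub_countable (subset_card_le sub) _.
    apply: sub_countable (card_image_le _ _) _.
    elim: (below) => [|a l IH]; first by rewrite (_ : [set v | _] = set0) // -subset0.
    rewrite (_ : [set v | _] = [set a] `|` [set v | List.In v l]); last first.
      by apply/seteqP; split=> v /= [->|]; by [left|right].
    by rewrite -bigcup2E; apply: bigcup_countable => // -[|[|k]] _ //=.
  pose E : psets N := fun s => D s `|` D' s.
  have hE : small E by exact: hsmall.
  (* The condition on the next value is that [l] stays solvable by some assignment continuing it.
     The remaining variables are quantified away, which leaves a 1-type. *)
  pose Q (l : seq T) (y : asg N (csingle s)) := exists x' : asg N W,
    (agree n x x' /\ x' s w = y s (here s)) /\ forall i, List.In i l -> P i x'.
  have hQ l : pdefinable E (Q l).
    have main : pdefinable E (fun e : asg N (cadd W (csingle s)) =>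
       ((forall v, List.In v below ->
          e _ (inl (projT2 v)) = x _ (projT2 v)) /\
        e s (inl w) = e s (inr (here s))) /\
       (forall i, List.In i l -> P i (acomp e (fun s v => inl v)))).
      apply: pdefinable_and; first apply: pdefinable_and.
      - apply: pdefinable_and_list => v hv'.
        by apply: pdefinable_eq; right; exists v.
      - exact: definable_pdefinable (definable_eq _ _).
      - apply: pdefinable_and_list => i _; apply: pdefinable_ren.
        by apply: (pdefinable_sub _ (hP i)) => s' a ha; left.
    apply: pdefinable_iff (pdefinable_ex_ctx d main) => y.
    split=> -[x' [[h1 h2] h3]]; exists x'; split=> //; split=> //.
      by move=> s' w' /hbelow h; exact: h1 (existT W s' w') h.
    by move=> [s' w'] /hbelow h; exact: h1.
  have [|y hy] := realize1 hE hQ.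
    move=> L; have [x' [ag h]] := hx (flatten L).
    exists (aone (x' s w)) => l hl; exists x'; split=> // i hi; apply: h.
    elim: L hl {hQ} => //= a L IH [->|/IH h]; apply/List.in_app_iff; by [left|right].
  have [x1 [[ag1 e1] _]] := hy [::].
  exists x1; split=> // l; have [x' [[ag' e'] h]] := hy l.
  exists x'; split=> // s' w'; rewrite ltnS leq_eqVlt => /orP[/eqP hh|hh].
    rewrite -hv in hh; have hT := inj _ _ hh.
    suff gen v : existT W s w = v -> x' _ (projT2 v) = x1 _ (projT2 v).
      exact: gen (existT W s' w') (esym hT).
    by move=> <- /=; rewrite e' e1.
  by rewrite ag' // ag1.
have [x0 _] := hfin [::].
have hx0 : Inv 0%N x0.
  by move=> l; have [x' h] := hfin l; exists x'; split.
pose nxt n (x : {x | Inv n x}) : {x | Inv n.+1 x} :=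
  exist _ (sval (cid (step n (sval x) (svalP x))))
          (svalP (cid (step n (sval x) (svalP x)))).2.
pose seq_ := fix F n : {x | Inv n x} :=
  if n is m.+1 then nxt m (F m) else exist _ x0 hx0.
have mono n m s w : (idx (existT W s w) < n)%N -> (n <= m)%N ->
    sval (seq_ m) s w = sval (seq_ n) s w.
  move=> hw; elim: m => [|m IH]; first by rewrite leqn0 => /eqP->.
  rewrite leq_eqVlt => /orP[/eqP-> //|]; rewrite ltnS => hnm.
  rewrite -(IH hnm) /= ; apply: (svalP (cid (step m _ _))).1.
  exact: leq_trans hnm.
(* The limit assignment reads each variable right after the stage that fixes it. A formula mentions
   finitely many variables, and stage [k], beyond the indices of all of them, agrees with the limit
   there. *)
exists (fun s w => sval (seq_ (idx (existT W s w)).+1) s w) => i.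
have [phi hphi] := hP i; have [l hl] := sat_support phi.
pose k := \max_(v <- l) (if v is existT s (inl w) then (idx (existT W s w)).+1 else 0%N).
have [x' [ag h]] := svalP (seq_ k) [:: i].
have hk s w : List.In (existT (cadd W (csub D)) s (inl w)) l -> (idx (existT W s w) < k)%N.
  rewrite /k; elim: (l) => //= v l' IH; rewrite big_cons => -[->|/IH h']; first exact: leq_maxl.
  exact: leq_trans h' (leq_maxr _ _).
rewrite -hphi (hl _ (acat x' (pin D))).
  by rewrite hphi; apply: h; left.
move=> s [w|c] //= /hk hw; rewrite ag //; apply/esym.
exact: (mono (idx (existT W s w)).+1 k s w (ltnSn _) hw).
Qed.

End Realize.
End Definable.

(** * Elementary relations *)

Section Elementary.
Variables (S : signature) (N : structure S).
Implicit Types (V W : ctx S) (E : forall s, N s -> N s -> Prop).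

(** Partial elementary maps are kept as relations; applied to an equation, the condition itself
    forces them to be injective functions ([elem_rel_eq]). *)
Definition elem_rel E := forall V (phi : formula V) (e e' : asg N V),
  (forall s v, E s (e s v) (e' s v)) -> (sat phi e <-> sat phi e').

Lemma elem_rel_definable E V (Q : asg N V -> Prop) (e e' : asg N V) :
  elem_rel E -> definable Q -> (forall s v, E s (e s v) (e' s v)) ->
  (Q e <-> Q e').
Proof. by move=> hE [phi h] hee; rewrite -!h; exact: hE. Qed.

Lemma elem_rel_inv E : elem_rel E -> elem_rel (fun s x y => E s y x).
Proof. by move=> hE V phi e e' h; apply: iff_sym; exact: hE. Qed.

Lemma elem_rel_sub E E' : (forall s x y, E' s x y -> E s x y) ->
  elem_rel E -> elem_rel E'.
Proof. by move=> h hE V phi e e' hee; apply: hE => s v; exact/h/hee. Qed.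

(** A formula involves finitely many variables, so elementarity is a property of finite parts. This
    is what later reduces arbitrary relations to countable ones. *)
Lemma elem_rel_finite E :
  (forall l : seq {s & (N s * N s)%type},
    (forall p, List.In p l -> E _ (projT2 p).1 (projT2 p).2) ->
    exists2 E', elem_rel E' &
      forall p, List.In p l -> E' _ (projT2 p).1 (projT2 p).2) ->
  elem_rel E.
Proof.
move=> hfin V phi e e' hee.
have [l [phi0 h]] := formula_support N phi.
pose pr (x : {s & V s}) : {s & (N s * N s)%type} :=
  existT _ (projT1 x) (e _ (projT2 x), e' _ (projT2 x)).
have [|E' hE' hl] := hfin (List.map pr l).
  by move=> p /List.in_map_iff[[s v] [<- _]] /=; exact: hee.
rewrite !h; apply: (hE' _ phi0) => s [v hv].
exact: hl (pr (existT _ s v)) (List.in_map pr _ _ hv).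
Qed.

Lemma elem_rel_eq E s x x' y y' : elem_rel E -> E s x x' -> E s y y' ->
  (x = y <-> x' = y').
Proof.
move=> hE hx hy.
pose V : ctx S := cadd (csingle s) (csingle s).
have h s' (v : V s') :
  E s' ((acat (aone x) (aone y) : asg N V) s' v) ((acat (aone x') (aone y') : asg N V) s' v).
  by case: v => -[].
exact: elem_rel_definable hE (definable_eq N (inl (here s) : V s) (inr (here s))) h.
Qed.

(** The type of [X] over the domain of [E] is carried to the range of [E] and realised there by
    saturation; that a finite part is consistent is an existential statement, true on the domain
    side. *)
Lemma elem_rel_extend (small : psets N -> Prop) (d : forall s, N s)
    E (X : psets N) :
  type_saturated small -> small_addable small -> elem_rel E ->
  small (fun s => [set y | exists x, E s x y]) ->
  countable (tagged_union X) ->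
  exists h : forall s, N s -> N s,
    elem_rel (fun s x y => E s x y \/ (X s x /\ y = h s x)).
Proof.
move=> hsat hsmall hE hD cX; set D : psets N := fun s => _ in hD.
have pre_ex s (y : csub D s) : exists x, E s x (sval y) by case: y.
pose pre : asg N (csub D) := fun s y => sval (cid (pre_ex s y)).
have hpre s y : E s (pre s y) (sval y) by exact: svalP (cid (pre_ex s y)).
pose T := {phi : formula (cadd (csub X) (csub D)) | sat phi (acat (pin X) pre)}.
pose P (phi : T) (x : asg N (csub X)) := sat (sval phi) (acat x (pin D)).
have /countable_injP[g ginj] := cX.
pose idx (v : {s & csub X s}) := g (existT N _ (sval (projT2 v))).
have idx_inj : injective idx.
  move=> [s [x hx]] [s' [x' hx']]; rewrite /idx /= => /ginj.
  rewrite !inE => /(_ hx hx') hT.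
  suff gen (p : {s & N s}) (hp : X _ (projT2 p)) : existT N s x = p ->
      existT (csub X) s (exist _ x hx) = existT (csub X) _ (exist _ (projT2 p) hp).
    exact: gen (existT N s' x') hx' hT.
  by move=> hT'; move: hp; case: _ / hT' => /= hp; congr existT; exact: eq_exist.
have [||x hx] := realize hsat hsmall d (P := P) idx_inj hD.
- by move=> phi; exists (sval phi).
- move=> l.
  have hQ : definable (fun u : asg N (csub D) => exists x : asg N (csub X),
      forall phi : T, List.In phi l -> sat (sval phi) (acat x u)).
    apply: (definable_ex_ctx d (Q := fun e => forall phi : T, List.In phi l ->
      sat (sval phi) e)).
    by apply: definable_and_list => phi; exact: definable_sat.
  apply: (iffLR (elem_rel_definable hE hQ hpre)).
  by exists (pin X) => phi _; exact: (svalP phi).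
pose h s (y : N s) : N s :=
  if pselect (X s y) is left hy then x s (exist _ y hy) else y.
have hh s y (hy : X s y) : h s y = x s (exist _ y hy).
  by rewrite /h; case: pselect => // hy'; congr (x s _); exact: eq_exist.
exists h.
suff main V (phi : formula V) (e e' : asg N V) :
    (forall s v, E s (e s v) (e' s v) \/ (X s (e s v) /\ e' s v = h s (e s v))) ->
    sat phi e -> sat phi e'.
  move=> V phi e e' hee; split; first exact: main.
  by move=> he'; apply: contrapT => he; exact: (main V (FImp phi (FBot V)) e e' hee he he').
move=> hee he.
have hee' s v : ~ (X s (e s v) /\ e' s v = h s (e s v)) -> D s (e' s v).
  by case: (hee s v) => [h1 _|//]; exists (e s v).
(* Each variable denotes either a new element of [X] or a parameter from the range. The latter is
   represented on the domain side by its chosen preimage [pre], which equals the given one by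
   injectivity. *)
pose f : ren V (cadd (csub X) (csub D)) := fun s v =>
  match pselect (X s (e s v) /\ e' s v = h s (e s v)) with
  | left hv => inl (exist _ (e s v) hv.1)
  | right hv => inr (exist _ (e' s v) (hee' s v hv))
  end.
have hphi : sat (rename f phi) (acat (pin X) pre).
  rewrite sat_rename; move: he; congr (sat phi _); apply: asg_ext => s v.
  rewrite /acomp /f; case: pselect => [//|hv] /=.
  have [h1|//] := hee s v.
  exact: (iffRL (elem_rel_eq hE h1 (hpre s _))).
have := hx (exist (fun phi => sat phi (acat (pin X) pre)) _ hphi); rewrite /P /= sat_rename.
congr (sat phi _); apply: asg_ext => s v.
rewrite /acomp /f; case: pselect => [hv|hv] //=.
exact: esym (etrans hv.2 (hh _ _ hv.1)).
Qed.

End Elementary.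

(** * One-sorted reducts *)

Section Reduct.
Variables (S : signature) (M : structure S) (s0 : Defs.sort S).
Variables (F : Type) (fs : F -> unit) (fa : F -> nat).
Variables (R : Type) (rd : R -> seq unit).
Let S1 := @Signature unit F fs fa R rd.
Variable fi : forall f : F, ('I_(fa f) -> M s0) -> M s0.
Variable ri : forall r : R, args (fun _ : unit => M s0) (rd r) -> Prop.
Let N := @Structure S1 (fun=> M s0) fi ri.

Definition pull (V : ctx S1) (W : ctx S) (e : asg M W) (f : V tt -> W s0) :
  asg N V := fun s => match s return V s -> M s0 with tt => fun v => e s0 (f v) end.

(** How the symbols of the reduct translate into [M] is left to the hypotheses [hterm] and [hrel],
    so that the residue field and the value group are treated by one argument. *)
Definition pterm (V : ctx S1) (W : ctx S) (f : V tt -> W s0) s (t : term V s) :=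
  exists t' : term W s0, forall e : asg M W, eval e t' = eval (pull e f) t.

Hypothesis hterm : forall (V : ctx S1) (W : ctx S) (f : V tt -> W s0) s (t : term V s), pterm f t.
Hypothesis hrel : forall (V : ctx S1) (W : ctx S) (f : V tt -> W s0) (r : R)
  (ts : args (term V) (rd r)),
  definable (fun e : asg M W => ri (fun i => eval (pull e f) (ts i))).

Lemma definable_reduct (V : ctx S1) (W : ctx S) (f : V tt -> W s0) (phi : formula V) :
  definable (fun e : asg M W => sat phi (pull e f)).
Proof.
elim: phi W f => {V} [V s t u|V r ts|V|V p IHp q IHq|V [] p IHp] W f /=.
- have [t' ht] := hterm f t; have [u' hu] := hterm f u.
  by exists (FEq t' u') => e /=; rewrite ht hu.
- exact: hrel.
- exact: definable_bot.
- exact: definable_imp.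
pose f' (v : @cadd S1 V (@csingle S1 tt) tt) : cadd W (csingle s0) s0 :=
  match v with inl x => inl (f x) | inr _ => inr (here s0) end.
apply: definable_iff (definable_all (IHp _ f')) => e.
by split=> h x; have := h x; congr (sat p _);
  (apply: asg_ext => s [v|c]; [case: s v|case: s / c]).
Qed.

(** Equality of dependent pairs expresses that [x] lies in the sort [s0] without deciding equality
    of sorts. *)
Definition lift_psets (D : psets N) : psets M :=
  fun s => [set x | exists2 y, D tt y & existT M s0 y = existT M s x].

Lemma pdefinable_reduct (D : psets N) (V : ctx S1) (W : ctx S) (f : V tt -> W s0)
    (phi : formula (cadd V (csub D))) :
  pdefinable (lift_psets D) (fun e : asg M W => sat phi (acat (pull e f) (pin D))).
Proof.
pose g (v : @cadd S1 V (csub D) tt) : cadd W (csub (lift_psets D)) s0 :=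
  match v with
  | inl x => inl (f x)
  | inr (exist y hy) => inr (exist _ y (ex_intro2 _ _ y hy erefl))
  end.
apply: pdefinable_iff (pdefinable_gen (definable_reduct g phi)) => e.
suff -> : pull (acat e (pin (lift_psets D))) g = acat (pull e f) (pin D) by [].
by apply: asg_ext => -[] [v|[y hy]].
Qed.

Variable small : psets M -> Prop.
Hypothesis hsat : type_saturated small.
Hypothesis hsmall : small_addable small.

Definition reduct_small (D : psets N) := small (lift_psets D).

(** A type of the reduct is a partial type of [M] in the sort [s0] over the same parameters. *)
Lemma reduct_type_saturated : type_saturated reduct_small.
Proof.
move=> D hD [] p hp.
pose P (phi : {phi | p phi}) (e : asg M (csingle s0)) :=
  sat (sval phi) (acat (@aone S1 N tt (e s0 (here s0))) (pin D)).
have [||y hy] := realize1 hsat (P := P) hD.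
- move=> phi.
  apply: pdefinable_iff (pdefinable_reduct (fun=> here s0) (sval phi)) => e.
  rewrite /P; set a := acat _ _; set b := acat _ _.
  by have -> : a = b by apply: asg_ext => s [c|]; first case: s / c.
- move=> l; have [|x hx] := hp (size l) (fun i => sval (List.nth i l (tnth (in_tuple l) i))).
    by move=> i; exact: svalP.
  exists (@aone S M s0 x) => phi hphi.
  have [i [hi <-]] := List.In_nth l phi phi hphi.
  have hi' : (i < size l)%N by apply/ssrnat.ltP.
  by have := hx (Ordinal hi'); rewrite /P (List.nth_indep _ _ phi).
by exists (y s0 (here s0)) => phi hphi; exact: hy (exist _ phi hphi).
Qed.

Lemma reduct_small_addable : small_addable reduct_small.
Proof.
move=> D D' hD cD'.
have := hsmall hD (D' := lift_psets D'); rewrite /reduct_small.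
have -> : (fun s => @lift_psets D s `|` @lift_psets D' s) =
          lift_psets (fun s => D s `|` D' s).
  apply: functional_extensionality_dep => s; apply/seteqP; split=> x.
    by move=> [] [y hy hx]; exists y => //; [left|right].
  by move=> [y [] hy hx]; [left|right]; exists y.
apply.
have -> : tagged_union (lift_psets D') =
    (fun p : {s : unit & M s0} => existT M s0 (projT2 p)) @` (tagged_union D').
  apply/seteqP; split=> [[s x] [y hy /= hx]|_ [[[] y] hy <-]].
    by exists (existT _ tt y).
  by exists y.
exact: sub_countable (card_image_le _ _) cD'.
Qed.

End Reduct.

(** * Valuations, residues and leading terms *)

Section ValuedFieldBasics.
Variable M : valuedField.
Implicit Types (x y z : M).

Section OrderedGroup.
Variable G : orderedGroupType.
Implicit Types (a b c : G).

Lemma og_leD a b c d : a <= b -> c <= d -> a + c <= b + d.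
Proof.
move=> ab cd; apply: le_trans (ogroup_le_add a cd) _.
by rewrite ![_ + d]addrC; exact: ogroup_le_add.
Qed.

Lemma og_leDr a b c : (a + c <= b + c) = (a <= b).
Proof.
apply/idP/idP => h; last exact: og_leD.
by rewrite -[a](addrK c) -[b](addrK c) ![_ - c]addrC; exact: ogroup_le_add.
Qed.

Lemma og_mulrn_eq0 a n : a *+ n.+1 = 0 -> a = 0.
Proof.
have pos b : 0 <= b -> b *+ n.+1 = 0 -> b = 0.
  move=> b0 h; apply/le_anti; rewrite b0 andbT -h mulrS -{1}[b]addr0.
  have : 0 <= b *+ n by elim: n {h} => // n IH; rewrite mulrS -[0]addr0 og_leD.
  exact: ogroup_le_add.
have /orP[/pos//|an h] := ogroup_le_total 0 a.
have na : 0 <= - a by rewrite -(og_leDr _ _ a) add0r addNr.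
by apply/oppr_inj; rewrite oppr0; apply: pos; rewrite // mulNrn h oppr0.
Qed.

Lemma vle_refl (u : option G) : vle u u.
Proof. by case: u => //= a; exact: lexx. Qed.

Lemma vle_trans (v u w : option G) : vle u v -> vle v w -> vle u w.
Proof. by case: u v w => [a|] [b|] [c|] //=; exact: le_trans. Qed.

Lemma vle_total (u v : option G) : vle u v || vle v u.
Proof. by case: u v => [a|] [b|] //=; exact: ogroup_le_total. Qed.

Lemma vle_anti (u v : option G) : vle u v -> vle v u -> u = v.
Proof. by case: u v => [a|] [b|] //= h1 h2; congr Some; apply/le_anti/andP. Qed.

End OrderedGroup.

(** Values are compared through field elements, which makes 0 an ordinary least element and turns
    shifts of values into multiplications. *)
Definition dle x y : bool := vle (vval x) (vval y).
Definition dlt x y : bool := ~~ dle y x.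

Lemma dle_refl x : dle x x. Proof. exact: vle_refl. Qed.
Lemma dle_trans y x z : dle x y -> dle y z -> dle x z. Proof. exact: vle_trans. Qed.
Lemma dle_total x y : dle x y || dle y x. Proof. exact: vle_total. Qed.
Lemma dleNgt x y : dle x y = ~~ dlt y x. Proof. by rewrite /dlt negbK. Qed.
Lemma dltW x y : dlt x y -> dle x y.
Proof. by have /orP[-> //|h] := dle_total x y; rewrite /dlt h. Qed.
Lemma dle_lt_trans y x z : dle x y -> dlt y z -> dlt x z.
Proof. by move=> xy; apply: contra => zx; exact: dle_trans zx xy. Qed.
Lemma dlt_le_trans y x z : dlt x y -> dle y z -> dlt x z.
Proof. by move=> xy yz; apply: contra xy => zx; exact: dle_trans yz zx. Qed.
Lemma dlt_trans y x z : dlt x y -> dlt y z -> dlt x z.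
Proof. by move=> /dltW; exact: dle_lt_trans. Qed.
Lemma dltxx x : dlt x x = false. Proof. by rewrite /dlt dle_refl. Qed.
Lemma dltNle x y : dlt x y -> dle y x -> False. Proof. by rewrite /dlt => /negP. Qed.
Lemma deqP x y : vval x = vval y <-> dle x y /\ dle y x.
Proof. by split=> [h|[]]; [rewrite /dle h vle_refl|exact: vle_anti]. Qed.

Lemma vval_0 : vval (0 : M) = None. Proof. exact/vval0. Qed.
Lemma vval_neq0 x : x != 0 -> exists g, vval x = Some g.
Proof.
case E : (vval x) => [g|]; first by exists g.
by move/vval0: E => ->; rewrite eqxx.
Qed.

Lemma dle0x x : dle 0 x. Proof. by rewrite /dle vval_0. Qed.
Lemma dlex0 x : dle x 0 = (x == 0).
Proof.
apply/idP/eqP => [|->]; last exact: dle_refl.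
rewrite /dle vval_0; case E : (vval x) => [//|] _; exact/vval0.
Qed.
Lemma dlt0x x : dlt 0 x = (x != 0). Proof. by rewrite /dlt dlex0. Qed.
Lemma dlt_neq0 x y : dlt x y -> y != 0.
Proof. by rewrite -dlt0x; apply: dle_lt_trans (dle0x x). Qed.

Lemma dleM2r z x y : z != 0 -> dle (x * z) (y * z) = dle x y.
Proof.
move=> /vval_neq0[g hg]; rewrite /dle !vvalM hg.
by case: (vval x) (vval y) => [a|] [b|] //=; exact: og_leDr.
Qed.
Lemma dleM2l z x y : z != 0 -> dle (z * x) (z * y) = dle x y.
Proof. by rewrite ![z * _]mulrC; exact: dleM2r. Qed.
Lemma dltM2r z x y : z != 0 -> dlt (x * z) (y * z) = dlt x y.
Proof. by move=> z0; rewrite /dlt dleM2r. Qed.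
Lemma dltM2l z x y : z != 0 -> dlt (z * x) (z * y) = dlt x y.
Proof. by move=> z0; rewrite /dlt dleM2l. Qed.

Lemma dleM x x' y y' : dle x x' -> dle y y' -> dle (x * y) (x' * y').
Proof.
move=> hx hy; have [->|y0] := eqVneq y 0; first by rewrite mulr0 dle0x.
apply: (@dle_trans (x' * y)); first by rewrite dleM2r.
have [->|x0] := eqVneq x' 0; first by rewrite mul0r dle0x.
by rewrite dleM2l.
Qed.

Lemma dltMl x x' y y' : dlt x x' -> dle y y' -> y' != 0 -> dlt (x * y) (x' * y').
Proof.
by move=> hx hy y0; apply: (@dle_lt_trans (x * y'));
  [exact: dleM (dle_refl _) hy|rewrite dltM2r].
Qed.

Lemma dltMr x x' y y' : dle x x' -> dlt y y' -> x' != 0 -> dlt (x * y) (x' * y').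
Proof. by move=> hx hy x0; rewrite ![_ * y]mulrC [_ * y']mulrC; exact: dltMl. Qed.

Lemma dleD x y z : dle x z -> dle y z -> dle (x + y) z.
Proof.
move=> hx hy; apply: vle_trans (vvalD x y) _.
by rewrite /vmax; case: ifP.
Qed.

Lemma dltD x y z : dlt x z -> dlt y z -> dlt (x + y) z.
Proof.
move=> hx hy; have /orP[xy|yx] := dle_total x y.
  by apply: dle_lt_trans hy; exact: dleD xy (dle_refl _).
by apply: dle_lt_trans hx; exact: dleD (dle_refl _) yx.
Qed.

Lemma vval_1 : vval (1 : M) = Some 0.
Proof.
have := vvalM (1 : M) 1; rewrite mulr1.
have [g ->] := vval_neq0 (oner_neq0 M) => /= -[] /eqP.
by rewrite -subr_eq0 opprD addNKr oppr_eq0 => /eqP->.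
Qed.

Lemma vval_unitE x : vval x = Some 0 <-> dle x 1 /\ dle 1 x.
Proof. by rewrite -vval_1; exact: deqP. Qed.

(** Since $(-1)^2=1$, the value of $-1$ is 2-torsion, hence 0. *)
Lemma vval_N x : vval (- x) = vval x.
Proof.
rewrite -mulN1r vvalM; have -> : vval (-1 : M) = Some 0.
  have n1 : (-1 : M) != 0 by rewrite oppr_eq0 oner_neq0.
  have [g hg] := vval_neq0 n1.
  have := vvalM (-1 : M) (-1); rewrite mulrNN mulr1 vval_1 hg => -[] h.
  by rewrite (@og_mulrn_eq0 _ g 1) // mulr2n.
by case: (vval x) => //= g; rewrite add0r.
Qed.

Lemma dleNl x y : dle (- x) y = dle x y. Proof. by rewrite /dle vval_N. Qed.
Lemma dleNr x y : dle x (- y) = dle x y. Proof. by rewrite /dle vval_N. Qed.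
Lemma dltNl x y : dlt (- x) y = dlt x y. Proof. by rewrite /dlt dleNr. Qed.
Lemma dltNr x y : dlt x (- y) = dlt x y. Proof. by rewrite /dlt dleNl. Qed.
Lemma dleB x y z : dle x z -> dle y z -> dle (x - y) z.
Proof. by move=> hx hy; rewrite dleD // dleNl. Qed.
Lemma dltB x y z : dlt x z -> dlt y z -> dlt (x - y) z.
Proof. by move=> hx hy; rewrite dltD // dltNl. Qed.
Lemma dlt_subC x y z : dlt (x - y) z = dlt (y - x) z.
Proof. by rewrite -dltNl opprB. Qed.

Lemma dle_sum (I : Type) (r : seq I) (P : pred I) (F : I -> M) z :
  (forall i, P i -> dle (F i) z) -> dle (\sum_(i <- r | P i) F i) z.
Proof.
by move=> h; elim/big_ind: _ => //; [exact: dle0x|move=> x y; exact: dleD].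
Qed.

Lemma dlt_sum (I : Type) (r : seq I) (P : pred I) (F : I -> M) z :
  z != 0 -> (forall i, P i -> dlt (F i) z) -> dlt (\sum_(i <- r | P i) F i) z.
Proof.
by move=> z0 h; elim/big_ind: _ => //; [rewrite dlt0x|move=> x y; exact: dltD].
Qed.

Lemma dleX x y n : dle x y -> dle (x ^+ n) (y ^+ n).
Proof.
by move=> h; elim: n => [|n IH]; rewrite ?expr0 ?dle_refl // !exprS dleM.
Qed.

Lemma dltX x y n : dlt x y -> dlt (x ^+ n.+1) (y ^+ n.+1).
Proof.
move=> h; elim: n => [|n IH]; first by rewrite !expr1.
by rewrite exprS [y ^+ _]exprS dltMl // ?dltW // expf_neq0 // (dlt_neq0 h).
Qed.

Lemma vvalX_inj x y n : vval (x ^+ n.+1) = vval (y ^+ n.+1) -> vval x = vval y.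
Proof.
move/deqP=> [h1 h2]; apply/deqP; split; rewrite dleNgt;
  by apply/negP => /(@dltX _ _ n)/dltNle; exact.
Qed.

Lemma dleV x y : x != 0 -> y != 0 -> dle (x^-1) (y^-1) = dle y x.
Proof.
move=> x0 y0; rewrite -(dleM2r _ _ x0) mulVf // -(dleM2l _ _ y0) mulr1.
by rewrite mulrA divff // mul1r.
Qed.

Lemma dle_div1 x y : y != 0 -> dle (x / y) 1 = dle x y.
Proof. by move=> y0; rewrite -(dleM2r _ _ y0) divfK // mul1r. Qed.
Lemma dlt_div1 x y : y != 0 -> dlt (x / y) 1 = dlt x y.
Proof. by move=> y0; rewrite -(dltM2r _ _ y0) divfK // mul1r. Qed.
Lemma dle_1div x y : y != 0 -> dle 1 (x / y) = dle y x.
Proof. by move=> y0; rewrite -(dleM2r _ _ y0) divfK // mul1r. Qed.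

Lemma dle_eqr x y z : vval x = vval y -> dle z x = dle z y.
Proof. by rewrite /dle => ->. Qed.
Lemma dle_eql x y z : vval x = vval y -> dle x z = dle y z.
Proof. by rewrite /dle => ->. Qed.
Lemma dlt_eqr x y z : vval x = vval y -> dlt z x = dlt z y.
Proof. by rewrite /dlt /dle => ->. Qed.
Lemma dlt_eql x y z : vval x = vval y -> dlt x z = dlt y z.
Proof. by rewrite /dlt /dle => ->. Qed.
Lemma vval_eq0 x y : vval x = vval y -> (x == 0) = (y == 0).
Proof. by move=> h; rewrite -!dlex0 (dle_eql _ h). Qed.
Lemma vval_mul x x' y y' : vval x = vval x' -> vval y = vval y' ->
  vval (x * y) = vval (x' * y').
Proof. by rewrite !vvalM => -> ->. Qed.
Lemma vval_inv x y : vval x = vval y -> vval x^-1 = vval y^-1.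
Proof.
have [->|x0] := eqVneq x 0.
  by move=> /vval_eq0; rewrite eqxx => /esym/eqP->.
have [->|y0] := eqVneq y 0; first by move/vval_eq0; rewrite eqxx (negbTE x0).
by move/deqP=> [h1 h2]; apply/deqP; rewrite !dleV.
Qed.
Lemma vval_exp x y n : vval x = vval y -> vval (x ^+ n) = vval (y ^+ n).
Proof.
by move=> h; elim: n => [|n IH]; rewrite ?expr0 // !exprS; exact: vval_mul.
Qed.

(* Equality of leading terms; false at [y = 0]. *)
Definition aeq x y : bool := dlt (x - y) y.

Lemma aeq_refl x : x != 0 -> aeq x x.
Proof. by rewrite /aeq subrr dlt0x. Qed.

Lemma vval_aeq x y : aeq x y -> vval x = vval y.
Proof.
rewrite /aeq => h; apply/deqP; split.
  by rewrite -[x](subrK y) dleD ?dle_refl // dltW.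
rewrite dleNgt; apply/negP => xy.
suff : dlt y y by rewrite dltxx.
by rewrite -{1}[y](subrK x) dltD // dlt_subC.
Qed.

Lemma aeq_neq0r x y : aeq x y -> y != 0. Proof. exact: dlt_neq0. Qed.
Lemma aeq_neq0l x y : aeq x y -> x != 0.
Proof. by move=> h; rewrite (vval_eq0 (vval_aeq h)); exact: aeq_neq0r h. Qed.

Lemma aeq_sym x y : aeq x y -> aeq y x.
Proof.
by move=> h; rewrite /aeq dlt_subC (dlt_eqr _ (vval_aeq h)).
Qed.

Lemma aeq_trans y x z : aeq x y -> aeq y z -> aeq x z.
Proof.
move=> h1 h2; rewrite /aeq -[x](subrK y) -addrA dltD //.
by rewrite -(dlt_eqr _ (vval_aeq h2)).
Qed.

Lemma aeq_mul x x' y y' : aeq x x' -> aeq y y' -> aeq (x * y) (x' * y').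
Proof.
move=> h1 h2; rewrite /aeq.
have -> : x * y - x' * y' = (x - x') * y + x' * (y - y').
  by rewrite mulrBl mulrBr addrA subrK.
apply: dltD; first by rewrite dltMl ?(aeq_neq0r h2) //; have /deqP[] := vval_aeq h2.
by rewrite dltMr ?dle_refl // (aeq_neq0r h1).
Qed.

Lemma aeq_inv x y : aeq x y -> aeq x^-1 y^-1.
Proof.
move=> h; have x0 := aeq_neq0l h; have y0 := aeq_neq0r h.
rewrite /aeq -(dltM2r _ _ x0) -(dltM2r _ _ y0) mulrBl mulVf // mulrBl mul1r.
have -> : y^-1 * x * y = x by rewrite mulrAC mulVf // mul1r.
by rewrite dlt_subC (dlt_eqr _ (vval_aeq h)).
Qed.

Lemma aeq_div x x' y y' : aeq x x' -> aeq y y' -> aeq (x / y) (x' / y').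
Proof. by move=> h1 h2; rewrite aeq_mul // aeq_inv. Qed.

Lemma aeq_mul2l z x y : z != 0 -> aeq (z * x) (z * y) = aeq x y.
Proof. by move=> z0; rewrite /aeq -mulrBr dltM2l. Qed.

Lemma aeq_addl x y : dlt y x -> aeq (x + y) x.
Proof. by rewrite /aeq addrAC subrr add0r. Qed.

Lemma vle_dle1 x : vle (vval x) (Some 0) = dle x 1.
Proof. by rewrite /dle vval_1. Qed.

Lemma res_ker x : dle x 1 -> (vres x == 0) = dlt x 1.
Proof.
rewrite -vle_dle1 => h; have := vres_ker h; rewrite /vlt /dlt /dle vval_1 => hk.
by apply/eqP/idP => /hk.
Qed.

Lemma resD x y : dle x 1 -> dle y 1 -> vres (x + y) = vres x + vres y.
Proof. by rewrite -!vle_dle1; exact: vresD. Qed.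
Lemma resM x y : dle x 1 -> dle y 1 -> vres (x * y) = vres x * vres y.
Proof. by rewrite -!vle_dle1; exact: vresM. Qed.
Lemma res_1 : vres (1 : M) = 1. Proof. exact: vres1. Qed.
Lemma res_0 : vres (0 : M) = 0.
Proof. by apply/eqP; rewrite res_ker ?dle0x // dlt0x oner_neq0. Qed.
Lemma resN x : dle x 1 -> vres (- x) = - vres x.
Proof.
move=> h; apply/eqP; rewrite eq_sym -subr_eq0.
by rewrite -opprD oppr_eq0 -resD ?dleNl // subrr res_0.
Qed.
Lemma resB x y : dle x 1 -> dle y 1 -> vres (x - y) = vres x - vres y.
Proof. by move=> hx hy; rewrite resD ?dleNl // resN. Qed.
Lemma res_eq x y : dle x 1 -> dle y 1 -> (vres x == vres y) = dlt (x - y) 1.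
Proof. by move=> hx hy; rewrite -subr_eq0 -resB // res_ker // dleB. Qed.
Lemma res_sum (I : Type) (r : seq I) (P : pred I) (F : I -> M) :
  (forall i, P i -> dle (F i) 1) ->
  vres (\sum_(i <- r | P i) F i) = \sum_(i <- r | P i) vres (F i).
Proof.
move=> h; suff [] : dle (\sum_(i <- r | P i) F i) 1 /\
  vres (\sum_(i <- r | P i) F i) = \sum_(i <- r | P i) vres (F i) by [].
elim/big_rec2: _ => [|i x y Pi [h1 h2]]; first by rewrite dle0x res_0.
by rewrite dleD ?h // resD ?h // h2.
Qed.
Lemma dle1X x n : dle x 1 -> dle (x ^+ n) 1.
Proof. by move=> /(@dleX _ _ n); rewrite expr1n. Qed.
Lemma dle1M x y : dle x 1 -> dle y 1 -> dle (x * y) 1.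
Proof. by move=> hx hy; rewrite -[1]mulr1 dleM. Qed.
Lemma resX x n : dle x 1 -> vres (x ^+ n) = vres x ^+ n.
Proof.
by move=> h; elim: n => [|n IH]; rewrite ?expr0 ?res_1 // !exprS resM ?IH // dle1X.
Qed.
Lemma res_surj (r : vk M) : exists2 x, dle x 1 & vres x = r.
Proof. by have [x hx <-] := vres_surj r; exists x; rewrite // -vle_dle1. Qed.
Lemma res_neq0 x : dle x 1 -> (vres x != 0) = dle 1 x.
Proof. by move=> h; rewrite res_ker // /dlt negbK. Qed.
Lemma resV x : dle x 1 -> dle 1 x -> vres x^-1 = (vres x)^-1.
Proof.
move=> h1 h2; have x0 : x != 0 by rewrite -dlt0x; apply: dlt_le_trans h2; rewrite dlt0x oner_neq0.
have r0 : vres x != 0 by rewrite res_neq0.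
have hV : dle x^-1 1 by rewrite -[1]invr1 dleV // oner_neq0.
by apply: (mulIf r0); rewrite mulVf // -resM // mulVf // res_1.
Qed.
Lemma res_aeq x y : dle y 1 -> aeq x y -> vres x = vres y.
Proof.
move=> hy h; apply/eqP; rewrite res_eq //; first by apply: dlt_le_trans h hy.
by have /deqP[h1 _] := vval_aeq h; exact: dle_trans h1 hy.
Qed.

Lemma unit_neq0 x : dle 1 x -> x != 0.
Proof. by rewrite -dlt0x; apply: dlt_le_trans; rewrite dlt0x oner_neq0. Qed.

Lemma rv_eq x y : x != 0 -> y != 0 -> (vrv x = vrv y <-> aeq x y).
Proof.
move=> x0 y0; have e : (vrv x = vrv (x / y) * vrv y)%g.
  by rewrite -vrvM ?divfK // mulf_neq0 // invr_eq0.
have hk : vrv (x / y) = 1%g <-> aeq x y.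
  rewrite vrv_ker ?mulf_neq0 ?invr_eq0 // /aeq -(dltM2r _ _ (z := y^-1)) ?invr_eq0 //.
  by rewrite divff // mulrBl divff // /dlt /dle vval_1.
rewrite -hk e; split=> [h|->]; last by rewrite mul1g.
by apply: (mulIg (vrv y)); rewrite h mul1g.
Qed.

End ValuedFieldBasics.

(** * Newton's lemma and powers *)

Section Hensel.
Variable M : valuedField.
Hypothesis hHensel : henselian M.
Hypothesis hChar : [pchar (vk M)] =i pred0.
Implicit Types x y z : M.

(** Here residue characteristic zero enters: it makes exponents, and the integer factors produced by
    differentiation, units. *)
Lemma natr_unit n : (0 < n)%N -> vval (n%:R : M) = Some 0.
Proof.
move=> n0; have h : dle (n%:R : M) 1 /\ vres (n%:R : M) = n%:R.
  elim: n {n0} => [|n [h1 h2]]; first by rewrite dle0x res_0.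
  by rewrite -addn1 natrD dleD ?dle_refl // resD ?dle_refl // h2 natrD res_1.
apply/vval_unitE; split; first by case: h.
rewrite -res_neq0 ?h.1 // h.2; move/pcharf0P: hChar => ->.
by rewrite -lt0n.
Qed.

Lemma natr_neq0 n : (0 < n)%N -> (n%:R : M) != 0.
Proof. by move/natr_unit/vval_unitE => [_]; exact: unit_neq0. Qed.

Lemma dle_natrMl n x y : dle x y -> dle (n%:R * x) y.
Proof.
have [->|n0] := posnP n; first by rewrite mul0r dle0x.
move=> h; rewrite -[y]mul1r dleM //; by have /vval_unitE[] := natr_unit n0.
Qed.

Lemma vval_natrM n x : (0 < n)%N -> vval (n%:R * x) = vval x.
Proof.
move=> n0; have h : vval (n%:R : M) = vval (1 : M) by rewrite natr_unit // vval_1.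
by rewrite (vval_mul h (erefl (vval x))) mul1r.
Qed.

Lemma hensel_unit (p : {poly M}) (a : M) :
  (forall i, dle p`_i 1) -> dle a 1 -> dlt p.[a] 1 -> dle 1 p^`().[a] ->
  exists b, [/\ dle b 1, root p b & dlt (b - a) 1].
Proof.
move=> hp ha hpa hd.
have hor (q : {poly M}) : (forall i, dle q`_i 1) -> dle q.[a] 1.
  by move=> hq; rewrite horner_coef dle_sum // => i _; rewrite dle1M // dle1X.
have [||||b [hb1 hb2 hb3]] := hHensel (p := p) (a := a).
- by rewrite qualifE /=; apply/(all_nthP 0) => i _; move: (hp i); rewrite -vle_dle1.
- by rewrite inE vle_dle1.
- by rewrite /vlt -vval_1.
- apply/vval_unitE; split=> //; apply: hor => i; rewrite coef_deriv -mulr_natl.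
  exact: dle_natrMl.
exists b; split; [by move: hb1; rewrite inE vle_dle1|exact/rootP|].
by move: hb3; rewrite /vlt -vval_1.
Qed.

(** Hensel's lemma for $X^n-u$ at the point $1$, where the derivative is the unit $n$. *)
Lemma root_near1 (u : M) n :
  (0 < n)%N -> aeq u 1 -> exists2 w, w ^+ n = u & aeq w 1.
Proof.
move=> n0 hu; have hu1 : dle u 1 by have /deqP[] := vval_aeq hu.
have [||||b [hb /rootP h1 h2]] := @hensel_unit ('X^n - u%:P) 1.
- move=> i; rewrite coefB coefXn coefC dleB //.
    by case: eqP; rewrite ?dle_refl ?dle0x.
  by case: eqP; rewrite ?dle0x.
- exact: dle_refl.
- by rewrite !hornerE ?hornerXn expr1n dlt_subC.
- rewrite derivB derivC subr0 derivXn hornerMn hornerXn expr1n.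
  by have /vval_unitE[] := natr_unit n0.
exists b => //; apply/eqP; rewrite -subr_eq0; apply/eqP.
by rewrite -h1 !hornerE ?hornerXn.
Qed.

Definition isP n x := exists z, x = z ^+ n.

Lemma isP_mul n x y : isP n x -> isP n y -> isP n (x * y).
Proof. by move=> [a ->] [b ->]; exists (a * b); rewrite exprMn. Qed.
Lemma isP_inv n x : isP n x -> isP n x^-1.
Proof. by move=> [a ->]; exists a^-1; rewrite exprVn. Qed.
Lemma isP_div n x y : isP n x -> isP n y -> isP n (x / y).
Proof. by move=> hx hy; apply: isP_mul; last exact: isP_inv. Qed.

(** The quotient of two elements with the same leading term is close to 1, hence an n-th power. Thus
    n-th powers are recognised on leading terms. *)
Lemma isP_aeq n x y : (0 < n)%N -> aeq x y -> isP n x -> isP n y.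
Proof.
move=> n0 h hx; have y0 := aeq_neq0r h; have x0 := aeq_neq0l h.
have [|w hw _] := @root_near1 (y / x) n n0.
  by rewrite -(divff x0) aeq_div ?aeq_refl //; exact: aeq_sym.
by rewrite -(divfK x0 y); apply: isP_mul => //; exists w.
Qed.

Lemma isP_coset n a x : a != 0 -> x != 0 -> isP n (x / a) -> (isP n x <-> isP n a).
Proof.
move=> a0 x0 h; split=> hx; last by rewrite -(divfK a0 x); exact: isP_mul.
have : isP n (x / (x / a)) by exact: isP_div.
by rewrite invf_div mulrA mulrC mulrA mulVf // mul1r.
Qed.

(* [x + d y] is substituted in the Taylor expansion of [p] at [x], which is then
   divided by its linear coefficient. *)
Lemma newton (p : {poly M}) x d :
  p^`N(1).[x] != 0 -> d != 0 -> dle p.[x] (p^`N(1).[x] * d) ->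
  (forall j, (1 < j < size p)%N ->
     dlt (p^`N(j).[x] * d ^+ j) (p^`N(1).[x] * d)) ->
  exists2 h, dle h d & root p (x + h).
Proof.
move=> p10 d0 h0 hj; set c := p^`N(1).[x] * d in h0 hj.
have c0 : c != 0 by rewrite mulf_neq0.
(* $q(Y)=p(x+dY)/c$ is integral and congruent to $q_0+Y$ modulo the maximal ideal, so $-q_0$ is an
   approximate root at which the derivative is a unit. *)
pose q := \poly_(j < size p) (p^`N(j).[x] * d ^+ j / c).
have qE i : q`_i = (if (i < size p)%N then p^`N(i).[x] * d ^+ i / c else 0).
  by rewrite coef_poly.
have q0 : dle q`_0 1.
  by rewrite qE; case: ifP; rewrite ?dle0x // nderivn0 expr0 mulr1 dle_div1.
have sp : (1 < size p)%N.
  rewrite ltnNge; apply/negP => sp; move: p10; rewrite /nderivn.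
  by rewrite [\poly_(_ < _) _](_ : _ = 0) ?horner0 ?eqxx //;
    apply/polyP => i; rewrite coef_poly coef0; case: ifP => //;
    move: sp; case: (size p) => [|[|]].
have q1 : q`_1 = 1 by rewrite qE sp expr1 divff.
have qs i : (1 < i)%N -> dlt q`_i 1.
  rewrite qE => i1; case: ifP => si; last by rewrite dlt0x oner_neq0.
  by rewrite dlt_div1 // hj // i1.
have qO i : dle q`_i 1.
  by case: i => [|[|i]]; rewrite ?q1 ?dle_refl //; apply: dltW; exact: qs.
have sq : (size q <= size p)%N by exact: size_poly.
have qh y : q.[y] = p.[x + d * y] / c.
  rewrite nderiv_taylor; last exact: mulrC.
  rewrite (horner_coef_wide _ sq) mulr_suml; apply: eq_bigr => i _.
  by rewrite qE ltn_ord exprMn mulrA [RHS]mulrAC.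
have [||||y [hy1 hy2 _]] := @hensel_unit q (- q`_0) => //.
- by rewrite dleNl.
- rewrite (horner_coef_wide _ sq); case: (size p) sp => [|[|n]] // _.
  rewrite 2!big_ord_recl /= expr0 mulr1 q1 mul1r expr1 addrA subrr add0r.
  apply: dlt_sum => [|i _]; first exact: oner_neq0.
  by rewrite -[1]mulr1 dltMl ?oner_neq0 ?qs // dle1X // dleNl.
- have -> : q^`().[- q`_0] = 1 + \sum_(i < (size p).-2) (q`_i.+2 *+ i.+2) * (- q`_0) ^+ i.+1.
    rewrite (@horner_coef_wide _ (size p).-1); last first.
      rewrite -ltnS prednK; last by case: (size p) sp.
      apply: leq_trans sq; apply: lt_size_deriv; apply/eqP => q0'.
      by move: q1; rewrite q0' coef0 => /esym/eqP; rewrite oner_eq0.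
    case: (size p) sp => [|[|n]] // _; rewrite big_ord_recl /= coef_deriv q1.
    by rewrite expr0 mulr1; congr (_ + _); apply: eq_bigr => i _; rewrite coef_deriv.
  suff h : dlt (\sum_(i < (size p).-2) (q`_i.+2 *+ i.+2) * (- q`_0) ^+ i.+1) 1.
    by have /deqP[] := vval_aeq (aeq_addl h).
  apply: dlt_sum => [|i _]; first exact: oner_neq0.
  rewrite -[1]mulr1 dltMl ?oner_neq0 //; last by rewrite dle1X // dleNl.
  rewrite -mulr_natl; apply: dle_lt_trans (qs i.+2 isT).
  exact/dle_natrMl/dle_refl.
exists (d * y); first by rewrite -[d in dle _ d]mulr1 dleM ?dle_refl.
move/rootP: hy2; rewrite qh => /eqP; rewrite mulf_eq0 invr_eq0 (negbTE c0) orbF.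
by move/eqP/rootP.
Qed.

End Hensel.

Section TermDefinable.
Variables (S : signature) (N : structure S).

Definition tdefinable (V : ctx S) s (f : asg N V -> N s) :=
  exists t : term V s, forall e, eval e t = f e.

Lemma tdefinable_var (V : ctx S) s (v : V s) : tdefinable (fun e => e s v).
Proof. by exists (Var v). Qed.

Lemma tdefinable_app (V : ctx S) (g : Defs.fsym S)
    (f : 'I_(farity g) -> asg N V -> N (fsort g)) :
  (forall i, tdefinable (f i)) -> tdefinable (fun e => fint (fun i => f i e)).
Proof.
move=> hf; exists (App (fun i => sval (cid (hf i)))) => e /=.
congr (fint _); apply: functional_extensionality_dep => i.
exact: svalP (cid (hf i)) e.
Qed.

Lemma definable_teq (V : ctx S) s (f g : asg N V -> N s) :
  tdefinable f -> tdefinable g -> definable (fun e => f e = g e).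
Proof. by move=> [t ht] [u hu]; exists (FEq t u) => e /=; rewrite ht hu. Qed.

Definition args2 (T : Defs.sort S -> Type) s1 s2 (a : T s1) (b : T s2) :
    args T [:: s1; s2] := fun i : 'I_2 =>
  match i as i0 return T (tnth (in_tuple [:: s1; s2]) i0) with
  | @Ordinal _ 0 _ => a
  | @Ordinal _ 1 _ => b
  | @Ordinal _ n.+2 h => False_rect _ (notF h)
  end.

End TermDefinable.

(** * Isomorphisms between substructures of the residue field and value group *)

Section FieldIso.
Variable k : fieldType.
Let N := field_structure k.
Implicit Types (E : k -> k -> Prop) (r s t : k).

Lemma tdef_mul (V : ctx field_sig) (f g : asg N V -> k) :
  @tdefinable _ N V tt f -> @tdefinable _ N V tt g ->
  @tdefinable _ N V tt (fun e => f e * g e).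
Proof.
move=> hf hg.
apply: (@tdefinable_app _ N V RMul (fun i => if i == ord0 then f else g)) => i.
by case: (i == ord0).
Qed.

Lemma tdef_add (V : ctx field_sig) (f g : asg N V -> k) :
  @tdefinable _ N V tt f -> @tdefinable _ N V tt g ->
  @tdefinable _ N V tt (fun e => f e + g e).
Proof.
move=> hf hg.
apply: (@tdefinable_app _ N V RAdd (fun i => if i == ord0 then f else g)) => i.
by case: (i == ord0).
Qed.

Lemma tdef_1 (V : ctx field_sig) : @tdefinable _ N V tt (fun e => 1).
Proof. by apply: (@tdefinable_app _ N V ROne (fun i e => 1)); case. Qed.

Lemma tdef_0 (V : ctx field_sig) : @tdefinable _ N V tt (fun e => 0).
Proof. by apply: (@tdefinable_app _ N V RZero (fun i e => 1)); case. Qed.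

Lemma tdef_exp (V : ctx field_sig) (f : asg N V -> k) n :
  @tdefinable _ N V tt f -> @tdefinable _ N V tt (fun e => f e ^+ n).
Proof.
move=> hf; elim: n => [|n IH]; first exact: tdef_1.
have [t ht] := tdef_mul hf IH; by exists t => e; rewrite ht exprS.
Qed.

(** Closure under difference and quotient, together with 1, makes the domain and the range
    subfields. *)
Record field_iso (E : k -> k -> Prop) := FieldIso {
  fi_elem : @elem_rel _ N (fun _ => E);
  fi_1 : E 1 1;
  fi_B : forall r r' s s', E r r' -> E s s' -> E (r - s) (r' - s');
  fi_div : forall r r' s s', E r r' -> E s s' -> E (r / s) (r' / s') }.

Definition fctx3 : ctx field_sig :=
  cadd (cadd (@csingle field_sig tt) (@csingle field_sig tt)) (@csingle field_sig tt).
Definition asg3 r s t : asg N fctx3 :=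
  acat (acat (aone (r : N tt)) (aone (s : N tt))) (aone (t : N tt)).
Definition v1 : fctx3 tt := inl (inl (here (S := field_sig) tt)).
Definition v2 : fctx3 tt := inl (inr (here (S := field_sig) tt)).
Definition v3 : fctx3 tt := inr (here (S := field_sig) tt).

Lemma elem_asg3 E r r' s s' t t' (Q : asg N fctx3 -> Prop) :
  @elem_rel _ N (fun _ => E) -> definable Q -> E r r' -> E s s' -> E t t' ->
  (Q (asg3 r s t) <-> Q (asg3 r' s' t')).
Proof.
move=> hE hQ h1 h2 h3; apply: (elem_rel_definable hE hQ).
by move=> u [[c|c]|c]; case: u / c.
Qed.

Lemma elem_field_add E r r' s s' t t' : @elem_rel _ N (fun _ => E) ->
  E r r' -> E s s' -> E t t' -> (r + s = t <-> r' + s' = t').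
Proof.
move=> hE; apply: (elem_asg3 (Q := fun e => (e tt v1 : k) + (e tt v2 : k) = e tt v3) hE).
by apply: definable_teq; [apply: tdef_add|]; exact: tdefinable_var.
Qed.

Lemma elem_field_mul E r r' s s' t t' : @elem_rel _ N (fun _ => E) ->
  E r r' -> E s s' -> E t t' -> (r * s = t <-> r' * s' = t').
Proof.
move=> hE; apply: (elem_asg3 (Q := fun e => (e tt v1 : k) * (e tt v2 : k) = e tt v3) hE).
by apply: definable_teq; [apply: tdef_mul|]; exact: tdefinable_var.
Qed.

Lemma elem_field_eq E r r' s s' : @elem_rel _ N (fun _ => E) ->
  E r r' -> E s s' -> (r = s <-> r' = s').
Proof. by move=> hE h1 h2; exact: (@elem_rel_eq _ N (fun _ => E) tt r r' s s' hE h1 h2). Qed.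

Lemma elem_field_0 E r r' : @elem_rel _ N (fun _ => E) ->
  E r r' -> (r = 0 <-> r' = 0).
Proof.
move=> hE h; apply: (elem_asg3 (Q := fun e => (e tt v1 : k) = 0) hE _ h h h).
by apply: definable_teq; [exact: tdefinable_var|exact: tdef_0].
Qed.

Lemma elem_field_1 E r r' : @elem_rel _ N (fun _ => E) ->
  E r r' -> (r = 1 <-> r' = 1).
Proof.
move=> hE h; apply: (elem_asg3 (Q := fun e => (e tt v1 : k) = 1) hE _ h h h).
by apply: definable_teq; [exact: tdefinable_var|exact: tdef_1].
Qed.

Lemma elem_field_exp E n r r' s s' : @elem_rel _ N (fun _ => E) ->
  E r r' -> E s s' ->
  ((exists t, r = s * t ^+ n) <-> (exists t, r' = s' * t ^+ n)).
Proof.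
move=> hE h1 h2.
pose Q (e : asg N (cadd fctx3 (@csingle field_sig tt))) :=
  (e tt (inl v1) : k) = (e tt (inl v2) : k) * (e tt (inr (here (S := field_sig) tt)) : k) ^+ n.
have hQ : definable Q.
  apply: definable_teq; first exact: tdefinable_var.
  by apply: tdef_mul; [|apply: tdef_exp]; exact: tdefinable_var.
exact: (elem_asg3 hE (definable_ex hQ) h1 h2 h2).
Qed.

Section Theory.
Variable E : k -> k -> Prop.
Hypothesis hE : field_iso E.

Lemma fi_0 : E 0 0.
Proof. by rewrite -(subrr 1); exact: (fi_B hE (fi_1 hE) (fi_1 hE)). Qed.
Lemma fi_N r r' : E r r' -> E (- r) (- r').
Proof. by move=> h; rewrite -sub0r -[- r']sub0r; exact: (fi_B hE fi_0 h). Qed.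
Lemma fi_D r r' s s' : E r r' -> E s s' -> E (r + s) (r' + s').
Proof. by move=> h1 /fi_N h2; rewrite -[s]opprK -[s']opprK; exact: (fi_B hE h1 h2). Qed.
Lemma fi_V r r' : E r r' -> E r^-1 r'^-1.
Proof. by move=> h; rewrite -[r^-1]mul1r -[r'^-1]mul1r; exact: (fi_div hE (fi_1 hE) h). Qed.
Lemma fi_M r r' s s' : E r r' -> E s s' -> E (r * s) (r' * s').
Proof. by move=> h1 /fi_V h2; rewrite -[s]invrK -[s']invrK; exact: (fi_div hE h1 h2). Qed.
Lemma fi_sum (I : Type) (r : seq I) (P : pred I) (F F' : I -> k) :
  (forall i, P i -> E (F i) (F' i)) ->
  E (\sum_(i <- r | P i) F i) (\sum_(i <- r | P i) F' i).
Proof.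
by move=> h; elim/big_rec2: _ => [|i x y Pi]; [exact: fi_0|apply: fi_D; exact: h].
Qed.
Lemma fi_eq0 r r' : E r r' -> (r == 0) = (r' == 0).
Proof.
by move=> h; apply/eqP/eqP => /(elem_field_0 (fi_elem hE) h).
Qed.

End Theory.

Lemma field_iso_inv E : field_iso E -> field_iso (fun x y => E y x).
Proof.
move=> [h1 h2 h3 h4]; split=> //; first exact: elem_rel_inv.
  by move=> r r' s s'; exact: h3.
by move=> r r' s s'; exact: h4.
Qed.

End FieldIso.

Section GroupIso.
Variable G : orderedGroupType.
Let N := ogroup_structure G.
Implicit Types (E : G -> G -> Prop) (r s t : G).

Lemma tdef_gadd (V : ctx ogroup_sig) (f g : asg N V -> G) :
  @tdefinable _ N V tt f -> @tdefinable _ N V tt g ->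
  @tdefinable _ N V tt (fun e => f e + g e).
Proof.
move=> hf hg.
apply: (@tdefinable_app _ N V GMul (fun i => if i == ord0 then f else g)) => i.
by case: (i == ord0).
Qed.

Lemma tdef_g0 (V : ctx ogroup_sig) : @tdefinable _ N V tt (fun e => 0).
Proof. by apply: (@tdefinable_app _ N V GUnit (fun i e => 0)); case. Qed.

Lemma tdef_gmuln (V : ctx ogroup_sig) (f : asg N V -> G) n :
  @tdefinable _ N V tt f -> @tdefinable _ N V tt (fun e => f e *+ n).
Proof.
move=> hf; elim: n => [|n IH]; first exact: tdef_g0.
have [t ht] := tdef_gadd hf IH; by exists t => e; rewrite ht mulrS.
Qed.

Record group_iso (E : G -> G -> Prop) := GroupIso {
  gi_elem : @elem_rel _ N (fun _ => E);
  gi_0 : E 0 0;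
  gi_B : forall r r' s s', E r r' -> E s s' -> E (r - s) (r' - s') }.

Definition gctx3 : ctx ogroup_sig :=
  cadd (cadd (@csingle ogroup_sig tt) (@csingle ogroup_sig tt)) (@csingle ogroup_sig tt).
Definition gasg3 (r s t : G) : asg N gctx3 :=
  acat (acat (aone (r : N tt)) (aone (s : N tt))) (aone (t : N tt)).
Definition gv1 : gctx3 tt := inl (inl (here (S := ogroup_sig) tt)).
Definition gv2 : gctx3 tt := inl (inr (here (S := ogroup_sig) tt)).
Definition gv3 : gctx3 tt := inr (here (S := ogroup_sig) tt).

Lemma elem_gasg3 E r r' s s' t t' (Q : asg N gctx3 -> Prop) :
  @elem_rel _ N (fun _ => E) -> definable Q -> E r r' -> E s s' -> E t t' ->
  (Q (gasg3 r s t) <-> Q (gasg3 r' s' t')).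
Proof.
move=> hE hQ h1 h2 h3; apply: (elem_rel_definable hE hQ).
by move=> u [[c|c]|c]; case: u / c.
Qed.

Lemma elem_group_add E r r' s s' t t' : @elem_rel _ N (fun _ => E) ->
  E r r' -> E s s' -> E t t' -> (r + s = t <-> r' + s' = t').
Proof.
move=> hE; apply: (elem_gasg3 (Q := fun e => (e tt gv1 : G) + (e tt gv2 : G) = e tt gv3) hE).
by apply: definable_teq; [apply: tdef_gadd|]; exact: tdefinable_var.
Qed.

Lemma elem_group_0 E r r' : @elem_rel _ N (fun _ => E) ->
  E r r' -> (r = 0 <-> r' = 0).
Proof.
move=> hE h; apply: (elem_gasg3 (Q := fun e => (e tt gv1 : G) = 0) hE _ h h h).
by apply: definable_teq; [exact: tdefinable_var|exact: tdef_g0].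
Qed.

Lemma elem_group_eq E r r' s s' : @elem_rel _ N (fun _ => E) ->
  E r r' -> E s s' -> (r = s <-> r' = s').
Proof. by move=> hE h1 h2; exact: (@elem_rel_eq _ N (fun _ => E) tt r r' s s' hE h1 h2). Qed.

Lemma elem_group_le E r r' s s' : @elem_rel _ N (fun _ => E) ->
  E r r' -> E s s' -> (r <= s <-> r' <= s').
Proof.
move=> hE h1 h2.
apply: (elem_gasg3 (Q := fun e => (e tt gv1 : G) <= (e tt gv2 : G)) hE _ h1 h2 h2).
by exists (@FRel ogroup_sig gctx3 tt (args2 (S := ogroup_sig)
  (Var gv1 : @term ogroup_sig gctx3 tt) (Var gv2 : @term ogroup_sig gctx3 tt))).
Qed.

Lemma elem_group_div E n r r' s s' : @elem_rel _ N (fun _ => E) ->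
  E r r' -> E s s' ->
  ((exists t, r = s + t *+ n) <-> (exists t, r' = s' + t *+ n)).
Proof.
move=> hE h1 h2.
pose Q (e : asg N (cadd gctx3 (@csingle ogroup_sig tt))) :=
  (e tt (inl gv1) : G) = (e tt (inl gv2) : G) + (e tt (inr (here (S := ogroup_sig) tt)) : G) *+ n.
have hQ : definable Q.
  apply: definable_teq; first exact: tdefinable_var.
  by apply: tdef_gadd; [|apply: tdef_gmuln]; exact: tdefinable_var.
exact: (elem_gasg3 hE (definable_ex hQ) h1 h2 h2).
Qed.

Section Theory.
Variable E : G -> G -> Prop.
Hypothesis hE : group_iso E.

Lemma gi_N r r' : E r r' -> E (- r) (- r').
Proof. by move=> h; rewrite -sub0r -[- r']sub0r; exact: (gi_B hE (gi_0 hE) h). Qed.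
Lemma gi_D r r' s s' : E r r' -> E s s' -> E (r + s) (r' + s').
Proof. by move=> h1 /gi_N h2; rewrite -[s]opprK -[s']opprK; exact: (gi_B hE h1 h2). Qed.
Lemma gi_le r r' s s' : E r r' -> E s s' -> (r <= s) = (r' <= s').
Proof. by move=> h1 h2; apply/idP/idP => /(elem_group_le (gi_elem hE) h1 h2). Qed.

End Theory.

Lemma group_iso_inv E : group_iso E -> group_iso (fun x y => E y x).
Proof.
move=> [h1 h2 h3]; split=> //; first exact: elem_rel_inv.
by move=> r r' s s'; exact: h3.
Qed.

End GroupIso.

(** * Partial isomorphisms of valued fields *)

(** [rep_unit] is kept apart because [rep_all] may represent a unit by an element of nonzero value,
    differing from it by an n-th power that is not a unit. *)
Record coset_reps (M : valuedField) (A0 : set M) := CosetReps {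
  rep_neq0 : forall a, A0 a -> a != 0;
  rep_all : forall n x, (0 < n)%N -> x != 0 -> exists2 a, A0 a & isP n (x / a);
  rep_unit : forall n x, (0 < n)%N -> vval x = Some 0 ->
    exists2 a, A0 a /\ vval a = Some 0 & isP n (x / a) }.

Section GoodPairs.
Variable M : valuedField.
Hypothesis hHensel : henselian M.
Hypothesis hChar : [pchar (vk M)] =i pred0.
Variable A0 : set M.
Hypothesis hA0 : coset_reps A0.
Implicit Types (x y z : M) (G : M -> M -> Prop).
Implicit Types (Ek : vk M -> vk M -> Prop) (EG : vG M -> vG M -> Prop).

Definition EV EG x x' := exists g g', [/\ vval x = Some g, vval x' = Some g' & EG g g'].

Definition ER Ek x x' := [/\ dle x 1, dle x' 1 & Ek (vres x) (vres x')].

(** What must hold for two leading terms to correspond. The clause on powers carries the information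
    about the group of leading terms that values and residues miss. *)
Definition nice Ek EG x x' := [/\ EV EG x x', (dle x 1 -> ER Ek x x') &
  forall n, (0 < n)%N -> (isP n x <-> isP n x')].

(** The graph of an isomorphism between subfields: [g_B] and [g_0] make it single-valued, and with
    [g_nice] it is injective. By [g_A] the coset representatives are fixed, so that preserving
    powers amounts to preserving all power cosets. *)
Record good Ek EG G := Good {
  g_1 : G 1 1;
  g_B : forall x x' y y', G x x' -> G y y' -> G (x - y) (x' - y');
  g_div : forall x x' y y', G x x' -> G y y' -> G (x / y) (x' / y');
  g_0 : forall x', G 0 x' -> x' = 0;
  g_nice : forall x x', G x x' -> x != 0 -> nice Ek EG x x';
  g_A : forall a, A0 a -> G a a }.

Section Isos.
Variables (Ek : vk M -> vk M -> Prop) (EG : vG M -> vG M -> Prop).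
Hypothesis hEk : field_iso Ek.
Hypothesis hEG : group_iso EG.

Lemma EV_neq0 x x' : EV EG x x' -> x != 0 /\ x' != 0.
Proof.
move=> [g [g' [h1 h2 _]]]; split; apply/eqP => /vval0; by rewrite ?h1 ?h2.
Qed.

Lemma EV_mul x x' y y' : EV EG x x' -> EV EG y y' -> EV EG (x * y) (x' * y').
Proof.
move=> [g [g' [h1 h2 h3]]] [h [h' [k1 k2 k3]]]; exists (g + h), (g' + h').
by rewrite !vvalM h1 h2 k1 k2; split=> //; exact: gi_D.
Qed.

Lemma vval_V x g : vval x = Some g -> vval x^-1 = Some (- g).
Proof.
move=> h; have x0 : x != 0 by apply/eqP => /vval0; rewrite h.
have : vadd (vval x^-1) (vval x) = Some 0 by rewrite -vvalM mulVf // vval_1.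
rewrite h; case: (vval x^-1) => //= u [hu]; congr Some.
by apply/eqP; rewrite -subr_eq0 opprK hu.
Qed.

Lemma EV_inv x x' : EV EG x x' -> EV EG x^-1 x'^-1.
Proof.
move=> [g [g' [h1 h2 h3]]]; exists (- g), (- g').
by split; [exact: vval_V|exact: vval_V|exact: gi_N].
Qed.

Lemma EV_1 : EV EG 1 1.
Proof. by exists 0, 0; rewrite vval_1; split=> //; exact: gi_0. Qed.

Lemma EV_X x x' n : EV EG x x' -> EV EG (x ^+ n) (x' ^+ n).
Proof.
by move=> h; elim: n => [|n IH]; [rewrite !expr0; exact: EV_1|rewrite !exprS; exact: EV_mul].
Qed.

Lemma EV_le x x' y y' : EV EG x x' -> EV EG y y' -> dle x y = dle x' y'.
Proof.
move=> [g [g' [h1 h2 h3]]] [h [h' [k1 k2 k3]]]; rewrite /dle h1 h2 k1 k2 /=.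
exact: (gi_le hEG h3 k3).
Qed.

Lemma EV_lt x x' y y' : EV EG x x' -> EV EG y y' -> dlt x y = dlt x' y'.
Proof. by move=> h1 h2; rewrite /dlt (EV_le h2 h1). Qed.

Lemma EV_eq x x' y y' : EV EG x x' -> EV EG y y' ->
  (vval x = vval y <-> vval x' = vval y').
Proof. by move=> h1 h2; rewrite !deqP (EV_le h1 h2) (EV_le h2 h1). Qed.

Lemma EV_val x x' y y' : vval x = vval y -> vval x' = vval y' ->
  EV EG y y' -> EV EG x x'.
Proof. by move=> h1 h2 [g [g' [k1 k2 k3]]]; exists g, g'; rewrite h1 h2. Qed.

Lemma ER_unit x x' : ER Ek x x' -> dle 1 x = dle 1 x'.
Proof. by move=> [h1 h2 h3]; rewrite -!res_neq0 // (fi_eq0 hEk h3). Qed.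

Lemma ER_mul x x' y y' : ER Ek x x' -> ER Ek y y' -> ER Ek (x * y) (x' * y').
Proof.
move=> [h1 h2 h3] [k1 k2 k3]; split; rewrite ?dle1M // !resM //.
exact: fi_M.
Qed.

Lemma ER_inv x x' : dle 1 x -> ER Ek x x' -> ER Ek x^-1 x'^-1.
Proof.
move=> hx h; have hx' : dle 1 x' by rewrite -(ER_unit h).
case: h => [h1 h2 h3]; have i1 := unit_neq0 hx; have i2 := unit_neq0 hx'.
split; rewrite ?resV //; last exact: fi_V.
  by rewrite -[1]invr1 dleV // oner_neq0.
by rewrite -[1]invr1 dleV // oner_neq0.
Qed.

Lemma ER_small x x' : dlt x 1 -> dlt x' 1 -> ER Ek x x'.
Proof.
move=> h1 h2; split; rewrite ?dltW //.
have /eqP-> : vres x == 0 by rewrite res_ker // dltW.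
have /eqP-> : vres x' == 0 by rewrite res_ker // dltW.
exact: fi_0.
Qed.

Lemma EV_unit x x' : ER Ek x x' -> dle 1 x -> EV EG x x'.
Proof.
move=> h hx; have hx' : dle 1 x' by rewrite -(ER_unit h).
case: h => [h1 h2 _]; apply: EV_val EV_1; exact/deqP.
Qed.

Lemma nice_aeq x x' y y' : aeq x y -> aeq x' y' -> nice Ek EG y y' -> nice Ek EG x x'.
Proof.
move=> h h' [k1 k2 k3]; split.
- by apply: EV_val k1; exact: vval_aeq.
- rewrite (dle_eql _ (vval_aeq h)) => hy; have [i1 i2 i3] := k2 hy.
  rewrite /ER (dle_eql _ (vval_aeq h)) (dle_eql _ (vval_aeq h')).
  by rewrite (res_aeq hy h) (res_aeq i2 h').
- move=> n n0; split=> hP.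
    by apply: (isP_aeq hHensel hChar n0 (aeq_sym h')); apply/k3/(isP_aeq hHensel hChar n0 h hP).
  by apply: (isP_aeq hHensel hChar n0 (aeq_sym h)); apply/(iffRL (k3 n n0))/(isP_aeq hHensel hChar n0 h' hP).
Qed.

Hypothesis hA0k : forall a, A0 a -> vval a = Some 0 -> ER Ek a a.

(** For a unit, the class modulo n-th powers is visible on the residue: that $\mathrm{res}(x)$ is
    $\mathrm{res}(a)$ times an n-th power is carried over by the elementary relation [Ek], and
    Hensel's lemma lifts it back to [x']. For this the representative [a] must itself be a unit. *)
Lemma nice_unit x x' : ER Ek x x' -> dle 1 x -> nice Ek EG x x'.
Proof.
move=> hR hx; have hx' : dle 1 x' by rewrite -(ER_unit hR).
have hV := EV_unit hR hx; split=> //.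
case: hR => h1 h2 h3 n n0.
have ux : vval x = Some 0 by apply/vval_unitE.
have [a [ha ua] hP] := rep_unit hA0 n0 ux.
have a0 := rep_neq0 hA0 ha; have x0 := unit_neq0 hx; have x'0 := unit_neq0 hx'.
have /vval_unitE[a1 a2] := ua.
suff hP' : isP n (x' / a).
  by rewrite (isP_coset a0 x0 hP) (isP_coset a0 x'0 hP').
have [z hz] := hP.
have z1 : dle z 1.
  rewrite dleNgt; apply/negP => /(@dltX _ _ _ n.-1); rewrite prednK // expr1n -hz.
  by apply/negP; rewrite -dleNgt dle_div1 //; exact: dle_trans a2.
have : exists t, vres x = vres a * t ^+ n.
  by exists (vres z); rewrite -resX // -resM ?dle1X // -hz mulrC divfK.
have [_ _ hEa] := hA0k ha ua.
move/(elem_field_exp n (fi_elem hEk) h3 hEa) => [t ht].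
have [w w1 hw] := res_surj t.
have hh : dlt (x' - a * w ^+ n) 1.
  by rewrite -res_eq ?dle1M ?dle1X // resM ?dle1X // resX // hw -ht.
have ux' : vval x' = vval (1 : M) by apply/deqP.
have key : aeq (a * w ^+ n) x' by rewrite /aeq dlt_subC (dlt_eqr _ ux').
have : aeq (a * w ^+ n / a) (x' / a) by rewrite aeq_div // aeq_refl.
rewrite mulrAC divff // mul1r => /(isP_aeq hHensel hChar n0); apply.
by exists w.
Qed.

(* The field of fractions of a ring of pairs is good as soon as the nonzero
   pairs of the ring have the leading terms of a group of nice pairs. *)
Lemma good_frac (R H : M -> M -> Prop) :
  R 1 1 ->
  (forall x x' y y', R x x' -> R y y' -> R (x - y) (x' - y')) ->
  (forall x x' y y', R x x' -> R y y' -> R (x * y) (x' * y')) ->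
  (forall a, A0 a -> R a a) ->
  (forall x x', H x x' -> nice Ek EG x x') ->
  (forall x x' y y', H x x' -> H y y' -> H (x / y) (x' / y')) ->
  (forall x x', R x x' -> (x = 0 /\ x' = 0) \/
     exists z z', [/\ H z z', aeq x z & aeq x' z']) ->
  good Ek EG (fun x x' => exists a a' b b',
    [/\ R a a', R b b', b != 0, x = a / b & x' = a' / b']).
Proof.
move=> R1 RB RM RA Hn Hdiv hR.
have R0 : R 0 0 by rewrite -(subrr 1); exact: RB.
have Rn0 b b' : R b b' -> b != 0 -> b' != 0.
  by move=> /hR[[-> _]|[z [z' [_ _ /aeq_neq0l]]] //]; rewrite eqxx.
split.
- by exists 1, 1, 1, 1; rewrite oner_neq0 divr1.
- move=> x x' y y' [a [a' [b [b' [h1 h2 b0 -> ->]]]]] [c [c' [d [d' [k1 k2 d0 -> ->]]]]].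
  have b0' := Rn0 _ _ h2 b0; have d0' := Rn0 _ _ k2 d0.
  exists (a * d - c * b), (a' * d' - c' * b'), (b * d), (b' * d').
  rewrite mulf_neq0 //; split=> //; try by [apply: RB; apply: RM|apply: RM];
    by rewrite -mulNr addf_div // mulNr.
- move=> x x' y y' [a [a' [b [b' [h1 h2 b0 -> ->]]]]] [c [c' [d [d' [k1 k2 d0 -> ->]]]]].
  have b0' := Rn0 _ _ h2 b0; have d0' := Rn0 _ _ k2 d0.
  (* If the divisor is zero, so is its partner, and both quotients are 0. *)
  have [[c0 c0']|[z [z' [_ /aeq_neq0l c0 /aeq_neq0l c0']]]] := hR _ _ k1.
    by exists 0, 0, 1, 1; rewrite c0 c0' !mul0r !invr0 !mulr0 oner_neq0.
  exists (a * d), (a' * d'), (b * c), (b' * c').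
  rewrite mulf_neq0 // !invf_div !mulf_div; split=> //; exact: RM.
- move=> x' [a [a' [b [b' [h1 h2 b0 /esym/eqP h ->]]]]].
  move: h; rewrite mulf_eq0 invr_eq0 (negbTE b0) orbF => /eqP a0.
  have [[_ ->]|[z [z' [_ /aeq_neq0l]]]] := hR _ _ h1; first by rewrite mul0r.
  by rewrite a0 eqxx.
- move=> x x' [a [a' [b [b' [h1 h2 b0 -> ->]]]]].
  rewrite mulf_eq0 invr_eq0 (negbTE b0) orbF => a0.
  have [[a0' _]|[z [z' [Hz az az']]]] := hR _ _ h1; first by rewrite a0' eqxx in a0.
  have [[b0' _]|[w [w' [Hw aw aw']]]] := hR _ _ h2; first by rewrite b0' eqxx in b0.
  by apply: nice_aeq (Hn _ _ (Hdiv _ _ _ _ Hz Hw)); exact: aeq_div.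
- by move=> a ha; exists a, a, 1, 1; rewrite oner_neq0 !divr1; split=> //; exact: RA.
Qed.

End Isos.

Section GoodTheory.
Variables (Ek : vk M -> vk M -> Prop) (EG : vG M -> vG M -> Prop).
Hypothesis hEk : field_iso Ek.
Hypothesis hEG : group_iso EG.
Variable G : M -> M -> Prop.
Hypothesis hG : good Ek EG G.

Lemma g_00 : G 0 0.
Proof. by rewrite -(subrr 1); exact: (g_B hG (g_1 hG) (g_1 hG)). Qed.
Lemma g_N x x' : G x x' -> G (- x) (- x').
Proof. by move=> h; rewrite -sub0r -[- x']sub0r; exact: (g_B hG g_00 h). Qed.
Lemma g_D x x' y y' : G x x' -> G y y' -> G (x + y) (x' + y').
Proof. by move=> h1 /g_N h2; rewrite -[y]opprK -[y']opprK; exact: (g_B hG h1 h2). Qed.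
Lemma g_V x x' : G x x' -> G x^-1 x'^-1.
Proof. by move=> h; rewrite -[x^-1]mul1r -[x'^-1]mul1r; exact: (g_div hG (g_1 hG) h). Qed.
Lemma g_M x x' y y' : G x x' -> G y y' -> G (x * y) (x' * y').
Proof. by move=> h1 /g_V h2; rewrite -[y]invrK -[y']invrK; exact: (g_div hG h1 h2). Qed.
Lemma g_X x x' n : G x x' -> G (x ^+ n) (x' ^+ n).
Proof.
by move=> h; elim: n => [|n IH]; [rewrite !expr0; exact: g_1 hG|rewrite !exprS; exact: g_M].
Qed.
Lemma g_sum (I : Type) (r : seq I) (P : pred I) (F F' : I -> M) :
  (forall i, P i -> G (F i) (F' i)) ->
  G (\sum_(i <- r | P i) F i) (\sum_(i <- r | P i) F' i).
Proof.
by move=> h; elim/big_rec2: _ => [|i x y Pi]; [exact: g_00|apply: g_D; exact: h].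
Qed.
Lemma g_natmul x x' n : G x x' -> G (x *+ n) (x' *+ n).
Proof.
by move=> h; elim: n => [|n IH]; [rewrite !mulr0n; exact: g_00|rewrite !mulrS; exact: g_D].
Qed.
Lemma g_EV x x' : G x x' -> x != 0 -> EV EG x x'.
Proof. by move=> h x0; have [] := g_nice hG h x0. Qed.
Lemma g_eq0 x x' : G x x' -> (x == 0) = (x' == 0).
Proof.
move=> h; have [x0|x0] := eqVneq x 0.
  by move: h; rewrite x0 => /(g_0 hG)->; rewrite eqxx.
by have [_ /negbTE->] := EV_neq0 (g_EV h x0).
Qed.
Lemma g_fun x x' y : G x x' -> G x y -> x' = y.
Proof.
move=> h1 h2; have := g_B hG h1 h2; rewrite subrr => /(g_0 hG)/eqP.
by rewrite subr_eq0 => /eqP.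
Qed.
Lemma g_inj x x' y : G x x' -> G y x' -> x = y.
Proof.
move=> h1 h2; apply/eqP; rewrite -subr_eq0 (g_eq0 (g_B hG h1 h2)) subrr.
by rewrite eqxx.
Qed.
Lemma g_le x x' y y' : G x x' -> G y y' -> dle x y = dle x' y'.
Proof.
move=> h1 h2; have [x0|x0] := eqVneq x 0.
  have x0' : x' = 0 by apply: g_0 hG _ _; rewrite -x0.
  by rewrite x0 x0' !dle0x.
have [y0|y0] := eqVneq y 0; last exact: (EV_le hEG (g_EV h1 x0) (g_EV h2 y0)).
have y0' : y' = 0 by apply: g_0 hG _ _; rewrite -y0.
by rewrite y0 y0' !dlex0 (g_eq0 h1).
Qed.
Lemma g_lt x x' y y' : G x x' -> G y y' -> dlt x y = dlt x' y'.
Proof. by move=> h1 h2; rewrite /dlt (g_le h2 h1). Qed.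
Lemma g_aeq x x' y y' : G x x' -> G y y' -> aeq x y = aeq x' y'.
Proof. by move=> h1 h2; rewrite /aeq; exact: (g_lt (g_B hG h1 h2) h2). Qed.
Lemma g_ER x x' : G x x' -> dle x 1 -> ER Ek x x'.
Proof.
move=> h; have [x0|x0] := eqVneq x 0.
  have x0' : x' = 0 by apply: g_0 hG _ _; rewrite -x0.
  move=> _; rewrite x0 x0'; apply: ER_small => //; by rewrite dlt0x oner_neq0.
by have [] := g_nice hG h x0.
Qed.

Lemma g_A0k a : A0 a -> vval a = Some 0 -> ER Ek a a.
Proof. by move=> ha /vval_unitE[h _]; apply: g_ER => //; exact: (g_A hG ha). Qed.

Definition Gp (p p' : {poly M}) := forall i, G p`_i p'`_i.

Lemma Gp_size p p' : Gp p p' -> size p = size p'.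
Proof.
move=> h; have h' i : (p`_i == 0) = (p'`_i == 0) by exact: g_eq0.
apply/eqP; rewrite eqn_leq; apply/andP; split; apply/leq_sizeP => j hj; apply/eqP.
  by rewrite h' nth_default.
by rewrite -h' nth_default.
Qed.

Lemma Gp_B p p' q q' : Gp p p' -> Gp q q' -> Gp (p - q) (p' - q').
Proof. by move=> h1 h2 i; rewrite !coefB; exact: (g_B hG (h1 i) (h2 i)). Qed.
Lemma Gp_M p p' q q' : Gp p p' -> Gp q q' -> Gp (p * q) (p' * q').
Proof. by move=> h1 h2 i; rewrite !coefM; apply: g_sum => j _; exact: g_M. Qed.
Lemma Gp_C c c' : G c c' -> Gp c%:P c'%:P.
Proof. by move=> h i; rewrite !coefC; case: eqP => // _; exact: g_00. Qed.
Lemma Gp_Xn n : Gp 'X^n 'X^n.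
Proof. by move=> i; rewrite !coefXn; case: eqP => // _; [exact: g_1 hG|exact: g_00]. Qed.
Lemma Gp_X : Gp 'X 'X.
Proof. by rewrite -['X]expr1; exact: Gp_Xn. Qed.
Lemma Gp_deriv p p' : Gp p p' -> Gp p^`() p'^`().
Proof. by move=> h i; rewrite !coef_deriv; exact: g_natmul. Qed.
Lemma Gp_horner p p' x x' : Gp p p' -> G x x' -> G p.[x] p'.[x'].
Proof.
move=> h hx; rewrite !horner_coef -(Gp_size h); apply: g_sum => i _.
by apply: g_M => //; exact: g_X.
Qed.

(** Euclidean division run on both sides in parallel: the leading coefficients correspond under [G],
    hence so do the multiples of the divisor subtracted at each stage. *)
Lemma Gp_mod P P' : Gp P P' -> P \is monic -> (1 < size P)%N ->
  forall p p', Gp p p' -> exists s s' q q',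
    [/\ Gp s s' /\ Gp q q', (size q < size P)%N, p = s * P + q & p' = s' * P' + q'].
Proof.
move=> hP mP sP p; have [n] := ubnP (size p).
elim: n => // n IH in p *; rewrite ltnS => hn p' hp.
have [sp|sp] := ltnP (size p) (size P).
  exists 0, 0, p, p'; rewrite !mul0r !add0r; split=> //; split=> //.
  by move=> i; rewrite coef0; exact: g_00.
have mP' : P' \is monic.
  have : G (lead_coef P) (lead_coef P') by rewrite !lead_coefE (Gp_size hP); exact: hP.
  by rewrite (monicP mP) monicE => /(g_fun (g_1 hG)) <-.
pose d := (size p - size P)%N.
have p0 : p != 0 by rewrite -size_poly_gt0; apply: leq_trans sp; apply: ltnW.
have gl : G (lead_coef p) (lead_coef p') by rewrite !lead_coefE (Gp_size hp); exact: hp.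
pose t := (lead_coef p)%:P * 'X^d; pose t' := (lead_coef p')%:P * 'X^d.
have ht : Gp t t' by apply: Gp_M; [exact: Gp_C|exact: Gp_Xn].
have st : (size (p - t * P)%R < size p)%N.
  have lp0 : lead_coef p != 0 by rewrite lead_coef_eq0.
  have sizet : size (t * P) = size p.
    rewrite size_Mmonic ?mulf_neq0 ?polyC_eq0 // -?size_poly_eq0 ?size_polyXn //.
    by rewrite /t size_Cmul // size_polyXn addSn /= subnK.
  have lt : lead_coef (t * P) = lead_coef p.
    by rewrite lead_coef_Mmonic // /t lead_coef_Mmonic ?monicXn // lead_coefC.
  have hle : (size (p - t * P)%R <= size p)%N.
    by apply: leq_trans (size_polyD _ _) _; rewrite size_polyN sizet maxnn.
  rewrite ltn_neqAle hle andbT; apply/eqP => e.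
  have : lead_coef (p - t * P) = 0.
    rewrite lead_coefE e coefB -lead_coefE -{1}sizet -lead_coefE lt subrr //.
  by move/eqP; rewrite lead_coef_eq0 -size_poly_eq0 e size_poly_eq0 (negbTE p0).
have [||s [s' [q [q' [[h1 h2] h3 h4 h5]]]]] := IH (p - t * P) _ (p' - t' * P').
- by apply: leq_trans hn.
- by apply: Gp_B => //; exact: Gp_M.
exists (t + s), (t' + s'), q, q'; split=> //.
- by split=> // i; rewrite !coefD; apply: g_D => //; exact: ht.
- by rewrite mulrDl -addrA -h4 addrC subrK.
by rewrite mulrDl -addrA -h5 addrC subrK.
Qed.

(* The simple extension generated by [r] and [r']; [H] collects leading terms. *)
Lemma good_extend (H : M -> M -> Prop) r r' :
  (forall x x', H x x' -> nice Ek EG x x') ->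
  (forall x x' y y', H x x' -> H y y' -> H (x / y) (x' / y')) ->
  (forall p p', Gp p p' -> (p.[r] = 0 /\ p'.[r'] = 0) \/
     exists z z', [/\ H z z', aeq p.[r] z & aeq p'.[r'] z']) ->
  exists G', [/\ good Ek EG G', forall x x', G x x' -> G' x x', G' r r' &
    forall x x', G' x x' -> exists p q : {poly M}, [/\ (forall i, exists c, G p`_i c),
       (forall i, exists c, G q`_i c) & x = p.[r] / q.[r]]].
Proof.
move=> Hn Hd hp.
pose R x x' := exists p p' : {poly M}, [/\ Gp p p', x = p.[r] & x' = p'.[r']].
have RC c c' : G c c' -> R c c'.
  by move=> h; exists c%:P, c'%:P; rewrite !hornerC; split=> //; exact: Gp_C.
have R1 : R 1 1 by apply: RC; exact: g_1 hG.
have := @good_frac _ _ R H R1 _ _ _ Hn Hd _.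
set G' := (fun x x' => _) => hG'.
exists G'; split.
- apply: hG'.
  + move=> x x' y y' [p [p' [h1 -> ->]]] [q [q' [h2 -> ->]]].
    by exists (p - q), (p' - q'); rewrite !hornerE; split=> //; exact: Gp_B.
  + move=> x x' y y' [p [p' [h1 -> ->]]] [q [q' [h2 -> ->]]].
    by exists (p * q), (p' * q'); rewrite !hornerE; split=> //; exact: Gp_M.
  + by move=> a ha; apply: RC; exact: g_A hG _ ha.
  + by move=> x x' [p [p' [h -> ->]]]; exact: hp.
- move=> x x' h; exists x, x', 1, 1; rewrite oner_neq0 !divr1; split=> //.
  exact: RC.
- exists r, r', 1, 1; rewrite oner_neq0 !divr1; split=> //.
  by exists 'X, 'X; rewrite !hornerX; split=> //; exact: Gp_X.
- move=> x x' [a [a' [b [b' [[p [p' [h1 -> _]]] [q [q' [h2 -> _]]] _ -> _]]]]].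
  exists p, q; split=> // i; first by exists p'`_i.
  by exists q'`_i.
Qed.

End GoodTheory.

Lemma nice_inv Ek EG : field_iso Ek -> group_iso EG -> forall x x',
  nice Ek EG x x' -> nice (fun r s => Ek s r) (fun g h => EG h g) x' x.
Proof.
move=> hEk hEG x x' [h1 h2 h3]; split.
- by case: h1 => [g [g' [k1 k2 k3]]]; exists g', g.
- have -> : dle x' 1 = dle x 1 by apply/esym/(EV_le hEG h1 (EV_1 hEG)).
  by move/h2 => [].
- by move=> n /h3 h; split=> /h.
Qed.

Lemma good_inv Ek EG G : field_iso Ek -> group_iso EG -> good Ek EG G ->
  good (fun r s => Ek s r) (fun g h => EG h g) (fun x x' => G x' x).
Proof.
move=> hEk hEG hG; split.
- exact: g_1 hG.
- by move=> x x' y y' h1 h2; exact: (g_B hG h1 h2).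
- by move=> x x' y y' h1 h2; exact: (g_div hG h1 h2).
- by move=> x' h; apply/eqP; rewrite (g_eq0 hG h).
- move=> x x' h x0; apply: nice_inv => //; apply: (g_nice hG) => //.
  by rewrite (g_eq0 hG h).
- by move=> a ha; exact: (g_A hG ha).
Qed.

End GoodPairs.

Lemma argmax (M : valuedField) n (f : 'I_n.+1 -> M) : exists i, forall j, dle (f j) (f i).
Proof.
suff [i _ h] : exists2 i, i \in enum 'I_n.+1 & forall j, j \in enum 'I_n.+1 -> dle (f j) (f i).
  by exists i => j; apply: h; rewrite mem_enum.
have : enum 'I_n.+1 != [::] by rewrite -size_eq0 size_enum_ord.
elim: (enum 'I_n.+1) => // a [|b l] IH _.
  by exists a; rewrite ?inE // => j; rewrite inE => /eqP->; exact: dle_refl.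
have [//|i hi h] := IH; have /orP[ai|ia] := dle_total (f a) (f i).
  by exists i => [|j]; rewrite inE ?hi ?orbT // => /orP[/eqP->|/h].
exists a => [|j]; rewrite inE ?eqxx // => /orP[/eqP->|/h hj]; first exact: dle_refl.
exact: dle_trans ia.
Qed.

(** * Polynomials near an element without a best approximation *)

Section Limit.
Variable M : valuedField.
Hypothesis hHensel : henselian M.
Hypothesis hChar : [pchar (vk M)] =i pred0.
Variables (F : set M) (x : M).
Hypothesis F0 : exists c, F c.
Hypothesis nobest : forall a, F a -> exists2 b, F b & dlt (x - b) (x - a).
Implicit Types (a b c y w : M) (p : {poly M}).

(* [Q] holds at all elements of [F] close enough to [x]. *)
Definition Ev (Q : M -> Prop) := exists2 c, F c & forall a, F a -> dle (x - a) (x - c) -> Q a.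

Lemma Ev_mono (Q R : M -> Prop) : (forall a, F a -> Q a -> R a) -> Ev Q -> Ev R.
Proof. by move=> h [c hc hQ]; exists c => // a ha hac; apply: h => //; exact: hQ. Qed.

Lemma Ev_and (Q R : M -> Prop) : Ev Q -> Ev R -> Ev (fun a => Q a /\ R a).
Proof.
move=> [c hc hQ] [d hd hR]; have /orP[h|h] := dle_total (x - c) (x - d).
  by exists c => // a ha hac; split; [exact: hQ|apply: hR => //; exact: dle_trans h].
by exists d => // a ha had; split; [apply: hQ => //; exact: dle_trans h|exact: hR].
Qed.

Lemma Ev_ex (Q : M -> Prop) : Ev Q -> exists2 a, F a & Q a.
Proof. by move=> [c hc h]; exists c => //; apply: h => //; exact: dle_refl. Qed.

Lemma Ev_lt a : F a -> Ev (fun b => dlt (x - b) (x - a)).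
Proof.
by move=> /nobest[c hc h]; exists c => // b hb hbc; exact: dle_lt_trans h.
Qed.

Lemma Ev_true (Q : M -> Prop) : (forall a, F a -> Q a) -> Ev Q.
Proof. by move=> h; have [c hc] := F0; exists c => // a ha _; exact: h. Qed.

Lemma Ev_forall n (Q : nat -> M -> Prop) :
  (forall j, (j < n)%N -> Ev (Q j)) -> Ev (fun a => forall j, (j < n)%N -> Q j a).
Proof.
elim: n => [|n IH] h; first by apply: Ev_true.
have h1 := IH (fun j hj => h j (ltnW hj)).
apply: Ev_mono (Ev_and h1 (h n (ltnSn n))) => a _ [h2 h3] j.
by rewrite ltnS leq_eqVlt => /orP[/eqP->|]; [|exact: h2].
Qed.

Lemma sub_neq0 a : F a -> a - x != 0.
Proof. by move=> /nobest[b _ h]; rewrite subr_eq0 eq_sym -subr_eq0; exact: dlt_neq0 h. Qed.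

(** An equality between the values of the terms of degrees $i<j$ fixes the value of $(a-x)^{j-i}$.
    As the approximations keep getting strictly closer, it fails from some point on. *)
Lemma Ev_distinct (t : nat -> M) n : Ev (fun a => forall j, (j < n)%N -> forall i, (i < j)%N ->
  t i != 0 -> t j != 0 -> vval (t i * (a - x) ^+ i) <> vval (t j * (a - x) ^+ j)).
Proof.
apply: Ev_forall => j _.
have main i : (i < j)%N -> Ev (fun a => t i != 0 -> t j != 0 ->
    vval (t i * (a - x) ^+ i) <> vval (t j * (a - x) ^+ j)).
  move=> ij.
  have red a : F a -> t j != 0 -> vval (t i * (a - x) ^+ i) = vval (t j * (a - x) ^+ j) ->
      vval ((a - x) ^+ (j - i)) = vval (t i / t j).
    move=> ha tj e; have a0 := sub_neq0 ha.
    have -> : (a - x) ^+ (j - i) = t j * (a - x) ^+ j / (t j * (a - x) ^+ i).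
      by rewrite -mulf_div divff // mul1r -{2}(subnK (ltnW ij)) exprD mulfK // expf_neq0.
    have -> : t i / t j = t i * (a - x) ^+ i / (t j * (a - x) ^+ i).
      by rewrite -mulf_div divff ?mulr1 // expf_neq0.
    by apply: vval_mul.
  have [[a [ha ti tj e]]|none] := pselect (exists a, [/\ F a, t i != 0, t j != 0 &
      vval (t i * (a - x) ^+ i) = vval (t j * (a - x) ^+ j)]); last first.
    by apply: Ev_true => a ha ti tj e; apply: none; exists a.
  apply: Ev_mono (Ev_lt ha) => b hb hlt _ _ e'.
  have := red b hb tj e'; rewrite -(red a ha tj e) => eb.
  have hlt' : dlt ((b - x) ^+ (j - i)) ((a - x) ^+ (j - i)).
    rewrite -(prednK (n := j - i)) ?subn_gt0 //; apply: dltX.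
    by rewrite dlt_subC -opprB dltNl -dltNr opprB -dltNl opprB.
  by move: hlt'; rewrite (dlt_eql _ eb) dltxx.
apply: Ev_mono (Ev_forall (n := j) (Q := fun i a => t i != 0 -> t j != 0 ->
    vval (t i * (a - x) ^+ i) <> vval (t j * (a - x) ^+ j)) main).
by move=> a _ h.
Qed.

(** Terms of pairwise distinct values cannot cancel, so the largest one gives the leading term of
    the sum. *)
Lemma dominant (t : nat -> M) n d : d != 0 ->
  (forall j, (j < n)%N -> forall i, (i < j)%N ->
     t i != 0 -> t j != 0 -> vval (t i * d ^+ i) <> vval (t j * d ^+ j)) ->
  (forall j, (j < n)%N -> t j = 0) \/
  exists i, [/\ (i < n)%N, t i != 0, aeq (\sum_(j < n) t j * d ^+ j) (t i * d ^+ i) &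
    forall j, (j < n)%N -> j != i -> dlt (t j * d ^+ j) (t i * d ^+ i)].
Proof.
move=> d0 hd; case: n hd => [|n] hd; first by left.
have [i hi] := argmax (fun j : 'I_n.+1 => t j * d ^+ j).
have [ti|ti] := eqVneq (t i) 0.
  left=> j hj; have := hi (Ordinal hj); rewrite ti mul0r dlex0 mulf_eq0 expf_eq0.
  by rewrite (negbTE d0) andbF orbF => /eqP.
right; exists i.
have hlt (j : nat) : (j < n.+1)%N -> j != i -> dlt (t j * d ^+ j) (t i * d ^+ i).
  move=> hj ji; rewrite /dlt; apply/negP => hij.
  have e : vval (t i * d ^+ i) = vval (t j * d ^+ j).
    by apply/deqP; split=> //; exact: (hi (Ordinal hj)).
  have tj : t j != 0.
    have := vval_eq0 e; rewrite !mulf_eq0 !expf_eq0 (negbTE d0) !andbF !orbF (negbTE ti).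
    by move=> <-.
  case: (ltngtP i j) ji => // ij _; first exact: hd ij ti tj e.
  exact: hd (ltn_ord i) _ ij tj ti (esym e).
split=> //; rewrite (bigD1 i) //=; apply: aeq_addl; apply: dlt_sum.
  by rewrite mulf_neq0 // expf_neq0.
by move=> j ji; apply: hlt.
Qed.

(** Without cancellation, a bound on the sum is a bound on each of its terms. *)
Lemma Ev_terms (t : nat -> M) n w : Ev (fun a => dlt (\sum_(j < n) t j * (a - x) ^+ j) w) ->
  Ev (fun a => forall j, (j < n)%N -> dlt (t j * (a - x) ^+ j) w).
Proof.
move=> h; apply: Ev_mono (Ev_and h (Ev_distinct t n)) => a ha [hw hd] j hj.
have [t0|[i [hi ti hs hlt]]] := dominant (sub_neq0 ha) hd.
  by rewrite t0 // mul0r dlt0x (dlt_neq0 hw).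
have hiw : dlt (t i * (a - x) ^+ i) w by rewrite -(dlt_eql _ (vval_aeq hs)).
have [->//|ji] := eqVneq j i.
exact: dlt_trans (hlt j hj ji) hiw.
Qed.

(** The coefficient of degree 0 is suppressed so that the Taylor sum is $p(a)-p(x)$. *)
Definition tcoef p j := if j is 0 then 0 else p^`N(j).[x].

Lemma taylor_sub p a : p.[a] - p.[x] = \sum_(j < size p) tcoef p j * (a - x) ^+ j.
Proof.
have [->|p0] := eqVneq p 0; first by rewrite size_poly0 big_ord0 !horner0 subrr.
have -> : p.[a] = p.[x + (a - x)] by rewrite addrC subrK.
rewrite nderiv_taylor; last exact: mulrC.
have : (0 < size p)%N by rewrite size_poly_gt0.
case: (size p) => // n _; rewrite !big_ord_recl /= nderivn0 expr0 mulr1 mul0r add0r.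
by rewrite addrC addKr.
Qed.

Definition stable p := Ev (fun a => aeq p.[a] p.[x]).

Lemma stable_terms p : stable p ->
  Ev (fun a => forall j, (j < size p)%N -> dlt (tcoef p j * (a - x) ^+ j) p.[x]).
Proof.
by move=> h; apply: Ev_terms; apply: Ev_mono h => a _; rewrite /aeq taylor_sub.
Qed.

(** These are the pseudo-limits of the family of approximations to [x] from [F]. *)
Definition limit y := forall a, F a -> dle (y - x) (x - a).

Lemma stable_neq0 p : stable p -> p.[x] != 0.
Proof. by case/Ev_ex => a _; exact: aeq_neq0r. Qed.

(** A pseudo-limit is at least as close to [x] as every approximation, so each Taylor term at [y] is
    bounded by the one at an approximation [a], where it is already smaller than $p(x)$. *)
Lemma stable_limit p y : stable p -> limit y -> aeq p.[y] p.[x].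
Proof.
move=> hp; have px := stable_neq0 hp; case/stable_terms/Ev_ex: hp => a ha h hy.
rewrite /aeq taylor_sub; apply: dlt_sum => // j _.
apply: dle_lt_trans (h j (ltn_ord j)); apply: dleM; first exact: dle_refl.
by apply: dleX; rewrite -[a - x]opprB dleNr; exact: hy.
Qed.

(** An intrinsic form of [stable]: it evaluates [p] at elements of [F] only, hence can be compared
    across a partial isomorphism with domain [F]. *)
Definition istable p := exists2 c, F c & forall a b, F a -> F b ->
  dle (x - a) (x - c) -> dle (x - b) (x - c) -> aeq p.[a] p.[b].

(** For the converse, suppose that $p(a)-p(x)$, which has a dominant Taylor term, is not smaller
    than $p(c)$. For a closer [b] the difference $p(b)-p(x)$ is strictly smaller, so $p(a)-p(b)$ has
    the leading term of $p(a)-p(x)$. This contradicts the agreement of the leading terms of $p(a)$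
    and $p(b)$ with that of $p(c)$. *)
Lemma stable_istable p : stable p <-> istable p.
Proof.
split=> [[c hc h]|[c hc h]].
  by exists c => // a b ha hb hac hbc; apply: (aeq_trans (h a ha hac)); apply/aeq_sym/h.
have cc := dle_refl (x - c).
set w := p.[c]; have hw a : F a -> dle (x - a) (x - c) -> aeq p.[a] w.
  by move=> ha hac; exact: h.
have w0 : w != 0 := aeq_neq0r (hw c hc cc).
have near_c : Ev (fun a => dle (x - a) (x - c)) by exists c.
apply: Ev_mono (Ev_and near_c (Ev_distinct (tcoef p) (size p))) => a ha [hac hd].
have a0 := sub_neq0 ha.
suff hlt : dlt (p.[a] - p.[x]) w.
  by apply: aeq_sym; rewrite /aeq dlt_subC (dlt_eqr _ (vval_aeq (hw a ha hac))).
have [t0|[i [hi ti hs hlt]]] := dominant a0 hd.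
  rewrite taylor_sub big1 ?dlt0x // => j _; by rewrite t0 // mul0r.
rewrite -taylor_sub in hs; rewrite (dlt_eql _ (vval_aeq hs)) /dlt; apply/negP => hwi.
have [b hb hba] := nobest ha.
have hbc : dle (x - b) (x - c) by apply: dle_trans hac; exact: dltW.
have hti : tcoef p i * (a - x) ^+ i != 0 by rewrite mulf_neq0 // expf_neq0.
have hb' : dlt (p.[b] - p.[x]) (tcoef p i * (a - x) ^+ i).
  rewrite taylor_sub; apply: dlt_sum => // j _.
  have [tj|tj] := eqVneq (tcoef p j) 0; first by rewrite tj mul0r dlt0x.
  have j0 : (0 < j)%N by case: (nat_of_ord j) tj => //; rewrite eqxx.
  apply: (@dlt_le_trans _ (tcoef p j * (a - x) ^+ j)).
    rewrite dltM2l // -(prednK j0); apply: dltX.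
    by rewrite -[b - x]opprB -[a - x]opprB dltNl dltNr.
  have [->|ji] := eqVneq (j : nat) i; first exact: dle_refl.
  exact/dltW/hlt.
have e1 : aeq (p.[a] - p.[b]) (tcoef p i * (a - x) ^+ i).
  have -> : p.[a] - p.[b] = (p.[a] - p.[x]) + - (p.[b] - p.[x]) by ring.
  apply: (aeq_trans _ hs); apply: aeq_addl.
  by rewrite dltNl (dlt_eqr _ (vval_aeq hs)).
have e2 : dlt (p.[a] - p.[b]) w.
  have -> : p.[a] - p.[b] = (p.[a] - w) - (p.[b] - w) by ring.
  by apply: dltB; exact: hw.
by move: e2; rewrite (dlt_eql _ (vval_aeq e1)) => /dltNle; apply.
Qed.

Lemma nderivn_deriv (p : {poly M}) j : p^`()^`N(j) = p^`N(j.+1) *+ j.+1.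
Proof.
apply/polyP => i; rewrite coefMn !coef_nderivn coef_deriv addSn -!mulrnA.
by congr (_ *+ _); rewrite [RHS]mulnC -mul_bin_diag.
Qed.

(** Stability of the derivative makes the linear Taylor term dominate the higher ones, and
    instability of [p] keeps $p(x)$ from exceeding it. Newton's lemma then applies at [x] and yields
    a root that is a pseudo-limit. *)
Lemma newton_limit p : ~ stable p -> stable p^`() -> exists2 r, root p r & limit r.
Proof.
move=> np sp; set p1 := p^`().[x]; have p10 : p1 != 0 := stable_neq0 sp.
have p1E : p^`N(1).[x] = p1 by rewrite nderivn1.
(* The Taylor coefficients of the derivative are those of [p] times positive integers, which are
   units; so its terms have the values of the terms of [p] divided by $a-x$. *)
have reg : Ev (fun a => forall j, (1 < j)%N ->
    dlt (p^`N(j).[x] * (a - x) ^+ j) (p1 * (a - x))).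
  apply: Ev_mono (stable_terms sp) => a ha h [|[|j]] // _.
  have a0 := sub_neq0 ha.
  rewrite exprSr mulrA dltM2r //.
  have e : p^`N(j.+2).[x] * j.+2%:R = p^`()^`N(j.+1).[x].
    by rewrite nderivn_deriv hornerMn mulr_natr.
  have -> : dlt (p^`N(j.+2).[x] * (a - x) ^+ j.+1) p1 =
            dlt (p^`()^`N(j.+1).[x] * (a - x) ^+ j.+1) p1.
    by rewrite -e [_ * _%:R]mulrC -mulrA (dlt_eql _ (vval_natrM hChar _ (ltn0Sn _))).
  have [sj|sj] := ltnP j.+1 (size p^`()); first exact: (h j.+1 sj).
  by rewrite nderivn_poly0 // horner0 mul0r dlt0x.
have [c hc hreg] := reg.
(* Otherwise $p(x)$ would exceed all Taylor terms from [a] on, and [p] would be stable. *)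
have px a : F a -> dle (x - a) (x - c) -> dle p.[x] (p1 * (a - x)).
  move=> ha hac; rewrite dleNgt; apply/negP => hlt; apply: np.
  exists a => // b hb hba; have hbc := dle_trans hba hac.
  rewrite /aeq taylor_sub; apply: dlt_sum => [|j _]; first exact: dlt_neq0 hlt.
  apply: (@dle_lt_trans _ (p1 * (b - x))); last first.
    apply: dle_lt_trans hlt; rewrite dleM2l //.
    by rewrite -[b - x]opprB -[a - x]opprB dleNl dleNr.
  case: (nat_of_ord j) => [|[|k]] /=; first by rewrite mul0r dle0x.
    by rewrite p1E expr1 dle_refl.
  by apply: dltW; exact: (hreg b hb hbc k.+2 isT).
have c0 := sub_neq0 hc; have cc := dle_refl (x - c).
have [||||h hh hr] := @newton _ hHensel hChar p x (c - x).
- by rewrite p1E.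
- by [].
- by rewrite p1E; exact: px.
- by move=> j /andP[j1 _]; rewrite p1E; exact: hreg.
exists (x + h) => // b hb; rewrite addrC addKr.
(* Newton's lemma bounds [h] by $c-x$ only. Since $p(x)$ and $p'(x)h$ have the same value, the
   bounds [px] on $p(x)$ give a bound on [h] for every closer [a]. *)
suff main a : F a -> dle (x - a) (x - c) -> dle h (x - a).
  have /orP[bc|cb] := dle_total (x - b) (x - c); first exact: main.
  exact: dle_trans (main c hc cc) cb.
move=> ha hac; have [->|h0] := eqVneq h 0; first exact: dle0x.
rewrite -dleNr opprB -(dleM2l _ _ p10).
suff e : aeq (- p.[x]) (p1 * h).
  have e0 : vval (p1 * h) = vval p.[x] by rewrite -(vval_aeq e) vval_N.
  by rewrite (dle_eql _ e0); exact: px.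
have := taylor_sub p (x + h); rewrite (rootP hr) sub0r addrAC subrr add0r => ->.
have s1 : (1 < size p)%N.
  rewrite ltnNge; apply/negP => s1; move: p10; rewrite -p1E nderivn_poly0 ?horner0 ?eqxx //.
rewrite (bigD1 (Ordinal s1)) //= p1E expr1; apply: aeq_addl.
apply: dlt_sum => [|j j1]; first by rewrite mulf_neq0.
have : (j : nat) != 1%N by [].
case: (nat_of_ord j) => [|[|k]] //= _.
  by rewrite mul0r dlt0x mulf_neq0.
apply: (@dle_lt_trans _ (p^`N(k.+2).[x] * (c - x) ^+ k.+1 * h)).
  by rewrite exprSr mulrA dleM2r // dleM ?dle_refl // dleX.
rewrite dltM2r // -(dltM2r _ _ c0) -mulrA -exprSr.
exact: (hreg c hc cc).
Qed.

Lemma limit_notin r : limit r -> ~ F r.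
Proof.
move=> hr Fr; have [b hb h] := nobest Fr.
by have := hr b hb; rewrite -dleNl opprB; exact: dltNle h.
Qed.

End Limit.

(** * Definable relations of the valued field *)

Section DefinableVF.
Variable M : valuedField.
Let N := vf_structure M.
Variable V : ctx vf_sig.
Implicit Types f g : asg N V -> M.

Lemma tdefK_mul f g : @tdefinable _ N V VF f -> @tdefinable _ N V VF g ->
  @tdefinable _ N V VF (fun e => f e * g e).
Proof.
move=> hf hg.
apply: (@tdefinable_app _ N V (KOp RMul) (fun i => if i == ord0 then f else g)) => i.
by case: (i == ord0).
Qed.

Lemma tdefK_opp f : @tdefinable _ N V VF f -> @tdefinable _ N V VF (fun e => - f e).
Proof. by move=> hf; apply: (@tdefinable_app _ N V (KOp ROpp) (fun i => f)). Qed.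

Lemma tdefK_add f g : @tdefinable _ N V VF f -> @tdefinable _ N V VF g ->
  @tdefinable _ N V VF (fun e => f e + g e).
Proof.
move=> hf hg.
apply: (@tdefinable_app _ N V (KOp RAdd) (fun i => if i == ord0 then f else g)) => i.
by case: (i == ord0).
Qed.

Lemma tdefK_sub f g : @tdefinable _ N V VF f -> @tdefinable _ N V VF g ->
  @tdefinable _ N V VF (fun e => f e - g e).
Proof. by move=> hf hg; apply: tdefK_add => //; exact: tdefK_opp. Qed.

Lemma tdefK_1 : @tdefinable _ N V VF (fun e => 1).
Proof. by apply: (@tdefinable_app _ N V (KOp ROne) (fun i e => 1)); case. Qed.

Lemma tdefK_exp f n : @tdefinable _ N V VF f -> @tdefinable _ N V VF (fun e => f e ^+ n).
Proof.
move=> hf; elim: n => [|n IH]; first exact: tdefK_1.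
have [t ht] := tdefK_mul hf IH; by exists t => e; rewrite ht exprS.
Qed.

Lemma definable_val f (g : asg N V -> vG M) : @tdefinable _ N V VF f ->
  @tdefinable _ N V VG g -> definable (fun e => vval (f e) = Some (g e)).
Proof.
move=> [t ht] [u hu].
by exists (@FRel vf_sig V ValGraph (args2 (S := vf_sig) t u)) => e /=; rewrite ht hu.
Qed.

Lemma definable_res f (g : asg N V -> vk M) : @tdefinable _ N V VF f ->
  @tdefinable _ N V RF g -> definable (fun e => dle (f e) 1 /\ vres (f e) = g e).
Proof.
move=> [t ht] [u hu].
exists (@FRel vf_sig V ResGraph (args2 (S := vf_sig) t u)) => e /=.
by rewrite ht hu vle_dle1.
Qed.

Lemma definable_gle (f g : asg N V -> vG M) : @tdefinable _ N V VG f ->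
  @tdefinable _ N V VG g -> definable (fun e => f e <= g e).
Proof.
move=> [t ht] [u hu].
by exists (@FRel vf_sig V GLe (args2 (S := vf_sig) t u)) => e /=; rewrite ht hu.
Qed.

End DefinableVF.

Section DefinableDiv.
Variable M : valuedField.
Let N := vf_structure M.

Lemma tdef_ren (V W : ctx vf_sig) (h : ren V W) s (f : asg N V -> N s) :
  tdefinable f -> tdefinable (fun e : asg N W => f (acomp e h)).
Proof. by move=> [t ht]; exists (trename h t) => e; rewrite eval_rename ht. Qed.

(** The graph of the valuation omits 0, which has the least value by convention; hence the case
    distinction in the formula. *)
Lemma definable_dle (V : ctx vf_sig) (f g : asg N V -> M) :
  @tdefinable _ N V VF f -> @tdefinable _ N V VF g ->
  definable (fun e => dle (f e) (g e)).
Proof.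
move=> hf hg.
pose W : ctx vf_sig := cadd (cadd V (@csingle vf_sig VG)) (@csingle vf_sig VG).
pose h : ren V W := fun s v => inl (inl v).
pose w1 : W VG := inl (inr (here (S := vf_sig) VG)).
pose w2 : W VG := inr (here (S := vf_sig) VG).
pose Q (e : asg N W) := [/\ vval (f (acomp e h)) = Some (e VG w1 : vG M),
   vval (g (acomp e h)) = Some (e VG w2 : vG M) &
   (e VG w1 : vG M) <= e VG w2].
have hQ : definable Q.
  have h1 : definable (fun e : asg N W => vval (f (acomp e h)) = Some (e VG w1 : vG M)).
    by apply: definable_val; [exact: tdef_ren|exact: tdefinable_var].
  have h2 : definable (fun e : asg N W => vval (g (acomp e h)) = Some (e VG w2 : vG M)).
    by apply: definable_val; [exact: tdef_ren|exact: tdefinable_var].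
  have h3 : definable (fun e : asg N W => (e VG w1 : vG M) <= e VG w2).
    by apply: definable_gle; exact: tdefinable_var.
  apply: definable_iff (definable_and h1 (definable_and h2 h3)) => e.
  by split=> [[? []]|[]].
have h0 : definable (fun e : asg N V => f e = 0).
  have [t ht] := tdefK_sub hf hf.
  have [u hu] := hf.
  by exists (@FEq vf_sig V VF u t) => e /=; rewrite ht hu subrr.
apply: definable_iff (definable_imp (definable_not h0) (definable_ex (definable_ex hQ))) => e.
split=> [H|hfg fe0].
  have [->|fe0] := eqVneq (f e) 0; first exact: dle0x.
  have [|g1 [g2 [h1 h2 h3]]] := H; first by apply/eqP.
  by rewrite /dle [vval _]h1 [vval (g e)]h2.
have fe0' : f e != 0 by apply/eqP.
have ge0' : g e != 0.
  by apply/eqP => g0; move: hfg; rewrite g0 dlex0 (negbTE fe0').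
have [g1 h1] := vval_neq0 fe0'; have [g2 h2] := vval_neq0 ge0'.
by exists g1, g2; split=> //; move: hfg; rewrite /dle h1 h2.
Qed.

Lemma definable_coset (V : ctx vf_sig) (f g : asg N V -> M) n :
  @tdefinable _ N V VF f -> @tdefinable _ N V VF g ->
  definable (fun e => exists z, f e = g e * z ^+ n).
Proof.
move=> hf hg.
pose W : ctx vf_sig := cadd V (@csingle vf_sig VF).
pose h : ren V W := fun s v => inl v.
pose w : W VF := inr (here (S := vf_sig) VF).
have hQ : definable (fun e : asg N W => f (acomp e h) = g (acomp e h) * (e VF w : M) ^+ n).
  apply: (@definable_teq _ N W VF (fun e => f (acomp e h))); first exact: tdef_ren.
  apply: tdefK_mul; first exact: tdef_ren.
  apply: tdefK_exp; exact: tdefinable_var.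
exact: definable_ex hQ.
Qed.

End DefinableDiv.

Definition csmall (S : signature) (N : structure S) (D : psets N) := countable (tagged_union D).

Lemma countable_setU (T : Type) (X Y : set T) :
  countable X -> countable Y -> countable (X `|` Y).
Proof.
by move=> cX cY; rewrite -bigcup2E; apply: bigcup_countable => // -[|[|k]] _ //=.
Qed.

Lemma countable_image (T U : Type) (f : T -> U) (X : set T) :
  countable X -> countable (f @` X).
Proof. by move=> cX; exact: sub_countable (card_image_le _ _) cX. Qed.

Definition mkps (M : valuedField) (X : set M) (Y : set (vk M)) (Z : set (vG M)) :
  psets (vf_structure M) := fun s =>
  match s with VF => X | RF => Y | VG => Z | RV => set0 end.

Lemma countable_tagged (S : signature) (N : structure S) (D D' : psets N) :
  countable (tagged_union D) -> countable (tagged_union D') ->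
  countable (tagged_union (fun s => D s `|` D' s)).
Proof.
move=> cD cD'; rewrite (_ : tagged_union _ = tagged_union D `|` tagged_union D').
  exact: countable_setU.
by apply/seteqP; split=> -[s x].
Qed.

Lemma countable_mkps (M : valuedField) X Y Z :
  countable X -> countable Y -> countable Z ->
  countable (tagged_union (@mkps M X Y Z)).
Proof.
move=> cX cY cZ; pose N := vf_structure M.
apply: (@sub_countable _ _ _ ((existT N VF) @` X `|`
  ((existT N RF) @` Y `|` (existT N VG) @` Z))).
  apply: subset_card_le => -[[] x] //= h; [left|right; left|right; right]; by exists x.
by apply: countable_setU; [|apply: countable_setU]; exact: countable_image.
Qed.

(** * Extending a partial isomorphism inside a countable field *)

Section Step.
Variable M : valuedField.
Hypothesis hHensel : henselian M.
Hypothesis hChar : [pchar (vk M)] =i pred0.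
Variable A0 : set M.
Hypothesis hA0 : coset_reps A0.
Hypothesis cA0 : countable A0.
Let N := vf_structure M.
Hypothesis hsat : type_saturated (@csmall _ N).
Variables (Ek : vk M -> vk M -> Prop) (EG : vG M -> vG M -> Prop).
Hypothesis hEk : field_iso Ek.
Hypothesis hEG : group_iso EG.
Variable L : set M.
Hypothesis L1 : L 1.
Hypothesis LB : forall x y, L x -> L y -> L (x - y).
Hypothesis Ldiv : forall x y, L x -> L y -> L (x / y).
Hypothesis Lroot : forall (p : {poly M}) x, p != 0 -> (forall i, L p`_i) -> root p x -> L x.
Hypothesis cL : countable L.
Hypothesis LEk : forall x, L x -> dle x 1 -> exists r, Ek (vres x) r.
Hypothesis LEG : forall x g, L x -> vval x = Some g -> exists h, EG g h.
Variable G : M -> M -> Prop.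
Hypothesis hG : good A0 Ek EG G.
Hypothesis GL : forall x x', G x x' -> L x.
Implicit Types (x y z a b c r u : M).

Let gEV := g_EV hG.

(** [L] is fixed beforehand: countable, relatively algebraically closed, with residues and values
    already in the domains of [Ek] and [EG]. The domain of [G] can thus grow inside [L] while these
    two relations stay the same. The element added need not be the one that was asked for. *)
Definition can_extend := exists G', [/\ good A0 Ek EG G', forall x x', G x x' -> G' x x',
  forall x x', G' x x' -> L x & exists r r', G' r r' /\ ~ exists c, G r c].

Lemma L0 : L 0. Proof. by rewrite -(subrr 1); exact: LB. Qed.
Lemma LN x : L x -> L (- x).
Proof. by move=> h; rewrite -sub0r; apply: LB => //; exact: L0. Qed.
Lemma LD x y : L x -> L y -> L (x + y).
Proof. by move=> h /LN; rewrite -{2}[y]opprK; exact: LB. Qed.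
Lemma LM x y : L x -> L y -> L (x * y).
Proof.
move=> hx hy; rewrite -[y]invrK; apply: Ldiv => //.
by rewrite -[y^-1]mul1r; exact: Ldiv.
Qed.
Lemma LX x n : L x -> L (x ^+ n).
Proof. by move=> h; elim: n => [|n IH]; rewrite ?expr0 // exprS; exact: LM. Qed.
Lemma L_horner (p : {poly M}) x : (forall i, L p`_i) -> L x -> L p.[x].
Proof.
move=> hp hx; rewrite horner_coef; elim/big_ind: _ => //.
- exact: L0.
- exact: LD.
- by move=> i _; apply: LM => //; exact: LX.
Qed.

Lemma step_transc (H : M -> M -> Prop) r r' : L r -> ~ (exists c, G r c) ->
  (forall x x', H x x' -> nice Ek EG x x') ->
  (forall x x' y y', H x x' -> H y y' -> H (x / y) (x' / y')) ->
  (forall p p', Gp G p p' -> (p.[r] = 0 /\ p'.[r'] = 0) \/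
     exists z z', [/\ H z z', aeq p.[r] z & aeq p'.[r'] z']) -> can_extend.
Proof.
move=> Lr nr h1 h2 h3.
have [G' [k1 k2 k3 k4]] := good_extend hHensel hChar hG h1 h2 h3.
exists G'; split=> //; last by exists r, r'.
move=> x x' /k4[p [q [hp hq ->]]]; apply: Ldiv; apply: L_horner => // i.
  by have [c /GL] := hp i.
by have [c /GL] := hq i.
Qed.

(** Division by [P] leaves the polynomials of smaller degree. The nonzero ones have leading terms at
    [r], so they do not vanish there, and [P] acts as the minimal polynomial of [r]. *)
Lemma step_alg (H : M -> M -> Prop) r r' (P P' : {poly M}) : L r -> ~ (exists c, G r c) ->
  Gp G P P' -> P \is monic -> (1 < size P)%N -> P.[r] = 0 -> P'.[r'] = 0 ->
  (forall x x', H x x' -> nice Ek EG x x') ->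
  (forall x x' y y', H x x' -> H y y' -> H (x / y) (x' / y')) ->
  (forall p p', Gp G p p' -> p != 0 -> (size p < size P)%N ->
     exists z z', [/\ H z z', aeq p.[r] z & aeq p'.[r'] z']) -> can_extend.
Proof.
move=> Lr nr hP mP sP Pr Pr' h1 h2 h3; apply: (step_transc (H := H) (r' := r') Lr nr) => //.
move=> p p' /(Gp_mod hG hP mP sP)[s [s' [q [q' [[_ hq] sq -> ->]]]]].
rewrite !hornerE Pr Pr' !mulr0 !add0r.
have [q0|q0] := eqVneq q 0; last by right; exact: h3.
left; rewrite q0 horner0; split=> //.
have /eqP : size q' = 0%N by rewrite -(Gp_size hG hq) q0 size_poly0.
by rewrite size_poly_eq0 => /eqP ->; rewrite horner0.
Qed.

(** That [x] and [x'] are n-th powers for the same n is not a multiplicative condition; lying in a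
    common coset of the n-th powers is. *)
Definition coset_eq x x' := forall n, (0 < n)%N ->
  exists a, [/\ a != 0, isP n (x / a) & isP n (x' / a)].

Lemma coset_isP x x' : x != 0 -> x' != 0 -> coset_eq x x' ->
  forall n, (0 < n)%N -> (isP n x <-> isP n x').
Proof.
move=> x0 x0' h n n0; have [a [a0 h1 h2]] := h n n0.
by rewrite (isP_coset a0 x0 h1) (isP_coset a0 x0' h2).
Qed.

Lemma coset_mul x x' y y' : coset_eq x x' -> coset_eq y y' -> coset_eq (x * y) (x' * y').
Proof.
move=> h1 h2 n n0; have [a [a0 h3 h4]] := h1 n n0; have [b [b0 h5 h6]] := h2 n n0.
by exists (a * b); rewrite mulf_neq0 // -!mulf_div; split=> //; exact: isP_mul.
Qed.

Lemma coset_inv x x' : coset_eq x x' -> coset_eq x^-1 x'^-1.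
Proof.
move=> h n n0; have [a [a0 h1 h2]] := h n n0.
by exists a^-1; rewrite invr_eq0 -!invfM; split=> //; exact: isP_inv.
Qed.

Lemma coset_X x x' m : coset_eq x x' -> coset_eq (x ^+ m) (x' ^+ m).
Proof.
move=> h; elim: m => [|m IH]; last by rewrite !exprS; exact: coset_mul.
by move=> n n0; exists 1; rewrite oner_neq0 !expr0 divr1; split=> //; exists 1; rewrite expr1n.
Qed.

Lemma coset_G c c' : G c c' -> c != 0 -> coset_eq c c'.
Proof.
move=> hc c0 n n0; have [a ha hP] := rep_all hA0 n0 c0; have a0 := rep_neq0 hA0 ha.
exists a; split=> //.
have hca : G (c / a) (c' / a) by exact: (g_div hG hc (g_A hG ha)).
have [_ _ h] := g_nice hG hca (mulf_neq0 c0 (invr_neq0 a0)).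
exact/h.
Qed.

Lemma coset_unit t t' : ER Ek t t' -> dle 1 t -> coset_eq t t'.
Proof.
move=> hR ht n n0; have [t1 _ _] := hR.
have [|a [ha ua] hP] := rep_unit hA0 (x := t) n0; first exact/vval_unitE.
exists a; rewrite (rep_neq0 hA0 ha); split=> //.
have /vval_unitE[a1 a2] := ua.
have hA : ER Ek a a := g_A0k hEk hG ha ua.
have hR' : ER Ek (t / a) (t' / a) by apply: ER_mul => //; exact: ER_inv.
have ht' : dle 1 (t / a) by rewrite dle_1div ?(rep_neq0 hA0 ha) //; exact: dle_trans ht.
have [_ _ h] := nice_unit hHensel hChar hA0 hEk hEG (g_A0k hEk hG) hR' ht'.
exact/h.
Qed.

Lemma realize_VF D (I : Type) (P : I -> M -> Prop) :
  countable (tagged_union D) ->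
  (forall i, @pdefinable _ N D (@csingle vf_sig VF) (fun e => P i (e VF (here (S := vf_sig) VF)))) ->
  (forall l : seq I, exists y, forall i, List.In i l -> P i y) ->
  exists y, forall i, P i y.
Proof.
move=> cD hP hfin.
have [|y hy] := realize1 hsat cD hP; last by exists (y VF (here (S := vf_sig) VF)).
move=> l; have [y hy] := hfin l.
by exists (@aone vf_sig N VF y).
Qed.

(** Being in the coset of [r] for all n is a type over the representatives. Finitely many exponents
    are handled by their product, so for consistency it is enough to treat one exponent at a
    time. *)
Lemma realize_coset (D : psets N) (Q : M -> Prop) r :
  countable (tagged_union D) ->
  @pdefinable _ N D (@csingle vf_sig VF) (fun e => Q (e VF (here (S := vf_sig) VF))) ->
  r != 0 ->
  (forall n, (0 < n)%N -> exists a x', [/\ A0 a, isP n (r / a), isP n (x' / a) & Q x']) ->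
  exists2 r', Q r' & coset_eq r r'.
Proof.
move=> cD hQ r0 hfin.
pose I := option {na : nat * M | [/\ (0 < na.1)%N, A0 na.2 & isP na.1 (r / na.2)]}.
pose P (i : I) x := match i with
  | None => Q x
  | Some na => exists z, x = (sval na).2 * z ^+ (sval na).1
  end.
pose D' : psets N := fun s => D s `|` @mkps M A0 set0 set0 s.
have cD' : countable (tagged_union D').
  by apply: countable_tagged => //; apply: countable_mkps => //; exact: countable0.
have [||r' hr'] := realize_VF (D := D') (P := P) cD'.
- move=> [[[n a] /= [n0 ha hP]]|]; last first.
    by apply: pdefinable_sub hQ => s x; left.
  have ha' : D' VF a by right.
  pose c : csub D' VF := exist _ a ha'.
  apply: (@pdefinable_gen _ N D' (@csingle vf_sig VF) (fun e => exists z : M,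
    (e VF (inl (here (S := vf_sig) VF)) : M) = (e VF (inr c) : M) * z ^+ n)).
  by apply: definable_coset; exact: tdefinable_var.
- move=> l.
  pose m := \prod_(i <- l) (if i is Some na then (sval na).1 else 1%N).
  have m0 : (0 < m)%N.
    by rewrite /m prodn_gt0 // => -[[[n a] /= []]|].
  have [a [x' [ha hr hx' hQx']]] := hfin m m0.
  exists x' => -[[[n b] /= [n0 hb hP]]|] //= hi.
  have /dvdnP[k hk] : (n %| m)%N.
    rewrite /m; elim: l hi {m m0 hr hx'} => //= i l IH [->|/IH h]; rewrite big_cons.
      by rewrite dvdn_mulr.
    by rewrite dvdn_mull.
  have down y : isP m y -> isP n y.
    by move=> [z ->]; exists (z ^+ k); rewrite -exprM hk.
  have a0 := rep_neq0 hA0 ha; have b0 := rep_neq0 hA0 hb.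
  have [z hz] : isP n (x' / b).
    have -> : x' / b = (x' / a) / (r / a) * (r / b).
      by rewrite invf_div !mulrA divfK // divfK.
    by apply: isP_mul => //; apply: isP_div; exact: down.
  by exists z; rewrite -hz mulrC divfK.
exists r'; first exact: hr' None.
move=> n n0; have [a ha hP] := rep_all hA0 n0 r0; have a0 := rep_neq0 hA0 ha.
exists a; split=> //.
have [/= z ->] := hr' (Some (exist _ (n, a) (And3 n0 ha hP))).
by exists z; rewrite mulrC mulKf.
Qed.

(** * Elements with a new value *)

Definition val_in x := exists c c', [/\ G c c', c != 0 & vval c = vval x].

(** The group of pairs generated by the nonzero part of [G] and $(r,r')$; two natural exponents
    stand for one integer. *)
Definition Hval r r' z z' := exists c c' i j,
  [/\ G c c', c != 0, z = c * r ^+ i / r ^+ j & z' = c' * r' ^+ i / r' ^+ j].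

Lemma Hval_div r r' : r != 0 -> r' != 0 -> forall x x' y y', Hval r r' x x' ->
  Hval r r' y y' -> Hval r r' (x / y) (x' / y').
Proof.
move=> r0 r0' x x' y y' [c [c' [i [j [h1 h2 -> ->]]]]] [d [d' [k [l [k1 k2 -> ->]]]]].
have eqn (a u v b w t : M) : a * u / v / (b * w / t) = a / b * (u * t) / (v * w).
  by rewrite !invfM invrK; ring.
exists (c / d), (c' / d'), (i + l)%N, (j + k)%N.
by rewrite mulf_neq0 ?invr_neq0 // !exprD !eqn; split=> //; exact: (g_div hG h1 k1).
Qed.

(** If $c\,r^m$ is a unit, then $\mathrm{val}(r^{|m|})$ is a value of the domain of [G]; by the last
    hypothesis the power itself lies in that domain, where residues are known to correspond. *)
Lemma Hval_nice r r' : EV EG r r' -> coset_eq r r' ->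
  (forall k, (0 < k)%N -> val_in (r ^+ k) -> G (r ^+ k) (r' ^+ k)) ->
  forall z z', Hval r r' z z' -> nice Ek EG z z'.
Proof.
move=> hV hC hk z z' [c [c' [i [j [hc c0 ez ez']]]]].
have [r0 r0'] := EV_neq0 hV.
have hz : EV EG z z'.
  rewrite ez ez'; apply: EV_mul => //; first apply: EV_mul => //.
  - exact: gEV.
  - exact: EV_X.
  - by apply: EV_inv => //; exact: EV_X.
have [z0 z0'] := EV_neq0 hz.
split=> //; last first.
  apply: coset_isP => //; rewrite ez ez'.
  apply: coset_mul; first apply: coset_mul.
  - exact: coset_G.
  - exact: coset_X.
  - by apply: coset_inv; exact: coset_X.
move=> z1; have [z2|] := boolP (dle 1 z); last first.
  move=> hlt; apply: ER_small => //.
  by have := EV_lt hEG hz (EV_1 hEG); rewrite /dlt hlt => <-.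
apply: (g_ER hEk hG) => //.
have vz : vval z = vval (1 : M) by apply/deqP.
have [ij|ij] := leqP i j.
  have ez2 : z = c / r ^+ (j - i).
    by rewrite ez -{1}(subnK ij) exprD -mulf_div divff ?mulr1 // expf_neq0.
  have ez2' : z' = c' / r' ^+ (j - i).
    by rewrite ez' -{1}(subnK ij) exprD -mulf_div divff ?mulr1 // expf_neq0.
  rewrite ez2 ez2'; have [e|pos] := posnP (j - i)%N; first by rewrite e !expr0 !divr1.
  apply: (g_div hG hc); apply: hk => //; exists c, c'; split=> //.
  by rewrite -[c](divfK (expf_neq0 (j - i) r0)) -ez2 (vval_mul vz (erefl _)) mul1r.
have ez2 : z = c * r ^+ (i - j).
  by rewrite ez -{1}(subnK (ltnW ij)) exprD mulrA mulfK // expf_neq0.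
have ez2' : z' = c' * r' ^+ (i - j).
  by rewrite ez' -{1}(subnK (ltnW ij)) exprD mulrA mulfK // expf_neq0.
rewrite ez2 ez2'; apply: (g_M hG hc); apply: hk; first by rewrite subn_gt0.
exists c^-1, c'^-1; split; [exact: (g_V hG hc)|by rewrite invr_neq0|].
by rewrite -[r ^+ _](mulKf c0) -ez2 (vval_mul (erefl _) vz) mulr1.
Qed.

(** Two monomials of the same value would make some $r^k$ with $0<k<d$ have the value of a quotient
    of coefficients. So the monomial of largest value gives the leading term, on both sides. *)
Lemma Hval_poly r r' d : EV EG r r' ->
  (forall k, (0 < k < d)%N -> ~ val_in (r ^+ k)) ->
  forall p p', Gp G p p' -> p != 0 -> (size p <= d)%N ->
     exists z z', [/\ Hval r r' z z', aeq p.[r] z & aeq p'.[r'] z'].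
Proof.
move=> hV hd p p' hp p0 sp; have [r0 r0'] := EV_neq0 hV.
have [n sn] : exists n, size p = n.+1.
  by exists (size p).-1; rewrite prednK // size_poly_gt0.
have sn' : size p' = n.+1 by rewrite -(Gp_size hG hp).
have [i hi] := argmax (fun i : 'I_n.+1 => p`_i * r ^+ i).
have hT (j : nat) : p`_j != 0 -> EV EG (p`_j * r ^+ j) (p'`_j * r' ^+ j).
  by move=> pj; apply: EV_mul => //; [exact: gEV|exact: EV_X].
have pi0 : p`_i != 0.
  apply/eqP => pi; move: p0; rewrite -lead_coef_eq0 lead_coefE sn /=.
  have := hi ord_max; rewrite pi mul0r dlex0 mulf_eq0 expf_eq0 (negbTE r0) andbF orbF.
  by move=> /eqP->; rewrite eqxx.
have lt (j : 'I_n.+1) : j != i -> dlt (p`_j * r ^+ j) (p`_i * r ^+ i).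
  move=> ji; rewrite /dlt; apply/negP => hij.
  have vij : vval (p`_i * r ^+ i) = vval (p`_j * r ^+ j) by apply/deqP; split=> //; exact: hi.
  have pj0 : p`_j != 0.
    have := vval_eq0 vij; rewrite !mulf_eq0 !expf_eq0 (negbTE r0) !andbF !orbF (negbTE pi0).
    by move=> <-.
  have key (k l : 'I_n.+1) : (k < l)%N -> p`_k != 0 -> p`_l != 0 ->
      vval (p`_k * r ^+ k) = vval (p`_l * r ^+ l) -> False.
    move=> kl pk pl e; apply: (hd (l - k)%N).
      rewrite subn_gt0 kl /=; apply: leq_trans sp; rewrite sn.
      by apply: leq_ltn_trans (ltn_ord l); exact: leq_subr.
    exists (p`_k / p`_l), (p'`_k / p'`_l); split.
    - exact: (g_div hG (hp k) (hp l)).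
    - by rewrite mulf_neq0 ?invr_neq0.
    have -> : p`_k / p`_l = (p`_k * r ^+ k) / (p`_l * r ^+ k).
      by rewrite -mulf_div divff ?mulr1 // expf_neq0.
    rewrite (vval_mul e (erefl (vval (p`_l * r ^+ k)^-1))) -mulf_div divff // mul1r.
    by rewrite -{1}(subnK (ltnW kl)) exprD mulfK // expf_neq0.
  case: (ltngtP i j) => [ij|ij|/val_inj ij].
  - exact: key ij pi0 pj0 vij.
  - exact: key ij pj0 pi0 (esym vij).
  - by rewrite ij eqxx in ji.
exists (p`_i * r ^+ i), (p'`_i * r' ^+ i); split.
- by exists p`_i, p'`_i, i, 0%N; rewrite !expr0 !divr1.
- rewrite horner_coef sn (bigD1 i) //=; apply: aeq_addl; apply: dlt_sum => //.
  by rewrite mulf_neq0 // expf_neq0.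
rewrite horner_coef sn' (bigD1 i) //=; apply: aeq_addl; apply: dlt_sum.
  by rewrite mulf_neq0 ?expf_neq0 // -(g_eq0 hG (hp i)).
move=> j ji; have [pj|pj] := eqVneq p`_j 0.
  have := g_eq0 hG (hp j); rewrite pj eqxx => /esym/eqP->.
  by rewrite mul0r dlt0x mulf_neq0 ?expf_neq0 // -(g_eq0 hG (hp i)).
by rewrite -(EV_lt hEG (hT j pj) (hT i pi0)); exact: lt.
Qed.


Lemma vval_X x g n : vval x = Some g -> vval (x ^+ n) = Some (g *+ n).
Proof.
move=> h; elim: n => [|n IH]; first by rewrite expr0 vval_1.
by rewrite exprS vvalM h IH mulrS.
Qed.

Lemma val_in_eq x y : vval x = vval y -> val_in x -> val_in y.
Proof. by move=> e [c [c' [h1 h2 h3]]]; exists c, c'; rewrite -e. Qed.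

(** As no positive power of [y] has an old value, [y'] only has to have the value that corresponds
    to that of [y] and to lie in the same power cosets. *)
Lemma extend_value_free y : L y -> (forall k, (0 < k)%N -> ~ val_in (y ^+ k)) ->
  y != 0 -> can_extend.
Proof.
move=> Ly hk y0; have [g hg] := vval_neq0 y0; have [g' hgg] := LEG Ly hg.
have [||||y' hy' hC] := @realize_coset (mkps set0 set0 [set g'])
  (fun x => vval x = Some g') y.
- by apply: countable_mkps; [exact: countable0|exact: countable0|exact: countable1].
- pose c : csub (mkps set0 set0 [set g']) VG := exist _ g' erefl.
  pose v : cadd (@csingle vf_sig VF) (csub (mkps (M := M) set0 set0 [set g'])) VF :=
    inl (here (S := vf_sig) VF).
  apply: (@pdefinable_gen _ N _ (@csingle vf_sig VF) (fun e =>
    vval (e VF v : M) = Some (e VG (inr c) : vG M))).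
  by apply: definable_val; exact: tdefinable_var.
- by [].
- move=> n n0; have [a ha [z hz]] := rep_all hA0 n0 y0; have a0 := rep_neq0 hA0 ha.
  have z0 : z != 0.
    apply/eqP => z0; move: hz; rewrite z0 expr0n eqn0Ngt n0 => /eqP.
    by rewrite mulf_eq0 invr_eq0 (negbTE y0) (negbTE a0).
  have [va hva] := vval_neq0 a0; have [vz hvz] := vval_neq0 z0.
  have haa : EG va va.
    have [g1 [g2 [e1 e2 e3]]] := gEV (g_A hG ha) a0.
    by move: e1 e2 e3; rewrite hva => -[->] [->].
  (* The coset of [a] is compatible with the prescribed value: that $g-\mathrm{val}(a)$ is divisible
     by n is carried over by [EG]. *)
  have : exists t, g = va + t *+ n.
    exists vz; have : vval y = vval (a * z ^+ n) by rewrite -hz mulrC divfK.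
    by rewrite hg vvalM hva (vval_X n hvz) => -[].
  move/(elem_group_div n (gi_elem hEG) hgg haa) => [t ht].
  have [w hw] := vval_surj t.
  exists a, (a * w ^+ n); split=> //; first by exists z.
    by exists w; rewrite mulrC mulKf.
  by rewrite vvalM hva (vval_X n hw) /= ht.
have hV : EV EG y y' by exists g, g'.
have nr : ~ exists c, G y c.
  by move=> [c hc]; apply: (hk 1%N isT); exists y, c; rewrite expr1.
have [_ y0'] := EV_neq0 hV.
apply: (step_transc (H := Hval y y') (r' := y') Ly nr).
- apply: Hval_nice => // k k0 /(hk k k0) //.
- exact: Hval_div.
- move=> p p' hp; have [p0|p0] := eqVneq p 0; last first.
    right; apply: (Hval_poly hV (d := size p)) => // k /andP[k0 _]; exact: hk.
  left; rewrite p0 horner0; split=> //.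
  have /eqP : size p' = 0%N by rewrite -(Gp_size hG hp) p0 size_poly0.
  by rewrite size_poly_eq0 => /eqP ->; rewrite horner0.
Qed.

(** In the torsion case let n be least such that $n\,\mathrm{val}(y)$ is an old value
    $\mathrm{val}(c)$. The unit $y^n/c$ has the form $az^n$ with [a] a representative of value 0, so
    $r=y/z$ has the value of [y] and satisfies $r^n=ca$, an element of the domain. *)
Lemma extend_value y : L y -> y != 0 -> ~ val_in y -> can_extend.
Proof.
move=> Ly y0 hy.
have [[k0 [k00 hk0]]|none] := pselect (exists k, (0 < k)%N /\ val_in (y ^+ k)); last first.
  by apply: (extend_value_free Ly) => // k k0 hk; apply: none; exists k.
have exk : exists k, (0 < k)%N && `[< val_in (y ^+ k) >].
  by exists k0; rewrite k00 /=; apply/asboolP.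
case: (ex_minnP exk) => n /andP[n0 /asboolP[c [c' [hc c0 vc]]]] nmin.
have minn k : (0 < k < n)%N -> ~ val_in (y ^+ k).
  move=> /andP[k1 kn] hk; have := nmin k; rewrite k1 /=.
  have -> : `[< val_in (y ^+ k) >] by apply/asboolP.
  by move=> /(_ isT); rewrite leqNgt kn.
have [|a [ha ua] [z hz]] := rep_unit hA0 (x := y ^+ n / c) n0.
  by rewrite (vval_mul (esym vc) (erefl _)) divff // vval_1.
have a0 := rep_neq0 hA0 ha.
have z1 : vval z = Some 0.
  rewrite -vval_1; apply: (@vvalX_inj _ _ _ n.-1); rewrite prednK // expr1n -hz.
  rewrite (vval_mul (vval_mul (esym vc) (erefl _)) (erefl _)) divff // mul1r.
  by rewrite vval_1 (vval_V ua) oppr0.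
have z0 : z != 0 by apply/eqP => /vval0; rewrite z1.
pose r := y / z; pose e := c * a; pose e' := c' * a.
have he : G e e' by exact: (g_M hG hc (g_A hG ha)).
have re : r ^+ n = e.
  have zn0 : z ^+ n != 0 by rewrite expf_neq0.
  rewrite /r expr_div_n; apply: (mulIf zn0); rewrite divfK // -hz /e.
  by rewrite mulrC [c * a]mulrC mulrA divfK // divfK.
have vr : vval r = vval y.
  rewrite /r vvalM (vval_V z1) oppr0; case: (vval y) => //= u; by rewrite addr0.
have r0 : r != 0 by rewrite (vval_eq0 vr).
have e0 : e != 0 by rewrite mulf_neq0.
have hE : Gp G ('X^n - e%:P) ('X^n - e'%:P).
  by apply: (Gp_B hG); [exact: (Gp_Xn hG)|exact: (Gp_C hG)].
have mP : 'X^n - e%:P \is monic by exact: monicXnsubC.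
have sP : size ('X^n - e%:P) = n.+1 by exact: size_XnsubC.
have Lr : L r.
  apply: (Lroot (p := 'X^n - e%:P)).
  - by rewrite monic_neq0.
  - by move=> i; exact: GL (hE i).
  - by apply/rootP; rewrite !hornerE re subrr.
have [||||r' hr' hC] := @realize_coset (mkps [set e'] set0 set0)
  (fun x => x ^+ n = e') r.
- by apply: countable_mkps; [exact: countable1|exact: countable0|exact: countable0].
- pose d : csub (mkps (M := M) [set e'] set0 set0) VF := exist _ e' erefl.
  pose v : cadd (@csingle vf_sig VF) (csub (mkps (M := M) [set e'] set0 set0)) VF :=
    inl (here (S := vf_sig) VF).
  apply: (@pdefinable_gen _ N _ (@csingle vf_sig VF) (fun e =>
    (e VF v : M) ^+ n = (e VF (inr d) : M))).
  apply: (@definable_teq _ N _ VF (fun e => (e VF v : M) ^+ n)).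
    by apply: tdefK_exp; exact: tdefinable_var.
  exact: tdefinable_var.
- by [].
(* An n-th root of [e'] is needed in the coset of [b] modulo m-th powers. Now $e/b^n$ is an $mn$-th
   power, hence so is $e'/b^n$, which gives the root. *)
- move=> m m0; have [b hb [w hw]] := rep_all hA0 m0 r0; have b0 := rep_neq0 hA0 hb.
  have hbb : G (e / b ^+ n) (e' / b ^+ n).
    exact: (g_div hG he (g_X hG n (g_A hG hb))).
  have eb0 : e / b ^+ n != 0 by rewrite mulf_neq0 ?invr_neq0 ?expf_neq0.
  have [_ _ hP] := g_nice hG hbb eb0.
  have : isP (m * n) (e / b ^+ n).
    by exists w; rewrite -re -expr_div_n hw -exprM.
  move/hP; rewrite muln_gt0 m0 n0 => /(_ isT)[x hx].
  exists b, (b * x ^+ m); split=> //; first by exists w.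
    by exists x; rewrite mulrC mulKf.
  by rewrite exprMn -exprM -hx mulrC divfK // expf_neq0.
(* The value group is torsion-free, so the value of [r'] is determined by that of $r'^n=e'$. *)
have hV : EV EG r r'.
  have [g hg] := vval_neq0 r0; have [g' hgg] := LEG Lr hg.
  have [s hs] := vval_surj g'.
  have hrs : EV EG r s by exists g, g'.
  apply: (EV_val (erefl _) _ hrs); apply: (@vvalX_inj _ _ _ n.-1); rewrite prednK // hr'.
  apply: (iffLR (EV_eq hEG (gEV he e0) (EV_X hEG n hrs))); by rewrite re.
have [_ r0'] := EV_neq0 hV.
have vin k : val_in (r ^+ k) -> val_in (y ^+ k).
  by apply: val_in_eq; exact: vval_exp.
have nr : ~ exists c, G r c.
  by move=> [d hd]; apply: hy; apply: val_in_eq vr _; exists r, d.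
apply: (step_alg (H := Hval r r') (r' := r') Lr nr hE mP).
- by rewrite sP ltnS.
- by rewrite !hornerE re subrr.
- by rewrite !hornerE hr' subrr.
(* By minimality of n, [val_in (r ^+ k)] forces n to divide k, and then $r^k$ is a power of [e]. *)
- apply: Hval_nice => // k k1 hk.
  have ek : r ^+ k = e ^+ (k %/ n) * r ^+ (k %% n).
    by rewrite {1}(divn_eq k n) exprD mulnC exprM re.
  have ek' : r' ^+ k = e' ^+ (k %/ n) * r' ^+ (k %% n).
    by rewrite {1}(divn_eq k n) exprD mulnC exprM hr'.
  rewrite ek ek'; have [->|pos] := posnP (k %% n)%N.
    by rewrite !expr0 !mulr1; exact: (g_X hG).
  case: (minn (k %% n)%N); first by rewrite pos ltn_mod.
  apply: vin; move: hk; rewrite ek => -[d [d' [hd d0 vd]]].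
  exists (d / e ^+ (k %/ n)), (d' / e' ^+ (k %/ n)); split.
  + exact: (g_div hG hd (g_X hG _ he)).
  + by rewrite mulf_neq0 ?invr_neq0 ?expf_neq0.
  by rewrite (vval_mul vd (erefl _)) mulrAC mulfV ?mul1r // expf_neq0.
- exact: Hval_div.
- move=> p p' hp p0; rewrite sP ltnS => spn.
  by apply: (Hval_poly hV (d := n)) => // k hk /vin; exact: minn.
Qed.

(** * Elements with a new residue *)

(** The leading terms of an extension without new values: an old element times a unit whose residue
    corresponds. *)
Definition Hres z z' := exists c c' t t',
  [/\ G c c' /\ c != 0, ER Ek t t' /\ dle 1 t, z = c * t & z' = c' * t'].

Lemma Hres_div x x' y y' : Hres x x' -> Hres y y' -> Hres (x / y) (x' / y').
Proof.
move=> [c [c' [t [t' [[h1 c0] [ht t1] -> ->]]]]] [d [d' [s [s' [[h2 d0] [hs s1] -> ->]]]]].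
exists (c / d), (c' / d'), (t / s), (t' / s'); rewrite -!mulf_div; split=> //.
  by rewrite mulf_neq0 ?invr_neq0 //; split=> //; exact: (g_div hG h1 h2).
split; first by apply: ER_mul => //; exact: ER_inv.
by rewrite dle_1div ?(unit_neq0 s1) //; case: hs => hs _ _; exact: dle_trans t1.
Qed.

Lemma Hres_nice z z' : Hres z z' -> nice Ek EG z z'.
Proof.
move=> [c [c' [t [t' [[h1 c0] [ht t1] -> ->]]]]].
have hV : EV EG (c * t) (c' * t').
  exact: (EV_mul hEG (gEV h1 c0) (EV_unit hEk hEG ht t1)).
have [z0 z0'] := EV_neq0 hV; split=> //.
  have vt : vval t = vval (1 : M) by case: ht => ht _ _; apply/deqP.
  rewrite (dle_eql _ (vval_mul (erefl (vval c)) vt)) mulr1 => c1.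
  by apply: ER_mul => //; exact: (g_ER hEk hG).
by apply: coset_isP => //; apply: coset_mul; [exact: coset_G|exact: coset_unit].
Qed.

Lemma ER_X x x' n : ER Ek x x' -> ER Ek (x ^+ n) (x' ^+ n).
Proof.
move=> h; elim: n => [|n IH]; last by rewrite !exprS; exact: ER_mul.
by rewrite !expr0; apply: (g_ER hEk hG); [exact: g_1 hG|exact: dle_refl].
Qed.

Lemma ER_sum (I : Type) (l : seq I) (P : pred I) (F F' : I -> M) :
  (forall i, P i -> ER Ek (F i) (F' i)) ->
  ER Ek (\sum_(i <- l | P i) F i) (\sum_(i <- l | P i) F' i).
Proof.
move=> h; split.
- by apply: dle_sum => i /h[].
- by apply: dle_sum => i /h[].
rewrite !res_sum; try by move=> i /h[].
by apply: (fi_sum hEk) => i /h[].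
Qed.

Lemma ER_horner p p' x x' : Gp G p p' -> (forall i, dle p`_i 1) -> ER Ek x x' ->
  ER Ek p.[x] p'.[x'].
Proof.
move=> hp h1 hx; rewrite !horner_coef -(Gp_size hG hp); apply: ER_sum => i _.
by apply: ER_mul => //; [exact: (g_ER hEk hG)|exact: ER_X].
Qed.

Lemma dle_horner (p : {poly M}) x : (forall i, dle p`_i 1) -> dle x 1 -> dle p.[x] 1.
Proof.
by move=> hp hx; rewrite horner_coef dle_sum // => i _; rewrite dle1M // dle1X.
Qed.

Lemma res_horner (p : {poly M}) x y : (forall i, dle p`_i 1) -> dle x 1 -> dle y 1 ->
  vres x = vres y -> vres p.[x] = vres p.[y].
Proof.
move=> hp hx hy e; rewrite !horner_coef !res_sum => [||i _];
  last by rewrite dle1M ?dle1X.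
  by apply: eq_bigr => i _; rewrite !resM ?resX ?dle1X // e.
by move=> i _; rewrite dle1M ?dle1X.
Qed.

Definition overG (p : {poly M}) := forall i, exists c, G p`_i c.

Lemma overG_pair p : overG p -> exists p', Gp G p p'.
Proof.
move=> h; pose c i := sval (cid (h i)).
have hc i : G p`_i (c i) by exact: svalP (cid (h i)).
exists (\poly_(i < size p) c i) => i; rewrite coef_poly; case: ifP => // /negbT.
by rewrite -leqNgt => si; rewrite nth_default //; exact: (g_00 hG).
Qed.

(** Divide [p] by a coefficient [c] of largest value, taken of largest index among those. Modulo the
    maximal ideal the quotient is the monic polynomial [m], whose value at [r] is a unit by
    hypothesis; so $p(r)/c$ is a unit. *)
Lemma Hres_poly r r' d : ER Ek r r' ->
  (forall q, q \is monic -> overG q -> (forall i, dle q`_i 1) -> (size q <= d)%N ->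
     dle 1 q.[r]) ->
  forall p p', Gp G p p' -> p != 0 -> (size p <= d)%N ->
     exists z z', [/\ Hres z z', aeq p.[r] z & aeq p'.[r'] z'].
Proof.
move=> hR hd p p' hp p0 sp; have [r1 r1' _] := hR.
have [n sn] : exists n, size p = n.+1.
  by exists (size p).-1; rewrite prednK // size_poly_gt0.
have [i0 hi0] := argmax (fun i : 'I_n.+1 => p`_i).
have [i /eqP vi maxi] := @arg_maxnP _ i0 (fun i : 'I_n.+1 => vval p`_i == vval p`_i0)
  (fun i => nat_of_ord i) (eqxx _).
set c := p`_i in vi.
have hi (j : 'I_n.+1) : dle p`_j c by rewrite (dle_eqr _ vi); exact: hi0.
have c0 : c != 0.
  apply/eqP => c0; move: p0; rewrite -lead_coef_eq0 lead_coefE sn /=.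
  by have := hi ord_max; rewrite c0 dlex0 => /eqP ->; rewrite eqxx.
have lti (j : 'I_n.+1) : (i < j)%N -> dlt p`_j c.
  move=> ij; rewrite /dlt; apply/negP => hij.
  have /maxi : vval p`_j == vval p`_i0 by rewrite -vi; apply/eqP/deqP; split=> //; exact: hi.
  by rewrite /= leqNgt ij.
have hcj j : dle (p`_j / c) 1.
  rewrite dle_div1 //; case: (ltnP j n.+1) => jn; first exact: (hi (Ordinal jn)).
  by rewrite nth_default ?dle0x // sn.
pose m := \poly_(j < i.+1) (p`_j / c).
have mc : p`_i / c = 1 by rewrite divff.
have sm : size m = i.+1 by rewrite size_poly_eq // mc oner_neq0.
have mm : m \is monic by rewrite monicE lead_coef_poly // mc // oner_neq0.
have m1 j : dle m`_j 1 by rewrite coef_poly; case: ifP => // _; rewrite dle0x.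
have mG : overG m.
  move=> j; rewrite coef_poly; case: ifP => _; last by exists 0; exact: (g_00 hG).
  by exists (p'`_j / p'`_i); exact: (g_div hG (hp j) (hp i)).
have m1r : dle 1 m.[r].
  by apply: hd => //; rewrite sm; apply: leq_trans sp; rewrite sn.
pose t := p.[r] / c.
have et : t = \sum_(j < n.+1) (p`_j / c) * r ^+ j.
  rewrite /t horner_coef sn mulr_suml; apply: eq_bigr => j _; by rewrite mulrAC.
have tm : dlt (t - m.[r]) 1.
  rewrite et (@horner_coef_wide _ n.+1); last by rewrite sm.
  rewrite -sumrB; apply: dlt_sum => [|j _]; first exact: oner_neq0.
  rewrite -mulrBl coef_poly ltnS; case: leqP => ij.
    by rewrite subrr mul0r dlt0x oner_neq0.
  rewrite subr0 -[1]mulr1 dltMl ?oner_neq0 ?dle1X // dlt_div1 //.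
  exact: lti.
have t1 : dle 1 t.
  rewrite dleNgt; apply/negP => tlt.
  have : dlt m.[r] 1 by rewrite -[m.[r]](subKr t) dltB.
  by move/dltNle; apply.
pose t' := p'.[r'] / p'`_i.
have et' : t' = \sum_(j < n.+1) (p'`_j / p'`_i) * r' ^+ j.
  rewrite /t' horner_coef -(Gp_size hG hp) sn mulr_suml; apply: eq_bigr => j _.
  by rewrite mulrAC.
have htt : ER Ek t t'.
  rewrite et et'; apply: ER_sum => j _; apply: ER_mul => //; last exact: ER_X.
  by apply: (g_ER hEk hG) => //; exact: (g_div hG (hp j) (hp i)).
have c0' : p'`_i != 0 by rewrite -(g_eq0 hG (hp i)).
have t1' : dle 1 t' by rewrite -(ER_unit hEk htt).
have pe : p.[r] = c * t by rewrite /t mulrC divfK.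
have pe' : p'.[r'] = p'`_i * t' by rewrite /t' mulrC divfK.
exists p.[r], p'.[r']; split.
- by exists c, p'`_i, t, t'; split=> //; split=> //; exact: hp.
- by rewrite aeq_refl // pe mulf_neq0 // unit_neq0.
- by rewrite aeq_refl // pe' mulf_neq0 // unit_neq0.
Qed.

(** If the residue of [u] is algebraic over those of the domain, a monic integral [P] of least
    degree with $P(u)$ in the maximal ideal lifts its minimal polynomial. The element adjoined is
    the root of [P] near [u], matched with the root of [P'] near [u']. In the transcendental case it
    is [u] itself. *)
Lemma extend_residue u : L u -> dle u 1 -> dle 1 u ->
  (forall a a', G a a' -> ~ dlt (u - a) 1) -> can_extend.
Proof.
move=> Lu u1 u2 hu.
have [rho hrho] := LEk Lu u1; have [u' u1' hu'] := res_surj rho.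
have hR : ER Ek u u' by split=> //; rewrite hu'.
pose nul q := [/\ q \is monic, overG q, forall i, dle q`_i 1 & dlt q.[u] 1].
(* The existence of a [nul] polynomial says that the residue of [u] is algebraic over the residues
   of the domain. *)
have [[q0 hq0]|none] := pselect (exists q, nul q); last first.
  have nr : ~ exists c, G u c.
    by move=> [c hc]; apply: (hu _ _ hc); rewrite subrr dlt0x oner_neq0.
  apply: (step_transc (H := Hres) (r' := u') Lu nr).
  - exact: Hres_nice.
  - exact: Hres_div.
  - move=> p p' hp; have [p0|p0] := eqVneq p 0; last first.
      right; apply: (Hres_poly (d := size p) hR) => // q h1 h2 h3 _.
      by rewrite dleNgt; apply/negP => h4; apply: none; exists q.
    left; rewrite p0 horner0; split=> //.
    have /eqP : size p' = 0%N by rewrite -(Gp_size hG hp) p0 size_poly0.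
    by rewrite size_poly_eq0 => /eqP ->; rewrite horner0.
have exs : exists n, `[< exists2 q, nul q & size q = n >].
  by exists (size q0); apply/asboolP; exists q0.
case: (ex_minnP exs) => n /asboolP[P [mP oP P1 Pu] sP] nmin {q0 hq0 exs}.
have notnul q : q \is monic -> overG q -> (forall i, dle q`_i 1) -> (size q < n)%N ->
    dle 1 q.[u].
  move=> h1 h2 h3 sq; rewrite dleNgt; apply/negP => h4.
  have := nmin (size q); rewrite leqNgt sq => h; apply: notF; apply: h.
  by apply/asboolP; exists q.
have n1 : (1 < n)%N.
  rewrite -sP ltnNge; apply/negP => s1.
  have PC := size1_polyC s1; move: mP Pu; rewrite PC monicE lead_coefC hornerC => /eqP->.
  by rewrite dltxx.
have [P' hP] := overG_pair oP.
have P1' i : dle P'`_i 1 by rewrite -(g_le hEG hG (hP i) (g_1 hG)).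
have dP1 (q : {poly M}) : (forall i, dle q`_i 1) -> forall i, dle q^`()`_i 1.
  by move=> hq i; rewrite coef_deriv -mulr_natl; exact: (dle_natrMl hChar).
have n1' : (0 < n.-1)%N by case: (n) n1 => [|[]].
have nu := natr_unit hChar n1'; have nn0 := natr_neq0 hChar n1'.
have sd : size P^`() = n.-1.
  apply/eqP; rewrite eqn_leq; apply/andP; split.
    rewrite -ltnS prednK; last by apply: ltnW.
    by rewrite -sP; apply: lt_size_deriv; rewrite monic_neq0.
  rewrite leqNgt; apply/negP => hlt.
  have : P^`()`_n.-2 = 0 by apply: nth_default; rewrite -ltnS prednK.
  rewrite coef_deriv prednK // => /eqP.
  have -> : P`_n.-1 = 1 by rewrite -sP -lead_coefE (monicP mP).
  by rewrite (negbTE nn0).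
have lP : P^`()`_n.-2 = n.-1%:R.
  by rewrite coef_deriv prednK // -sP -lead_coefE (monicP mP).
(* The derivative divided by its leading coefficient $n-1$ ([n] is the size of [P], one more than
   its degree) is monic and integral of smaller degree, so the minimality of [P] applies to it. *)
have hd : dle 1 P^`().[u].
  pose q := (n.-1%:R)^-1 *: P^`().
  have qE : P^`().[u] = n.-1%:R * q.[u] by rewrite hornerZ mulVKf.
  rewrite qE (dle_eqr _ (vval_natrM hChar _ n1')); apply: notnul.
  - by rewrite monicE lead_coefZ lead_coefE sd lP mulVf.
  - move=> i; exists (n.-1%:R^-1 * P'^`()`_i); rewrite coefZ.
    apply: (g_M hG); last exact: (Gp_deriv hG).
    by apply: (g_V hG); exact: (g_natmul hG _ (g_1 hG)).
  - move=> i; rewrite coefZ dle1M ?dP1 //.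
    have e : vval (n.-1%:R : M) = vval (1 : M) by rewrite nu vval_1.
    by rewrite (dle_eql _ (vval_inv e)) invr1 dle_refl.
  - rewrite size_scale ?invr_neq0 // sd; by rewrite prednK // ltnW.
have [r [r1 rP ru]] := hensel_unit hHensel hChar P1 u1 Pu hd.
have hPu : dlt P'.[u'] 1.
  by have := ER_unit hEk (ER_horner hP P1 hR); rewrite /dlt => <-.
have hd' : dle 1 P'^`().[u'].
  by rewrite -(ER_unit hEk (ER_horner (Gp_deriv hG hP) (dP1 _ P1) hR)).
have [r' [r1' rP' ru']] := hensel_unit hHensel hChar P1' u1' hPu hd'.
have er : vres r = vres u by apply/eqP; rewrite res_eq.
have er' : vres r' = vres u' by apply/eqP; rewrite res_eq.
have hRr : ER Ek r r' by case: hR => _ _ h; split=> //; rewrite er er'.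
have Lr : L r.
  apply: (Lroot (p := P)) => //; first by rewrite monic_neq0.
  by move=> i; exact: GL (hP i).
have nr : ~ exists c, G r c.
  by move=> [c hc]; apply: (hu _ _ hc); rewrite dlt_subC.
apply: (step_alg (H := Hres) (r' := r') Lr nr hP mP).
- by rewrite sP.
- exact/rootP.
- exact/rootP.
- exact: Hres_nice.
- exact: Hres_div.
- move=> p p' hp p0; rewrite sP => spn.
  apply: (Hres_poly (d := n.-1) hRr) => //; last first.
    by rewrite -ltnS prednK // ltnW.
  move=> q h1 h2 h3 sq; have := notnul q h1 h2 h3; rewrite -res_neq0; last exact: dle_horner.
  rewrite -res_neq0; last exact: dle_horner.
  rewrite (res_horner h3 r1 u1 er); apply.
  by apply: leq_ltn_trans sq _; rewrite prednK // ltnW.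
Qed.

(** * Limits *)

Definition domG : set M := [set a | exists a', G a a'].
Definition codG : set M := [set a' | exists a, G a a'].

Lemma countable_codG : countable codG.
Proof.
have hc a' : exists a, codG a' -> G a a'.
  by have [[a ha]|h] := pselect (codG a'); [exists a|exists 0].
pose f a' := sval (cid (hc a')).
have hf a' : codG a' -> G (f a') a' := svalP (cid (hc a')).
have /countable_injP[g ginj] := cL.
apply/countable_injP; exists (g \o f) => a' b'; rewrite !inE => ha hb /=.
move=> /ginj; rewrite !inE => /(_ (GL (hf _ ha)) (GL (hf _ hb))) e.
by apply: (g_fun hG (hf _ ha)); rewrite e; exact: hf.
Qed.

Section Immediate.
Variable x : M.
Hypothesis nb : forall a a', G a a' -> exists b b', G b b' /\ dlt (x - b) (x - a).

Let nbD a : domG a -> exists2 b, domG b & dlt (x - b) (x - a).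
Proof. by move=> [a' /nb[b [b' [hb h]]]]; exists b => //; exists b'. Qed.
Let D0 : exists c, domG c.
Proof. by exists 1, 1; exact: g_1 hG. Qed.

Lemma diff_near a b : dlt (x - b) (x - a) -> aeq (b - a) (x - a).
Proof.
move=> h; have -> : b - a = (x - a) + - (x - b) by ring.
by apply: aeq_addl; rewrite dltNl.
Qed.

(** The difference $x-a$ has no image, but it has the leading term of $b-a$ for any strictly closer
    [b], and $b'-a'$ is available. The resulting type is finitely satisfied by the images of good
    enough approximations. *)
Lemma immediate_limit : exists x', forall a a' b b', G a a' -> G b b' ->
  dlt (x - b) (x - a) -> dlt (x' - b') (b' - a').
Proof.
pose I := {q : (M * M) * (M * M) | [/\ G q.1.1 q.1.2, G q.2.1 q.2.2 &
  dlt (x - q.2.1) (x - q.1.1)]}.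
pose P (i : I) y := dlt (y - (sval i).2.2) ((sval i).2.2 - (sval i).1.2).
have cD : countable (tagged_union (mkps codG set0 set0)).
  by apply: countable_mkps; [exact: countable_codG|exact: countable0|exact: countable0].
have [||y hy] := realize_VF (P := P) cD.
- move=> [[[a a'] [b b']] /= [ha hb hab]].
  have ca' : codG a' by exists a.
  have cb' : codG b' by exists b.
  pose da : csub (mkps (M := M) codG set0 set0) VF := exist _ a' ca'.
  pose db : csub (mkps (M := M) codG set0 set0) VF := exist _ b' cb'.
  pose v : cadd (@csingle vf_sig VF) (csub (mkps (M := M) codG set0 set0)) VF :=
    inl (here (S := vf_sig) VF).
  have h : definable (fun e : asg N (cadd (@csingle vf_sig VF) (csub (mkps (M := M) codG set0 set0))) =>
      ~ dle ((e VF (inr db) : M) - (e VF (inr da) : M)) ((e VF v : M) - (e VF (inr db) : M))).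
    by apply: definable_not; apply: definable_dle; apply: tdefK_sub; exact: tdefinable_var.
  apply: pdefinable_iff (pdefinable_gen h) => e.
  by rewrite /P /= /dlt; split=> /negP.
- move=> l.
  have : Ev domG x (fun c => forall i, List.In i l -> dlt (x - c) (x - (sval i).2.1)).
    elim: l => [|i l IH]; first by apply: Ev_true.
    have [hi1 hi2 hi3] := svalP i.
    have hi : domG (sval i).2.1 by exists (sval i).2.2.
    apply: Ev_mono (Ev_and IH (Ev_lt nbD hi)) => c _ [h1 h2] j /=.
    by case=> [<-|]; [|exact: h1].
  case/Ev_ex => c [c' hc] h; exists c' => i hi; have [hi1 hi2 hi3] := svalP i.
  rewrite /P -(g_lt hEG hG (g_B hG hc hi2) (g_B hG hi2 hi1)).
  rewrite (dlt_eqr _ (vval_aeq (diff_near hi3))).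
  by rewrite (dlt_eql _ (vval_aeq (diff_near (h i hi)))).
exists y => a a' b b' ha hb hab.
exact: hy (exist (fun q : (M * M) * (M * M) => [/\ G q.1.1 q.1.2, G q.2.1 q.2.2 &
  dlt (x - q.2.1) (x - q.1.1)]) ((a, a'), (b, b')) (And3 ha hb hab)).
Qed.

Variable x' : M.
Hypothesis hx' : forall a a' b b', G a a' -> G b b' ->
  dlt (x - b) (x - a) -> dlt (x' - b') (b' - a').

Lemma limit_diff a a' b b' : G a a' -> G b b' -> dlt (x - b) (x - a) ->
  aeq (x' - a') (b' - a').
Proof.
move=> ha hb hab; have -> : x' - a' = (b' - a') + (x' - b') by ring.
by apply: aeq_addl; exact: hx' hab.
Qed.

Lemma limit_lt a a' b b' : G a a' -> G b b' -> dlt (x - b) (x - a) ->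
  dlt (x' - b') (x' - a').
Proof.
move=> ha hb hab; rewrite (dlt_eqr _ (vval_aeq (limit_diff ha hb hab))).
exact: hx' hab.
Qed.

(** Both distances are compared through an approximation [c] closer than either: $x-a$ and $x-b$ may
    be replaced by $c-a$ and $c-b$, whose images are known. *)
Lemma limit_le a a' b b' : G a a' -> G b b' -> dle (x - a) (x - b) = dle (x' - a') (x' - b').
Proof.
move=> ha hb; apply/idP/idP => [hab|h]; last first.
  by rewrite dleNgt; apply/negP => /(limit_lt ha hb)/dltNle; apply.
have [c [c' [hc hca]]] := nb ha; have hcb := dlt_le_trans hca hab.
rewrite (dle_eql _ (vval_aeq (limit_diff ha hc hca))).
rewrite (dle_eqr _ (vval_aeq (limit_diff hb hc hcb))).
rewrite -(g_le hEG hG (g_B hG hc ha) (g_B hG hc hb)).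
by rewrite (dle_eql _ (vval_aeq (diff_near hca))) (dle_eqr _ (vval_aeq (diff_near hcb))).
Qed.

Let nbC a : codG a -> exists2 b, codG b & dlt (x' - b) (x' - a).
Proof.
move=> [c hc]; have [b [b' [hb h]]] := nb hc.
by exists b'; [exists b|exact: limit_lt h].
Qed.
Let C0 : exists c, codG c.
Proof. by exists 1, 1; exact: g_1 hG. Qed.

(** The intrinsic form of stability involves only comparisons of distances and of leading terms,
    both of which correspond under [G]. *)
Lemma stable_transfer p p' : Gp G p p' -> stable domG x p <-> stable codG x' p'.
Proof.
move=> hp; rewrite (stable_istable D0 nbD) (stable_istable C0 nbC); split.
  move=> [c [c' hc] h]; exists c'; first by exists c.
  move=> a' b' [a ha] [b hb]; rewrite -(limit_le ha hc) -(limit_le hb hc) => h1 h2.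
  rewrite -(g_aeq hEG hG (Gp_horner hG hp ha) (Gp_horner hG hp hb)).
  by apply: h => //; [exists a'|exists b'].
move=> [c' [c hc] h]; exists c; first by exists c'.
move=> a b [a' ha] [b' hb]; rewrite (limit_le ha hc) (limit_le hb hc) => h1 h2.
rewrite (g_aeq hEG hG (Gp_horner hG hp ha) (Gp_horner hG hp hb)).
by apply: h => //; [exists a|exists b].
Qed.

Lemma Ev_common Q Q' : Ev domG x Q -> Ev codG x' Q' -> exists a a', [/\ G a a', Q a & Q' a'].
Proof.
move=> [c [c' hc] h] [d' [d hd] h'].
have /orP[cd|dc] := dle_total (x - c) (x - d).
  exists c, c'; split=> //; first by apply: h; [exists c'|exact: dle_refl].
  by apply: h'; [exists c|rewrite -(limit_le hc hd)].
exists d, d'; split=> //; first by apply: h; [exists d'|].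
by apply: h'; [exists d|exact: dle_refl].
Qed.

End Immediate.

Lemma Gne_nice z z' : G z z' /\ z != 0 -> nice Ek EG z z'.
Proof. by case=> h z0; exact: (g_nice hG h z0). Qed.

Lemma Gne_div z z' y y' : G z z' /\ z != 0 -> G y y' /\ y != 0 ->
  G (z / y) (z' / y') /\ z / y != 0.
Proof.
move=> [h1 z0] [h2 y0]; split; first exact: (g_div hG h1 h2).
by rewrite mulf_neq0 // invr_neq0.
Qed.

(** Kaplansky's argument. If every nonzero polynomial over the domain is stable, its leading terms
    at [x] and [x'] are read off at a common approximation. Otherwise a monic unstable [P] of least
    degree has a stable derivative, hence a root that is a pseudo-limit on each side, and these
    roots are adjoined in place of [x]. *)
Lemma extend_immediate x : L x ->
  (forall a a', G a a' -> exists b b', G b b' /\ dlt (x - b) (x - a)) -> can_extend.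
Proof.
move=> Lx nb; have [x' hx'] := immediate_limit nb.
have D0 : exists c, domG c by exists 1, 1; exact: g_1 hG.
have C0 : exists c, codG c by exists 1, 1; exact: g_1 hG.
have nbD a : domG a -> exists2 b, domG b & dlt (x - b) (x - a).
  by move=> [a' /nb[b [b' [hb h]]]]; exists b => //; exists b'.
have nbC a : codG a -> exists2 b, codG b & dlt (x' - b) (x' - a).
  move=> [c hc]; have [b [b' [hb h]]] := nb _ _ hc.
  by exists b'; [exists b|exact: (limit_lt hx' hc hb h)].
have nx : ~ exists c, G x c.
  by move=> /nbD[b _]; rewrite subrr => /dltNle; apply; exact: dle0x.
have tr p p' := @stable_transfer x nb x' hx' p p'.
have [[p0 [op0 p00 np0]]|all] := pselect (exists p, [/\ overG p, p != 0 & ~ stable domG x p]);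
  last first.
  apply: (step_transc (H := fun z z' => G z z' /\ z != 0) (r' := x') Lx nx).
  - exact: Gne_nice.
  - exact: Gne_div.
  - move=> p p' hp; have [p0|p0] := eqVneq p 0.
      left; rewrite p0 horner0; split=> //.
      have /eqP : size p' = 0%N by rewrite -(Gp_size hG hp) p0 size_poly0.
      by rewrite size_poly_eq0 => /eqP ->; rewrite horner0.
    have sp : stable domG x p.
      by apply: contrapT => h; apply: all; exists p; split=> // i; exists p'`_i.
    have [a [a' [ha h1 h2]]] := Ev_common nb hx' sp (iffLR (tr _ _ hp) sp).
    right; exists p.[a], p'.[a']; split; [split|exact: aeq_sym|exact: aeq_sym].
      exact: (Gp_horner hG hp ha).
    exact: aeq_neq0l h1.
have exs : exists n, `[< exists p, [/\ overG p, p != 0, ~ stable domG x p & size p = n] >].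
  by exists (size p0); apply/asboolP; exists p0.
case: (ex_minnP exs) => n /asboolP[q [oq q0 nq sq]] nmin {p0 op0 p00 np0 exs}.
have stab p : overG p -> p != 0 -> (size p < n)%N -> stable domG x p.
  move=> op p0 sp; apply: contrapT => np.
  have := nmin (size p); rewrite leqNgt sp => h; apply: notF; apply: h.
  by apply/asboolP; exists p.
have lq0 : lead_coef q != 0 by rewrite lead_coef_eq0.
pose P := (lead_coef q)^-1 *: q.
have PE a : P.[a] = (lead_coef q)^-1 * q.[a] by rewrite hornerZ.
have nP : ~ stable domG x P.
  move=> h; apply: nq; apply: (Ev_mono _ h) => a _.
  by rewrite !PE aeq_mul2l // invr_neq0.
have mP : P \is monic by rewrite monicE lead_coefZ mulVf.
have sP : size P = n by rewrite size_scale ?invr_neq0.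
have oP : overG P.
  have [q' hq'] := overG_pair oq.
  move=> i; exists ((lead_coef q')^-1 * q'`_i); rewrite coefZ.
  apply: (g_M hG); last exact: hq'.
  by apply: (g_V hG); rewrite !lead_coefE -(Gp_size hG hq'); exact: hq'.
have [P' hP] := overG_pair oP.
have n1 : (1 < n)%N.
  rewrite -sP ltnNge; apply/negP => s1.
  have PC := size1_polyC s1; apply: nP; rewrite /stable; apply: Ev_true => [//|a _].
  by move: mP; rewrite PC monicE lead_coefC => /eqP->; rewrite !hornerC aeq_refl ?oner_neq0.
have P'0 : P^`() != 0.
  apply/eqP => e; have : P^`()`_n.-2 = 0 by rewrite e coef0.
  rewrite coef_deriv prednK; last by case: (n) n1 => [|[]].
  have -> : P`_n.-1 = 1 by rewrite -sP -lead_coefE (monicP mP).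
  by apply/eqP; apply: (natr_neq0 hChar); case: (n) n1 => [|[]].
have oP' : overG P^`().
  by move=> i; exists (P'^`()`_i); exact: (Gp_deriv hG hP).
have sP' : stable domG x P^`().
  by apply: stab => //; rewrite -sP; apply: lt_size_deriv; rewrite monic_neq0.
have [r rP lr] := newton_limit hHensel hChar D0 nbD nP sP'.
have [|r' rP' lr'] := newton_limit hHensel hChar C0 nbC (p := P') _
    (iffLR (tr _ _ (Gp_deriv hG hP)) sP').
  by move=> h; apply: nP; exact/(tr _ _ hP).
have nr : ~ exists c, G r c := limit_notin nbD lr.
have Lr : L r.
  apply: (Lroot (p := P)) => //; first by rewrite monic_neq0.
  by move=> i; exact: GL (hP i).
apply: (step_alg (H := fun z z' => G z z' /\ z != 0) (r' := r') Lr nr hP mP).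
- by rewrite sP.
- exact/rootP.
- exact/rootP.
- exact: Gne_nice.
- exact: Gne_div.
- move=> p p' hp p0; rewrite sP => spn.
  have sp : stable domG x p by apply: stab => // i; exists p'`_i.
  have sp' := iffLR (tr _ _ hp) sp.
  have [a [a' [ha h1 h2]]] := Ev_common nb hx' sp sp'.
  exists p.[a], p'.[a']; split.
  + split; first exact: (Gp_horner hG hp ha).
    exact: aeq_neq0l h1.
  + exact: (aeq_trans (stable_limit D0 nbD sp lr) (aeq_sym h1)).
  exact: (aeq_trans (stable_limit C0 nbC sp' lr') (aeq_sym h2)).
Qed.

(** If [x] has a best approximation [a], put $y=x-a$. Either $\mathrm{val}(y)$ is new, or it equals
    $\mathrm{val}(c)$ for some [c] in the domain and the residue of $y/c$ is new: a [b] with that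
    residue would make $a+bc$ a better approximation. *)
Lemma extend_step x : L x -> ~ (exists c, G x c) -> can_extend.
Proof.
move=> Lx nx.
have [nb|best] := pselect (forall a a', G a a' -> exists b b', G b b' /\ dlt (x - b) (x - a)).
  exact: extend_immediate nb.
have [a [a' [ha hbest]]] : exists a a', G a a' /\ forall b b', G b b' -> dle (x - a) (x - b).
  apply: contrapT => h; apply: best => a a' ha; apply: contrapT => h'.
  apply: h; exists a, a'; split=> // b b' hb; rewrite dleNgt; apply/negP => hlt.
  by apply: h'; exists b, b'.
pose y := x - a.
have Ly : L y by apply: LB => //; exact: GL ha.
have y0 : y != 0 by rewrite subr_eq0; apply/eqP => e; apply: nx; exists a'; rewrite e.
have hy b b' : G b b' -> dle y (y - b).
  by move=> hb; rewrite /y -addrA -opprD; exact: hbest (g_D hG ha hb).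
have [[c [c' [hc c0 vc]]]|nv] := pselect (val_in y); last exact: extend_value nv.
have Lc := GL hc.
apply: (extend_residue (u := y / c)).
- exact: Ldiv.
- by rewrite dle_div1 // (dle_eqr _ vc) dle_refl.
- by rewrite dle_1div // (dle_eqr _ (esym vc)) dle_refl.
move=> b b' hb hlt.
have := hy _ _ (g_M hG hb hc); rewrite -(dle_eql _ vc) dleNgt => /negP; apply.
by move: hlt; rewrite -(dltM2r _ _ c0) mulrBl divfK // mul1r.
Qed.

End Step.

(** * Countable closures *)

Lemma countable_list (T : Type) (l : seq T) : countable [set x | List.In x l].
Proof.
elim: l => [|a l IH]; first by rewrite (_ : [set x | _] = set0) // -subset0.
rewrite (_ : [set x | _] = [set a] `|` [set v | List.In v l]).
  by apply: countable_setU => //; exact: countable1.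
by apply/seteqP; split=> v /= [->|]; by [left|right].
Qed.

(** Countably many iterations suffice because [cl] takes finite lists, and a finite list of elements
    of the union already appears at some stage. *)
Lemma countable_closure (T : Type) (cl : seq T -> set T) (X : set T) :
  (forall l, countable (cl l)) -> countable X ->
  exists Y : set T, [/\ countable Y, X `<=` Y &
    forall l, (forall t, List.In t l -> Y t) -> cl l `<=` Y].
Proof.
move=> ccl cX.
pose next (Z : set T) := Z `|` \bigcup_(l in [set l | forall t, List.In t l -> Z t]) cl l.
have cnext Z : countable Z -> countable (next Z).
  move=> cZ; apply: countable_setU => //; apply: bigcup_countable => [|l _]; last exact: ccl.
  have /countable_injP[g ginj] := cZ.
  apply/countable_injP; exists (fun l => pickle (List.map g l)) => l l'.
  rewrite !inE /= => hl hl' /(pcan_inj pickleK).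
  elim: l l' hl hl' => [|a l IH] [|b l'] //= hl hl' [e1 e2].
  rewrite (ginj a b) ?inE; [|by apply: hl; left|by apply: hl'; left|by []].
  by rewrite (IH l') // => t ht; [apply: hl|apply: hl']; right.
pose Y_ n := iter n next X.
have cY n : countable (Y_ n) by elim: n => //= n; exact: cnext.
have mono n m : (n <= m)%N -> Y_ n `<=` Y_ m.
  elim: m => [|m IH]; first by rewrite leqn0 => /eqP->.
  rewrite leq_eqVlt => /orP[/eqP-> //|]; rewrite ltnS => /IH h t ht.
  by left; exact: h.
exists (\bigcup_n Y_ n); split.
- by apply: bigcup_countable => //; exact: countableP.
- by move=> t ht; exists 0%N.
- move=> l hl t ht.
  have [n hn] : exists n, forall t, List.In t l -> Y_ n t.
    elim: l hl {ht} => [|a l IH] hl; first by exists 0%N.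
    have [|n hn] := IH; first by move=> u hu; apply: hl; right.
    have [m _ hm] := hl a (or_introl erefl).
    exists (maxn n m) => u /= [<-|hu]; first exact: (mono m _ (leq_maxr _ _) _ hm).
    by apply: (mono n); [exact: leq_maxl|exact: hn].
  by exists n.+1 => //; right; exists l.
Qed.

Lemma countable_closure2 (T : Type) (o1 o2 : T -> T -> T) (cl : seq T -> set T) (X : set T) :
  (forall l, countable (cl l)) -> countable X ->
  exists Y : set T, [/\ countable Y, X `<=` Y,
    (forall x y, Y x -> Y y -> Y (o1 x y)) /\ (forall x y, Y x -> Y y -> Y (o2 x y)) &
    forall l, (forall t, List.In t l -> Y t) -> cl l `<=` Y].
Proof.
move=> ccl cX.
pose cl' l := (\bigcup_(x in [set x | List.In x l]) \bigcup_(y in [set y | List.In y l])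
   ([set o1 x y] `|` [set o2 x y])) `|` cl l.
have [|Y [cY XY hY]] := @countable_closure T cl' X _ cX.
  move=> l; apply: countable_setU => //.
  apply: bigcup_countable => [|x _]; first exact: countable_list.
  apply: bigcup_countable => [|y _]; first exact: countable_list.
  by apply: countable_setU; exact: countable1.
exists Y; split=> //; last by move=> l hl t ht; apply: (hY l) => //; right.
split=> x y hx hy; apply: (hY [:: x; y]).
- by move=> t /= [<-|[<-|]].
- left; exists x; first by left.
  by exists y; [right; left|left].
- by move=> t /= [<-|[<-|]].
- left; exists x; first by left.
  by exists y; [right; left|right].
Qed.

Lemma roots_list (F : fieldType) (p : {poly F}) : p != 0 ->
  exists s : seq F, forall x, root p x -> List.In x s.
Proof.
have [n] := ubnP (size p); elim: n => // n IH in p *; rewrite ltnS => sp p0.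
have [[a /factor_theorem[q pq]]|none] := pselect (exists a, root p a); last first.
  by exists [::] => x hx; apply: none; exists x.
have q0 : q != 0 by apply: contraNneq p0; rewrite pq => ->; rewrite mul0r.
have [||s hs] := IH q => //.
  by apply: leq_trans sp; rewrite pq size_Mmonic ?monicXsubC // size_XsubC addn2.
exists (a :: s) => x; rewrite pq rootM root_XsubC => /orP[/hs|/eqP->]; by [right|left].
Qed.

Lemma countable_alg_closed (F : fieldType) (X : set F) : countable X ->
  exists L : set F, [/\ countable L, X `<=` L, L 1,
    (forall x y, L x -> L y -> L (x - y)) /\ (forall x y, L x -> L y -> L (x / y)) &
    forall (p : {poly F}) x, p != 0 -> (forall i, L p`_i) -> root p x -> L x].
Proof.
move=> cX.
(* Polynomials are given by their lists of coefficients; a nonzero one has finitely many roots. The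
   element 1 is put in so that it is there even when [X] is empty. *)
pose cl (l : seq F) := [set x | Poly l != 0 /\ root (Poly l) x] `|` [set 1].
have [|L [cL XL [h1 h2] h3]] := @countable_closure2 F (fun x y => x - y)
    (fun x y => x / y) cl X _ cX.
  move=> l; apply: countable_setU; last exact: countable1.
  have [e|p0] := eqVneq (Poly l) 0.
    rewrite (_ : [set x | _] = set0); first exact: countable0.
    by rewrite -subset0 => x [].
  have [s hs] := roots_list p0.
  apply: sub_countable (countable_list s); apply: subset_card_le.
  by move=> x [_ /hs].
exists L; split=> //; first by apply: (h3 [::]) => //; right.
move=> p x p0 hp hx; apply: (h3 (p : seq F)); last by left; rewrite polyseqK.
move=> t; elim: {p0 hx}(p : seq F) hp => //= a l IH hp [<-|]; first exact: (hp 0%N).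
by apply: IH => i; exact: (hp i.+1).
Qed.

(** * Extension to a whole countable field *)

Section Maximal.
Variable M : valuedField.
Hypothesis hHensel : henselian M.
Hypothesis hChar : [pchar (vk M)] =i pred0.
Variable A0 : set M.
Hypothesis hA0 : coset_reps A0.
Hypothesis cA0 : countable A0.
Let N := vf_structure M.
Hypothesis hsat : type_saturated (@csmall _ N).

Lemma good_iff Ek EG (G G' : M -> M -> Prop) : (forall x y, G x y <-> G' x y) ->
  good A0 Ek EG G -> good A0 Ek EG G'.
Proof.
move=> h hG; have -> // : G' = G.
by apply: functional_extensionality_dep => x; apply: functional_extensionality_dep => y;
  apply/propext; split=> /h.
Qed.

(** Zorn's lemma is applied to the set of pairs added to [G0], so that the union of the empty chain
    gives [G0] itself. A maximal relation has all of [L] as its domain by [extend_step], whichever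
    element that step adds. *)
Lemma maximal_good Ek EG (L : set M) (G0 : M -> M -> Prop) :
  field_iso Ek -> group_iso EG -> L 1 ->
  (forall x y, L x -> L y -> L (x - y)) -> (forall x y, L x -> L y -> L (x / y)) ->
  (forall (p : {poly M}) x, p != 0 -> (forall i, L p`_i) -> root p x -> L x) ->
  countable L ->
  (forall x, L x -> dle x 1 -> exists r, Ek (vres x) r) ->
  (forall x g, L x -> vval x = Some g -> exists h, EG g h) ->
  good A0 Ek EG G0 -> (forall x x', G0 x x' -> L x) ->
  exists G, [/\ good A0 Ek EG G, forall x x', G0 x x' -> G x x',
    forall x x', G x x' -> L x & forall x, L x -> exists x', G x x'].
Proof.
move=> hEk hEG L1 LB Ldiv Lroot cL LEk LEG hG0 G0L.
pose ext (X : set (M * M)) x x' := G0 x x' \/ X (x, x').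
pose P (X : set (M * M)) := good A0 Ek EG (ext X) /\ forall p, X p -> L p.1.
have [|A [[hA AL] maxA]] := @Zorn_bigcup _ P.
  move=> F FP Ftot; split; last by move=> p [X FX] /(FP X FX).2.
  set U := \bigcup_(X in F) X.
  have sub X : F X -> forall x x', ext X x x' -> ext U x x'.
    by move=> FX x x' [|h]; [left|right; exists X].
  have two x x' y y' : ext U x x' -> ext U y y' ->
      exists E, [/\ good A0 Ek EG E, forall z z', E z z' -> ext U z z', E x x' & E y y'].
    have one X z z' w w' : F X -> ext X z z' -> ext X w w' ->
        exists E, [/\ good A0 Ek EG E, forall u u', E u u' -> ext U u u', E z z' & E w w'].
      by move=> FX h1 h2; exists (ext X); split=> //; [exact: (FP X FX).1|exact: sub].
    move=> [hx|[X FX hx]] [hy|[Y FY hy]].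
    - by exists G0; split=> // z z' hz; left.
    - by apply: (one Y) => //; [left|right].
    - by apply: (one X) => //; [right|left].
    - have [XY|YX] := Ftot X Y FX FY.
        by apply: (one Y) => //; right; [exact: XY|].
      by apply: (one X) => //; right; [|exact: YX].
  split.
  - by left; exact: g_1 hG0.
  - move=> x x' y y' hx hy; have [E [hE sE h1 h2]] := two _ _ _ _ hx hy.
    by apply: sE; exact: (g_B hE h1 h2).
  - move=> x x' y y' hx hy; have [E [hE sE h1 h2]] := two _ _ _ _ hx hy.
    by apply: sE; exact: (g_div hE h1 h2).
  - move=> x' hx; have [E [hE sE h1 h2]] := two _ _ _ _ hx hx.
    exact: (g_0 hE h1).
  - move=> x x' hx; have [E [hE sE h1 h2]] := two _ _ _ _ hx hx.
    exact: (g_nice hE h1).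
  - by move=> a ha; left; exact: (g_A hG0 ha).
have hL x x' : ext A x x' -> L x by move=> [/G0L//|/AL].
exists (ext A); split=> //; first by move=> x x' h; left.
move=> x Lx; apply: contrapT => nx.
have [G' [hG' AG' G'L [r [r' [hr nr]]]]] :=
  extend_step hHensel hChar hA0 cA0 hsat hEk hEG L1 LB Ldiv Lroot cL LEk LEG hA hL Lx nx.
apply: (maxA [set p | G' p.1 p.2]).
  split; last by move=> /(_ (r, r') hr) h; apply: nr; exists r'; right.
  by move=> [z z'] hz; apply: AG'; right.
split; last by move=> [z z'] /= /G'L.
apply: good_iff hG' => z z'; split=> [h|[h|//]]; first by right.
by apply: AG'; left.
Qed.

End Maximal.

(** * Enlarging partial elementary maps of the residue field and the value group *)

Section EnlargeField.
Variable k : fieldType.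
Let N := field_structure k.
Hypothesis hsat : type_saturated (@csmall _ N).

Lemma countable_unit_psets (S : signature) (K : structure S) (s : Defs.sort S)
    (D : psets K) : (forall s', s' = s) -> countable (D s) -> countable (tagged_union D).
Proof.
move=> hs cD; have := countable_image (existT K s) cD; apply: sub_countable.
apply: subset_card_le => -[s' x] /= hx; have e := hs s'.
by subst s'; exists x.
Qed.

(** A countable field [Y] is formed before extending: the map that saturation provides on all of [Y]
    respects the operations because they belong to the language. *)
Lemma field_iso_enlarge (E : k -> k -> Prop) (X : set k) :
  @elem_rel _ N (fun _ => E) -> countable [set p : k * k | E p.1 p.2] -> countable X ->
  exists E', [/\ field_iso E', countable [set p : k * k | E' p.1 p.2],
    forall x y, E x y -> E' x y & forall x, X x -> exists y, E' x y].
Proof.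
move=> hE cE cX.
have [||Y [cY XY [hB hdiv] h1]] := @countable_closure2 k (fun x y => x - y)
    (fun x y => x / y) (fun _ => [set 1]) (X `|` fst @` [set p : k * k | E p.1 p.2]).
- by move=> l; exact: countable1.
- by apply: countable_setU => //; exact: countable_image.
have Y1 : Y 1 by apply: (h1 [::]).
have [|||h hh] := @elem_rel_extend _ N (@csmall _ N) (fun _ => 0 : k) (fun _ => E) (fun _ => Y)
  hsat _ hE.
- by move=> D D'; exact: countable_tagged.
- rewrite /csmall; apply: (@countable_unit_psets field_sig N tt) => [[]//|].
  have := countable_image snd cE; apply: sub_countable; apply: subset_card_le.
  by move=> y [x hx]; exists (x, y).
- by apply: (@countable_unit_psets field_sig N tt) => [[]//|].
set E2 := fun s => _ in hh.
have hE2 x : Y x -> E2 tt x (h tt x) by right.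
pose E' x y := Y x /\ y = h tt x.
have E'2 x y : E' x y -> E2 tt x y by move=> [hx ->]; exact: hE2.
have hh' : @elem_rel _ N (fun _ => E2 tt) by apply: elem_rel_sub hh => -[].
exists E'; split.
- split.
  + apply: elem_rel_sub hh' => s x y; exact: E'2.
  + by split=> //; apply/esym/(elem_field_1 hh' (hE2 _ Y1)).
  + move=> r r' s s' [hr er] [hs es]; split; first exact: hB.
    have := elem_field_add hh' (hE2 _ (hB _ _ hr hs)) (hE2 _ hs) (hE2 _ hr).
    by rewrite subrK er es => -[/(_ erefl) <- _]; rewrite addrK.
  + move=> r r' s s' [hr er] [hs es]; split; first exact: hdiv.
    have Y0 : Y 0 by rewrite -(subrr 1); exact: hB.
    have h0 : h tt 0 = 0 by apply/(elem_field_0 hh' (hE2 _ Y0)).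
    have [s0|s0] := eqVneq s 0; first by rewrite er es s0 invr0 mulr0 h0 invr0 mulr0.
    have := elem_field_mul hh' (hE2 _ (hdiv _ _ hr hs)) (hE2 _ hs) (hE2 _ hr).
    rewrite divfK // er es => -[/(_ erefl) <- _]; rewrite mulfK //.
    by apply/eqP => /(elem_field_0 hh' (hE2 _ hs))/eqP; rewrite (negbTE s0).
- have := countable_image (fun x => (x, h tt x)) cY; apply: sub_countable.
  by apply: subset_card_le => -[x y] /= [hx ->]; exists x.
- move=> x y hxy; have hx : Y x by apply: XY; right; exists (x, y).
  split=> //; apply/(elem_field_eq hh' (_ : E2 tt x y) (hE2 _ hx)) => //.
  by left.
- by move=> x hx; exists (h tt x); split=> //; apply: XY; left.
Qed.

End EnlargeField.

Section EnlargeGroup.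
Variable G : orderedGroupType.
Let N := ogroup_structure G.
Hypothesis hsat : type_saturated (@csmall _ N).

Lemma group_iso_enlarge (E : G -> G -> Prop) (X : set G) :
  @elem_rel _ N (fun _ => E) -> countable [set p : G * G | E p.1 p.2] -> countable X ->
  exists E', [/\ group_iso E', countable [set p : G * G | E' p.1 p.2],
    forall x y, E x y -> E' x y & forall x, X x -> exists y, E' x y].
Proof.
move=> hE cE cX.
have [||Y [cY XY [hB _] h1]] := @countable_closure2 G (fun x y => x - y)
    (fun x y => x - y) (fun _ => [set 0]) (X `|` fst @` [set p : G * G | E p.1 p.2]).
- by move=> l; exact: countable1.
- by apply: countable_setU => //; exact: countable_image.
have Y0 : Y 0 by apply: (h1 [::]).
have [|||h hh] := @elem_rel_extend _ N (@csmall _ N) (fun _ => 0 : G) (fun _ => E) (fun _ => Y)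
  hsat _ hE.
- by move=> D D'; exact: countable_tagged.
- rewrite /csmall; apply: (@countable_unit_psets ogroup_sig N tt) => [[]//|].
  have := countable_image snd cE; apply: sub_countable; apply: subset_card_le.
  by move=> y [x hx]; exists (x, y).
- by apply: (@countable_unit_psets ogroup_sig N tt) => [[]//|].
set E2 := fun s => _ in hh.
have hE2 x : Y x -> E2 tt x (h tt x) by right.
pose E' x y := Y x /\ y = h tt x.
have E'2 x y : E' x y -> E2 tt x y by move=> [hx ->]; exact: hE2.
have hh' : @elem_rel _ N (fun _ => E2 tt) by apply: elem_rel_sub hh => -[].
exists E'; split.
- split.
  + apply: elem_rel_sub hh' => s x y; exact: E'2.
  + by split=> //; apply/esym/(elem_group_0 hh' (hE2 _ Y0)).
  + move=> r r' s s' [hr er] [hs es]; split; first exact: hB.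
    have := elem_group_add hh' (hE2 _ (hB _ _ hr hs)) (hE2 _ hs) (hE2 _ hr).
    by rewrite subrK er es => -[/(_ erefl) <- _]; rewrite addrK.
- have := countable_image (fun x => (x, h tt x)) cY; apply: sub_countable.
  by apply: subset_card_le => -[x y] /= [hx ->]; exists x.
- move=> x y hxy; have hx : Y x by apply: XY; right; exists (x, y).
  split=> //; apply/(elem_group_eq hh' (_ : E2 tt x y) (hE2 _ hx)) => //.
  by left.
- by move=> x hx; exists (h tt x); split=> //; apply: XY; left.
Qed.

End EnlargeGroup.

(** * Saturation of the residue field and the value group *)

Section VFReducts.
Variable M : valuedField.
Let N := vf_structure M.

Lemma field_hterm (V : ctx field_sig) (W : ctx vf_sig) (f : V tt -> W RF)
    s (t : term V s) :
  @pterm vf_sig N RF ring_op (fun=> tt) ring_arity void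
    (fun r => match r with end) (@ring_int (vk M))
    (fun r => match r with end) V W f s t.
Proof.
elim: t => [[] v|o ts IH]; first by exists (Var (f v)).
exists (@App vf_sig W (kOp o) (fun i => sval (cid (IH i)))) => e /=.
congr (ring_int _); apply: functional_extensionality_dep => i.
exact: svalP (cid (IH i)) e.
Qed.

Lemma field_hrel (V : ctx field_sig) (W : ctx vf_sig) (f : V tt -> W RF) (r : void)
    (ts : args (term V) (match r with end)) :
  definable (fun e : asg N W => (match r return
    args (fun _ : unit => vk M) (match r with end) -> Prop with end)
    (fun i => eval (@pull vf_sig N RF ring_op (fun=> tt) ring_arity void
    (fun r => match r with end) (@ring_int (vk M))
    (fun r => match r with end) V W e f) (ts i))).
Proof. by case: r ts. Qed.

Lemma group_hterm (V : ctx ogroup_sig) (W : ctx vf_sig) (f : V tt -> W VG)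
    s (t : term V s) :
  @pterm vf_sig N VG group_op (fun=> tt) group_arity unit
    (fun=> [:: tt; tt]) (@zmod_int (vG M))
    (fun _ a => (a ord0 : vG M) <= (a ord_max : vG M)) V W f s t.
Proof.
elim: t => [[] v|o ts IH]; first by exists (Var (f v)).
exists (@App vf_sig W (GOp o) (fun i => sval (cid (IH i)))) => e /=.
congr (zmod_int _); apply: functional_extensionality_dep => i.
exact: svalP (cid (IH i)) e.
Qed.

Lemma group_hrel (V : ctx ogroup_sig) (W : ctx vf_sig) (f : V tt -> W VG) (r : unit)
    (ts : args (@term ogroup_sig V) [:: tt; tt]) :
  definable (fun e : asg N W => (fun a : args (fun _ : unit => vG M) [:: tt; tt] =>
    (a ord0 : vG M) <= (a ord_max : vG M))
    (fun i => eval (@pull vf_sig N VG group_op (fun=> tt) group_arity unit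
    (fun=> [:: tt; tt]) (@zmod_int (vG M))
    (fun _ a => (a ord0 : vG M) <= (a ord_max : vG M)) V W e f) (ts i))).
Proof.
have [t ht] := group_hterm f (ts ord0); have [u hu] := group_hterm f (ts ord_max).
exists (@FRel vf_sig W GLe (args2 (S := vf_sig) t u)) => e /=.
by rewrite ht hu.
Qed.

Variable small : psets N -> Prop.
Hypothesis hsat : type_saturated small.
Hypothesis hsmall : small_addable small.

Definition small_k (D : psets (field_structure (vk M))) := small (mkps set0 (D tt) set0).
Definition small_G (D : psets (ogroup_structure (vG M))) := small (mkps set0 set0 (D tt)).

Lemma lift_k (D : psets (field_structure (vk M))) :
  @lift_psets vf_sig N RF ring_op (fun=> tt) ring_arity void
    (fun r => match r with end) (@ring_int (vk M)) (fun r => match r with end) D =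
  mkps set0 (D tt) set0.
Proof.
apply: functional_extensionality_dep => s; apply/seteqP; split=> x.
  move=> [y hy e]; have es := f_equal (@projT1 _ _) e; rewrite /= in es; subst s.
  suff gen (p : {s & N s}) : existT N RF y = p -> mkps set0 (D tt) set0 (projT2 p).
    exact: gen (existT N RF x) e.
  by move=> <-.
by case: s x => //= x hx; exists x.
Qed.

Lemma lift_G (D : psets (ogroup_structure (vG M))) :
  @lift_psets vf_sig N VG group_op (fun=> tt) group_arity unit
    (fun=> [:: tt; tt]) (@zmod_int (vG M))
    (fun _ a => (a ord0 : vG M) <= (a ord_max : vG M)) D =
  mkps set0 set0 (D tt).
Proof.
apply: functional_extensionality_dep => s; apply/seteqP; split=> x.
  move=> [y hy e]; have es := f_equal (@projT1 _ _) e; rewrite /= in es; subst s.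
  suff gen (p : {s & N s}) : existT N VG y = p -> mkps set0 set0 (D tt) (projT2 p).
    exact: gen (existT N VG x) e.
  by move=> <-.
by case: s x => //= x hx; exists x.
Qed.

Lemma field_saturated : type_saturated small_k.
Proof.
have := reduct_type_saturated field_hterm field_hrel hsat.
rewrite /reduct_small => h D hD; apply: h; by rewrite lift_k.
Qed.

Lemma group_saturated : type_saturated small_G.
Proof.
have := reduct_type_saturated group_hterm group_hrel hsat.
rewrite /reduct_small => h D hD; apply: h; by rewrite lift_G.
Qed.

Lemma small_k_addable : small_addable small_k.
Proof.
have := @reduct_small_addable vf_sig N RF ring_op (fun=> tt) ring_arity void
    (fun r => match r with end) (@ring_int (vk M)) (fun r => match r with end) small hsmall.
rewrite /reduct_small => h D D' hD cD'; have := h D D'.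
by rewrite !lift_k; apply.
Qed.

Lemma small_G_addable : small_addable small_G.
Proof.
have := @reduct_small_addable vf_sig N VG group_op (fun=> tt) group_arity unit
    (fun=> [:: tt; tt]) (@zmod_int (vG M))
    (fun _ a => (a ord0 : vG M) <= (a ord_max : vG M)) small hsmall.
rewrite /reduct_small => h D D' hD cD'; have := h D D'.
by rewrite !lift_G; apply.
Qed.

End VFReducts.

(** * Back and forth *)

Section BackAndForth.
Variable M : valuedField.
Hypothesis hHensel : henselian M.
Hypothesis hChar : [pchar (vk M)] =i pred0.
Variable A0 : set M.
Hypothesis hA0 : coset_reps A0.
Hypothesis cA0 : countable A0.
Let N := vf_structure M.
Hypothesis hsat : type_saturated (@csmall _ N).

Lemma csat_k : type_saturated (@csmall _ (field_structure (vk M))).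
Proof.
move=> D cD; apply: (field_saturated hsat); apply: countable_mkps; try exact: countable0.
have := countable_image (fun p : {s : unit & vk M} => projT2 p) cD; apply: sub_countable.
by apply: subset_card_le => x hx; exists (existT _ tt x).
Qed.

Lemma csat_G : type_saturated (@csmall _ (ogroup_structure (vG M))).
Proof.
move=> D cD; apply: (group_saturated hsat); apply: countable_mkps; try exact: countable0.
have := countable_image (fun p : {s : unit & vG M} => projT2 p) cD; apply: sub_countable.
by apply: subset_card_le => x hx; exists (existT _ tt x).
Qed.

(** Leading terms get no independent relation: a pair of them must come from a pair of field
    elements. *)
Definition bfR (Ek : vk M -> vk M -> Prop) (EG : vG M -> vG M -> Prop) (G : M -> M -> Prop) :
    forall s, N s -> N s -> Prop := fun s =>
  match s return vf_car M s -> vf_car M s -> Prop with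
  | VF => G
  | RF => Ek
  | VG => EG
  | RV => fun r r' => exists x x', [/\ G x x', x != 0, vrv x = r & vrv x' = r']
  end.

Record triple (Ek : vk M -> vk M -> Prop) (EG : vG M -> vG M -> Prop) (G : M -> M -> Prop) := Triple {
  t_k : field_iso Ek;
  t_g : group_iso EG;
  t_G : good A0 Ek EG G;
  t_ck : countable [set p : vk M * vk M | Ek p.1 p.2];
  t_cg : countable [set p : vG M * vG M | EG p.1 p.2];
  t_cG : countable [set p : M * M | G p.1 p.2] }.

Lemma countable_swap (T : Type) (R : T -> T -> Prop) :
  countable [set p : T * T | R p.1 p.2] -> countable [set p : T * T | R p.2 p.1].
Proof.
move=> /(countable_image (fun p => (p.2, p.1))); apply: sub_countable.
by apply: subset_card_le => -[x y] /= h; exists (y, x).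
Qed.

Lemma triple_inv Ek EG G : triple Ek EG G ->
  triple (fun x y => Ek y x) (fun x y => EG y x) (fun x y => G y x).
Proof.
move=> [h1 h2 h3 h4 h5 h6]; split; try exact: countable_swap.
- exact: field_iso_inv.
- exact: group_iso_inv.
- exact: good_inv.
Qed.

Lemma good_mono (Ek Ek' : vk M -> vk M -> Prop) (EG EG' : vG M -> vG M -> Prop) G :
  (forall x y, Ek x y -> Ek' x y) -> (forall x y, EG x y -> EG' x y) ->
  good A0 Ek EG G -> good A0 Ek' EG' G.
Proof.
move=> hk hg [h1 h2 h3 h4 h5 h6]; split=> // x x' /h5 h /h[[g [g' [k1 k2 k3]]] k4 k5].
split=> //; first by exists g, g'; split=> //; exact: hg.
by move=> /k4[i1 i2 i3]; split=> //; exact: hk.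
Qed.

Definition tsub (Ek : vk M -> vk M -> Prop) (EG : vG M -> vG M -> Prop)
    (G : M -> M -> Prop) Ek' EG' G' := [/\ forall x y : vk M, Ek x y -> Ek' x y,
  forall x y : vG M, EG x y -> EG' x y & forall x y : M, G x y -> G' x y].

Lemma bfR_sub Ek EG G Ek' EG' G' : tsub Ek EG G Ek' EG' G' ->
  forall s x y, @bfR Ek EG G s x y -> @bfR Ek' EG' G' s x y.
Proof.
move=> [h1 h2 h3] [] x y //=; [exact: h3|exact: h1|exact: h2|].
by move=> [z [z' [k1 k2 k3 k4]]]; exists z, z'; split=> //; exact: h3.
Qed.

(** The order matters: the countable field [L] containing [x] comes first, then [Ek] and [EG] are
    enlarged to all its residues and values, and only then is [G] extended to [L]. *)
Lemma extend_VF Ek EG G x : triple Ek EG G -> exists Ek' EG' G',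
  [/\ triple Ek' EG' G', tsub Ek EG G Ek' EG' G' & exists y, G' x y].
Proof.
move=> [h1 h2 h3 h4 h5 h6].
have [|L [cL XL L1 [LB Ldiv] Lroot]] := @countable_alg_closed M
    ([set x] `|` fst @` [set p : M * M | G p.1 p.2]).
  by apply: countable_setU; [exact: countable1|exact: countable_image].
have [Ek' [k1 k2 k3 k4]] := field_iso_enlarge csat_k (fi_elem h1) h4
  (countable_image (@vres M) cL).
have [EG' [g1 g2 g3 g4]] := group_iso_enlarge csat_G (gi_elem h2) h5
  (countable_image (fun x => odflt 0 (vval x)) cL).
have hG' := good_mono k3 g3 h3.
have [|||G' [i1 i2 i3 i4]] := maximal_good hHensel hChar hA0 cA0 hsat k1 g1 L1 LB Ldiv
  Lroot cL _ _ hG'.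
- by move=> z Lz _; apply: k4; exists z.
- by move=> z g Lz hz; apply: g4; exists z => //; rewrite hz.
- by move=> z z' hz; apply: XL; right; exists (z, z').
exists Ek', EG', G'; split=> //; last by apply: i4; apply: XL; left.
split=> //.
have /countable_injP[f finj] := cL.
apply/countable_injP; exists (fun p => f p.1) => -[z z'] [w w']; rewrite !inE /= => hz hw.
move=> /finj; rewrite !inE => /(_ (i3 _ _ hz) (i3 _ _ hw)) e.
by congr pair => //; apply: (g_fun i1 hz); rewrite e.
Qed.

Lemma bf_extend Ek EG G s (x : N s) : triple Ek EG G -> exists Ek' EG' G',
  [/\ triple Ek' EG' G', tsub Ek EG G Ek' EG' G' & exists y, @bfR Ek' EG' G' s x y].
Proof.
case: s x => /= x ht.
- exact: extend_VF.
- case: (ht) => h1 h2 h3 h4 h5 h6.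
  have [Ek' [k1 k2 k3 k4]] := field_iso_enlarge csat_k (fi_elem h1) h4 (countable1 x).
  exists Ek', EG, G; split; [split=> //; exact: good_mono h3|by split|exact: k4].
- case: (ht) => h1 h2 h3 h4 h5 h6.
  have [EG' [k1 k2 k3 k4]] := group_iso_enlarge csat_G (gi_elem h2) h5 (countable1 x).
  exists Ek, EG', G; split; [split=> //; exact: good_mono h3|by split|exact: k4].
- have [z z0 <-] := vrv_surj x.
  have [Ek' [EG' [G' [k1 k2 [z' hz]]]]] := extend_VF z ht.
  by exists Ek', EG', G'; split=> //; exists (vrv z'), z, z'.
Qed.

Lemma rv_1 : vrv (1 : M) = 1%g.
Proof.
have n1 : (1 : M) != 0 := oner_neq0 _.
by apply: (mulIg (vrv (1 : M))); rewrite -vrvM // mulr1 mul1g.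
Qed.

Lemma rv_V (x : M) : x != 0 -> vrv x^-1 = (vrv x)^-1%g.
Proof.
move=> x0; apply: (mulIg (vrv x)).
by rewrite -vrvM ?invr_eq0 // mulVf // mulVg rv_1.
Qed.

Section TripleTheory.
Variables (Ek : vk M -> vk M -> Prop) (EG : vG M -> vG M -> Prop) (G : M -> M -> Prop).
Hypothesis ht : triple Ek EG G.
Let hk := t_k ht. Let hg := t_g ht. Let hG := t_G ht.

Lemma bfR_eval (V : ctx vf_sig) (e e' : asg N V) s (t : term V s) :
  (forall s v, bfR Ek EG G (e s v) (e' s v)) -> bfR Ek EG G (eval e t) (eval e' t).
Proof.
move=> hee; elim: t => [s' v|[] o ts IH]; first exact: hee.
- case: o ts IH => ts IH /=.
  + exact: (g_00 hG).
  + exact: (g_1 hG).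
  + exact: (g_D hG (IH _) (IH _)).
  + exact: (g_N hG (IH _)).
  + exact: (g_M hG (IH _) (IH _)).
- case: o ts IH => ts IH /=.
  + exact: (fi_0 hk).
  + exact: (fi_1 hk).
  + exact: (fi_D hk (IH _) (IH _)).
  + exact: (fi_N hk (IH _)).
  + exact: (fi_M hk (IH _) (IH _)).
- case: o ts IH => ts IH /=.
  + exact: (gi_0 hg).
  + exact: (gi_D hg (IH _) (IH _)).
  + exact: (gi_N hg (IH _)).
- case: o ts IH => ts IH /=.
  + by exists 1, 1; rewrite oner_neq0 rv_1; split=> //; exact: (g_1 hG).
  + have [x [x' [h1 x0 <- <-]]] := IH ord0; have [y [y' [h2 y0 <- <-]]] := IH ord_max.
    have x0' : x' != 0 by rewrite -(g_eq0 hG h1).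
    have y0' : y' != 0 by rewrite -(g_eq0 hG h2).
    exists (x * y), (x' * y'); rewrite mulf_neq0 // !vrvM //; split=> //.
    exact: (g_M hG).
  + have [x [x' [h1 x0 <- <-]]] := IH ord0.
    have x0' : x' != 0 by rewrite -(g_eq0 hG h1).
    exists x^-1, x'^-1; rewrite invr_eq0 !rv_V //; split=> //; exact: (g_V hG).
Qed.

Lemma bfR_eq s (x x' y y' : N s) : bfR Ek EG G x x' -> bfR Ek EG G y y' ->
  (x = y <-> x' = y').
Proof.
case: s x x' y y' => /= x x' y y' h1 h2.
- split=> [e|e]; first by apply: (g_fun hG h1); rewrite e.
  by apply: (g_inj hG h1); rewrite e.
- exact: (elem_field_eq (fi_elem hk) h1 h2).
- exact: (elem_group_eq (gi_elem hg) h1 h2).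
- case: h1 h2 => [z [z' [h1 z0 <- <-]]] [w [w' [h2 w0 <- <-]]].
  have z0' : z' != 0 by rewrite -(g_eq0 hG h1).
  have w0' : w' != 0 by rewrite -(g_eq0 hG h2).
  by rewrite !rv_eq // (g_aeq hg hG h1 h2).
Qed.

Lemma bfR_rel (r : vf_rsym) (a a' : args N (vf_rdom r)) :
  (forall i, bfR Ek EG G (a i) (a' i)) -> (@rint _ N r a <-> @rint _ N r a').
Proof.
case: r a a' => a a' h /=; have h0 := h ord0; have h1 := h ord_max.
- by rewrite (gi_le hg (h0 : EG _ _) (h1 : EG _ _)).
- move: (a ord0 : M) (a' ord0 : M) (a ord_max : vG M) (a' ord_max : vG M) h0 h1.
  move=> x x' g g' /= h0 h1; have [x0|x0] := eqVneq x 0.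
    have x0' : x' = 0 by apply: (g_0 hG); rewrite -x0.
    by rewrite x0 x0' vval_0.
  have [i [i' [-> -> hi]]] := g_EV hG h0 x0.
  have := elem_group_eq (gi_elem hg) hi h1.
  by move=> E; split=> -[] /E ->.
- move: (a ord0 : M) (a' ord0 : M) (a ord_max : vk M) (a' ord_max : vk M) h0 h1.
  move=> x x' g g' /= h0 h1; rewrite !vle_dle1 (g_le hg hG h0 (g_1 hG)).
  have [hx|hx] := boolP (dle x' 1); last by split=> -[].
  have [_ _ hi] : ER Ek x x' by apply: (g_ER hk hG h0); rewrite (g_le hg hG h0 (g_1 hG)).
  by split=> -[_ e]; split=> //; apply/(elem_field_eq (fi_elem hk) hi h1).
- move: (a ord0 : M) (a' ord0 : M) (a ord_max : vRV M) (a' ord_max : vRV M) h0 h1.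
  move=> x x' g g' /= h0 [y [y' [hy y0 <- <-]]].
  rewrite (g_eq0 hG h0).
  have y0' : y' != 0 by rewrite -(g_eq0 hG hy).
  split=> -[x0 e]; split=> //.
    by apply/rv_eq => //; rewrite -(g_aeq hg hG h0 hy); apply/rv_eq => //; rewrite (g_eq0 hG h0).
  apply/rv_eq => //; rewrite ?(g_eq0 hG h0) //.
  by rewrite (g_aeq hg hG h0 hy); apply/rv_eq.
Qed.

End TripleTheory.

Lemma bfR_inv Ek EG G : triple Ek EG G -> forall s (x x' : N s),
  bfR Ek EG G x x' -> bfR (fun x y => Ek y x) (fun x y => EG y x) (fun x y => G y x) x' x.
Proof.
move=> ht [] x x' //= [z [z' [h1 z0 h2 h3]]]; exists z', z; split=> //.
by rewrite -(g_eq0 (t_G ht) h1).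
Qed.

(** Induction on formulas for all triples at once. At a quantifier one direction enlarges the
    triple, the other enlarges its inverse. *)
Lemma bfR_elem Ek EG G : triple Ek EG G -> elem_rel (@bfR Ek EG G).
Proof.
move=> ht V phi; elim: phi Ek EG G ht => {V} [V s t u|V r ts|V|V p IHp q IHq|V s p IHp] Ek EG G ht e e' hee /=.
- by apply: (bfR_eq ht); exact: bfR_eval.
- by apply: (bfR_rel ht) => i; exact: bfR_eval.
- by [].
- by rewrite (IHp _ _ _ ht _ _ hee) (IHq _ _ _ ht _ _ hee).
split=> h x.
  have [Ek' [EG' [G' [k1 k2 [y hy]]]]] := bf_extend x (triple_inv ht).
  have k1' := triple_inv k1; have hy' := bfR_inv k1 hy.
  have k2' : tsub Ek EG G (fun x y => Ek' y x) (fun x y => EG' y x) (fun x y => G' y x).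
    by case: k2 => i1 i2 i3; split=> z w; [exact: i1|exact: i2|exact: i3].
  have hxy s' (v : cadd V (csingle s) s') : bfR (fun x y => Ek' y x) (fun x y => EG' y x)
      (fun x y => G' y x) (acat e (@aone _ N s y) v) (acat e' (@aone _ N s x) v).
    by case: v => [v|[]] //=; exact/(bfR_sub k2')/hee.
  exact: (iffLR (IHp _ _ _ k1' _ _ hxy) (h y)).
have [Ek' [EG' [G' [k1 k2 [y hy]]]]] := bf_extend x ht.
have hxy s' (v : cadd V (csingle s) s') :
    bfR Ek' EG' G' (acat e (@aone _ N s x) v) (acat e' (@aone _ N s y) v).
  by case: v => [v|[]] //=; exact/(bfR_sub k2)/hee.
exact: (iffRL (IHp _ _ _ k1 _ _ hxy) (h y)).
Qed.

(* Relative quantifier elimination: by [elem_rel_finite] it is enough to treat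
   a countable part of [G], to which the back-and-forth argument applies. *)
Theorem elementary_good (Ek : vk M -> vk M -> Prop) (EG : vG M -> vG M -> Prop)
    (G : M -> M -> Prop) :
  @elem_rel _ (field_structure (vk M)) (fun _ => Ek) ->
  @elem_rel _ (ogroup_structure (vG M)) (fun _ => EG) ->
  good A0 Ek EG G -> elem_rel (@bfR Ek EG G).
Proof.
move=> hk hg hG; apply: elem_rel_finite => l hl.
(* A pair of leading terms in [l] is replaced by a pair of field elements above it. *)
have [lw [hw1 hw2]] : exists lw : seq (M * M), (forall q, List.In q lw -> G q.1 q.2) /\
    forall p, List.In p l -> (match p return Prop with
      | existT VF (x, y) => List.In (x, y) lw
      | existT RV (r, r') => exists x x', [/\ List.In (x, x') lw, x != 0, vrv x = r & vrv x' = r']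
      | _ => True end).
  elim: l hl => [|p l IH] hl; first by exists [::].
  have [|lw [h1 h2]] := IH; first by move=> q hq; apply: hl; right.
  have := hl p (or_introl erefl); case: p {hl} => -[] [x y] /= hp.
  - exists ((x, y) :: lw); split=> [q /= [<-//|]|q /= [<-|]]; [exact: h1|by left|].
    by move/h2; case: q => -[] [u v] //; [right|move=> [z [z' [i1 i2 i3 i4]]]; exists z, z'; split=> //; right].
  - by exists lw; split=> // q /= [<-//|/h2].
  - by exists lw; split=> // q /= [<-//|/h2].
  - case: hp => z [z' [i1 i2 i3 i4]].
    exists ((z, z') :: lw); split=> [q /= [<-//|]|q /= [<-|]]; first exact: h1.
      by exists z, z'; split=> //; left.
    by move/h2; case: q => -[] [u v] //; [right|move=> [w [w' [j1 j2 j3 j4]]]; exists w, w'; split=> //; right].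
have [||Y [cY XY [YB Ydiv] Y1]] := @countable_closure2 (M * M)%type
   (fun p q => (p.1 - q.1, p.2 - q.2)) (fun p q => (p.1 / q.1, p.2 / q.2))
   (fun _ => [set (1, 1)]) ([set q | List.In q lw] `|` (fun a => (a, a)) @` A0).
- by move=> ?; exact: countable1.
- by apply: countable_setU; [exact: countable_list|exact: countable_image].
pose G1 x x' := Y (x, x') /\ G x x'.
(* The residues of [G1] are included so that [G1] stays good for the countable relations built from
   [Ek1] and [EG1], and the pairs of [l] because they have to be preserved. *)
pose Ek1 r r' := (exists x x', [/\ G1 x x', x != 0 /\ dle x 1, vres x = r & vres x' = r']) \/
  List.In (existT (fun s => (N s * N s)%type) RF (r, r')) l.
pose EG1 g g' := (exists x x', [/\ G1 x x', vval x = Some g & vval x' = Some g']) \/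
  List.In (existT (fun s => (N s * N s)%type) VG (g, g')) l.
have cG1 : countable [set p : M * M | G1 p.1 p.2].
  by apply: sub_countable cY; apply: subset_card_le => -[x x'] [].
have sEk r r' : Ek1 r r' -> Ek r r'.
  move=> [[x [x' [[_ h] [x0 x1] <- <-]]]|/hl //].
  by have [_ /(_ x1)[]] := g_nice hG h x0.
have sEG g g' : EG1 g g' -> EG g g'.
  move=> [[x [x' [[_ h] hg1 hg2]]]|/hl //].
  have x0 : x != 0 by apply/eqP => /vval0; rewrite hg1.
  by have [i [i' []]] := g_EV hG h x0; rewrite hg1 hg2 => -[<-] [<-].
have clist (T : Type) (f : {s & (N s * N s)%type} -> T) :
    countable [set f p | p in [set p | List.In p l]].
  by apply: countable_image; exact: countable_list.
pose kpart (p : {s & (N s * N s)%type}) : vk M * vk M :=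
  match p with existT RF q => q | _ => (0, 0) end.
pose gpart (p : {s & (N s * N s)%type}) : vG M * vG M :=
  match p with existT VG q => q | _ => (0, 0) end.
have [|||Ek' [k1 k2 k3 _]] := field_iso_enlarge csat_k (E := Ek1) (X := set0).
- by apply: elem_rel_sub hk => s x y; exact: sEk.
- have := countable_setU (countable_image (fun q => (vres q.1, vres q.2)) cG1) (clist _ kpart).
  apply: sub_countable; apply: subset_card_le => -[r r'] /=.
  move=> [[x [x' [h _ <- <-]]]|h]; [left; exists (x, x')|right] => //.
  by exists (existT (fun s => (N s * N s)%type) RF (r, r')).
- exact: countable0.
have [|||EG' [g1 g2 g3 _]] := group_iso_enlarge csat_G (E := EG1) (X := set0).
- by apply: elem_rel_sub hg => s x y; exact: sEG.
- have := countable_setU (countable_image (fun q => (odflt 0 (vval q.1), odflt 0 (vval q.2))) cG1)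
    (clist _ gpart).
  apply: sub_countable; apply: subset_card_le => -[r r'] /=.
  move=> [[x [x' [h h1 h2]]]|h]; [left; exists (x, x')|right] => //=.
    by rewrite h1 h2.
  by exists (existT (fun s => (N s * N s)%type) VG (r, r')).
- exact: countable0.
have hG1 : good A0 Ek' EG' G1.
  split.
  - by split; [apply: (Y1 [::])|exact: (g_1 hG)].
  - move=> x x' y y' [h1 h2] [i1 i2]; split; last exact: (g_B hG).
    exact: (YB (x, x') (y, y')).
  - move=> x x' y y' [h1 h2] [i1 i2]; split; last exact: (g_div hG).
    exact: (Ydiv (x, x') (y, y')).
  - by move=> x' [_ h]; exact: (g_0 hG h).
  - move=> x x' h x0; have [[g [g' [i1 i2 i3]]] j k] := g_nice hG h.2 x0; split=> //.
      by exists g, g'; split=> //; apply: g3; left; exists x, x'.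
    by move=> x1; have [_ j2 _] := j x1; split=> //; apply: k3; left; exists x, x'.
  - by move=> a ha; split; [apply: XY; right; exists a|exact: (g_A hG ha)].
exists (@bfR Ek' EG' G1); first by apply: bfR_elem.
move=> p hp; have := hw2 p hp; case: p hp => -[] [x y] /= hp h.
- by split; [apply: XY; left|exact: (hw1 (x, y))].
- by apply: k3; right.
- by apply: g3; right.
- case: h => z [z' [i1 i2 i3 i4]]; exists z, z'; split=> //.
  by split; [apply: XY; left|exact: (hw1 (z, z'))].
Qed.

End BackAndForth.

(** * Countable contexts and types *)

Section CountableContexts.
Variable S : signature.
Implicit Types V W : ctx S.

Definition cctx V := exists idx : {s & V s} -> nat, injective idx.

Lemma cctx_cadd V W : cctx V -> cctx W -> cctx (cadd V W).
Proof.
move=> [f finj] [g ginj].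
pose h (x : {s & cadd V W s}) : nat + nat :=
  match x with
  | existT s (inl v) => inl (f (existT _ s v))
  | existT s (inr w) => inr (g (existT _ s w))
  end.
exists (fun x => pickle (h x)) => x y /(pcan_inj pickleK).
case: x y => [s [v|w]] [s' [v'|w']] //= [].
  move=> /finj e; have es := f_equal (@projT1 _ _) e; rewrite /= in es.
  suff gen p : existT V s v = p ->
    existT (cadd V W) s (inl v) = existT (cadd V W) (projT1 p) (inl (projT2 p)) by exact: gen e.
  by move=> <-.
move=> /ginj e.
suff gen p : existT W s w = p ->
  existT (cadd V W) s (inr w) = existT (cadd V W) (projT1 p) (inr (projT2 p)) by exact: gen e.
by move=> <-.
Qed.

Lemma cctx_prod (I : countType) V : cctx V -> cctx (fun s => (I * V s)%type).
Proof.
move=> [f finj].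
exists (fun x => pickle ((projT2 x).1, f (existT _ (projT1 x) (projT2 x).2))).
move=> [s [i v]] [s' [i' v']] /= /(pcan_inj pickleK)[<- /finj e].
suff gen p : existT V s v = p ->
  existT (fun s => (I * V s)%type) s (i, v) =
  existT (fun s => (I * V s)%type) (projT1 p) (i, projT2 p) by exact: gen e.
by move=> <-.
Qed.

Variable N : structure S.

Lemma cctx_csub (D : psets N) : countable (tagged_union D) -> cctx (csub D).
Proof.
move=> /countable_injP[g ginj]; exists (fun v : {s & csub D s} => g (existT N _ (sval (projT2 v)))).
move=> [s [x hx]] [s' [x' hx']] /= /ginj.
rewrite !inE => /(_ hx hx') hT.
suff gen (p : {s & N s}) (hp : D _ (projT2 p)) : existT N s x = p ->
    existT (csub D) s (exist _ x hx) = existT (csub D) _ (exist _ (projT2 p) hp).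
  exact: gen (existT N s' x') hx' hT.
by move=> hT'; move: hp; case: _ / hT' => /= hp; congr existT; exact: eq_exist.
Qed.

Definition prange V (x : asg N V) : psets N := fun s => [set a | exists v, x s v = a].

Lemma countable_prange V (x : asg N V) : cctx V -> countable (tagged_union (prange x)).
Proof.
move=> [f finj].
have : countable (setT : set {s & V s}).
  by apply/countable_injP; exists f => u v _ _; exact: finj.
move/(countable_image (fun v => existT N (projT1 v) (x _ (projT2 v)))); apply: sub_countable.
apply: subset_card_le => -[s a] [v /= e]; exists (existT _ s v) => //=.
by rewrite e.
Qed.

End CountableContexts.

Section Types.
Variables (S : signature) (N : structure S).
Implicit Types V W P Q : ctx S.
Variable small : psets N -> Prop.
Hypothesis hsat : type_saturated small.
Hypothesis hsmall : small_addable small.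
Variable d : forall s, N s.
Variable A : psets N.
Hypothesis hA : small A.

Definition eqtp V (x y : asg N V) := forall phi : formula (cadd V (csub A)),
  sat phi (acat x (pin A)) <-> sat phi (acat y (pin A)).

Lemma eqtp_pdefinable V (x y : asg N V) (R : asg N V -> Prop) :
  eqtp x y -> pdefinable A R -> (R x <-> R y).
Proof. by move=> h [phi hphi]; rewrite -!hphi. Qed.

Lemma eqtp_ren V W (f : ren V W) (x y : asg N W) :
  eqtp x y -> eqtp (acomp x f) (acomp y f).
Proof.
move=> h phi.
have e z : sat phi (acat (acomp z f) (pin A)) <->
    sat (rename (@lift_ren S V W f (csub A)) phi) (acat z (pin A)).
  rewrite sat_rename; suff -> : acomp (acat z (pin A)) (@lift_ren S V W f (csub A)) =
    acat (acomp z f) (pin A) by [].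
  by apply: asg_ext => s [].
by rewrite !e.
Qed.

(** The type of [u] over [A] and [x], rewritten over [y], is finitely satisfiable because the
    solvability of a finite part is a formula true of [x]; saturation realises it. *)
Lemma eqtp_realize P Q (u : asg N Q) (x y : asg N P) : cctx P -> cctx Q ->
  eqtp x y -> exists u', eqtp (acat u x) (acat u' y).
Proof.
move=> cP [idx inj] hxy.
pose T := {phi : formula (cadd (cadd Q P) (csub A)) | sat phi (acat (acat u x) (pin A))}.
pose R (phi : T) (z : asg N Q) := sat (sval phi) (acat (acat z y) (pin A)).
pose D : psets N := fun s => @A s `|` @prange S N P y s.
have hD : small D by apply: hsmall => //; exact: countable_prange.
have [||u' hu'] := realize hsat hsmall d (P := R) inj hD.
- move=> [phi hphi].
  pose f : ren (cadd (cadd Q P) (csub A)) (cadd Q (csub D)) := fun s v =>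
    match v with
    | inl (inl q) => inl q
    | inl (inr p) => inr (exist _ (y s p) (or_intror (ex_intro _ p erefl)))
    | inr a => inr (exist _ (sval a) (or_introl (svalP a)))
    end.
  have h := pdefinable_gen (definable_ren f (@definable_sat S N _ phi)).
  apply: (pdefinable_iff _ h) => e.
  rewrite /R /=; suff -> : acomp (acat e (pin D)) f = acat (acat e y) (pin A) by [].
  by apply: asg_ext => s [[]|].
- move=> l.
  pose E (e : asg N (cadd Q P)) := forall phi : T, List.In phi l ->
    sat (sval phi) (acat e (pin A)).
  have hE : pdefinable A E.
    apply: (pdefinable_and_list (P := fun (phi : T) e => sat (sval phi) (acat e (pin A)))).
    by move=> phi _; exists (sval phi).
  have := eqtp_pdefinable hxy (pdefinable_ex_ctx d hE).
  move=> [h _]; case: h => [|z hz]; first by exists u => phi _; exact: (svalP phi).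
  by exists z.
exists u'.
have one (phi : formula (cadd (cadd Q P) (csub A))) :
    sat phi (acat (acat u x) (pin A)) -> sat phi (acat (acat u' y) (pin A)).
  move=> h; exact: hu' (exist (fun phi => sat phi (acat (acat u x) (pin A))) phi h).
move=> phi; split; first exact: one.
by move=> h; apply: contrapT => h'; exact: (one (FImp phi (FBot _)) h' h).
Qed.

End Types.

(** * Indiscernible sequences from ultrafilters *)

Section Limits.
Variable U : set_system nat.
Hypothesis hU : UltraFilter U.
Hypothesis hfree : forall n, U [set m | (n < m)%N].

(* Iterated limit along [U] of a property of [n]-tuples of indices. *)
Fixpoint Lim n (Q : seq nat -> Prop) : Prop :=
  if n is m.+1 then U [set i | Lim m (fun t => Q (i :: t))] else Q [::].

Lemma Lim_imp n (Q Q' : seq nat -> Prop) : (forall t, Q t -> Q' t) -> Lim n Q -> Lim n Q'.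
Proof.
elim: n Q Q' => [|n IH] Q Q' h /=; first exact: h.
by apply: filterS => i /=; apply: IH => t; exact: h.
Qed.

Lemma Lim_and n (Q Q' : seq nat -> Prop) : Lim n Q -> Lim n Q' ->
  Lim n (fun t => Q t /\ Q' t).
Proof.
elim: n Q Q' => [|n IH] Q Q' //= h1 h2.
by apply: filterS (filterI h1 h2) => i [i1 i2]; exact: IH.
Qed.

Lemma Lim_true n (Q : seq nat -> Prop) : (forall t, Q t) -> Lim n Q.
Proof.
elim: n Q => [|n IH] Q h //=.
rewrite (_ : [set i | _] = setT); first exact: filterT.
by apply/seteqP; split=> // i _; apply: IH => t; exact: h.
Qed.

Lemma Lim_all n (T : Type) (l : seq T) (Q : T -> seq nat -> Prop) :
  (forall i, List.In i l -> Lim n (Q i)) -> Lim n (fun t => forall i, List.In i l -> Q i t).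
Proof.
elim: l => [|a l IH] h; first by apply: Lim_true.
have h1 := h a (or_introl erefl); have h2 := IH (fun i hi => h i (or_intror hi)).
apply: Lim_imp (Lim_and h1 h2) => t [k1 k2] i /= [<-//|]; exact: k2.
Qed.

Lemma Lim_em n (Q : seq nat -> Prop) : Lim n Q \/ Lim n (fun t => ~ Q t).
Proof.
elim: n Q => [|n IH] Q /=; first exact: EM.
have [h|h] := in_ultra_setVsetC [set i | Lim n (fun t => Q (i :: t))] hU; first by left.
by right; apply: filterS h => i /= h; case: (IH (fun t => Q (i :: t))).
Qed.

Lemma Lim_ex n (Q : seq nat -> Prop) m : Lim n Q ->
  exists t, [/\ size t = n, path ltn m t & Q t].
Proof.
elim: n Q m => [|n IH] Q m /= h; first by exists [::].
have [i [/= mi hi]] := filter_ex (filterI (hfree m) h).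
by have [t [h1 h2 h3]] := IH _ i hi; exists (i :: t); rewrite /= h1 mi.
Qed.

Lemma map_nth_cons (i : nat) t js : all (fun j => 0 < j)%N js ->
  [seq nth 0%N (i :: t) j | j <- js] = [seq nth 0%N t j | j <- map predn js].
Proof.
by move=> h; rewrite -map_comp; apply/eq_in_map => j hj; case: j hj (allP h j hj).
Qed.

(** The limit over a coordinate that does not occur is trivial for a proper filter. Hence the limit
    of a formula along increasing indices [js] depends only on their number, and this is where
    indiscernibility comes from. *)
Lemma Lim_dummy n (Q : seq nat -> Prop) js : sorted ltn js -> all (fun j => j < n)%N js ->
  (Lim n (fun t => Q [seq nth 0%N t j | j <- js]) <-> Lim (size js) Q).
Proof.
elim: n Q js => [|n IH] Q js hs ha.
  by case: js hs ha.
have pred_ok js' : sorted ltn js' -> all (fun j => 0 < j)%N js' ->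
    all (fun j => j < n.+1)%N js' ->
    sorted ltn (map predn js') /\ all (fun j => j < n)%N (map predn js').
  move=> h1 h2 h3; split; last first.
    by rewrite all_map; apply/allP => j hj /=; have := allP h2 j hj; have := allP h3 j hj; case: j {hj}.
  rewrite sorted_map; apply: (sub_in_sorted (P := fun j => (0 < j)%N)) h1.
    by move=> [|i] [|j].
  exact: h2.
have [pos|] := boolP (all (fun j => 0 < j)%N js).
  have [h1 h2] := pred_ok js hs pos ha.
  have e i : Lim n (fun t => Q [seq nth 0%N (i :: t) j | j <- js]) <-> Lim (size js) Q.
    rewrite -(size_map predn js) -(IH Q _ h1 h2).
    by split; apply: Lim_imp => t; rewrite map_nth_cons.
  rewrite /=; split=> h; first by have [i /e] := filter_ex h.
  by apply: filterS filterT => i _; apply/e.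
case: js hs ha => // -[|j] js /= hs ha; last first.
  move=> /negP[]; apply/allP => k hk.
  by have := order_path_min ltn_trans hs => /allP/(_ k hk); apply: leq_ltn_trans.
move=> _; have pos : all (fun j => 0 < j)%N js := order_path_min ltn_trans hs.
have [h1 h2] := pred_ok js (path_sorted hs) pos ha.
have e i : Lim n (fun t => Q (i :: [seq nth 0%N (i :: t) j | j <- js])) <->
    Lim (size js) (fun t => Q (i :: t)).
  rewrite -(size_map predn js) -(IH (fun t => Q (i :: t)) _ h1 h2).
  by split; apply: Lim_imp => t; rewrite map_nth_cons.
by split; apply: filterS => i /e.
Qed.

End Limits.

Lemma free_ultrafilter : exists U : set_system nat, UltraFilter U /\
  forall n, U [set m | (n < m)%N].
Proof.
have [U [hU sU]] := @ultraFilterLemma nat (\oo) _.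
by exists U; split=> // n; apply: sU; exists n.+1.
Qed.

Section Extend.
Variables (S : signature) (N : structure S).
Implicit Types V W P Q : ctx S.
Variable small : psets N -> Prop.
Hypothesis hsat : type_saturated small.
Hypothesis hsmall : small_addable small.
Variable d : forall s, N s.
Variable A : psets N.
Hypothesis hA : small A.

Lemma sorted_enum n (j : 'I_n -> nat) : {homo j : x y / (x < y)%N} ->
  sorted ltn [seq j i | i <- enum 'I_n].
Proof.
move=> hj; rewrite sorted_map; apply: (sub_sorted (e := relpre val ltn)).
  by move=> x y; exact: hj.
by rewrite -sorted_map val_enum_ord iota_ltn_sorted.
Qed.

Lemma nth_enum n (g : 'I_n -> nat) (i : 'I_n) : nth 0%N [seq g k | k <- enum 'I_n] i = g i.
Proof. by rewrite (nth_map i) ?size_enum_ord // nth_ord_enum. Qed.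

Lemma indiscernible_eqtp P (c : nat -> asg N P) i j : indiscernible A c -> eqtp A (c i) (c j).
Proof.
move=> hc phi.
pose f : ren (cadd P (csub A)) (cadd (fun s => ('I_1 * P s)%type) (csub A)) := fun s v =>
  match v with inl p => inl (ord0, p) | inr a => inr a end.
have hh (k : nat) : {homo (fun _ : 'I_1 => k) : x y / (x < y)%N}.
  by move=> x y; rewrite !ord1 ltnn.
have := hc 1%N _ _ (hh i) (hh j) (rename f phi).
have e k : acomp (acat (fun s (v : 'I_1 * P s) => c k s v.2) (pin A)) f = acat (c k) (pin A).
  by apply: asg_ext => s [].
by rewrite !sat_rename !e.
Qed.

(** Each $c_i$ is given a companion $b_i$ such that $(b_i,c_i)$ is conjugate to $(u,c_0)$. The pairs
    need not be indiscernible; [e] realises their iterated limit type along a free ultrafilter, with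
    its first term prescribed. Formulas true of [c] remain true because [c] is indiscernible. *)
Lemma indiscernible_extend P Q (c : nat -> asg N P) (u : asg N Q) :
  cctx P -> cctx Q -> indiscernible A c ->
  exists e : nat -> asg N (cadd Q P), [/\ e 0%N = acat u (c 0%N), indiscernible A e &
    forall m (phi : formula (cadd (fun s => ('I_m * P s)%type) (csub A))),
      sat phi (acat (fun s (v : 'I_m * P s) => c v.1 s v.2) (pin A)) ->
      sat phi (acat (fun s (v : 'I_m * P s) => e v.1 s (inr v.2)) (pin A))].
Proof.
move=> cP cQ hc; pose R := cadd Q P.
have [U [hU hfree]] := free_ultrafilter.
have ex i : exists b : asg N Q, eqtp A (acat u (c 0%N)) (acat b (c i)).
  exact: (eqtp_realize hsat hsmall d hA u cP cQ (indiscernible_eqtp 0 i hc)).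
pose E i : asg N R := acat (sval (cid (ex i))) (c i).
have hE i : eqtp A (acat u (c 0%N)) (E i) by exact: svalP (cid (ex i)).
pose ev n t : asg N (fun s => ('I_n * R s)%type) := fun s v => E (nth 0%N t v.1) s v.2.
pose QL n (chi : formula (cadd (fun s => ('I_n * R s)%type) (csub A))) t :=
  sat chi (acat (ev n t) (pin A)).
pose W : ctx S := fun s => (nat * R s)%type.
pose sel n (j : 'I_n -> nat) (x : asg N W) : asg N (fun s => ('I_n * R s)%type) :=
  fun s v => x s (j v.1, v.2).
pose T1 := {n : nat & {q : formula (cadd (fun s => ('I_n * R s)%type) (csub A)) * ('I_n -> nat)
  | {homo q.2 : x y / (x < y)%N} /\ Lim U n (QL n q.1)}}.
pose T := (T1 + {s & R s})%type.
pose e0 : asg N R := acat u (c 0%N).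
pose P1 (t : T1) (x : asg N W) :=
  sat (sval (projT2 t)).1 (acat (sel _ (sval (projT2 t)).2 x) (pin A)).
pose PT (t : T) (x : asg N W) := match t with
  | inl t => P1 t x
  | inr v => x _ (0%N, projT2 v) = e0 _ (projT2 v) end.
pose D : psets N := fun s => @A s `|` @prange S N R e0 s.
have hD : small D by apply: hsmall => //; apply: countable_prange; exact: cctx_cadd.
have [idx inj] : cctx W by apply: cctx_prod; exact: cctx_cadd.
have P1def t : pdefinable A (P1 t).
  case: t => n [[chi j] hq].
  pose f : ren (cadd (fun s => ('I_n * R s)%type) (csub A)) (cadd W (csub A)) := fun s v =>
    match v with inl v => inl (j v.1, v.2) | inr a => inr a end.
  have h := pdefinable_gen (definable_ren f (@definable_sat S N _ chi)).
  apply: (pdefinable_iff _ h) => x; rewrite /P1 /=.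
  suff -> : acomp (acat x (pin A)) f = acat (sel n j x) (pin A) by [].
  by apply: asg_ext => s [].
have [||x hx] := realize hsat hsmall d (P := PT) inj hD.
- move=> [t|[s v]]; first by apply: pdefinable_sub (P1def t) => s x; left.
  by apply: (@pdefinable_eq S N D W s (0%N, v)); right; exists v.
- move=> l.
  pose l1 := flatten [seq (match t with inl t => [:: t] | inr _ => [::] end) | t <- l].
  have hl1 t : List.In (inl t) l -> List.In t l1.
    rewrite /l1; elim: (l) => //= a l' IH [->|/IH h]; first by left.
    by apply/List.in_app_iff; right.
  have [n hn] : exists n, forall t, List.In t l1 -> forall i, ((sval (projT2 t)).2 i < n)%N.
    elim: l1 {hl1} => [|t l1 [n hn]]; first by exists 0%N.
    exists (maxn n (\max_i (sval (projT2 t)).2 i).+1) => t' /= [<-|ht'] i.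
      by rewrite leq_max orbC ltnS leq_bigmax.
    by rewrite leq_max hn.
  pose tx (t : seq nat) : asg N W := fun s v => E (nth 0%N t v.1) s v.2.
  have hLim : Lim U n.+1 (fun t => forall a, List.In a l1 -> P1 a (tx t)).
    apply: (Lim_all hU) => -[k [[chi j] /= [hj hchi]]] ha.
    have hs := sorted_enum hj.
    have hall : all (fun j => j < n.+1)%N [seq j i | i <- enum 'I_k].
      by apply/allP => z /mapP[i _ ->]; apply: leqW; exact: (hn _ ha i).
    have hX t : QL k chi [seq nth 0%N t j0 | j0 <- [seq j i | i <- enum 'I_k]] ->
        sat chi (acat (sel k j (tx t)) (pin A)).
      rewrite /QL; congr (sat chi (acat _ _)).
      apply: asg_ext => s [i v]; rewrite /ev /sel /tx /= -map_comp.
      by rewrite (nth_enum (fun i => nth 0%N t (j i))).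
    have hY : Lim U (size [seq j i | i <- enum 'I_k]) (QL k chi).
      by rewrite size_map size_enum_ord.
    exact: (Lim_imp hU hX (iffRL (Lim_dummy hU (QL k chi) hs hall) hY)).
  have [t [_ _ ht]] := Lim_ex hU hfree 0%N hLim.
  (* A finite part of the limit type holds along some increasing tuple [t] of indices. The first
     term of that tuple is then moved to [e0] by conjugacy, the other terms being quantified
     existentially. *)
  pose g : ren W (cadd W R) := fun s v => if v.1 == 0%N then inr v.2 else inl v.
  have gdef : pdefinable A (fun y : asg N R => exists x : asg N W,
      forall a, List.In a l1 -> P1 a (acomp (acat x y) g)).
    apply: (pdefinable_ex_ctx d (Q := fun z : asg N (cadd W R) =>
      forall a, List.In a l1 -> P1 a (acomp z g))).
    apply: (pdefinable_and_list (P := fun a (z : asg N (cadd W R)) => P1 a (acomp z g))).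
    by move=> a _; exact: (pdefinable_ren g (P1def a)).
  have [|z hz] := iffRL (eqtp_pdefinable (hE (nth 0%N t 0)) gdef).
    exists (tx t) => a ha; have := ht a ha; congr (P1 a _).
    apply: asg_ext => s [i v]; rewrite /acomp /g /=; case: eqP => [->|] //=.
  exists (acomp (acat z e0) g) => -[a /hl1|[s v] _]; first exact: hz.
  by rewrite /PT /acomp /g /=.
pose e k : asg N R := fun s v => x s (k, v).
have key n chi (j : 'I_n -> nat) : {homo j : x y / (x < y)%N} -> Lim U n (QL n chi) ->
    sat chi (acat (fun s (v : 'I_n * R s) => e (j v.1) s v.2) (pin A)).
  by move=> hj hL; exact: (hx (inl (existT _ n (exist _ (chi, j) (conj hj hL))))).
exists e; split.
- by apply: asg_ext => s v; exact: (hx (inr (existT _ s v))).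
- move=> n i j hi hj phi.
  have [h|h] := Lim_em hU n (QL n phi).
    by split=> _; exact: key.
  have h' : Lim U n (QL n (FImp phi (FBot _))) by exact: h.
  have hi' := key n _ i hi h'; have hj' := key n _ j hj h'.
  by split=> k; [case: (hi' k)|case: (hj' k)].
move=> m phi hphi.
pose f : ren (cadd (fun s => ('I_m * P s)%type) (csub A))
             (cadd (fun s => ('I_m * R s)%type) (csub A)) := fun s v =>
  match v with inl v => inl (v.1, inr v.2) | inr a => inr a end.
have fE (y : asg N (fun s => ('I_m * R s)%type)) :
    acomp (acat y (pin A)) f = acat (fun s (v : 'I_m * P s) => y s (v.1, inr v.2)) (pin A).
  by apply: asg_ext => s [].
have h0 : {homo (fun i : 'I_m => nat_of_ord i) : x y / (x < y)%N} by [].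
(* If the negation held in the limit, it would hold at some increasing tuple of terms of [c], hence
   at the first m terms. *)
have hL : Lim U m (QL m (rename f phi)).
  have [//|h] := Lim_em hU m (QL m (rename f phi)).
  have [t [st pt]] := Lim_ex hU hfree 0%N h; rewrite /QL sat_rename fE; case.
  have hj : {homo (fun i : 'I_m => nth 0%N t i) : x y / (x < y)%N}.
    move=> a b ab; apply: (sorted_ltn_nth ltn_trans) => //; rewrite ?inE ?st //.
    exact: path_sorted pt.
  exact: (iffLR (hc m _ _ h0 hj phi) hphi).
have := key m _ _ h0 hL.
by rewrite sat_rename fE.
Qed.

End Extend.

(** * Compositum of independent extensions *)

Section Domination.
Variable M : valuedField.
Hypothesis hHensel : henselian M.
Hypothesis hChar : [pchar (vk M)] =i pred0.
Variable A0 : set M.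
Hypothesis hA0 : coset_reps A0.
Variables (Ek : vk M -> vk M -> Prop) (EG : vG M -> vG M -> Prop).
Hypothesis hEk : field_iso Ek.
Hypothesis hEG : group_iso EG.
Variables HC HB : M -> M -> Prop.
Hypothesis gC : good A0 Ek EG HC.
Hypothesis gB : good A0 Ek EG HB.
Variable A1 : set M.
Hypothesis A1C : forall a, A1 a -> HC a a.
Hypothesis A1B : forall a, A1 a -> HB a a.
Hypothesis A1div : forall a b, A1 a -> A1 b -> A1 (a / b).
Hypothesis A10 : A1 0.

Hypothesis sepC : forall (I : finType) (v v' : I -> M), (forall i, HC (v i) (v' i)) ->
  exists m (w w' : 'I_m -> M) (a : I -> 'I_m -> M),
    [/\ forall l, HC (w l) (w' l) /\ w l != 0, forall i l, A1 (a i l),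
        forall i, v i = \sum_l a i l * w l &
        forall f : 'I_m -> M, (forall l, A1 (f l)) ->
          forall l, dle (f l * w l) (\sum_k f k * w k)].

(** Linear disjointness of the residues, stated with representatives: residues from [HC] that are
    independent over the base stay independent over [HB]. *)
Hypothesis linC : forall (J : finType) (u u' : J -> M), (forall j, HC (u j) (u' j)) ->
  (forall j, dle (u j) 1) ->
  (forall a : J -> M, (forall j, A1 (a j)) -> (forall j, dle (a j) 1) ->
    dlt (\sum_j a j * u j) 1 -> forall j, dlt (a j) 1) ->
  forall s s' : J -> M, (forall j, HB (s j) (s' j)) -> (forall j, dle (s j) 1) ->
    dlt (\sum_j s j * u j) 1 -> forall j, dlt (s j) 1.

Hypothesis valC : forall c c' b b', HC c c' -> HB b b' -> c != 0 -> vval c = vval b ->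
  exists2 a, A1 a & vval a = vval c.

(* By separatedness, linear disjointness of the residues and independence of the
   values, a nonzero sum [\sum_i c_i b_i] has the leading term of some [c b t] with
   [t] a unit, so that the ring [Rdom] and the group [Hdom] satisfy [good_frac]. *)
Definition Rdom x x' := exists (I : finType) (c c' b b' : I -> M),
  [/\ forall i, HC (c i) (c' i), forall i, HB (b i) (b' i),
      x = \sum_i c i * b i & x' = \sum_i c' i * b' i].

Definition Hdom z z' := exists c c' b b' t t',
  [/\ HC c c' /\ c != 0, HB b b' /\ b != 0, ER Ek t t' /\ dle 1 t,
      z = c * b * t & z' = c' * b' * t'].

Lemma Rdom_1 : Rdom 1 1.
Proof.
exists unit, (fun=> 1), (fun=> 1), (fun=> 1), (fun=> 1).
rewrite !big_const card_unit /= mulr1 addr0; split=> // _; [exact: g_1 gC|exact: g_1 gB].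
Qed.

Lemma Rdom_B x x' y y' : Rdom x x' -> Rdom y y' -> Rdom (x - y) (x' - y').
Proof.
move=> [I [c [c' [b [b' [h1 h2 -> ->]]]]]] [J [d [d' [e [e' [k1 k2 -> ->]]]]]].
pose f (T : Type) (p : I -> T) (q : J -> T) (i : I + J) := match i with inl i => p i | inr j => q j end.
exists (I + J)%type, (f _ c (fun j => - d j)), (f _ c' (fun j => - d' j)), (f _ b e), (f _ b' e').
split; [case=> i //=; exact: (g_N gC)|by case=> i //=| |]; rewrite big_sumType /= -sumrN;
  by congr (_ + _); apply: eq_bigr => j _; rewrite mulNr.
Qed.

Lemma Rdom_M x x' y y' : Rdom x x' -> Rdom y y' -> Rdom (x * y) (x' * y').
Proof.
move=> [I [c [c' [b [b' [h1 h2 -> ->]]]]]] [J [d [d' [e [e' [k1 k2 -> ->]]]]]].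
exists (I * J)%type, (fun p => c p.1 * d p.2), (fun p => c' p.1 * d' p.2),
  (fun p => b p.1 * e p.2), (fun p => b' p.1 * e' p.2).
split=> [p|p||]; [exact: (g_M gC)|exact: (g_M gB)| |];
  by rewrite big_distrlr pair_big /=; apply: eq_bigr => p _; rewrite mulrACA.
Qed.

Lemma Hdom_div x x' y y' : Hdom x x' -> Hdom y y' -> Hdom (x / y) (x' / y').
Proof.
move=> [c [c' [b [b' [t [t' [[h1 c0] [h2 b0] [h3 t1] -> ->]]]]]]].
move=> [d [d' [e [e' [s [s' [[k1 d0] [k2 e0] [k3 s1] -> ->]]]]]]].
exists (c / d), (c' / d'), (b / e), (b' / e'), (t / s), (t' / s'); rewrite !mulf_div; split=> //.
- by rewrite mulf_neq0 ?invr_neq0 //; split=> //; exact: (g_div gC h1 k1).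
- by rewrite mulf_neq0 ?invr_neq0 //; split=> //; exact: (g_div gB h2 k2).
split; first by apply: ER_mul => //; exact: ER_inv.
by rewrite dle_1div ?(unit_neq0 s1) //; case: k3 => k3 _ _; exact: dle_trans t1.
Qed.

(** If $cbt$ is a unit, then $\mathrm{val}(c)=\mathrm{val}(b^{-1})$, and independence of the values
    provides a base element [a] of this value. Then $c/a$ and $ab$ are units, whose residues are
    handled separately in [HC] and [HB]. *)
Lemma Hdom_nice z z' : Hdom z z' -> nice Ek EG z z'.
Proof.
move=> [c [c' [b [b' [t [t' [[h1 c0] [h2 b0] [h3 t1] ez ez']]]]]]].
have Vc := g_EV gC h1 c0; have Vb := g_EV gB h2 b0; have Vt := EV_unit hEk hEG h3 t1.
have hV : EV EG z z' by rewrite ez ez'; exact: (EV_mul hEG (EV_mul hEG Vc Vb) Vt).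
have [z0 z0'] := EV_neq0 hV; split=> //; last first.
  apply: coset_isP => //; rewrite ez ez'; apply: coset_mul; first apply: coset_mul.
  - exact: (coset_G hA0 gC).
  - exact: (coset_G hA0 gB).
  - exact: (coset_unit hHensel hChar hA0 hEk hEG gC h3 t1).
move=> z1; have [z2|hlt] := boolP (dle 1 z); last first.
  apply: ER_small => //.
  by have := EV_lt hEG hV (EV_1 hEG); rewrite /dlt hlt => <-.
have vt : vval t = vval (1 : M) by case: h3 => ? _ _; apply/deqP.
have vz : vval z = vval (1 : M) by apply/deqP.
have vcb : vval (c * b) = vval (1 : M).
  by rewrite -vz ez (vval_mul (erefl (vval (c * b))) vt) mulr1.
have vc : vval c = vval b^-1.
  by rewrite -[c](mulfK b0) (vval_mul vcb (erefl _)) mul1r.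
have [a ha va] := valC h1 (g_V gB h2) c0 vc.
have a0 : a != 0 by rewrite (vval_eq0 va).
have e1 : z = (c / a) * (a * b) * t by rewrite ez mulrA divfK.
have e2 : z' = (c' / a) * (a * b') * t' by rewrite ez' mulrA divfK.
have v1 : vval (c / a) = vval (1 : M) by rewrite (vval_mul (esym va) (erefl _)) divff.
have v2 : vval (a * b) = vval (1 : M) by rewrite (vval_mul va (erefl _)).
rewrite e1 e2; apply: ER_mul => //; apply: ER_mul => //.
  apply: (g_ER hEk gC); first exact: (g_div gC h1 (A1C ha)).
  by have /deqP[] := v1.
apply: (g_ER hEk gB); first exact: (g_M gB (A1B ha) h2).
by have /deqP[] := v2.
Qed.

(** Rewriting the sum over a separated family [w] and dividing by a term $pq$ of largest value
    leaves a sum [t] of elements of the valuation ring. Its terms of value 0 factor into units from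
    [HC] and [HB], and [t] is a unit because the residues of the former factors stay independent
    over those of [HB]. *)
Lemma Rdom_lead x x' : Rdom x x' -> (x = 0 /\ x' = 0) \/
  exists z z', [/\ Hdom z z', aeq x z & aeq x' z'].
Proof.
move=> [I [c [c' [b [b' [h1 h2 ex ex']]]]]].
have [m [w [w' [a [hw hA1 hc hsep]]]]] := sepC h1.
have hc' i : c' i = \sum_l a i l * w' l.
  apply: (g_fun gC (h1 i)); rewrite hc; apply: (g_sum gC) => l _.
  by apply: (g_M gC); [exact: A1C|case: (hw l)].
pose be l := \sum_i a i l * b i; pose be' l := \sum_i a i l * b' i.
have hbe l : HB (be l) (be' l).
  by apply: (g_sum gB) => i _; apply: (g_M gB) => //; exact: A1B.
have swap (p : I -> M) (q : 'I_m -> M) :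
    \sum_i (\sum_l a i l * q l) * p i = \sum_l q l * (\sum_i a i l * p i).
  under eq_bigr do rewrite mulr_suml.
  rewrite exchange_big /=; apply: eq_bigr => l _; rewrite mulr_sumr.
  by apply: eq_bigr => i _; rewrite mulrCA mulrA.
have {}ex : x = \sum_l w l * be l.
  by rewrite ex -swap; apply: eq_bigr => i _; rewrite hc.
have {}ex' : x' = \sum_l w' l * be' l.
  by rewrite ex' -swap; apply: eq_bigr => i _; rewrite hc'.
have [[k0 bk0]|all0] := pselect (exists k, be k != 0); last first.
  have z k : be k = 0 by apply/eqP; apply: contrapT => /negP h; apply: all0; exists k.
  have z' k : be' k = 0 by apply/eqP; rewrite -(g_eq0 gB (hbe k)) z eqxx.
  left; rewrite ex ex'; split; apply: big1 => l _; by rewrite ?z ?z' mulr0.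
right.
case: m w w' a be be' hw hA1 hc hsep hc' hbe swap ex ex' k0 bk0 => [|m] w w' a be be'
  hw hA1 hc hsep hc' hbe swap ex ex' k0 bk0; first by case: k0 {bk0}.
have [l0 hl0] := argmax (fun l => w l * be l).
have w0 l : w l != 0 by case: (hw l).
have hw1 l : HC (w l) (w' l) by case: (hw l).
have b0 : be l0 != 0.
  apply/eqP => e; have := hl0 k0; rewrite e mulr0 dlex0 mulf_eq0 (negbTE (w0 k0)).
  by rewrite (negbTE bk0).
pose p := w l0; pose q := be l0; pose p' := w' l0; pose q' := be' l0.
have p0 : p != 0 := w0 l0; have q0 : q != 0 := b0.
have p0' : p' != 0 by rewrite -(g_eq0 gC (hw1 l0)).
have q0' : q' != 0 by rewrite -(g_eq0 gB (hbe l0)).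
have pq0 : p * q != 0 by rewrite mulf_neq0.
have pq0' : p' * q' != 0 by rewrite mulf_neq0.
have Vpq : EV EG (p * q) (p' * q').
  exact: (EV_mul hEG (g_EV gC (hw1 l0) p0) (g_EV gB (hbe l0) q0)).
pose inJ l := vval (w l * be l) == vval (p * q).
have be0 l : inJ l -> be l != 0.
  move/eqP/vval_eq0; rewrite (negbTE pq0) mulf_eq0 (negbTE (w0 l)) => /= h.
  by rewrite h.
(* For a term of maximal value, [w l / p] and [q / be l] have the same value, so it is the value of
   a base element [al l]. Shifting [al l] from one factor to the other makes both [u l] and [s l]
   units. *)
have alpha_ex l : exists al, inJ l -> A1 al /\ vval al = vval (w l / p).
  have [hl|] := boolP (inJ l); last by exists 0.
  have bl0 := be0 l hl.
  have vv : vval (w l / p) = vval (q / be l).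
    have -> : w l / p = (w l * be l) / (p * be l) by rewrite -mulf_div divff ?mulr1.
    rewrite (vval_mul (eqP hl) (erefl _)); have -> // : p * q / (p * be l) = q / be l.
    by rewrite -mulf_div divff // mul1r.
  have wp0 : w l / p != 0 by rewrite mulf_neq0 ?invr_neq0.
  have [al h3 h4] := valC (g_div gC (hw1 l) (hw1 l0)) (g_div gB (hbe l0) (hbe l)) wp0 vv.
  by exists al.
pose al l := sval (cid (alpha_ex l)).
have hal l : inJ l -> A1 (al l) /\ vval (al l) = vval (w l / p) := svalP (cid (alpha_ex l)).
have al0 l : inJ l -> al l != 0.
  move=> hl; have [_ e] := hal l hl.
  by rewrite (vval_eq0 e) mulf_neq0 ?invr_neq0.
pose u l := w l / p / al l; pose u' l := w' l / p' / al l.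
pose s l := be l * al l / q; pose s' l := be' l * al l / q'.
have hu l : inJ l -> HC (u l) (u' l).
  move=> hl; have [h3 _] := hal l hl.
  exact: (g_div gC (g_div gC (hw1 l) (hw1 l0)) (A1C h3)).
have hs l : inJ l -> HB (s l) (s' l).
  move=> hl; have [h3 _] := hal l hl.
  exact: (g_div gB (g_M gB (hbe l) (A1B h3)) (hbe l0)).
have vu l : inJ l -> vval (u l) = vval (1 : M).
  move=> hl; have [_ e] := hal l hl.
  by rewrite /u (vval_mul (esym e) (erefl _)) divff // al0.
have us l : inJ l -> u l * s l = w l * be l / (p * q).
  move=> hl; have := al0 l hl => a0; rewrite /u /s.
  have -> : w l / p / al l * (be l * al l / q) = w l * be l / (p * q) * (al l / al l).
    by rewrite !invfM; ring.
  by rewrite divff // mulr1.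
have us' l : inJ l -> u' l * s' l = w' l * be' l / (p' * q').
  move=> hl; have := al0 l hl => a0; rewrite /u' /s'.
  have -> : w' l / p' / al l * (be' l * al l / q') = w' l * be' l / (p' * q') * (al l / al l).
    by rewrite !invfM; ring.
  by rewrite divff // mulr1.
have vs l : inJ l -> vval (s l) = vval (1 : M).
  move=> hl; have : vval (u l * s l) = vval (1 : M).
    by rewrite us // (vval_mul (eqP hl) (erefl _)) divff.
  by rewrite (vval_mul (vu l hl) (erefl _)) mul1r.
pose t := x / (p * q); pose t' := x' / (p' * q').
have et : t = \sum_l w l * be l / (p * q) by rewrite /t ex mulr_suml.
have et' : t' = \sum_l w' l * be' l / (p' * q') by rewrite /t' ex' mulr_suml.
have small l : ~~ inJ l -> dlt (w l * be l / (p * q)) 1.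
  move=> hl; rewrite dlt_div1 // /dlt; apply/negP => hle.
  by move/negP: hl; apply; apply/eqP/deqP; split=> //; exact: hl0.
have htt : ER Ek t t'.
  rewrite et et'; apply: (ER_sum hEk) => l _.
  have [hl|hl] := boolP (inJ l).
    rewrite -us // -us' //; apply: (ER_mul hEk).
      by apply: (g_ER hEk gC); [exact: hu|have /deqP[] := vu l hl].
    by apply: (g_ER hEk gB); [exact: hs|have /deqP[] := vs l hl].
  apply: (ER_small hEk); first exact: small.
  have [bl|bl] := eqVneq (be l) 0.
    have /eqP -> : be' l == 0 by rewrite -(g_eq0 gB (hbe l)) bl.
    by rewrite mulr0 mul0r dlt0x oner_neq0.
  have Vl := EV_mul hEG (g_EV gC (hw1 l) (w0 l)) (g_EV gB (hbe l) bl).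
  by rewrite dlt_div1 // -(EV_lt hEG Vl Vpq) -dlt_div1 //; exact: small.
have t1 : dle 1 t.
  rewrite dleNgt; apply/negP => tlt.
  pose J : finType := {l : 'I_m.+1 | inJ l}.
  have sumJ (f : 'I_m.+1 -> M) : \sum_(j : J) f (val j) = \sum_(l | inJ l) f l.
    by rewrite [RHS]big_sub.
  have l0J : inJ l0 by rewrite /inJ.
  have hJ : dlt (\sum_(j : J) s (val j) * u (val j)) 1.
    rewrite (sumJ (fun l => s l * u l)).
    have -> : \sum_(l | inJ l) s l * u l = t - \sum_(l | ~~ inJ l) w l * be l / (p * q).
      have -> : t = \sum_(l | inJ l) w l * be l / (p * q) +
          \sum_(l | ~~ inJ l) w l * be l / (p * q) by rewrite et (bigID inJ).
      by rewrite addrK; apply: eq_bigr => l hl; rewrite mulrC us.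
    apply: dltB => //; apply: dlt_sum => [|l hl]; [exact: oner_neq0|exact: small].
  have := @linC J (fun j => u (val j)) (fun j => u' (val j)) (fun j => hu _ (valP j)) _ _
    (fun j => s (val j)) (fun j => s' (val j)) (fun j => hs _ (valP j)) _ hJ (Sub l0 l0J).
  rewrite /= => h; have /deqP[_ k] := vs l0 l0J; apply: (dltNle _ k); apply: h.
  - by move=> j; have /deqP[] := vu _ (valP j).
  - move=> f hf f1 hlt j.
    (* A residue relation among the [u] over the base, multiplied by [p], becomes a combination of
       the [w] with base coefficients, zero outside of [J]. Separatedness bounds each of its terms
       by the sum, so the relation is trivial. *)
    pose g (l : 'I_m.+1) := if insub l is Some j then f j / al l else 0 : M.
    have gA l : A1 (g l).
      rewrite /g; case: insubP => [i hi ei|_]; last exact: A10.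
      by apply: A1div => //; have [] := hal l hi.
    have eqJ (i : J) : f i * u (val i) * p = f i / al (val i) * w (val i).
      have -> : f i * u (val i) * p = f i / al (val i) * w (val i) * (p / p).
        by rewrite /u; ring.
      by rewrite divff // mulr1.
    have eg : \sum_k g k * w k = (\sum_(j : J) f j * u (val j)) * p.
      rewrite (bigID inJ) /= [X in _ + X]big1 ?addr0; last first.
        by move=> l hl; rewrite /g insubN // mul0r.
      rewrite -(sumJ (fun k => g k * w k)) /= mulr_suml; apply: eq_bigr => i _.
      by rewrite eqJ /g valK.
    have := hsep g gA (val j); rewrite eg /g valK => hle.
    have : dlt (f j * u (val j)) 1.
      rewrite -(dltM2r _ _ p0) mul1r eqJ.
      by apply: dle_lt_trans hle _; rewrite -[X in dlt _ X]mul1r dltM2r.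
    by rewrite (dlt_eql _ (vval_mul (erefl (vval (f j))) (vu _ (valP j)))) mulr1.
  - by move=> j; have /deqP[] := vs _ (valP j).
have ext : x = p * q * t by rewrite /t mulrC divfK.
have ext' : x' = p' * q' * t' by rewrite /t' mulrC divfK.
have t1' : dle 1 t' by rewrite -(ER_unit hEk htt).
exists x, x'; split.
- by exists p, p', q, q', t, t'; split=> //; split=> //; [exact: hw1|exact: hbe].
- by apply: aeq_refl; rewrite ext mulf_neq0 // unit_neq0.
- by apply: aeq_refl; rewrite ext' mulf_neq0 // unit_neq0.
Qed.

Lemma good_compositum : exists G, [/\ good A0 Ek EG G, forall x x', HC x x' -> G x x' &
  forall x x', HB x x' -> G x x'].
Proof.
have sC x x' : HC x x' -> Rdom x x'.
  move=> h; exists unit, (fun=> x), (fun=> x'), (fun=> 1), (fun=> 1).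
  by rewrite !big_const card_unit /= !mulr1 !addr0; split=> // _; exact: g_1 gB.
have sB x x' : HB x x' -> Rdom x x'.
  move=> h; exists unit, (fun=> 1), (fun=> 1), (fun=> x), (fun=> x').
  by rewrite !big_const card_unit /= !mul1r !addr0; split=> // _; exact: g_1 gC.
have := @good_frac M hHensel hChar A0 Ek EG Rdom Hdom Rdom_1 Rdom_B Rdom_M _ Hdom_nice
  Hdom_div Rdom_lead.
set G := (fun x x' => _) => hG; exists G; split.
- by apply: hG => a ha; apply: sC; exact: (g_A gC ha).
- move=> x x' h; exists x, x', 1, 1; rewrite oner_neq0 !divr1; split=> //.
    exact: sC.
  exact: Rdom_1.
- move=> x x' h; exists x, x', 1, 1; rewrite oner_neq0 !divr1; split=> //.
    exact: sB.
  exact: Rdom_1.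
Qed.

End Domination.

(** * Cardinality of parameter sets *)

Lemma card_le_inj (T U : Type) (X : set T) (E : set U) (u0 : U) :
  X #<= E -> exists f : T -> U, (forall x, X x -> E (f x)) /\ {in X &, injective f}.
Proof.
move=> /card_leP[f]; exists (fun x => if pselect (X x) is left h
  then val (f (exist _ x (mem_set h))) else u0).
split=> [x hx|x y]; first by case: pselect => // h; exact: set_mem (valP (f _)).
rewrite !inE => hx hy; case: pselect => // h; case: pselect => // h'.
move=> /val_inj/(@inj _ _ _ f); rewrite !inE => /(_ I I) e.
exact: (f_equal val e).
Qed.

(** Room for [Y] is made along an injective sequence [i] in [E]: images of [X] that lie on the
    sequence move to its even places, and the elements of [Y] outside of [X] take the odd ones. *)
Lemma card_leU_countable (T U : Type) (X Y : set T) (E : set U) :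
  infinite_set E -> X #<= E -> countable Y -> X `|` Y #<= E.
Proof.
move=> infE XE /countable_injP[h hinj].
have [u0 _] : E !=set0 by apply/set0P/eqP => E0; apply: infE; rewrite E0; exact: finite_set0.
move: infE => /infiniteP/(card_le_inj u0)[i [iE' iinj']].
have [f [fE finj']] := card_le_inj u0 XE.
have iE n : E (i n) by exact: iE'.
have iinj : injective i by move=> a b; apply: iinj'; rewrite inE.
have finj x y : X x -> X y -> f x = f y -> x = y.
  by move=> hx hy; apply: finj'; rewrite inE.
pose g x := match pselect (X x) with
  | left _ => match pselect (exists k, f x = i k) with
              | left hk => i (sval (cid hk)).*2
              | right _ => f x end
  | right _ => i (h x).*2.+1 end.
suff [gE ginj] : (forall x, (X `|` Y) x -> E (g x)) /\ {in X `|` Y &, injective g}.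
  have [F] : $|{injfun (X `|` Y) >-> E}| by apply/injfunPex; exists g.
  exact: inj_card_le F.
have gP x : [\/ exists k, [/\ X x, f x = i k & g x = i k.*2],
    [/\ X x, forall k, f x <> i k & g x = f x] | ~ X x /\ g x = i (h x).*2.+1].
  rewrite /g; case: pselect => hX; last by constructor 3.
  case: pselect => [hk|no].
    by constructor 1; exists (sval (cid hk)); split=> //; exact: svalP (cid hk).
  by constructor 2; split=> // k e; apply: no; exists k.
split=> [x hx|x y].
  by have [[k [_ _ ->]]|[h1 _ ->]|[_ ->]] := gP x; [exact: iE|exact: fE|exact: iE].
rewrite !inE => hx hy.
have par a b : i a.*2 <> i b.*2.+1.
  by move=> /iinj/(f_equal odd); rewrite /= !odd_double.
have [[k [h1 h2 ->]]|[h1 h2 ->]|[h1 ->]] := gP x;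
  have [[l [k1 k2 ->]]|[k1 k2 ->]|[k1 ->]] := gP y.
- by move=> /iinj/double_inj e; apply: finj => //; rewrite h2 k2 e.
- by move=> e; case: (k2 k.*2).
- by move/par.
- by move/h2.
- exact: finj.
- by move/h2.
- by move/esym/par.
- by move/esym/k2.
- move=> /iinj/eq_add_S/double_inj e; apply: hinj => //; rewrite inE.
    by case: hx.
  by case: hy.
Qed.

(** * Nondividing types along indiscernible sequences *)

Section Transport.
Variables (S : signature) (N : structure S).
Implicit Types V W X : ctx S.

Definition pairs_of W (x x' : asg N W) : forall s, N s -> N s -> Prop :=
  fun s a b => exists w : W s, x s w = a /\ x' s w = b.

(** One implication is enough because formulas are closed under negation. *)
Lemma elem_pairs_of W (x x' : asg N W) :
  (forall phi : formula W, sat phi x -> sat phi x') -> elem_rel (pairs_of x x').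
Proof.
move=> h; suff main V (phi : formula V) e e' :
    (forall s v, pairs_of x x' (e s v) (e' s v)) -> sat phi e -> sat phi e'.
  move=> V phi e e' hee; split; first exact: main.
  by move=> he'; apply: contrapT => he; exact: (main V (FImp phi (FBot V)) e e' hee he he').
move=> hee.
pose f : ren V W := fun s v => sval (cid (hee s v)).
have hf s v : x s (f s v) = e s v /\ x' s (f s v) = e' s v := svalP (cid (hee s v)).
have e1 : acomp x f = e by apply: asg_ext => s v; have [] := hf s v.
have e2 : acomp x' f = e' by apply: asg_ext => s v; have [] := hf s v.
by move=> hphi; have := h (rename f phi); rewrite !sat_rename e1 e2; apply.
Qed.

Variable d : forall s, N s.

(** [formula_divides] wants finitely many parameters in every sort. Every sort gets one for each
    entry of the support list; a position carries its variable if this is a parameter of that sort,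
    and the default [d] otherwise. *)
Lemma finite_params X V (phi : formula (cadd X V)) :
  exists (n : nat) (phi' : formula (cadd X (fun _ => 'I_n))) (g : forall s, 'I_n -> option (V s)),
    forall (x : asg N X) (y : asg N V),
      sat phi (acat x y) <-> sat phi' (acat x (fun s i => oapp (y s) (d s) (g s i))).
Proof.
have [l [phi0 h0]] := formula_support N phi.
have [El|[v0 _]] : l = [::] \/ exists v0 : {s & cadd X V s}, True.
  - by case: (l) => [|v0 l']; [left|right; exists v0].
  subst l; exists 0%N.
  pose f : ren (@listed _ (cadd X V) [::]) (cadd X (fun _ => 'I_0)) := fun s v =>
    False_rect _ (svalP v).
  exists (rename f phi0), (fun s i => None) => x y.
  rewrite h0 sat_rename; set a := acomp _ _; set b := acomp _ _.
  by have -> : a = b by apply: asg_ext => s [].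
pose n := size l.
pose get s (u : {s & cadd X V s}) : option (V s) :=
  match u with
  | existT s' (inr v) => match pselect (s' = s) with
      | left e => Some (eq_rect s' V v s e) | right _ => None end
  | _ => None end.
have getE s v : get s (existT _ s (inr v)) = Some v.
  rewrite /get; case: pselect => // e.
  by rewrite (Prop_irrelevance e erefl).
have pos_ex (u : {s & cadd X V s}) : List.In u l -> exists i : 'I_n, List.nth i l v0 = u.
  move=> /(@List.In_nth _ _ _ v0)[i [hi e]].
  have hi' : (i < n)%N by apply/ssrnat.ltP.
  by exists (Ordinal hi').
pose f : ren (listed l) (cadd X (fun _ => 'I_n)) := fun s v =>
  match v with
  | exist (inl x) _ => inl x
  | exist (inr y) hv => inr (sval (cid (pos_ex _ hv)))
  end.
exists n, (rename f phi0), (fun s i => get s (List.nth i l v0)) => x y.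
rewrite h0 sat_rename; set a := acomp _ _; set b := acomp _ _.
suff -> : a = b by [].
apply: asg_ext => s [[v|v] hv]; rewrite /a /b /acomp //=.
by rewrite (svalP (cid (pos_ex _ hv))) getE.
Qed.

(** If some finite conjunction [Phi] had no common solution along [b], it would divide over [A],
    although with the parameters $b_0$ from [B] it belongs to the type. So a single [y] serves all
    $b_i$. *)
Lemma nondividing_realize (small : psets N -> Prop) (A B C : psets N) (VC VB : ctx S)
    (rho : asg N VC) (b : nat -> asg N VB) :
  type_saturated small -> small_addable small -> small A ->
  cctx VC -> cctx VB -> (forall s, A s (d s)) -> (forall s, A s `<=` B s) ->
  (forall s v, C s (rho s v)) -> (forall s v, B s (b 0%N s v)) ->
  indiscernible A b -> ~ type_divides A (tp C B) ->
  exists y : asg N VC, forall i (phi : formula (cadd VC (cadd VB (csub A)))),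
    sat phi (acat rho (acat (b 0%N) (pin A))) -> sat phi (acat y (acat (b i) (pin A))).
Proof.
move=> hsat hsmall hA [idx inj] cVB dA AB rhoC bB hind nd.
pose T := (nat * {phi : formula (cadd VC (cadd VB (csub A))) |
  sat phi (acat rho (acat (b 0%N) (pin A)))})%type.
pose P (t : T) (y : asg N VC) := sat (sval t.2) (acat y (acat (b t.1) (pin A))).
pose bb : asg N (fun s => (nat * VB s)%type) := fun s v => b v.1 s v.2.
pose D : psets N := fun s => A s `|` @prange S N _ bb s.
have hD : small D by apply: hsmall => //; apply: countable_prange; exact: cctx_prod.
have [||y hy] := realize hsat hsmall d (P := P) inj hD.
- move=> [i [phi hphi]].
  pose f : ren (cadd VC (cadd VB (csub A))) (cadd VC (csub D)) := fun s v =>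
    match v with
    | inl v => inl v
    | inr (inl v) => inr (exist _ (b i s v) (or_intror (ex_intro _ (i, v) erefl)))
    | inr (inr a) => inr (exist _ (sval a) (or_introl (svalP a)))
    end.
  have h := pdefinable_gen (definable_ren f (@definable_sat S N _ phi)).
  apply: (pdefinable_iff _ h) => e; rewrite /P /=.
  suff -> : acomp (acat e (pin D)) f = acat e (acat (b i) (pin A)) by [].
  by apply: asg_ext => s [|[]].
- move=> l.
  have [Phi hPhi] := definable_and_list (P := fun (t : T) e => sat (sval t.2) e) l
    (fun t => @definable_sat S N _ (sval t.2)).
  pose m := (\max_(t <- l) t.1).+1.
  have hm t : List.In t l -> (t.1 < m)%N.
    rewrite /m ltnS; elim: (l) => //= a l' IH; rewrite big_cons => -[->|/IH h].
      exact: leq_maxl.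
    exact: leq_trans h (leq_maxr _ _).
  suff [y hy] : exists y, forall i : 'I_m, sat Phi (acat y (acat (b i) (pin A))).
    exists y => t ht; have := hy (Ordinal (hm t ht)); rewrite hPhi => h; exact: h.
  apply: contrapT => none; apply: nd.
  have [n [phi' [g hg]]] := finite_params Phi.
  pose bA i : asg N (cadd VB (csub A)) := acat (b i) (pin A).
  pose c i : asg N (fun _ => 'I_n) := fun s k => oapp (bA i s) (d s) (g s k).
  have cB s k : B s (c 0%N s k).
    rewrite /c; case: (g s k) => [[v|[a ha]]|] /=; first exact: bB.
      exact: AB.
    exact: AB.
  pose toC : ren VC (csub C) := fun s v => exist _ (rho s v) (rhoC s v).
  pose phiC : formula (cadd (csub C) (fun s => 'I_n)) :=
    rename (@lift_ren S VC (csub C) toC (fun _ => 'I_n)) phi'.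
  have phiCE (x : asg N (csub C)) i : sat phiC (acat x (c i)) <->
      sat Phi (acat (acomp x toC) (acat (b i) (pin A))).
    rewrite sat_rename hg; set u := acomp _ _; set w := acat _ _.
    by have -> : u = w by apply: asg_ext => s [].
  pose toB : ren (cadd (csub C) (fun _ => 'I_n)) (cadd (csub C) (csub B)) := fun s v =>
    match v with inl x => inl x | inr k => inr (exist _ (c 0%N s k) (cB s k)) end.
  have toBE (x : asg N (csub C)) : acomp (acat x (pin B)) toB = acat x (c 0%N).
    by apply: asg_ext => s [].
  exists (fun=> n), phiC, (c 0%N); split.
    exists 1%N, (fun=> rename toB phiC); split=> [_|x h].
      rewrite /tp /= sat_rename toBE phiCE hPhi => t ht.
      suff -> : acomp (pin C) toC = rho by exact: (svalP t.2).
      by apply: asg_ext.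
    by have := h ord0; rewrite sat_rename toBE.
  exists c; split=> //; last first.
    exists m => -[x hx]; apply: none; exists (acomp x toC) => i.
    by rewrite -phiCE.
  move=> k i j hi hj chi.
  (* The entries of the repackaged tuple come from [b], from [A], or are the default, which lies in
     [A]; so the new sequence is indiscernible along with [b]. *)
  pose f : ren (cadd (fun s => ('I_k * 'I_n)%type) (csub A))
               (cadd (fun s => ('I_k * VB s)%type) (csub A)) := fun s v =>
    match v with
    | inl (p, q) => match g s q with
        | Some (inl w) => inl (p, w)
        | Some (inr a) => inr a
        | None => inr (exist _ (d s) (dA s)) end
    | inr a => inr a
    end.
  have fE (r : 'I_k -> nat) :
      acomp (acat (fun s (v : 'I_k * VB s) => b (r v.1) s v.2) (pin A)) f =
      acat (fun s (v : 'I_k * 'I_n) => c (r v.1) s v.2) (pin A).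
    apply: asg_ext => s [[p q]|//]; rewrite /acomp /= /c.
    by case: (g s q) => [[]|].
  by rewrite -!fE -!sat_rename; exact: hind.
exists y => i phi hphi.
exact: (hy (i, exist (fun phi => sat phi (acat rho (acat (b 0%N) (pin A)))) phi hphi)).
Qed.

End Transport.

(** * Partial maps onto a sort *)

(** No decidable equality on the index type is assumed; any two proofs of an equality are identified
    instead. *)
Lemma existT_inj (T : Type) (P : T -> Type) x (a b : P x) :
  existT P x a = existT P x b -> a = b.
Proof.
move=> e; suff gen p q (h : projT1 p = projT1 q) : p = q :> {x & P x} ->
    eq_rect _ P (projT2 p) _ h = projT2 q by exact: (gen (existT P x a) (existT P x b) erefl e).
by move=> pq; subst q; rewrite (Prop_irrelevance h erefl).
Qed.

Section SortMap.
Variables (S : signature) (M : structure S) (s0 sK : Defs.sort S).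
Variables (F : Type) (fs : F -> unit) (fa : F -> nat).
Variables (R : Type) (rd : R -> seq unit).
Let S1 := @Signature unit F fs fa R rd.
Variable fi : forall f : F, ('I_(fa f) -> M s0) -> M s0.
Variable ri : forall r : R, args (fun _ : unit => M s0) (rd r) -> Prop.
Let N := @Structure S1 (fun=> M s0) fi ri.
Hypothesis hterm : forall (V : ctx S1) (W : ctx S) (f : V tt -> W s0) s (t : term V s),
  @pterm S M s0 F fs fa R rd fi ri V W f s t.
Hypothesis hrel : forall (V : ctx S1) (W : ctx S) (f : V tt -> W s0) (r : R)
  (ts : args (term V) (rd r)),
  definable (fun e : asg M W => ri (fun i => eval (@pull S M s0 F fs fa R rd fi ri V W e f) (ts i))).

Variables (dom : M sK -> Prop) (mu : M sK -> M s0).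
Hypothesis hmu : forall (W : ctx S) (v : W sK) (w : W s0),
  definable (fun e : asg M W => dom (e sK v) /\ mu (e sK v) = e s0 w).
Variable d : forall s, M s.

Definition imdom (W : ctx S) (e : asg M W) (u : W sK + W s0) : Prop :=
  if u is inl w then dom (e sK w) else True.

Definition imval (W : ctx S) (e : asg M W) (u : W sK + W s0) : M s0 :=
  match u with inl w => mu (e sK w) | inr w => e s0 w end.

Definition imasg (V : ctx S1) (W : ctx S) (e : asg M W) (g : V tt -> W sK + W s0) : asg N V :=
  fun s => match s return V s -> M s0 with tt => fun v => imval e (g v) end.

Definition supports (V : ctx S1) (chi : formula V) (l : seq {s & V s}) :=
  forall e e' : asg N V,
    (forall s v, List.In (existT V s v) l -> e s v = e' s v) -> (sat chi e <-> sat chi e').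

(** Only the variables in the support of [chi] are required to lie in the domain of [mu]: such a
    condition on all variables of an infinite context would not be first order. *)
Lemma definable_im (V : ctx S1) (W : ctx S) (g : V tt -> W sK + W s0) (chi : formula V) l :
  supports chi l ->
  definable (fun e : asg M W =>
    (forall v, List.In (existT V tt v) l -> imdom e (g v)) /\ sat chi (imasg e g)).
Proof.
move=> hl.
(* A context with a variable of sort [s0] for each variable of [V] and none in other sorts; the
   equality in its type stands for a test on sorts. *)
pose Wz : ctx S := fun s => {v : V tt | s0 = s}.
pose zv (v : V tt) : Wz s0 := exist _ v erefl.
pose pullz (z : asg M Wz) : asg N V := @pull S M s0 F fs fa R rd fi ri V Wz z zv.
pose at_ (u : {s & V s}) : V tt := match u with existT tt v => v end.
pose Q1 (e : asg M (cadd Wz W)) :=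
  (forall u, List.In u l -> match g (at_ u) with
     | inl w => dom (e sK (inr w)) /\ mu (e sK (inr w)) = e s0 (inl (zv (at_ u)))
     | inr w => e s0 (inr w) = e s0 (inl (zv (at_ u))) end) /\
  sat chi (@pull S M s0 F fs fa R rd fi ri V _ e (fun v => inl (zv v))).
have hQ1 : definable Q1.
  apply: definable_and; last exact: (definable_reduct hterm hrel (fun v => inl (zv v) : cadd Wz W s0) chi).
  apply: definable_and_list => u; case: (g _) => w; first exact: hmu.
  exact: (definable_eq M (inr w : cadd Wz W s0) (inl (zv (at_ u)))).
apply: definable_iff (definable_ex_ctx d hQ1) => e.
split=> [[z [h1 h2]]|[h1 h2]].
  have {}h1 v : List.In (existT V tt v) l -> imdom e (g v) /\ imval e (g v) = z s0 (zv v).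
    by move=> /h1 /=; case: (g v) => w.
  split=> [v /h1[]//|].
  have hag s v : List.In (existT V s v) l -> pullz z s v = @imasg V W e g s v.
    by case: s v => v hv /=; case: (h1 v hv).
  exact: (iffLR (hl _ _ hag) h2).
exists (fun s (v : Wz s) => eq_rect s0 M (imval e (g (sval v))) s (proj2_sig v)).
split; first by case=> -[] v /h1 /=; case: (g v) => w.
set z : asg M Wz := fun s v => _.
have hag s v : List.In (existT V s v) l -> @imasg V W e g s v = pullz z s v.
  by case: s v.
exact: (iffLR (hl _ _ hag) h2).
Qed.

Lemma definable_dom (W : ctx S) (v : W sK) : definable (fun e : asg M W => dom (e sK v)).
Proof.
have := definable_ex (hmu (inl v : cadd W (csingle s0) sK) (inr (here s0))).
by apply: definable_iff => e; split=> [[x []]//|h]; exists (mu (e sK v)).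
Qed.

Variables (KA : psets M) (DA : psets N).

Lemma im_indiscernible (U : ctx S) (V : ctx S1) (e : nat -> asg M U) (g : V tt -> U sK) :
  (forall y, @DA tt y -> exists x, [/\ @KA sK x, dom x & mu x = y]) ->
  indiscernible KA e -> (forall i v, dom (e i sK (g v))) ->
  @indiscernible S1 N V DA (fun i => imasg (e i) (fun v => inl (g v))).
Proof.
move=> hA he hdom n i j hi hj phi.
have lift_ex (a : csub DA tt) : exists x, [/\ @KA sK x, dom x & mu x = sval a].
  by case: a => y; exact: hA.
pose lift (a : csub DA tt) : csub KA sK :=
  exist _ (sval (cid (lift_ex a))) (let: And3 h _ _ := svalP (cid (lift_ex a)) in h).
have liftP a : dom (sval (lift a)) /\ mu (sval (lift a)) = sval a.
  by rewrite /lift /=; case: (svalP (cid (lift_ex a))).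
pose V1 : ctx S1 := cadd (fun s => ('I_n * V s)%type) (csub DA).
pose W1 : ctx S := cadd (fun s => ('I_n * U s)%type) (csub KA).
pose G (v : V1 tt) : W1 sK + W1 s0 :=
  match v with inl (k, v) => inl (inl (k, g v)) | inr a => inl (inr (lift a)) end.
have [l hl] := sat_support N phi.
have [q hq] := definable_im (W := W1) G hl.
pose ev (r : 'I_n -> nat) : asg M W1 := acat (fun s (v : 'I_n * U s) => e (r v.1) s v.2) (pin KA).
have hev r : sat q (ev r) <-> sat phi (acat (fun s (v : 'I_n * V s) =>
    @imasg V U (e (r v.1)) (fun v => inl (g v)) s v.2) (pin DA)).
  rewrite hq; have -> : imasg (ev r) G = acat (fun s (v : 'I_n * V s) =>
      @imasg V U (e (r v.1)) (fun v => inl (g v)) s v.2) (pin DA).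
    by apply: asg_ext => -[] [[k v]|a] //=; case: (liftP a).
  split=> [[]//|h]; split=> // -[[k v]|a] _; first exact: hdom (r k) v.
  by case: (liftP a).
by rewrite -!hev; exact: he.
Qed.

Variables (KB KC : psets M) (DB DC : psets N).
Hypothesis hDB : forall y, @DB tt y -> exists x, [/\ @KB sK x, dom x & mu x = y].
Hypothesis hDC : forall y, @DC tt y -> exists x, [/\ @KC sK x, dom x & mu x = y].
Hypothesis ext : forall E : forall s, N s -> N s -> Prop, elem_rel E ->
  (forall y, @DA tt y -> E tt y y) ->
  exists R : forall s, M s -> M s -> Prop, [/\ elem_rel R,
    forall s a, @KA s a -> R s a a, forall s, R s (d s) (d s) &
    forall y y', E tt y y' -> R s0 y y'].

(** The dividing formula is pulled back along [mu]. Its indiscernible sequence remains indiscernible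
    in [M]: a change of indices is an elementary relation of the reduct fixing [DA], and by [ext] it
    extends to one of [M] fixing [KA]. *)
Lemma type_divides_lift : type_divides DA (tp DC DB) -> type_divides KA (tp KC KB).
Proof.
move=> [n [phi [b [[m [psi [hpsi himp]]] [c [c0 hc [m0 hm0]]]]]]].
have liftC_ex (a : csub DC tt) : exists x, [/\ @KC sK x, dom x & mu x = sval a].
  by case: a => y; exact: hDC.
have liftB_ex (a : csub DB tt) : exists x, [/\ @KB sK x, dom x & mu x = sval a].
  by case: a => y; exact: hDB.
pose liftC (a : csub DC tt) : csub KC sK :=
  exist _ (sval (cid (liftC_ex a))) (let: And3 h _ _ := svalP (cid (liftC_ex a)) in h).
pose liftB (a : csub DB tt) : csub KB sK :=
  exist _ (sval (cid (liftB_ex a))) (let: And3 h _ _ := svalP (cid (liftB_ex a)) in h).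
have liftCP a : dom (sval (liftC a)) /\ mu (sval (liftC a)) = sval a.
  by rewrite /liftC /=; case: (svalP (cid (liftC_ex a))).
have liftBP a : dom (sval (liftB a)) /\ mu (sval (liftB a)) = sval a.
  by rewrite /liftB /=; case: (svalP (cid (liftB_ex a))).
(* The lifted tuple has [n tt] entries in every sort of [M]; those outside of [s0] are filled with
   [d]. *)
pose up (a : asg N (fun s => 'I_(n s))) : asg M (fun _ => 'I_(n tt)) := fun s v =>
  if pselect (s0 = s) is left e then eq_rect s0 M (a tt v) s e else d s.
have up0 a v : up a s0 v = a tt v.
  by rewrite /up; case: pselect => // e; rewrite (Prop_irrelevance e erefl).
pose img (x : asg M (csub KC)) : asg N (csub DC) := imasg x (fun v => inl (liftC v)).
pose W1 : ctx S := cadd (csub KC) (fun _ => 'I_(n tt)).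
pose W2 : ctx S := cadd (csub KC) (csub KB).
pose G1 (v : @cadd S1 (csub DC) (fun s => 'I_(n s)) tt) : W1 sK + W1 s0 :=
  match v with inl v => inl (inl (liftC v)) | inr k => inr (inr k) end.
pose G2 (v : @cadd S1 (csub DC) (csub DB) tt) : W2 sK + W2 s0 :=
  match v with inl v => inl (inl (liftC v)) | inr b => inl (inr (liftB b)) end.
have im1 x a : imasg (acat x (up a)) G1 = acat (img x) a.
  by apply: asg_ext => -[] [v|k] //=; exact: up0.
have im2 x : imasg (acat x (pin KB)) G2 = acat (img x) (pin DB).
  by apply: asg_ext => -[] [v|k] //=; case: (liftBP k).
have img_pin : img (pin KC) = pin DC.
  by apply: asg_ext => -[] v /=; case: (liftCP v).
have [l hl] := sat_support N phi.
have [phi' hphi'] := definable_im (W := W1) G1 hl.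
have psi'_ex i : exists q : formula W2, sat q (acat (pin KC) (pin KB)) /\
    forall x, sat q (acat x (pin KB)) -> sat (psi i) (acat (img x) (pin DB)).
  have [li hli] := sat_support N (psi i).
  have [q hq] := definable_im (W := W2) G2 hli.
  exists q; split=> [|x]; rewrite hq im2; last by case.
  rewrite img_pin; split; last exact: hpsi.
  by move=> [v|v] _ /=; [case: (liftCP v)|case: (liftBP v)].
pose psi' i := sval (cid (psi'_ex i)).
(* The pulled back formula also claims that certain variables lie in the domain of [mu], so the type
   has to imply this; it does so through [q0]. *)
have [q0 hq0] : definable (fun e : asg M W2 => forall u, List.In u l ->
    match u with existT tt (inl v) => dom (e sK (inl (liftC v))) | _ => True end).
  apply: definable_and_list => -[[] [v|v]]; first exact: definable_dom.
  exact: definable_top.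
exists (fun=> n tt), phi', (up b); split.
  exists m.+1, (fun i => if unlift ord0 i is Some j then psi' j else q0); split.
    move=> i; case: unliftP => [j _|_]; first by case: (svalP (cid (psi'_ex j))).
    by rewrite /tp /= hq0 => -[[] [v|//]] _; case: (liftCP v).
  move=> x hx; rewrite hphi' im1; split.
    move=> [v|//] hv /=; have := hx ord0; rewrite unlift_none hq0.
    by move=> /(_ _ hv).
  apply: himp => i; have := hx (lift ord0 i); rewrite liftK.
  exact: (svalP (cid (psi'_ex i))).2.
exists (fun i => up (c i)); split.
- move=> s k; rewrite /up; case: pselect => // e; by rewrite c0.
- move=> k i j hi hj chi.
  pose X1 (r : 'I_k -> nat) : asg N (cadd (fun s => ('I_k * 'I_(n s))%type) (csub DA)) :=
    acat (fun s v => c (r v.1) s v.2) (pin DA).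
  have hE : elem_rel (pairs_of (X1 i) (X1 j)).
    by apply: elem_pairs_of => f; exact: (iffLR (hc _ _ _ hi hj f)).
  have [|R1 [hR RA Rd RE]] := ext hE.
    by move=> y hy; exists (inr (exist _ y hy)).
  apply: hR => s [[p v]|a]; last exact: RA (svalP a).
  rewrite /= /up; case: pselect => [e|_]; last exact: Rd.
  by case: s / e => /=; apply: RE; exists (inl (p, v)).
exists m0 => -[x hx]; apply: hm0; exists (img x) => i.
by have := hx i; rewrite hphi' im1 => -[].
Qed.

(** [y] is the trace in the sort [s0] of a future conjugate of [xi]: images of [xi] are to move to
    [y] while those of the first term of [beta] move to those of the i-th, and the same [y] works
    for every i. *)
Lemma nondividing_image (small : psets N -> Prop) (UB UC : ctx S) (beta : nat -> asg M UB)
    (xi : asg M UC) :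
  type_saturated small -> small_addable small -> small DA -> cctx UB -> cctx UC ->
  (forall y, @DA tt y -> exists x, [/\ @KA sK x, dom x & mu x = y]) ->
  (exists y, @DA tt y) -> (forall y, @DA tt y -> @DB tt y) ->
  (forall v, dom (xi sK v) -> @DC tt (mu (xi sK v))) ->
  (forall v, dom (beta 0%N sK v) -> @DB tt (mu (beta 0%N sK v))) ->
  indiscernible KA beta -> ~ type_divides DA (tp DC DB) ->
  exists y : UC sK -> M s0, forall i, @elem_rel S1 N (fun _ r r' =>
    [\/ exists v, [/\ dom (xi sK v), r = mu (xi sK v) & r' = y v],
        exists v, [/\ dom (beta 0%N sK v), r = mu (beta 0%N sK v) & r' = mu (beta i sK v)]
      | @DA tt r /\ r' = r]).
Proof.
move=> hsat hsmall hDA [fB fBinj] [fC fCinj] hA [y0 hy0] AB xiC betaB hbeta nd.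
pose VC : ctx S1 := fun _ => {v : UC sK | dom (xi sK v)}.
pose VB : ctx S1 := fun _ => {v : UB sK | dom (beta 0%N sK v)}.
have cV (U : ctx S) (f : {s & U s} -> nat) (Q : U sK -> Prop) : injective f ->
    @cctx S1 (fun _ => {v : U sK | Q v}).
  move=> finj; exists (fun v : {_ : unit & {v : U sK | Q v}} => f (existT _ sK (sval (projT2 v)))).
  move=> [[] [v hv]] [[] [v' hv']] /= /finj e0; congr (existT _ tt _).
  by apply: eq_exist; exact: existT_inj e0.
have betadom i (v : UB sK) : dom (beta 0%N sK v) -> dom (beta i sK v).
  move=> h; have [hd _] := eqtp_pdefinable (indiscernible_eqtp 0 i hbeta)
    (definable_pdefinable _ (definable_dom v)).
  exact: hd.
pose bk i : asg N VB := imasg (beta i) (fun v => inl (sval v)).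
pose rho : asg N VC := imasg xi (fun v => inl (sval v)).
have hbk : indiscernible DA bk.
  by apply: im_indiscernible => // i [v hv]; exact: betadom.
pose dN : forall s, N s := fun _ => y0.
have [||||y hy] := nondividing_realize (d := dN) (B := DB) (C := DC) (rho := rho) hsat hsmall hDA
    (cV _ _ _ fCinj) (cV _ _ _ fBinj) _ _ _ _ hbk nd.
- by case.
- by case=> x; exact: AB.
- by case=> -[v hv]; exact: xiC.
- by case=> -[v hv]; exact: betaB.
pose yt v := if pselect (dom (xi sK v)) is left h then y tt (exist _ v h) else y0.
exists yt => i; have := elem_pairs_of (hy i); apply: elem_rel_sub => -[] r r'.
move=> [[v [hv -> ->]]|[v [hv -> ->]]|[hr ->]].
- exists (inl (exist _ v hv)); split=> //=; rewrite /yt.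
  by case: pselect => // h; congr (y tt _); exact: eq_exist.
- by exists (inr (inl (exist _ v hv))).
- by exists (inr (inr (exist _ r hr))).
Qed.

End SortMap.

(** * Countable witnesses *)

Section CosetReps.
Variable M : valuedField.
Hypothesis hHensel : henselian M.
Hypothesis hChar : [pchar (vk M)] =i pred0.
Variable A : {pred M}.
Hypothesis A1 : 1 \in A.
Hypothesis hIndex : forall N : nat, (0 < N)%N -> finite_set (power_cosets (vK M) N).
Hypothesis hRV : forall N : nat, (0 < N)%N -> forall r : vRV M,
  exists a : M, [/\ a \in A, a != 0 & exists t : vRV M, vrv a = (r * t ^+ N)%g].
Hypothesis hRes : forall N : nat, (0 < N)%N -> forall r : vk M, r != 0 ->
  exists a : M, [/\ a \in A, vval a = Some 0 &
    exists2 t : vk M, t != 0 & vres a = r * t ^+ N].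

Lemma rv_X (x : M) n : x != 0 -> vrv (x ^+ n) = (vrv x ^+ n)%g.
Proof.
move=> x0; elim: n => [|n IH]; first by rewrite expr0 expg0 rv_1.
by rewrite exprS expgS vrvM ?IH // expf_neq0.
Qed.

Lemma aeq_coset (a x y : M) n : (0 < n)%N -> aeq a (x * y ^+ n) ->
  exists2 z, z != 0 & a = x * z ^+ n.
Proof.
move=> n0 h; have xy0 := aeq_neq0r h; have a0 := aeq_neq0l h.
have hu : aeq (a / (x * y ^+ n)) 1.
  by rewrite -(divff xy0); apply: aeq_div => //; exact: aeq_refl.
have [w hw _] := root_near1 hHensel hChar n0 hu.
have e : a = x * (y * w) ^+ n by rewrite exprMn hw mulrA mulrC divfK.
exists (y * w) => //; apply: contraNneq a0 => yw0.
by rewrite e yw0 expr0n eqn0Ngt n0 mulr0.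
Qed.

(** Finite index leaves countably many cosets over all n. For each coset an element of [A] is chosen
    twice, with and without the demand of value 0. The hypotheses on leading terms and residues give
    an element of [A] with the leading term of an element of the coset, and Hensel's lemma puts it
    into the coset. *)
Lemma countable_coset_reps : exists A0 : set M,
  [/\ countable A0, A0 `<=` [set` A] & coset_reps A0].
Proof.
pose ok (u : bool) (S : set M) a := [/\ a \in A, a != 0, S a & u -> vval a = Some 0].
(* For a coset without such an element, the value 1 keeps the chosen set inside the nonzero elements
   of [A]. *)
pose rep u S : M := if pselect (exists a, ok u S a) is left h then sval (cid h) else 1.
have repP u S a : ok u S a -> ok u S (rep u S).
  move=> ha; rewrite /rep; case: pselect => [h|[]]; last by exists a.
  exact: svalP (cid h).
have repA u S : rep u S \in A /\ rep u S != 0.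
  rewrite /rep; case: pselect => [h|_]; last by rewrite oner_neq0.
  by case: (svalP (cid h)).
pose coset N x : set M := [set x * y ^+ N | y in @nonzero M].
exists (\bigcup_N (rep true @` power_cosets M N.+1 `|` rep false @` power_cosets M N.+1)).
have inA0 u N x : x != 0 ->
    (\bigcup_N (rep true @` power_cosets M N.+1 `|` rep false @` power_cosets M N.+1))
      (rep u (coset N.+1 x)).
  by move=> x0; exists N => //; case: u; [left|right]; exists (coset N.+1 x) => //; exists x.
have cosetP N x a : x != 0 -> coset N.+1 x a -> isP N.+1 (x / a).
  move=> x0 [z /= z0 <-]; exists z^-1.
  by rewrite invfM mulrA divff // mul1r exprVn.
split.
- apply: bigcup_countable => // N _.
  by apply: countable_setU; apply: countable_image; apply: finite_set_countable; exact: hIndex.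
- by move=> a [N _ [] [S _ <-]]; case: (repA true S); case: (repA false S).
- split.
  + by move=> a [N _ [] [S _ <-]]; case: (repA true S); case: (repA false S).
  + move=> [//|N] x _ x0; have [a [aA a0 [t ht]]] := hRV (ltn0Sn N) (vrv x).
    have [y y0 hy] := vrv_surj t.
    have h : aeq a (x * y ^+ N.+1).
      by apply/rv_eq; rewrite ?mulf_neq0 ?expf_neq0 // vrvM ?expf_neq0 // rv_X // hy.
    have [z z0 e] := aeq_coset (ltn0Sn N) h.
    have [|_ _ hr _] := @repP false (coset N.+1 x) a; first by split=> //; exists z.
    by exists (rep false (coset N.+1 x)); [exact: inA0|exact: cosetP].
  + move=> [//|N] x _ ux; have /vval_unitE[x1 x2] := ux; have x0 := unit_neq0 x2.
    have [|a [aA ua [t t0 ht]]] := hRes (ltn0Sn N) (r := vres x).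
      by rewrite res_neq0.
    have [y y1 hy] := res_surj t; have /vval_unitE[a1 a2] := ua.
    have y2 : dle 1 y by rewrite -res_neq0 // hy.
    have h : aeq a (x * y ^+ N.+1).
      rewrite /aeq; have e : vval (x * y ^+ N.+1) = vval (1 : M).
        have uy : vval y = vval (1 : M) by apply/deqP; split.
        by rewrite vvalM ux (vval_exp N.+1 uy) expr1n vval_1 /= addr0.
      by rewrite (dlt_eqr _ e) -res_eq ?dle1M ?dle1X // resM ?dle1X // resX // hy ht.
    have [z z0 e] := aeq_coset (ltn0Sn N) h.
    have [|_ _ hr hu] := @repP true (coset N.+1 x) a.
      by split=> //; [exact: unit_neq0|exists z].
    by exists (rep true (coset N.+1 x)); [split; [exact: inA0|exact: hu]|exact: cosetP].
Qed.

End CosetReps.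

(** * Separated bases and countable fields of witnesses *)

Section Basis.
Variable L : fieldType.
Variable F : {pred L}.
Hypothesis hF : GRing.divring_closed F.

Let F1 : 1 \in F. Proof. by case: hF. Qed.
Let FB x y : x \in F -> y \in F -> x - y \in F. Proof. by case: hF => _ h _; exact: h. Qed.
Let Fdiv x y : x \in F -> y \in F -> x / y \in F. Proof. by case: hF => _ _; exact. Qed.
Let F0 : 0 \in F. Proof. by rewrite -(subrr 1) FB. Qed.

Lemma divring_opp x : x \in F -> - x \in F.
Proof. by move=> h; rewrite -sub0r FB. Qed.
Lemma divring_add x y : x \in F -> y \in F -> x + y \in F.
Proof. by move=> h1 h2; rewrite -[y]opprK FB // divring_opp. Qed.
Lemma divring_mul x y : x \in F -> y \in F -> x * y \in F.
Proof. by move=> h1 h2; rewrite -[y]invrK Fdiv // -[y^-1]mul1r Fdiv. Qed.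
Lemma divring_sum (I : Type) (r : seq I) (P : pred I) (G : I -> L) :
  (forall i, P i -> G i \in F) -> \sum_(i <- r | P i) G i \in F.
Proof. by move=> h; elim/big_rec: _ => // i x Pi; apply: divring_add; exact: h. Qed.

Lemma span_self n (v : 'I_n -> L) i : lin_span [set` F] v (v i).
Proof.
exists (fun j => (j == i)%:R) => [j /=|]; first by case: eqP.
rewrite (bigD1 i) //= eqxx mul1r big1 ?addr0 // => j /negPf->; by rewrite mul0r.
Qed.

(** A nontrivial relation allows one vector to be dropped. This is needed because [separated] only
    speaks about subspaces that come with a basis. *)
Lemma span_basis n (v : 'I_n -> L) :
  exists m (w : 'I_m -> L), lin_basis [set` F] w (lin_span [set` F] v).
Proof.
elim: n v => [|n IH] v; first by exists 0%N, v; split=> // l _ _ [].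
have [h|] := pselect (lin_indep [set` F] v); first by exists n.+1, v.
move=> /existsNP[l /not_implyP[lF /not_implyP[hl /existsNP[i /eqP li0]]]].
have [m [w [h1 h2]]] := IH (fun j => v (lift i j)).
exists m, w; split=> //; rewrite h2; apply/seteqP; split=> x [c hc ->].
  exists (fun j => if unlift i j is Some j' then c j' else 0).
    by move=> j; case: unlift => //=.
  rewrite (bigD1_ord i) //= unlift_none mul0r add0r.
  by apply: eq_bigr => j _; rewrite liftK.
exists (fun j => c (lift i j) - c i * (l (lift i j) / l i)) => [j /=|].
  apply: FB; first exact: hc.
  by apply: divring_mul; [exact: hc|apply: Fdiv; exact: lF].
have vi : v i = - \sum_j l (lift i j) / l i * v (lift i j).
  apply: (mulfI li0); move/eqP: hl; rewrite (bigD1_ord i) //= addr_eq0 => /eqP->.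
  rewrite mulrN mulr_sumr; congr (- _); apply: eq_bigr => j _.
  by rewrite mulrA mulrCA mulfV // mulr1.
rewrite (bigD1_ord i) //= {1}vi mulrN mulr_sumr addrC -sumrB; apply: eq_bigr => j _.
by rewrite mulrBl !mulrA.
Qed.

End Basis.

Lemma vle_bigmax (G : orderedGroupType) n (f : 'I_n -> option G) i :
  vle (f i) (\big[@vmax G/None]_(j < n) f j).
Proof.
have vmaxl (u v : option G) : vle u (vmax u v).
  by rewrite /vmax; case: ifP => // _; exact: vle_refl.
have vmaxr (u v : option G) : vle v (vmax u v).
  by rewrite /vmax; case: ifP => [_|/negbT h]; [exact: vle_refl|have := vle_total u v; rewrite (negPf h)].
have : i \in index_enum 'I_n by rewrite mem_index_enum.
elim: (index_enum _) => //= j r IH; rewrite inE big_cons => /orP[/eqP->|/IH h].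
  exact: vmaxl.
exact: vle_trans h (vmaxr _ _).
Qed.

Section Closure.
Variables (M : valuedField) (A B C : {pred M}).
Hypothesis hA : GRing.divring_closed A.
Hypothesis hC : GRing.divring_closed C.
Hypothesis hAC : {subset A <= C}.
Hypothesis hDisj : linearly_disjoint (res_of A) (res_of C) (res_of B).
Hypothesis hVal : val_of C `&` val_of B = val_of A.
Hypothesis hSep : separated A C.

(** [w] is a separated basis of the span of the family; its norm identity bounds each term of a
    combination by the whole sum. *)
Lemma separated_coordinates n (v : 'I_n -> M) : (forall i, v i \in C) ->
  exists m (w : 'I_m -> M) (a : 'I_n -> 'I_m -> M),
    [/\ forall l, w l \in C /\ w l != 0, forall i l, a i l \in A,
        forall i, v i = \sum_l a i l * w l &
        forall f : 'I_m -> M, (forall l, f l \in A) ->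
          forall l, dle (f l * w l) (\sum_k f k * w k)].
Proof.
move=> vC.
have [m0 [w0 hw0]] := span_basis hA v.
have [|m [w [[ind span] norm]]] := hSep (V := lin_span [set` A] v) _ (ex_intro _ m0 (ex_intro _ w0 hw0)).
  move=> _ [c cA ->] /=; apply: (divring_sum hC) => i _.
  by apply: (divring_mul hC) => //; apply: hAC; exact: cA.
have coef i : exists c : 'I_m -> M, (forall l, c l \in A) /\ v i = \sum_l c l * w l.
  have : lin_span [set` A] w (v i) by rewrite span; exact: span_self.
  by move=> [c cA e]; exists c.
exists m, w, (fun i => sval (cid (coef i))); split.
- move=> l; split.
    have : lin_span [set` A] v (w l) by rewrite -span; exact: span_self.
    move=> [c cA ->]; apply: (divring_sum hC) => i _.
    by apply: (divring_mul hC) => //; apply: hAC; exact: cA.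
  apply/eqP => wl0; have [A1 AB _] := hA.
  suff /eqP : (l == l)%:R = 0 :> M by rewrite eqxx oner_eq0.
  apply: (ind (fun j => (j == l)%:R)) => [j /=|].
    by case: eqP => _ //; have := AB _ _ A1 A1; rewrite subrr.
  by apply: big1 => j _; case: eqP => [->|]; rewrite ?wl0 ?mulr0 ?mul0r.
- by move=> i l; case: (svalP (cid (coef i))).
- by move=> i; case: (svalP (cid (coef i))).
- move=> f fA l; rewrite /dle norm //; exact: (@vle_bigmax _ m (fun k => vval (f k * w k))).
Qed.

Lemma sum_enum_rank (J : finType) (F : J -> M) (G : nat -> M) :
  (forall j, G (enum_rank j) = F j) -> \sum_j F j = \sum_(0 <= k < #|J|) G k.
Proof.
move=> h; rewrite big_mkord (reindex (@enum_val J xpredT)) /=; last first.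
  by apply: onW_bij; exact: enum_val_bij.
by apply: eq_bigr => k _; rewrite -h enum_valK.
Qed.

(** This property, like [linW] and [valW], ties a finite list [l] to a finite list [W] of witnesses.
    Where its premise fails for [l] it holds trivially, so a [W] can be chosen for every [l], and a
    countable set can be closed under this choice. *)
Let sepW (l W : seq M) := (forall i, (i < size l)%N -> nth 0 l i \in C) ->
  exists m (w : 'I_m -> M) (a : nat -> 'I_m -> M),
    [/\ forall k, [/\ List.In (w k) W, w k \in C & w k != 0],
        forall i k, (i < size l)%N -> List.In (a i k) W /\ a i k \in A,
        forall i, (i < size l)%N -> nth 0 l i = \sum_k a i k * w k &
        forall f : 'I_m -> M, (forall k, f k \in A) ->
          forall k, dle (f k * w k) (\sum_k f k * w k)].

(** For integral [l] this is a nontrivial linear relation between the residues. *)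
Let residue_relation (P : M -> Prop) (l : seq M) :=
  exists a : nat -> M, [/\ forall i, (i < size l)%N -> P (a i) /\ dle (a i) 1,
    dlt (\sum_(0 <= i < size l) a i * nth 0 l i) 1 &
    exists2 i, (i < size l)%N & ~ dlt (a i) 1].

Let linW (l W : seq M) := residue_relation (fun x => x \in A) l ->
  residue_relation (fun x => x \in A /\ List.In x W) l.

Let valW (l W : seq M) := (exists2 a, a \in A & vval a = vval (head 0 l)) ->
  exists a, [/\ a \in A, List.In a W & vval a = vval (head 0 l)].

Lemma in_enum_map (I : finType) (f : I -> M) i : List.In (f i) [seq f j | j <- enum I].
Proof.
have := mem_enum I i; elim: (enum I) => //= a l IH.
by rewrite inE => /orP[/eqP<-|/IH]; [left|right].
Qed.

Let sepW_ex l : exists W, sepW l W.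
Proof.
have [h|h] := pselect (forall i, (i < size l)%N -> nth 0 l i \in C); last first.
  by exists [::] => h'; case: h.
have [|m [w [a [h1 h2 h3 h4]]]] := @separated_coordinates (size l) (fun i => nth 0 l i).
  by move=> i; exact: h.
pose a' i k := if insub i is Some j then a j k else 0.
have a'E i k (hi : (i < size l)%N) : a' i k = a (Ordinal hi) k by rewrite /a' insubT.
exists ([seq w k | k <- enum 'I_m] ++ [seq a p.1 p.2 | p <- enum {: 'I_(size l) * 'I_m}]) => _.
exists m, w, a'; split=> //.
- move=> k; have [? ?] := h1 k; split=> //; apply/List.in_app_iff; left; exact: in_enum_map.
- move=> i k hi; rewrite a'E; split=> //; apply/List.in_app_iff; right.
  exact: (@in_enum_map (prod 'I_(size l) 'I_m) (fun p => a p.1 p.2) (Ordinal hi, k)).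
- move=> i hi; have /= -> := h3 (Ordinal hi); by apply: eq_bigr => k _; rewrite a'E.
Qed.

Let linW_ex l : exists W, linW l W.
Proof.
have [[a [h1 h2 h3]]|h] := pselect (residue_relation (fun x => x \in A) l); last first.
  by exists [::] => h'; case: h.
exists [seq a (nat_of_ord i) | i <- enum 'I_(size l)] => _; exists a; split=> // i hi.
have [aA a1] := h1 i hi; split=> //; split=> //.
exact: (@in_enum_map 'I_(size l) (fun i => a (nat_of_ord i)) (Ordinal hi)).
Qed.

Let valW_ex l : exists W, valW l W.
Proof.
have [[a aA ha]|h] := pselect (exists2 a, a \in A & vval a = vval (head 0 l)); last first.
  by exists [::] => h'; case: h.
by exists [:: a] => _; exists a; split=> //; left.
Qed.

(** In the second clause independence is tested only with coefficients from [L]. A relation over all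
    of [A] would yield one with coefficients among the witnesses, hence in [L]; so the residues are
    independent over [res_of A], and linear disjointness passes this on to [res_of B]. *)
Lemma countable_witness_field (X : set M) : countable X -> exists L : set M,
  [/\ countable L, X `<=` L, (forall x y, L x -> L y -> L (x - y)),
      (forall x y, L x -> L y -> L (x / y)) &
  [/\ (forall (I : finType) (v : I -> M), (forall i, v i \in C /\ L (v i)) ->
        exists m (w : 'I_m -> M) (a : I -> 'I_m -> M),
          [/\ forall l, [/\ w l \in C, L (w l) & w l != 0],
              forall i l, a i l \in A /\ L (a i l), forall i, v i = \sum_l a i l * w l &
              forall f : 'I_m -> M, (forall l, f l \in A) ->
                forall l, dle (f l * w l) (\sum_k f k * w k)]),
      (forall (J : finType) (u : J -> M), (forall j, u j \in C /\ L (u j)) ->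
        (forall j, dle (u j) 1) ->
        (forall a : J -> M, (forall j, a j \in A /\ L (a j)) -> (forall j, dle (a j) 1) ->
          dlt (\sum_j a j * u j) 1 -> forall j, dlt (a j) 1) ->
        forall s : J -> M, (forall j, s j \in B) -> (forall j, dle (s j) 1) ->
          dlt (\sum_j s j * u j) 1 -> forall j, dlt (s j) 1) &
      (forall c b, c \in C -> L c -> b \in B -> c != 0 -> vval c = vval b ->
        exists a, [/\ a \in A, L a & vval a = vval c])]].
Proof.
move=> cX.
pose W l := sval (cid (sepW_ex l)) ++ sval (cid (linW_ex l)) ++ sval (cid (valW_ex l)).
have [|L [cL XL [LB Ldiv] Lcl]] := @countable_closure2 M (fun x y => x - y) (fun x y => x / y)
    (fun l => [set x | List.In x (W l)]) X _ cX.
  by move=> l; exact: countable_list.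
have LW l x : (forall t, List.In t l -> L t) -> List.In x (W l) -> L x.
  by move=> h; exact: (Lcl l h).
have nth_enum (I : finType) (f : I -> M) (i : I) :
    nth 0 [seq f j | j <- enum I] (enum_rank i) = f i.
  rewrite (nth_map i) ?nth_enum_rank // -cardE; exact: ltn_ord.
have In_enum (I : finType) (f : I -> M) : (forall i, L (f i)) ->
    forall t, List.In t [seq f j | j <- enum I] -> L t.
  by move=> h t; elim: (enum I) => //= i r IH [<-|].
have sz (I : finType) (f : I -> M) : size [seq f j | j <- enum I] = #|I|.
  by rewrite size_map -cardE.
have rk (I : finType) (i : I) : (enum_rank i < #|I|)%N by exact: ltn_ord.
exists L; split=> //; split.
- move=> I v hv; pose l := [seq v i | i <- enum I].
  have hl : forall t, List.In t l -> L t by apply: In_enum => i; case: (hv i).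
  have [|m [w [a [h1 h2 h3 h4]]]] := svalP (cid (sepW_ex l)).
    move=> i; rewrite sz => hi.
    by rewrite -[i]/(nat_of_ord (Ordinal hi)) -(enum_valK (Ordinal hi)) nth_enum; case: (hv (enum_val (Ordinal hi))).
  exists m, w, (fun i => a (enum_rank i)); split=> //.
  + move=> k; have [k1 k2 k3] := h1 k; split=> //; apply: (LW l) => //.
    by apply/List.in_app_iff; left.
  + move=> i k; have [|k1 k2] := h2 (enum_rank i) k; first by rewrite sz.
    by split=> //; apply: (LW l) => //; apply/List.in_app_iff; left.
  + by move=> i; rewrite -h3 ?sz // nth_enum.
- move=> J u hu u1 hlin s sB s1 hsum.
  pose l := [seq u i | i <- enum J].
  have hl : forall t, List.In t l -> L t by apply: In_enum => i; case: (hu i).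
  pose v (k : 'I_#|J|) := vres (u (enum_val k)).
  have sum_val (F : J -> M) : \sum_(k < #|J|) F (enum_val k) = \sum_j F j.
    by rewrite [RHS](reindex (@enum_val J xpredT)) //; apply: onW_bij; exact: enum_val_bij.
  have resum (f : J -> M) : (forall j, dle (f j) 1) ->
      \sum_(k < #|J|) vres (f (enum_val k)) * v k = vres (\sum_j f j * u j).
    move=> f1; rewrite -sum_val res_sum => [|i _]; last by rewrite dle1M.
    by apply: eq_bigr => k _; rewrite resM.
  have indA : lin_indep (res_of A) v.
    move=> c hc hsum0.
    have lift_ex j : exists x, [/\ x \in A, dle x 1 & vres x = c (enum_rank j)].
      by have [x [xA x1 xc]] := hc (enum_rank j); exists x; rewrite -vle_dle1.
    pose a j := sval (cid (lift_ex j)).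
    have aP j : [/\ a j \in A, dle (a j) 1 & vres (a j) = c (enum_rank j)] := svalP (cid (lift_ex j)).
    have a1 j : dle (a j) 1 by case: (aP j).
    have asum : dlt (\sum_j a j * u j) 1.
      rewrite -res_ker; last by apply: dle_sum => j _; rewrite dle1M.
      rewrite -resum //; apply/eqP; rewrite -[RHS]hsum0; apply: eq_bigr => k _.
      by case: (aP (enum_val k)) => _ _ ->; rewrite enum_valK.
    suff asmall j : dlt (a j) 1.
      move=> k; apply/eqP; have [_ _ h] := aP (enum_val k); rewrite enum_valK in h.
      by rewrite -h res_ker.
    apply: contrapT => naj.
    have [|a' [k1 k2 [i hi k3]]] := svalP (cid (linW_ex l)).
      pose a0 i : M := if (insub i : option 'I_#|J|) is Some k then a (enum_val k) else 0.
      have a0E (k : 'I_#|J|) : a0 k = a (enum_val k) by rewrite /a0 valK.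
      exists a0; rewrite sz; split.
      + by move=> i hi; rewrite -[i]/(nat_of_ord (Ordinal hi)) a0E; case: (aP (enum_val (Ordinal hi))).
      + rewrite -(@sum_enum_rank J (fun j => a j * u j)) // => j'.
        by rewrite a0E enum_rankK nth_enum.
      + by exists (enum_rank j) => //; rewrite a0E enum_rankK.
    rewrite sz in k1 k2 hi.
    have := hlin (fun j => a' (enum_rank j)) _ _ _ (enum_val (Ordinal hi)).
    rewrite enum_valK /= => h; apply: k3; apply: h.
    + move=> j'; have [|[k1a k1b] _] := k1 (enum_rank j'); first exact: rk.
      by split=> //; apply: (LW l) => //; apply/List.in_app_iff; right; apply/List.in_app_iff; left.
    + by move=> j'; have [|] := k1 (enum_rank j'); first exact: rk.
    + rewrite (@sum_enum_rank J _ (fun i => a' i * nth 0 l i)) // => j'.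
      by rewrite nth_enum.
  have indB : lin_indep (res_of B) v.
    apply: hDisj indA => k; have [uC _] := hu (enum_val k).
    by exists (u (enum_val k)); split=> //; rewrite inE vle_dle1.
  move=> j.
  have := indB (fun k => vres (s (enum_val k))) _ _ (enum_rank j).
  rewrite enum_rankK => h; rewrite -res_ker //; apply/eqP; apply: h.
    by move=> k; exists (s (enum_val k)); split=> //; rewrite inE vle_dle1.
  rewrite resum //; apply/eqP; rewrite res_ker //; apply: dle_sum => k _.
  by rewrite dle1M.
- move=> c b cC cL' bB c0 hcb; have [g hg] := vval_neq0 c0.
  have : val_of A g.
    by rewrite -hVal; split; [exists c|exists b => //; rewrite -hcb].
  move=> [a aA ha].
  have [|a' [k1 k2 k3]] := svalP (cid (valW_ex [:: c])); first by exists a => //=; rewrite ha hg.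
  exists a'; split=> //; apply: (LW [:: c]); first by move=> t [<-|].
  by apply/List.in_app_iff; right; apply/List.in_app_iff; right.
Qed.

End Closure.

(** * The dividing criterion *)

Lemma cctx_sorts (S : signature) (rank : Defs.sort S -> nat) (W : ctx S) :
  injective rank -> (forall s, exists f : W s -> nat, injective f) -> cctx W.
Proof.
move=> rinj hW; pose f s := sval (cid (hW s)).
have finj s : injective (f s) := svalP (cid (hW s)).
exists (fun x => pickle (rank (projT1 x), f _ (projT2 x))) => -[s v] [s' v'] /=.
move=> /(pcan_inj pickleK)[/rinj e]; subst s' => /finj->.
by [].
Qed.

Lemma countable_sig (T : Type) (D : set T) : countable D -> countable [set: {x | D x}].
Proof.
move=> /countable_injP[f finj]; apply/countable_injP; exists (fun v => f (sval v)).
move=> [x hx] [y hy] _ _ /= /finj; rewrite !inE => /(_ hx hy) e.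
exact: eq_exist.
Qed.

Lemma elem_rel_diag (S : signature) (N : structure S) (E : forall s, N s -> N s -> Prop) :
  (forall s x y, E s x y -> x = y) -> elem_rel E.
Proof.
move=> h V phi e e' hee; suff -> : e = e' by [].
by apply: asg_ext => s v; exact: h.
Qed.

Lemma indiscernible_ren (S : signature) (N : structure S) (A : psets N) (P Q : ctx S)
    (f : ren P Q) (e : nat -> asg N Q) :
  indiscernible A e -> indiscernible A (fun i => acomp (e i) f).
Proof.
move=> he n i j hi hj phi.
pose g : ren (cadd (fun s => ('I_n * P s)%type) (csub A))
             (cadd (fun s => ('I_n * Q s)%type) (csub A)) := fun s v =>
  match v with inl (k, p) => inl (k, f s p) | inr a => inr a end.
have gE (r : 'I_n -> nat) :
    acomp (acat (fun s (v : 'I_n * Q s) => e (r v.1) s v.2) (pin A)) g =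
    acat (fun s (v : 'I_n * P s) => @acomp _ _ _ _ (e (r v.1)) f s v.2) (pin A).
  by apply: asg_ext => s [[k p]|].
by rewrite -!gE -!sat_rename; exact: he.
Qed.

(** * Conjugates of a countable subfield *)

Section Conjugates.
Variable M : valuedField.
Let N := vf_structure M.
Variable A : {pred M}.
Hypothesis hA : GRing.divring_closed A.
Let A1 : 1 \in A. Proof. by case: hA. Qed.
Let A0 : 0 \in A. Proof. by case: hA => h1 h2 _; rewrite -(subrr 1) h2. Qed.
Variable D : set M.
Hypothesis DA1 : D 1.
Hypothesis DB : forall x y, D x -> D y -> D (x - y).
Hypothesis Ddiv : forall x y, D x -> D y -> D (x / y).

Definition ctxK : ctx vf_sig := csub (mkps D set0 set0 : psets N).
Definition atK x (h : D x) : ctxK VF := exist _ x h.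
Variable x0 : asg N ctxK.
Hypothesis hx0 : eqtp (psetsK A) (pin _) x0.

(** The membership proof is quantified because the variables of [ctxK] carry one. *)
Definition conj_graph (u u' : M) := exists h : D u, u' = x0 (atK h).

Lemma conj_graph_id a : a \in A -> D a -> conj_graph a a.
Proof.
move=> aA Da; exists Da.
have hd : pdefinable (psetsK A) (fun e : asg N ctxK => e VF (atK Da) = a).
  exact: (@pdefinable_eq _ N (psetsK A) ctxK VF).
by have [/(_ erefl)/esym] := eqtp_pdefinable hx0 hd.
Qed.

Let transfer (Q : asg N ctxK -> Prop) : definable Q -> (Q (pin _) <-> Q x0).
Proof. by move=> hQ; apply: (eqtp_pdefinable hx0); exact: definable_pdefinable. Qed.

Let var u (h : D u) := @tdefinable_var vf_sig N ctxK VF (atK h).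

(** Field operations and powers transfer because [x0] has the type of the elements of [D] over [A];
    only the correspondence of values and of residues has to be supplied from outside. *)
Lemma good_conj_graph A2 Ek EG : A2 `<=` [set` A] -> A2 `<=` D ->
  (forall u (h : D u), u != 0 -> EV EG u (x0 (atK h))) ->
  (forall u (h : D u), dle u 1 -> ER Ek u (x0 (atK h))) ->
  good A2 Ek EG conj_graph.
Proof.
move=> A2A A2D hEV hER.
have D0 : D 0 by rewrite -(subrr 1); exact: DB.
have irr u (h h' : D u) : x0 (atK h) = x0 (atK h') by congr (x0 _); exact: eq_exist.
have x00 (h : D 0) : x0 (atK h) = 0.
  by have [h' e] := conj_graph_id A0 D0; rewrite (irr _ h h') -e.
have x00' w (h : D w) : w = 0 -> x0 (atK h) = 0 by move=> w0; subst w.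
split.
- exact: conj_graph_id.
- move=> u u' v v' [hu ->] [hv ->]; exists (DB hu hv); apply/esym.
  by apply: (iffLR (transfer (definable_teq (var (DB hu hv)) (tdefK_sub (var hu) (var hv))))).
- move=> u u' v v' [hu ->] [hv ->]; exists (Ddiv hu hv).
  have [v0|v0] := eqVneq v 0.
    by rewrite (x00' _ hv v0) (x00' _ (Ddiv hu hv)) ?v0 invr0 mulr0.
  have v0' : x0 (atK hv) != 0 by case: (EV_neq0 (hEV v hv v0)).
  apply: (mulIf v0'); rewrite divfK //; apply/esym.
  apply: (iffLR (transfer (definable_teq (tdefK_mul (var (Ddiv hu hv)) (var hv)) (var hu)))).
  by rewrite /= /Defs.incl /= divfK.
- by move=> u' [h ->]; exact: x00.
- move=> u u' [hu ->] u0; split; first exact: hEV.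
    exact: hER.
  move=> n n0; have := transfer (definable_coset n (var hu) (@tdefK_1 M ctxK)).
  have e (w : M) : isP n w <-> exists z, w = 1 * z ^+ n.
    by split=> -[z ->]; exists z; rewrite mul1r.
  by rewrite !e.
- by move=> a ha; apply: conj_graph_id; [exact: A2A|exact: A2D].
Qed.

End Conjugates.

Section VFInstances.
Variable M : valuedField.
Let N := vf_structure M.

(** The valuation as a total map, in the form required of [mu]; the default at 0 is cut off by the
    domain condition [x != 0]. *)
Definition gval (x : M) : vG M := odflt 0 (vval x).

Lemma vval_gval (x : M) : x != 0 -> vval x = Some (gval x).
Proof. by move=> /vval_neq0[g hg]; rewrite /gval hg. Qed.

Lemma definable_resmap (W : ctx vf_sig) (v : W VF) (w : W RF) :
  definable (fun e : asg N W => dle (e VF v : M) 1 /\ vres (e VF v : M) = e RF w).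
Proof. exact: (definable_res (tdefinable_var N v) (tdefinable_var N w)). Qed.

Lemma definable_valmap (W : ctx vf_sig) (v : W VF) (w : W VG) :
  definable (fun e : asg N W => (e VF v : M) != 0 /\ gval (e VF v) = e VG w).
Proof.
apply: definable_iff (definable_val (tdefinable_var N v) (tdefinable_var N w)) => e.
split=> [h|[h <-]]; last exact: vval_gval.
by rewrite /gval h; split=> //; apply/eqP => /vval0; rewrite h.
Qed.

Lemma good_diag (A0 : set M) (A : {pred M}) (Ek : vk M -> vk M -> Prop)
    (EG : vG M -> vG M -> Prop) :
  GRing.divring_closed A -> A0 `<=` [set` A] ->
  (forall r, res_of A r -> Ek r r) -> (forall g, val_of A g -> EG g g) ->
  good A0 Ek EG (fun x x' => x \in A /\ x' = x).
Proof.
move=> [A1 AB Adiv] sA hk hg; split.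
- by [].
- by move=> x x' y y' [hx ->] [hy ->]; split=> //; exact: AB.
- by move=> x x' y y' [hx ->] [hy ->]; split=> //; exact: Adiv.
- by move=> x' [].
- move=> x x' [hx ->] x0; split=> //.
    by exists (gval x), (gval x); rewrite -vval_gval //; split=> //; apply: hg; exists x => //; exact: vval_gval.
  by move=> x1; split=> //; apply: hk; exists x; split=> //; rewrite inE vle_dle1.
- by move=> a /sA.
Qed.

Definition vf_zero (s : vf_sort) : N s :=
  match s with VF => 0 : M | RF => 0 : vk M | VG => 0 : vG M | RV => 1%g : vRV M end.

Definition vf_rank (s : vf_sort) : nat :=
  match s with VF => 0 | RF => 1 | VG => 2 | RV => 3 end.

Lemma vf_rank_inj : injective vf_rank.
Proof. by case; case. Qed.

End VFInstances.

Section Corollary.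
Variables (M : valuedField) (A B C : {pred M}).
Hypothesis hHensel : henselian M.
Hypothesis hChar : [pchar (vk M)] =i pred0.
Hypothesis hA : GRing.divring_closed A.
Hypothesis hB : GRing.divring_closed B.
Hypothesis hC : GRing.divring_closed C.
Hypothesis hAB : {subset A <= B}.
Hypothesis hAC : {subset A <= C}.
Hypothesis hSat : succ_saturated (vf_structure M) ([set` B] `|` [set` C]).
Let N := vf_structure M.
Let E : set M := [set` B] `|` [set` C].
Let small (D : psets N) : Prop := tagged_union D #<= E.
Let KA := psetsK A.
Let d := @vf_zero M.

(** The natural numbers are distinct elements of [C], their positive differences being units. *)
Lemma infinite_parameters : infinite_set E.
Proof.
apply/infiniteP.
have [F] : $|{injfun [set: nat] >-> E}|; last exact: inj_card_le F.
apply/injfunPex; exists (fun n => n%:R) => [n _|m n _ _].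
  right; elim: n => [|n IH] /=; first by case: hC => h1 h2 _; have := h2 _ _ h1 h1; rewrite subrr.
  by rewrite -addn1 natrD; apply: (divring_add hC) => //; case: hC.
have key a b : (a + b.+1)%:R = a%:R :> M -> False.
  rewrite natrD -[RHS]addr0 => /addrI h.
  by have := natr_unit hChar (ltn0Sn b); rewrite h vval_0.
wlog mn : m n / (m <= n)%N.
  move=> h e; have [mn|/ltnW nm] := leqP m n; first exact: h.
  by apply/esym; apply: h.
move=> e; have [//|] := eqVneq m n => mn'.
have lt : (m < n)%N by rewrite ltn_neqAle mn' mn.
by case: (@key m (n - m.+1)%N); rewrite e -addSnnS subnKC.
Qed.

Let hsat : type_saturated small.
Proof. exact: hSat. Qed.

Let hsmall : small_addable small.
Proof.
move=> D D' hD cD'; rewrite /small.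
have -> : tagged_union (fun s => D s `|` D' s) = tagged_union D `|` tagged_union D' by [].
exact: card_leU_countable infinite_parameters hD cD'.
Qed.

Let hsat_c : type_saturated (@csmall _ N).
Proof.
move=> D cD; apply: hsat; rewrite /small.
by apply: card_le_trans cD _; apply/infiniteP; exact: infinite_parameters.
Qed.

Lemma image_le_parameters (T : Type) (f : M -> T) (X : set T) :
  X `<=` f @` [set` A] -> X #<= E.
Proof.
move=> h; apply: card_le_trans (subset_card_le h) _.
apply: card_le_trans (card_image_le _ _) _.
by apply: subset_card_le => x /hAB; left.
Qed.

Let smallA : small KA.
Proof. by apply: (@image_le_parameters _ (existT N VF)) => -[[] x] //= hx; exists x. Qed.

Let smallAk : small_k small (psets_field (res_of A)).
Proof.
apply: (@image_le_parameters _ (fun x => existT N RF (vres x))) => -[[] x] //= [y [hy _ e]].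
by exists y => //=; rewrite e.
Qed.

Let smallAG : small_G small (psets_ogroup (val_of A)).
Proof.
apply: (@image_le_parameters _ (fun x => existT N VG (gval x))) => -[[] x] //= [y hy hv].
by exists y => //; rewrite /gval hv.
Qed.

Lemma res_of_lift (D : {pred M}) r : res_of D r -> exists x, [/\ @psetsK M D VF x, dle x 1 & vres x = r].
Proof. by move=> [x [h1 h2 h3]]; exists x; rewrite -vle_dle1. Qed.

Lemma val_of_lift (D : {pred M}) g :
  val_of D g -> exists x : M, [/\ @psetsK M D VF x, x != 0 & gval x = g].
Proof.
move=> [x h1 h2]; exists x; split=> //; last by rewrite /gval h2.
by apply/eqP => /vval0; rewrite h2.
Qed.

Lemma vres_res_of (D : {pred M}) x : x \in D -> dle x 1 -> res_of D (vres x).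
Proof. by exists x; split=> //; rewrite inE vle_dle1. Qed.

Lemma gval_val_of (D : {pred M}) (x : M) : x \in D -> x != 0 -> val_of D (gval x).
Proof. by move=> h x0; exists x => //; exact: vval_gval. Qed.

Let A1 : 1 \in A. Proof. by case: hA. Qed.
Let A0' : 0 \in A. Proof. by case: hA => h1 h2 _; rewrite -(subrr 1) h2. Qed.

Variable A0 : set M.
Hypothesis cA0 : countable A0.
Hypothesis A0A : A0 `<=` [set` A].
Hypothesis hA0 : coset_reps A0.

(** Relative quantifier elimination applied to the identity of [A]: over [A] the residue field and
    the value group are orthogonal and carry only the structure of their own languages. *)
Lemma extend_elem (Ek : vk M -> vk M -> Prop) (EG : vG M -> vG M -> Prop) :
  @elem_rel _ (field_structure (vk M)) (fun _ => Ek) ->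
  @elem_rel _ (ogroup_structure (vG M)) (fun _ => EG) ->
  (forall r, res_of A r -> Ek r r) -> (forall g, val_of A g -> EG g g) ->
  exists R : forall s, N s -> N s -> Prop, [/\ elem_rel R,
    forall s a, @KA s a -> R s a a, forall s, R s (d s) (d s),
    forall y y', Ek y y' -> R RF y y' & forall y y', EG y y' -> R VG y y'].
Proof.
move=> hk hg rk rg; have hG := good_diag hA A0A rk rg.
exists (bfR Ek EG (fun x x' => x \in A /\ x' = x)); split=> //.
- exact: (elementary_good hHensel hChar hA0 cA0 hsat_c hk hg hG).
- by case.
- case=> //=.
  + by apply: rk; exists 0; split=> //; [rewrite inE vle_dle1 dle0x|exact: res_0].
  + by apply: rg; exists 1 => //; exact: vval_1.
  + by exists 1, 1; rewrite oner_neq0 rv_1.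
Qed.

(** [extend_elem] provides the lifting of indiscernible sequences, with the value group moved by the
    identity. *)
Lemma field_divides : 
  type_divides (psets_field (res_of A)) (tp (psets_field (res_of C)) (psets_field (res_of B))) ->
  type_divides KA (tp (psetsK C) (psetsK B)).
Proof.
apply: (@type_divides_lift vf_sig N RF VF _ _ _ _ _ _ _ (@field_hterm M) (@field_hrel M)
  (fun x : M => dle x 1) (@vres M) (@definable_resmap M) d KA (psets_field (res_of A))).
- exact: res_of_lift.
- exact: res_of_lift.
move=> F hF FA.
have [||||R [h1 h2 h3 h4 h5]] := @extend_elem (F tt) (fun g g' => g' = g).
- by apply: elem_rel_sub hF => -[].
- by apply: elem_rel_diag => s x y ->.
- exact: FA.
- by [].
by exists R.
Qed.

Lemma group_divides : 
  type_divides (psets_ogroup (val_of A)) (tp (psets_ogroup (val_of C)) (psets_ogroup (val_of B))) ->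
  type_divides KA (tp (psetsK C) (psetsK B)).
Proof.
apply: (@type_divides_lift vf_sig N VG VF _ _ _ _ _ _ _ (@group_hterm M) (@group_hrel M)
  (fun x : M => x != 0) (@gval M) (@definable_valmap M) d KA (psets_ogroup (val_of A))).
- exact: val_of_lift.
- exact: val_of_lift.
move=> F hF FA.
have [||||R [h1 h2 h3 h4 h5]] := @extend_elem (fun r r' => r' = r) (F tt).
- by apply: elem_rel_diag => s x y ->.
- by apply: elem_rel_sub hF => -[].
- by [].
- exact: FA.
by exists R.
Qed.


Hypothesis hDisj : linearly_disjoint (res_of A) (res_of C) (res_of B).
Hypothesis hVal : val_of C `&` val_of B = val_of A.
Hypothesis hSep : separated A C.
Hypothesis ndk : ~ type_divides (psets_field (res_of A))
  (tp (psets_field (res_of C)) (psets_field (res_of B))).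
Hypothesis ndG : ~ type_divides (psets_ogroup (val_of A))
  (tp (psets_ogroup (val_of C)) (psets_ogroup (val_of B))).

(** The core of the converse. Nondividing in k and in Gamma yields residues [y] and values [z]
    compatible with all terms of [beta] at once. Then [xi] is a conjugate of the chosen part of [C]
    with these residues and values, and for each i the analysis of the compositum extends its
    correspondence with that part to the i-th term of [beta]. *)
Lemma conjugate_over_sequence (X : set M) : countable X ->
  exists L : set M, [/\ countable L, X `<=` L &
  forall beta : nat -> asg N (ctxK (fun x => x \in B /\ L x)),
    indiscernible KA beta -> beta 0%N = pin _ ->
  exists xi : asg N (ctxK (fun x => x \in C /\ L x)),
    forall i (psi : formula (cadd (ctxK (fun x => x \in C /\ L x)) (ctxK (fun x => x \in B /\ L x)))),
      sat psi (acat (pin _) (pin _)) -> sat psi (acat xi (beta i))].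
Proof.
move=> cX.
have [L [cL XL LB Ldiv [sepL linL valL]]] :=
  countable_witness_field hA hC hAC hDisj hVal hSep (countable_setU cX cA0).
exists L; split=> [//|x hx|beta hbeta beta0]; first by apply: XL; left.
pose C0 : set M := fun x => x \in C /\ L x; pose B0 : set M := fun x => x \in B /\ L x.
rewrite -/C0 -/B0 in beta hbeta beta0 *.
have [a0 ha0 _] := rep_all hA0 (n := 1) (x := 1) isT (oner_neq0 _).
have L1 : L 1.
  by rewrite -(divff (rep_neq0 hA0 ha0)); apply: Ldiv; apply: XL; right.
have L0 : L 0 by rewrite -(subrr 1); exact: LB.
have A0L a : A0 a -> L a by move=> h; apply: XL; right.
have C01 : C0 1 by split=> //; exact: hAC.
have B01 : B0 1 by split=> //; exact: hAB.
have C0B x y : C0 x -> C0 y -> C0 (x - y).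
  by move=> [h1 h2] [h3 h4]; split; [case: hC => _ h _; exact: h|exact: LB].
have B0B x y : B0 x -> B0 y -> B0 (x - y).
  by move=> [h1 h2] [h3 h4]; split; [case: hB => _ h _; exact: h|exact: LB].
have C0div x y : C0 x -> C0 y -> C0 (x / y).
  by move=> [h1 h2] [h3 h4]; split; [case: hC => _ _ h; exact: h|exact: Ldiv].
have B0div x y : B0 x -> B0 y -> B0 (x / y).
  by move=> [h1 h2] [h3 h4]; split; [case: hB => _ _ h; exact: h|exact: Ldiv].
have cC0 : countable C0 by apply: sub_countable cL; apply: subset_card_le => x [].
have cB0 : countable B0 by apply: sub_countable cL; apply: subset_card_le => x [].
have cctxC : cctx (ctxK C0) by apply: cctx_csub; apply: countable_mkps => //; exact: countable0.
have cctxB : cctx (ctxK B0) by apply: cctx_csub; apply: countable_mkps => //; exact: countable0.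
have betaE (v : ctxK B0 VF) : beta 0%N VF v = sval v by rewrite beta0.
(* Both [y] and, further below, [z] are found before an index i is fixed; this is what allows one
   conjugate to serve the whole sequence. *)
have [||||y hy] := @nondividing_image vf_sig N RF VF _ _ _ _ _ _ _ (@field_hterm M) (@field_hrel M)
  (fun x : M => dle x 1) (@vres M) (@definable_resmap M) d KA (psets_field (res_of A))
  (psets_field (res_of B)) (psets_field (res_of C)) _ _ _ beta (pin _)
  (field_saturated hsat) (small_k_addable hsmall) smallAk cctxB cctxC (@res_of_lift A) _ _ _ _ hbeta ndk.
- by exists 1, 1; split=> //; [rewrite inE vle_dle1 dle_refl|exact: vres1].
- by move=> r [x [h1 h2 h3]]; exists x; split=> //; exact: hAB.
- by move=> [v [vC vL]] v1; exact: vres_res_of.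
- by move=> v; rewrite betaE; case: v => v [vB vL] v1; exact: vres_res_of.
have [||||z hz] := @nondividing_image vf_sig N VG VF _ _ _ _ _ _ _ (@group_hterm M) (@group_hrel M)
  (fun x : M => x != 0) (@gval M) (@definable_valmap M) d KA (psets_ogroup (val_of A))
  (psets_ogroup (val_of B)) (psets_ogroup (val_of C)) _ _ _ beta (pin _)
  (group_saturated hsat) (small_G_addable hsmall) smallAG cctxB cctxC (@val_of_lift A) _ _ _ _ hbeta ndG.
- by exists 0, 1 => //; exact: vval_1.
- by move=> g [x h1 h2]; exists x => //; exact: hAB.
- by move=> [v [vC vL]] v1; exact: gval_val_of.
- by move=> v; rewrite betaE; case: v => v [vB vL] v1; exact: gval_val_of.
pose Rk i (r r' : vk M) := [\/ exists v : ctxK C0 VF, [/\ dle (sval v) 1, r = vres (sval v) & r' = y v],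
  exists v : ctxK B0 VF, [/\ dle (sval v) 1, r = vres (sval v) & r' = vres (beta i VF v)]
  | res_of A r /\ r' = r].
have hRk i : @elem_rel _ (field_structure (vk M)) (fun _ => Rk i).
  apply: elem_rel_sub (hy i) => s r r' [h|[v [h1 h2 h3]]|h]; [by constructor 1| |by constructor 3].
  by constructor 2; exists v; rewrite betaE.
pose RG i (g g' : vG M) := [\/ exists v : ctxK C0 VF, [/\ sval v != 0, g = gval (sval v) & g' = z v],
  exists v : ctxK B0 VF, [/\ sval v != 0, g = gval (sval v) & g' = gval (beta i VF v)]
  | val_of A g /\ g' = g].
have hRG i : @elem_rel _ (ogroup_structure (vG M)) (fun _ => RG i).
  apply: elem_rel_sub (hz i) => s r r' [h|[v [h1 h2 h3]]|h]; [by constructor 1| |by constructor 3].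
  by constructor 2; exists v; rewrite betaE.
(* The residues and values of the part of [C] form one tuple [p]. It has the type over [A] of the
   tuple [q] of prescribed residues and values, so the field elements themselves can be moved
   along. *)
pose W : ctx vf_sig := fun s => match s with
  | RF => {v : ctxK C0 VF | dle (sval v) 1}
  | VG => {v : ctxK C0 VF | sval v != 0}
  | _ => void end.
pose p : asg N W := fun s => match s return W s -> vf_car M s with
  | RF => fun v => vres (sval (sval v))
  | VG => fun v => gval (sval (sval v))
  | VF | RV => fun v => match v with end end.
pose q : asg N W := fun s => match s return W s -> vf_car M s with
  | RF => fun v => y (sval v)
  | VG => fun v => z (sval v)
  | VF | RV => fun v => match v with end end.
have cW : cctx W.
  have [f finj] := cctxC; apply: (@cctx_sorts vf_sig vf_rank W vf_rank_inj) => -[] /=.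
  - by exists (fun v : void => match v with end) => -[].
  - exists (fun v => f (existT _ VF (sval v))) => -[v hv] [v' hv'] /= /finj e.
    by apply: eq_exist; exact: existT_inj e.
  - exists (fun v => f (existT _ VF (sval v))) => -[v hv] [v' hv'] /= /finj e.
    by apply: eq_exist; exact: existT_inj e.
  - by exists (fun v : void => match v with end) => -[].
have hpq : eqtp KA p q.
  have [||R [hR RA _ Rk0 RG0]] := extend_elem (hRk 0%N) (hRG 0%N).
  - by move=> r hr; constructor 3.
  - by move=> g hg; constructor 3.
  move=> phi; apply: hR => s [v|a]; last exact: RA (svalP a).
  case: s v => //= v.
  - by apply: Rk0; constructor 1; exists (sval v); split=> //; exact: (svalP v).
  - by apply: RG0; constructor 1; exists (sval v); split=> //; exact: (svalP v).
have [xi hxi] := eqtp_realize hsat hsmall d smallA (pin (mkps C0 set0 set0 : psets N)) cW cctxC hpq.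
exists xi => i psi.
have xires (v : ctxK C0 VF) : dle (sval v) 1 -> dle (xi VF v) 1 /\ vres (xi VF v) = y v.
  move=> v1; pose w : W RF := exist _ v v1.
  have := eqtp_pdefinable hxi (definable_pdefinable _ (@definable_resmap M
    (cadd (ctxK C0) W) (inl v) (inr w))).
  by move=> [h _]; apply: h.
have xival (v : ctxK C0 VF) : sval v != 0 -> xi VF v != 0 /\ gval (xi VF v) = z v.
  move=> v1; pose w : W VG := exist _ v v1.
  have := eqtp_pdefinable hxi (definable_pdefinable _ (@definable_valmap M
    (cadd (ctxK C0) W) (inl v) (inr w))).
  by move=> [h _]; apply: h.
have hxi0 : eqtp KA (pin (mkps C0 set0 set0 : psets N)) xi.
  exact: (eqtp_ren (fun s v => inl v : cadd (ctxK C0) W s) hxi).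
have hbi : eqtp KA (pin (mkps B0 set0 set0 : psets N)) (beta i).
  by rewrite -beta0; exact: indiscernible_eqtp.
have ccC : countable [set: ctxK C0 VF] by exact: countable_sig.
have ccB : countable [set: ctxK B0 VF] by exact: countable_sig.
(* The index i is fixed by now and [xi] does not depend on it, so the residue and value maps may be
   enlarged separately for each i. *)
pose Ek1 r r' := (exists v : ctxK C0 VF, [/\ dle (sval v) 1, r = vres (sval v) & r' = y v]) \/
  (exists v : ctxK B0 VF, [/\ dle (sval v) 1, r = vres (sval v) & r' = vres (beta i VF v)]).
pose EG1 g g' := (exists v : ctxK C0 VF, [/\ sval v != 0, g = gval (sval v) & g' = z v]) \/
  (exists v : ctxK B0 VF, [/\ sval v != 0, g = gval (sval v) & g' = gval (beta i VF v)]).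
have [|||Ek [hk _ sk _]] := field_iso_enlarge (csat_k hsat_c) (E := Ek1) (X := set0).
- by apply: elem_rel_sub (hRk i) => s r r' []; [constructor 1|constructor 2].
- have := countable_setU (countable_image (fun v => (vres (sval v), y v)) ccC)
    (countable_image (fun v => (vres (sval v), vres (beta i VF v))) ccB).
  apply: sub_countable; apply: subset_card_le => -[r r'] /=.
  by move=> [[v [_ -> ->]]|[v [_ -> ->]]]; [left|right]; exists v.
- exact: countable0.
have [|||EG [hg _ sg _]] := group_iso_enlarge (csat_G hsat_c) (E := EG1) (X := set0).
- by apply: elem_rel_sub (hRG i) => s r r' []; [constructor 1|constructor 2].
- have := countable_setU (countable_image (fun v => (gval (sval v), z v)) ccC)
    (countable_image (fun v => (gval (sval v), gval (beta i VF v))) ccB).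
  apply: sub_countable; apply: subset_card_le => -[r r'] /=.
  by move=> [[v [_ -> ->]]|[v [_ -> ->]]]; [left|right]; exists v.
- exact: countable0.
have gC : good A0 Ek EG (conj_graph xi).
  apply: (good_conj_graph hA C01 C0B C0div hxi0) => //.
  - by move=> a ha; split; [apply: hAC; exact: A0A|exact: A0L].
  - move=> u hu u0; have [h1 h2] := xival (atK hu) u0.
    exists (gval u), (z (atK hu)); rewrite -h2 -!vval_gval //; split=> //.
    by apply: sg; left; exists (atK hu).
  - move=> u hu u1; have [h1 h2] := xires (atK hu) u1; split=> //.
    by apply: sk; left; exists (atK hu).
have bdom (v : ctxK B0 VF) : dle (sval v) 1 -> dle (beta i VF v) 1.
  have := eqtp_pdefinable hbi (definable_pdefinable _
    (definable_dle (@tdefinable_var _ N (ctxK B0) VF v) (@tdefK_1 M (ctxK B0)))).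
  by move=> [h _]; exact: h.
have gB : good A0 Ek EG (conj_graph (beta i)).
  have bne (v : ctxK B0 VF) : sval v != 0 -> (beta i VF v : M) != 0.
    have D0 : B0 0 by rewrite -(subrr 1); exact: B0B.
    have b0 : beta i VF (atK D0) = 0 :> M.
      have [h0 e] := conj_graph_id hbi A0' D0.
      by rewrite [RHS]e; congr (beta i VF _); exact: eq_exist.
    have [_ h] := eqtp_pdefinable hbi (definable_pdefinable _
      (definable_eq N v (atK D0 : ctxK B0 VF))).
    by move=> v0; apply: contraNneq v0 => e; apply/eqP; apply: h; rewrite e b0.
  apply: (good_conj_graph hA B01 B0B B0div hbi) => //.
  - by move=> a ha; split; [apply: hAB; exact: A0A|exact: A0L].
  - move=> u hu u0; have h1 := bne (atK hu) u0.
    exists (gval u), (gval (beta i VF (atK hu))); rewrite -!vval_gval //; split=> //.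
    by apply: sg; right; exists (atK hu).
  - move=> u hu u1; have h1 := bdom (atK hu) u1; split=> //.
    by apply: sk; right; exists (atK hu).
(* Independence is checked on the domain side only, where the choice of [L] has secured it. *)
have [|||||||G [hG sC sB]] := good_compositum hHensel hChar hA0 hk hg gC gB
  (A1 := fun a => a \in A /\ L a).
- by move=> a [aA aL]; apply: (conj_graph_id hxi0 aA); split=> //; exact: hAC.
- by move=> a [aA aL]; apply: (conj_graph_id hbi aA); split=> //; exact: hAB.
- by move=> a b [aA aL] [bA bL]; split; [case: hA => _ _ h; exact: h|exact: Ldiv].
- by [].
- move=> I v v' hv; have [|m [w [a [h1 h2 h3 h4]]]] := sepL I v.
    by move=> j; have [[]] := hv j.
  have wC l : C0 (w l) by have [] := h1 l.
  exists m, w, (fun l => xi VF (atK (wC l))), a; split=> //.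
  + by move=> l; have [_ _ w0] := h1 l; split=> //; exists (wC l).
  + by move=> f hf l; apply: h4 => k; have [] := hf k.
- move=> J u u' hu u1 hlin s s' hs s1; apply: (linL J u) => //.
    by move=> j; have [[]] := hu j.
  by move=> j; have [[]] := hs j.
- move=> c c' b b' [[cC cL'] _] [[bB bL] _] c0 e.
  by have [a [k1 k2 k3]] := valL c b cC cL' bB c0 e; exists a.
have hE := elementary_good hHensel hChar hA0 cA0 hsat_c (fi_elem hk) (gi_elem hg) hG.
move=> h; apply: (iffLR (hE _ psi _ _ _)) h => s [[v hv]|[v hv]]; case: s v hv => //= v hv.
- by apply: sC; exists hv.
- by apply: sB; exists hv.
Qed.


Definition widenK (D : {pred M}) (X : set M) :
    ren (ctxK (fun x => x \in D /\ X x)) (csub (psetsK D)) := fun s =>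
  match s return ctxK (fun x => x \in D /\ X x) s -> csub (psetsK D) s with
  | VF => fun v => exist _ (sval v) (svalP v).1
  | RF | VG | RV => fun v => v
  end.

Lemma formula_restrict (X : set M) (phi : formula (cadd (csub (psetsK C)) (csub (psetsK B)))) l
    (phi0 : formula (listed l)) :
  (forall e : asg N _, sat phi e <-> sat phi0 (acomp e (@unlist _ _ l))) ->
  (forall x (h : x \in C), List.In (existT (cadd (csub (psetsK C)) (csub (psetsK B))) VF
     (inl (exist _ x h))) l -> X x) ->
  (forall x (h : x \in B), List.In (existT (cadd (csub (psetsK C)) (csub (psetsK B))) VF
     (inr (exist _ x h))) l -> X x) ->
  exists psi : formula (cadd (ctxK (fun x => x \in C /\ X x)) (ctxK (fun x => x \in B /\ X x))),
    forall (x : asg N (csub (psetsK C))) (y : asg N (csub (psetsK B))),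
      sat phi (acat x y) <-> sat psi (acat (acomp x (@widenK C X)) (acomp y (@widenK B X))).
Proof.
move=> h hC' hB'.
pose W := cadd (ctxK (fun x => x \in C /\ X x)) (ctxK (fun x => x \in B /\ X x)).
have ex s (v : listed l s) : exists w : W s, match w with
    | inl a => inl (@widenK C X s a) | inr a => inr (@widenK B X s a) end = sval v.
  case: s v => -[[[x hx]|[x hx]] hv] //=.
    by exists (inl (exist _ x (conj hx (hC' x hx hv)))); congr inl; exact: eq_exist.
  by exists (inr (exist _ x (conj hx (hB' x hx hv)))); congr inr; exact: eq_exist.
pose f : ren (listed l) W := fun s v => sval (cid (ex s v)).
exists (rename f phi0) => x y; rewrite h sat_rename.
set e := acomp _ _; set e' := acomp _ _; suff -> : e = e' by [].
apply: asg_ext => s v; have fv := svalP (cid (ex s v)).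
rewrite /e /e' /acomp /unlist -/(f s v) in fv *.
by move: fv; case: (f s v) => w <-.
Qed.

(** Dividing is witnessed by a formula [phi] implied by finitely many [psi], but the parameters of
    [phi] need not come from [B]. Their indiscernible sequence is therefore extended by conjugates
    of a countable part of [B] containing the parameters of the [psi]. The conjugate [xi] then
    satisfies the [psi], and with them [phi], along the whole sequence. *)
Lemma not_type_divides : ~ type_divides KA (tp (psetsK C) (psetsK B)).
Proof.
move=> [n [phi [b [[m [psi [hpsi himp]]] [c [c0 hc [m0 hm0]]]]]]].
pose KC := psetsK C; pose KB := psetsK B.
pose V := cadd (csub KC) (csub KB).
pose l j := sval (cid (formula_support N (psi j))).
pose psi0 j := sval (cid (svalP (cid (formula_support N (psi j))))).
have hpsi0 j (e : asg N V) : sat (psi j) e <-> sat (psi0 j) (acomp e (@unlist _ _ (l j))) :=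
  svalP (cid (svalP (cid (formula_support N (psi j))))) e.
pose el (u : {s & V s}) : M := match u with
  | existT VF (inl v) => sval v | existT VF (inr v) => sval v | _ => 0 end.
(* The elements of [C] that name variables of the [psi] are collected along with the parameters from
   [B]. *)
pose X := \bigcup_(j in [set: 'I_m]) el @` [set u | List.In u (l j)].
have cX : countable X.
  apply: bigcup_countable; first exact: countableP.
  by move=> j _; apply: countable_image; exact: countable_list.
have [L [cL XL hL]] := conjugate_over_sequence cX.
have elL j u : List.In u (l j) -> L (el u) by move=> hu; apply: XL; exists j => //; exists u.
have psi1_ex j := @formula_restrict L (psi j) (l j) (psi0 j) (hpsi0 j)
  (fun x h hx => elL j _ hx)
  (fun x h hx => elL j _ hx).
pose psi1 j := sval (cid (psi1_ex j)).
have hpsi1 j x y : sat (psi j) (acat x y) <->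
    sat (psi1 j) (acat (acomp x (@widenK C L)) (acomp y (@widenK B L))) := svalP (cid (psi1_ex j)) x y.
pose P : ctx vf_sig := fun s => 'I_(n s); pose Q := ctxK (fun x => x \in B /\ L x).
pose QC := ctxK (fun x => x \in C /\ L x).
have cP : cctx P.
  apply: (@cctx_sorts vf_sig vf_rank P vf_rank_inj) => s; exists (@nat_of_ord (n s)).
  exact: ord_inj.
have cQ : cctx Q.
  apply: cctx_csub; apply: countable_mkps; try exact: countable0.
  by apply: sub_countable cL; apply: subset_card_le => x [].
have [e [e0 he eEM]] := indiscernible_extend hsat hsmall d smallA (pin _ : asg N Q) cP cQ hc.
pose R := cadd Q P.
(* The implication from the [psi] to [phi], valid for the original parameters, is a property of the
   type of the first term and so passes to the i-th. *)
have himp' i (x : asg N (csub KC)) :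
    (forall j, sat (psi1 j) (acat (acomp x (@widenK C L)) (fun s q => e i s (inl q)))) ->
    sat phi (acat x (fun s p => e i s (inr p))).
  pose f1 : ren (cadd QC Q) (cadd (csub KC) R) := fun s v =>
    match v with inl a => inl (@widenK C L s a) | inr q => inr (inl q) end.
  pose f2 : ren (cadd (csub KC) P) (cadd (csub KC) R) := fun s v =>
    match v with inl a => inl a | inr p => inr (inr p) end.
  have f1E (z : asg N (csub KC)) k : acomp (acat z (e k)) f1 =
      acat (acomp z (@widenK C L)) (fun s q => e k s (inl q)) by apply: asg_ext => s [].
  have f2E (z : asg N (csub KC)) k : acomp (acat z (e k)) f2 =
      acat z (fun s p => e k s (inr p)) by apply: asg_ext => s [].
  pose bad (w : asg N R) := exists z : asg N (csub KC),
    (forall j, sat (psi1 j) (acomp (acat z w) f1)) /\ ~ sat phi (acomp (acat z w) f2).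
  have hbad : definable bad.
    have hQ : definable (fun z : asg N (cadd (csub KC) R) =>
        (forall j, sat (psi1 j) (acomp z f1)) /\ ~ sat phi (acomp z f2)).
      apply: definable_and; last exact: (definable_not (definable_ren f2 (@definable_sat _ N _ phi))).
      by apply: definable_forall_fin => j; exact: (definable_ren f1 (@definable_sat _ N _ (psi1 j))).
    exact: (@definable_ex_ctx vf_sig N d _ _ _ hQ).
  have bad_eq := eqtp_pdefinable (indiscernible_eqtp i 0 he) (definable_pdefinable _ hbad).
  move=> hx; apply: contrapT => nphi; case: (iffLR bad_eq).
    by exists x; rewrite f2E; split=> // j; rewrite f1E.
  move=> z [hz]; rewrite f2E e0 => nz; apply: nz.
  have hc0 : c 0%N = b by apply: asg_ext.
  change (sat phi (acat z (c 0%N))); rewrite hc0.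
  apply: himp => j; rewrite hpsi1; have := hz j; rewrite f1E e0.
  congr (sat (psi1 j) (acat _ _)); by apply: asg_ext => -[].
(* The inconsistency of finitely many instances is a formula about the sequence [c], and the
   extension preserves such formulas. *)
have hm0' : ~ exists x : asg N (csub KC), forall i : 'I_m0,
    sat phi (acat x (fun s p => e i s (inr p))).
  pose f (i : 'I_m0) : ren (cadd (csub KC) P) (cadd (csub KC) (fun s => ('I_m0 * P s)%type)) :=
    fun s v => match v with inl a => inl a | inr p => inr (i, p) end.
  pose sol (w : asg N (fun s => ('I_m0 * P s)%type)) := exists z : asg N (csub KC),
    forall i, sat phi (acomp (acat z w) (f i)).
  have [chi hchi] : definable (fun w => ~ sol w).
    have hQ : definable (fun z : asg N (cadd (csub KC) (fun s => ('I_m0 * P s)%type)) =>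
        forall i, sat phi (acomp z (f i))).
      by apply: definable_forall_fin => i; exact: (definable_ren (f i) (@definable_sat _ N _ phi)).
    exact: (definable_not (@definable_ex_ctx vf_sig N d _ _ _ hQ)).
  pose g : ren (fun s => ('I_m0 * P s)%type) (cadd (fun s => ('I_m0 * P s)%type) (csub KA)) :=
    fun s v => inl v.
  have gE (w : asg N (fun s => ('I_m0 * P s)%type)) : acomp (acat w (pin KA)) g = w by [].
  have fE (z : asg N (csub KC)) (w : nat -> asg N P) i :
      acomp (acat z (fun s (v : 'I_m0 * P s) => w v.1 s v.2)) (f i) = acat z (w i).
    by apply: asg_ext => s [].
  have := eEM m0 (rename g chi); rewrite !sat_rename !gE !hchi => h [x hx].
  apply: h; first by move=> [z hz]; apply: hm0; exists z => i; have := hz i; rewrite fE.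
  exists x => i; have := hx i.
  by rewrite (fE x (fun k s p => e k s (inr p))).
have [|| xi hxi] := hL (fun i => acomp (e i) (fun s q => inl q)).
- exact: indiscernible_ren.
- by rewrite e0.
apply: hm0'.
(* Variables outside of [L] do not occur in the [psi] and are set to 0; the implication to [phi]
   holds whatever their values. *)
pose x s : csub KC s -> N s := match s return csub KC s -> N s with
  | VF => fun v => if pselect (L (sval v)) is left h then xi VF (exist _ (sval v) (conj (svalP v) h)) else 0
  | RF | VG | RV => fun v => False_rect _ (svalP v) end.
have xE : acomp x (@widenK C L) = xi.
  apply: asg_ext => s [v hv]; case: s v hv => //= v hv; rewrite /acomp /=.
  case: pselect => [h|[]]; last by case: hv.
  by congr (xi VF _); exact: eq_exist.
exists x => i; apply: himp' => j; rewrite xE.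
apply: hxi; have := hpsi j; rewrite /tp /= hpsi1.
congr (sat (psi1 j) (acat _ _)); by apply: asg_ext => -[] [].
Qed.

End Corollary.

Theorem corollary7p1p4 (M : valuedField) (A B C : {pred M})
  (hHensel : henselian M)
  (hNontriv : nontrivially_valued M)
  (hChar : [pchar (vk M)] =i pred0)
  (hA : GRing.divring_closed A)
  (hB : GRing.divring_closed B)
  (hC : GRing.divring_closed C)
  (hAB : {subset A <= B})
  (hAC : {subset A <= C})
  (hSat : succ_saturated (vf_structure M) ([set` B] `|` [set` C]))
  (hHom : strongly_succ_homogeneous (vf_structure M) ([set` B] `|` [set` C]))
  (hIndex : forall N : nat, (0 < N)%N -> finite_set (power_cosets (vK M) N))
  (hRV : forall N : nat, (0 < N)%N -> forall r : vRV M,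
     exists a : M, [/\ a \in A, a != 0 &
       exists t : vRV M, vrv a = (r * t ^+ N)%g])
  (hRes : forall N : nat, (0 < N)%N -> forall r : vk M, r != 0 ->
     exists a : M, [/\ a \in A, vval a = Some 0 &
       exists2 t : vk M, t != 0 & vres a = r * t ^+ N])
  (hDcl : forall g : vG M, dcl0 (vf_structure M) VG g ->
     exists2 a : M, a \in A & vval a = Some g)
  (hDisj : linearly_disjoint (res_of A) (res_of C) (res_of B))
  (hVal : val_of C `&` val_of B = val_of A)
  (hSep : separated A C) :
  ~ type_divides (psetsK A) (tp (psetsK C) (psetsK B)) <->
  ~ type_divides (psets_field (res_of A))
      (tp (psets_field (res_of C)) (psets_field (res_of B))) /\
  ~ type_divides (psets_ogroup (val_of A))
      (tp (psets_ogroup (val_of C)) (psets_ogroup (val_of B))).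
Proof.
have A1 : 1 \in A by case: hA.
have [A0 [cA0 A0A hA0]] := countable_coset_reps hHensel hChar A1 hIndex hRV hRes.
split=> [nd|[ndk ndG]].
  split=> h; apply: nd.
    exact: (field_divides hHensel hChar hA hC hSat cA0 A0A hA0 h).
  exact: (group_divides hHensel hChar hA hC hSat cA0 A0A hA0 h).
exact: (not_type_divides hHensel hChar hA hB hC hAB hAC hSat cA0 A0A hA0 hDisj hVal hSep ndk ndG).
Qed.
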